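(* Let $X$ be a càdlàg process in $\mathbb{R}^d$ with $X_t-X_0=\int_0^tF_s\,\mathrm{d}s+M_t+R_t$, and let $\Gamma,\alpha,\tau,\kappa,E$ be as in the context. For each $t\ge0$ let $\gamma_t$ be non-negative and let $H_t$ be an $\mathcal{M}_d(\mathbb{R})$-valued random matrix. Let $H\in\mathcal{M}_d(\mathbb{R})$ be a repulsive matrix, i.e. a matrix all of whose eigenvalues have a positive real part. Suppose that there is a finite random variable $T_0$ such that, almost surely on $\Gamma$, \begin{itemize} \item $F_t=\gamma_tH_tX_{t-}$ for almost all $t\ge T_0$; \item $\lim_{t\to\infty}H_t=H$; \item $\alpha_t^2-\alpha_{\tau(t)}^2=O\big(\langle M\rangle_{t,\tau(t)}\big)$, $\langle M\rangle_{t,\infty}=O(\alpha_t^2)$, $V(R,(t,\infty))=o(\alpha_t)$ and $E_t=O(\alpha_t^2)$. \end{itemize} Then $\mathbb{P}\big[\Gamma\cap\{\lim_{t\to\infty}X_t=0\}\big]=0$.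
   Context: $\mathcal{M}_d(\mathbb{R})$ is the set of real $d\times d$ matrices. $(\Omega,\mathcal{F},(\mathcal{F}_t)_{t\ge0},\mathbb{P})$ is a filtered probability space with complete right-continuous filtration. $\langle\cdot,\cdot\rangle$ is an inner product on $\mathbb{R}^d$ with norm $\|\cdot\|$; $x^1,\dots,x^d$ are the coordinates of $x$ in an orthonormal basis. In the decomposition $X_t-X_0=\int_0^tF_s\,\mathrm{d}s+M_t+R_t$: $F$ is an $\mathbb{R}^d$-valued progressively measurable process; each $M^i$ is a càdlàg locally square integrable martingale; each $R^i$ is a càdlàg adapted process with finite variations. For a càdlàg process $Z$: $Z_{t-}$ is the left limit at $t$, $\Delta Z_t=Z_t-Z_{t-}$; $V(Z,I)=\sum_iV(Z^i,I)$ is the total variation on the interval $I$. $\langle M^i\rangle$ is the predictable quadratic variation of $M^i$, $\langle M\rangle_t=\sum_i\langle M^i\rangle_t$, $\langle M\rangle_{s,t}=\langle M\rangle_t-\langle M\rangle_s$, and $\langle M\rangle_{t,\infty}=\lim_{s\to\infty}\langle M\rangle_{t,s}$. $\Gamma$ is an event. $\alpha:[0,\infty)\to(0,\infty)$ is a non-increasing càdlàg function with $\lim_{t\to\infty}\alpha(t)=0$ ($\alpha_t=\alpha(t)$). $\tau:[0,\infty)\to[0,\infty)$ is a non-decreasing càdlàg function with $\tau(t)>t$ and $\lim_{n\to\infty}\tau^n(t)=\infty$ for all $t>0$ ($\tau^n$ the $n$-th iterate). $\kappa:[0,1]\to[0,1]$ is a càdlàg increasing function such that $\kappa(p)\ge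 p$ for all $p\in[0,1]$. $E$ is a càdlàg adapted process with values in $[0,\infty]$ such that a.s. on $\Gamma$, for all $t\ge0$ and all stopping times $S$ larger than $t$, $$\frac{\mathbb{E}\big[\|\Delta M_S\|^2 1_{S<\infty}\,|\,\mathcal{F}_t\big]}{\kappa\big(\mathbb{P}[S<\infty|\mathcal{F}_t]\big)}\le E_t,$$ with the convention $\frac00=1$ and $\frac a0=\infty$ if $a>0$. The symbols $O,o$ are pathwise, as $t\to\infty$.
   Formalization: κ(0)=0 is added (for κ(0)>0 rare large jumps of M give a counterexample); the convention 0/0=1 becomes 0/0=0 (with κ(0)=0 and S=∞ the former forces E_t≥1 on Γ); X is taken adapted, so X_0 is F_0-measurable (otherwise X_0=-M_∞ is a counterexample). *)

(* Defs.v *)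
From HB Require Import structures.
From mathcomp Require Import all_boot all_order all_algebra.
From mathcomp Require Import complex.
From mathcomp Require Import all_classical all_reals all_analysis.
From mathcomp Require Import measurable_realfun.

Set Implicit Arguments.
Unset Strict Implicit.
Unset Printing Implicit Defensive.

Import Order.TTheory GRing.Theory Num.Theory.
Import numFieldNormedType.Exports.

Local Open Scope classical_set_scope.
Local Open Scope ring_scope.

(* Time is a real number restricted to [0, +oo[: paths and processes are
   functions on R whose values at negative times play no role. *)

Section paths.
Context {R : realType}.

(* The one-sided neighbourhoods are cut down to I, so that nothing is required
   outside of I; the filter is trivial on the outer side of an endpoint. *)
Definition cadlag {T : ptopologicalType} (I : set R) (f : R -> T) :=
  forall t, I t ->
    f s @[s --> within I t^'+] --> f t /\ cvg (f s @[s --> within I t^'-]).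

(* At t = 0 the left limit is a junk value. *)
Definition left_lim {T : ptopologicalType} (f : R -> T) (t : R) : T :=
  lim (f s @[s --> t^'-]).

Definition nondecreasing_on (I : set R) (f : R -> R) :=
  forall s t, I s -> I t -> s <= t -> f s <= f t.

Definition nonincreasing_on (I : set R) (f : R -> R) :=
  forall s t, I s -> I t -> s <= t -> f t <= f s.

Definition variation_on (I : set R) (f : R -> R) : \bar R :=
  ereal_sup [set total_variation p.1 p.2 f |
             p in [set p : R * R | p.1 <= p.2 /\ `[p.1, p.2] `<=` I]].

(* Landau relations as t --> +oo for extended real-valued f; in contrast with
   applying fine to f, they force f to be finite near +oo. *)
Definition ebigO (f : R -> \bar R) (g : R -> R) :=
  exists C : R, \forall t \near +oo, (`|f t| <= (C * `|g t|)%:E)%E.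

Definition elittleo (f : R -> \bar R) (g : R -> R) :=
  forall e : R, 0 < e -> \forall t \near +oo, (`|f t| <= (e * `|g t|)%:E)%E.

End paths.

Section euclidean.
Context {R : realType} {d : nat}.

(* Coordinates of x in the orthonormal family e. *)
Definition coord_in (dot : {dot 'cV[R]_d for idfun}) (e : d.-tuple 'cV[R]_d)
  (i : 'I_d) (x : 'cV[R]_d) : R := dot x (tnth e i).

Definition repulsive (H : 'M[R]_d) :=
  forall z : R[i], eigenvalue (map_mx (real_complex R) H) z ->
    0 < complex.Re z.

End euclidean.

Section processes.
Context {R : realType} {dO : measure_display} {Omega : measurableType dO}.
Variable P : probability Omega R.

Definition measurable_wrt {dV : measure_display} {V : measurableType dV}
  (G : set (set Omega)) (f : Omega -> V) :=
  forall B, measurable B -> G (f @^-1` B).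

(* g is a version of E[f | G], for f integrable, or f measurable with values in
   [0, +oo]. *)
Definition is_cond_exp (G : set (set Omega)) (f g : Omega -> \bar R) :=
  measurable_wrt G g /\
  forall A, G A -> (\int[P]_(w in A) g w = \int[P]_(w in A) f w)%E.

(* Complete and right-continuous filtration. *)
Definition usual_filtration (Ft : R -> set (set Omega)) :=
  [/\ forall t, 0 <= t ->
        sigma_algebra [set: Omega] (Ft t) /\ Ft t `<=` measurable,
      forall s t, 0 <= s -> s <= t -> Ft s `<=` Ft t,
      forall t, 0 <= t -> \bigcap_(s in `]t, +oo[) Ft s `<=` Ft t
    & forall N, P.-negligible N -> Ft 0 N].

Variable Ft : R -> set (set Omega).

Definition adapted {dV : measure_display} {V : measurableType dV}
  (X : R -> Omega -> V) :=
  forall t, 0 <= t -> measurable_wrt (Ft t) (X t).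

Definition progressively_measurable (X : R -> Omega -> R) :=
  forall t, 0 <= t -> forall B : set R, measurable B ->
    <<s [set (A : set R) `*` C | A in measurable & C in Ft t] >>
      (`[0, t] `*` [set: Omega] `&` [set p : R * Omega | B (X p.1 p.2)]).

Definition predictable (X : R -> Omega -> R) :=
  let D := `[0, +oo[ `*` [set: Omega] in
  forall B : set R, measurable B ->
    <<s D, [set [set 0] `*` C | C in Ft 0] `|`
           [set Q | exists s t C, [/\ 0 <= s, s <= t, Ft s C &
                                      Q = `]s, t] `*` C]] >>
      (D `&` [set p : R * Omega | B (X p.1 p.2)]).

Definition stopping_time (S : Omega -> \bar R) :=
  (forall w, 0 <= S w)%E /\
  forall t, 0 <= t -> Ft t [set w | (S w <= t%:E)%E].

Definition stopped (X : R -> Omega -> R) (S : Omega -> \bar R) t w : R :=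
  X (fine (Order.min t%:E (S w))) w.

Definition martingale (X : R -> Omega -> R) :=
  (forall t, 0 <= t -> P.-integrable [set: Omega] (EFin \o X t)) /\
  forall s t, 0 <= s -> s <= t ->
    is_cond_exp (Ft s) (EFin \o X t) (EFin \o X s).

Definition square_integrable_martingale (X : R -> Omega -> R) :=
  martingale X /\
  forall t, 0 <= t ->
    P.-integrable [set: Omega] (EFin \o (fun w => X t w ^+ 2)).

(* The initial value is subtracted, so that X 0 need not be integrable. *)
Definition locally (C : (R -> Omega -> R) -> Prop) (X : R -> Omega -> R) :=
  exists T : nat -> Omega -> \bar R,
    [/\ forall n, stopping_time (T n),
        forall n w, (T n w <= T n.+1 w)%E,
        {ae P, forall w, T n w @[n --> \oo] --> +oo%E}
      & forall n, C (fun t w => stopped X (T n) t w - X 0 w)].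

Definition cadlag_process {T : ptopologicalType} (X : R -> Omega -> T) :=
  forall w, cadlag `[0, +oo[ (X ^~ w).

Definition local_martingale (X : R -> Omega -> R) :=
  [/\ cadlag_process X, adapted X & locally martingale X].

Definition locally_square_integrable_martingale (X : R -> Omega -> R) :=
  [/\ cadlag_process X, adapted X & locally square_integrable_martingale X].

Definition is_predictable_qv (X A : R -> Omega -> R) :=
  [/\ predictable A, cadlag_process A,
      forall w, A 0 w = 0 /\ nondecreasing_on `[0, +oo[ (A ^~ w)
    & local_martingale (fun t w => X t w ^+ 2 - A t w)].

Definition finite_variation_process (X : R -> Omega -> R) :=
  [/\ cadlag_process X, adapted X &
      forall w t, 0 <= t -> bounded_variation 0 t (X ^~ w)].

End processes.

Section jumps.
Context {R : realType} {dO : measure_display} {Omega : measurableType dO}.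
Context {d : nat}.
Variables (P : probability Omega R) (Ft : R -> set (set Omega)).

(* ||Delta Z_S||^2 1_{S < oo} *)
Definition sq_jump_at (dot : {dot 'cV[R]_d for idfun})
    (Z : R -> Omega -> 'cV[R]_d) (S : Omega -> \bar R) (w : Omega) : \bar R :=
  if S w is r%:E then
    let J := Z r w - left_lim (Z ^~ w) r in (dot J J)%:E
  else 0%E.

(* a / b with a / 0 = +oo for a > 0 and 0 / 0 = 0.  It is used with b = kappa p,
   where kappa 0 = 0, and S = +oo gives a = b = 0: the convention 0 / 0 = 1
   would turn the bound below into 1 <= E_t, which is incompatible with
   E_t --> 0.  On the other hand kappa 0 = 0, that is, kappa p --> 0 as
   p --> 0, cannot be dispensed with: for kappa bounded away from 0 the bound
   does not exclude jumps of M that are large but so rare that M is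
   eventually constant with positive probability. *)
Definition quot0 (a : \bar R) (b : R) : \bar R :=
  if b == 0 then (if a == 0%E then 0%E else +oo%E) else (a * (b^-1)%:E)%E.

(* Conditional expectations are only defined up to null sets, whence the order
   of the quantifiers: the bound holds almost surely on Gamma for each t, each
   S and all versions g, p of the two conditional expectations. *)
Definition jump_bound (dot : {dot 'cV[R]_d for idfun}) (Gamma : set Omega)
    (kappa : R -> R) (Z : R -> Omega -> 'cV[R]_d) (E : R -> Omega -> \bar R) :=
  forall t (S : Omega -> \bar R), 0 <= t -> stopping_time Ft S ->
    (forall w, (t%:E < S w)%E) ->
  forall g p : Omega -> \bar R,
    is_cond_exp P (Ft t) (sq_jump_at dot Z S) g ->
    is_cond_exp P (Ft t) (fun w => (\1_[set w | (S w < +oo)%E] w)%:E) p ->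
  {ae P, forall w, Gamma w -> (quot0 (g w) (kappa (fine (p w))) <= E t w)%E}.

End jumps.

(* Main.v *)
(* Let q be a quadratic form with q(Hx, x) >= c q(x, x), and |x|^2 = q(x, x).
   On Gamma the drift of X eventually points outwards. Fix a late time t, an
   event B of F_t on which the hypotheses hold with probability close to 1, put
   a = alpha t and r = K a, with K large. Inside the ball of radius r, |X|^2 grows
   on average at least as fast as <M>, which gains at least a^2 / C; the jump of M
   at the exit time costs little since kappa(p) --> 0 as p --> 0; hence X leaves
   the ball with probability bounded below. But once |X| > r / 2, returning to 0
   would require, by convexity of the Huber function of radius r / 2, that a
   transform of M by a bounded predictable process reach a multiple of r^2, while
   <M> gains at most C a^2: by Lenglart's inequality this has probability at most
   1/2. If X --> 0 with positive probability, an event B as above exists on which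
   X --> 0 with conditional probability close to 1, a contradiction.

   Stochastic integrals are replaced by sums over grids of vanishing mesh. For
   Lenglart's inequality with the predictable process <M>, the stochastic interval
   before <M> exceeds a level is covered by finitely many rectangles ]s, t] x C
   with C in F_s; the exit time from this cover is a stopping time. *)

Require Import Defs.
From HB Require Import structures.
From mathcomp Require Import all_boot all_order all_algebra.
From mathcomp Require Import complex.
From mathcomp Require Import all_classical all_reals all_analysis.
From mathcomp Require Import measurable_realfun.
From mathcomp Require Import ring lra.

Set Implicit Arguments.
Unset Strict Implicit.
Unset Printing Implicit Defensive.

Import Order.TTheory GRing.Theory Num.Theory.
Import numFieldNormedType.Exports.

Local Open Scope classical_set_scope.
Local Open Scope ring_scope.

(** * Expectation *)

Section sub_sigma_algebra.
Context {R : realType} {dO : measure_display} {Omega : measurableType dO}.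
Implicit Types G : set (set Omega).

(** The hypotheses hold along the paths of [Gamma] only, with random constants and from a random
    time on, whereas martingale estimates need events of some [Ft t] and deterministic constants. A
    countable decomposition fixes the constants and the starting time. To avoid conditioning on the
    future, the outward estimate concerns a process stopped as soon as any of the required bounds
    fails; such a failure misses the paths that converge to 0, so density charges it to
    [eta * Pr P B]. Two bounds on the probability of crossing the sphere of radius r then conflict:
    it is at least [(q0 - eta) * Pr P B] when at least half of B starts inside, and at most
    [5 * eta * Pr P B]. The jump at the exit enters through [kappa p <= kappa del + p / del]: the
    last term is a multiple of the exit probability, which is the unknown, so only [kappa del] has
    to be small. The constants are fixed in the order C, K, del, eps, eta, and [q0] does not involve
    [eta]. *)

Lemma measurable_wrtP G : sigma_algebra [set: Omega] G ->
  forall (dV : measure_display) (V : measurableType dV) (f : Omega -> V),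
  measurable_wrt G f <->
  measurable_fun [set: g_sigma_algebraType G] (f : g_sigma_algebraType G -> V).
Proof.
move=> sG dV V f; split.
- move=> mf _ B mB; rewrite setTI.
  by apply: sub_sigma_algebra; exact: mf.
- move=> mf B mB; have := mf measurableT B mB; rewrite setTI.
  by rewrite /measurable /= sigma_algebra_id.
Qed.

Lemma measurable_wrt_fun G : G `<=` measurable ->
  forall (dV : measure_display) (V : measurableType dV) (f : Omega -> V),
  measurable_wrt G f -> measurable_fun [set: Omega] f.
Proof. by move=> GM dV V f mf _ B mB; rewrite setTI; apply/GM/mf. Qed.

End sub_sigma_algebra.

Section expectation.
Context {R : realType} {dO : measure_display} {Omega : measurableType dO}.
Variable P : probability Omega R.
Implicit Types (f g : Omega -> R) (A B : set Omega).

Definition intg f := P.-integrable [set: Omega] (EFin \o f).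
(** Real-valued, so that inequalities between expectations are within reach of [lra]; integrability
    is carried separately by [intg]. *)
Definition Ex f := Rintegral P [set: Omega] f.

Lemma intg_measurable f : intg f -> measurable_fun setT f.
Proof. by move=> /measurable_int/measurable_EFinP. Qed.

Lemma intgD f g : intg f -> intg g -> intg (fun w => f w + g w).
Proof. by move=> fi gi; exact: (integrableD measurableT fi gi). Qed.

Lemma intgB f g : intg f -> intg g -> intg (fun w => f w - g w).
Proof. by move=> fi gi; exact: (integrableB measurableT fi gi). Qed.

Lemma intgZ k f : intg f -> intg (fun w => k * f w).
Proof. by move=> fi; exact: (integrableZl measurableT k fi). Qed.

Lemma intg_norm f : intg f -> intg (fun w => `|f w|).
Proof. by move=> fi; exact: (@integrable_norm _ _ _ P setT _ fi). Qed.

Lemma intg_cst k : intg (fun=> k).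
Proof. exact: finite_measure_integrable_cst. Qed.

Lemma intg_le g f : measurable_fun setT f -> intg g ->
  (forall w, `|f w| <= g w) -> intg f.
Proof.
move=> mf ig fg; apply: le_integrable ig => //; first exact/measurable_EFinP.
by move=> w _ /=; rewrite lee_fin (le_trans (fg w))// ler_norm.
Qed.

Lemma intg_bounded k f : measurable_fun setT f ->
  (forall w, `|f w| <= k) -> intg f.
Proof. by move=> mf fk; apply: (intg_le mf (intg_cst k)). Qed.

Lemma intg_sum (I : Type) (s : seq I) (h : I -> Omega -> R) :
  (forall i, intg (h i)) -> intg (fun w => \sum_(i <- s) h i w).
Proof.
move=> ih; elim: s => [|i s IH].
  by apply: eq_integrable (intg_cst 0) => // w _ /=; rewrite big_nil.
apply: eq_integrable (intgD (ih i) IH) => // w _ /=; by rewrite big_cons.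
Qed.

Lemma intg_mulb k f g : intg f -> measurable_fun setT g ->
  (forall w, `|g w| <= k) -> intg (fun w => g w * f w).
Proof.
move=> fi mg gk; apply: (intg_le _ (intgZ k (intg_norm fi))).
  by apply: measurable_funM => //; exact: intg_measurable.
by move=> w; rewrite normrM ler_wpM2r.
Qed.

Lemma norm_indic A w : `|\1_A w : R| <= 1.
Proof. by rewrite indicE; case: (w \in A); rewrite ?normr1 ?normr0. Qed.

Lemma intg_indic A : measurable A -> intg (\1_A).
Proof. by move=> mA; apply: (intg_bounded _ (norm_indic A)). Qed.

Lemma intg_indicM A f : measurable A -> intg f -> intg (fun w => \1_A w * f w).
Proof. by move=> mA fi; exact: (intg_mulb fi _ (norm_indic A)). Qed.

Lemma intg_sqrM f g : measurable_fun setT f -> measurable_fun setT g ->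
  intg (fun w => f w ^+ 2) -> intg (fun w => g w ^+ 2) ->
  intg (fun w => f w * g w).
Proof.
move=> mf mg fi gi; apply: (intg_le _ (intgD fi gi)).
  exact: measurable_funM.
move=> w; rewrite ler_norml; apply/andP; split; nra.
Qed.

Lemma ExD f g : intg f -> intg g -> Ex (fun w => f w + g w) = Ex f + Ex g.
Proof. by move=> fi gi; rewrite /Ex RintegralD. Qed.

Lemma ExB f g : intg f -> intg g -> Ex (fun w => f w - g w) = Ex f - Ex g.
Proof. by move=> fi gi; rewrite /Ex RintegralB. Qed.

Lemma ExZ k f : intg f -> Ex (fun w => k * f w) = k * Ex f.
Proof. by move=> fi; rewrite /Ex RintegralZl. Qed.

Lemma Ex_cst k : Ex (fun=> k) = k.
Proof.
transitivity (k * fine (P setT)); first exact: Rintegral_cst.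
by rewrite probability_setT mulr1.
Qed.

Lemma Ex_sum (I : Type) (s : seq I) (h : I -> Omega -> R) :
  (forall i, intg (h i)) ->
  Ex (fun w => \sum_(i <- s) h i w) = \sum_(i <- s) Ex (h i).
Proof.
move=> ih; elim: s => [|i s IH].
  rewrite big_nil -[RHS](Ex_cst 0).
  by congr Ex; apply/funext => w; rewrite big_nil.
rewrite big_cons -IH -ExD//; last exact: intg_sum.
by congr Ex; apply/funext => w; rewrite big_cons.
Qed.

Lemma le_Ex f g : intg f -> intg g -> (forall w, f w <= g w) -> Ex f <= Ex g.
Proof. by move=> fi gi fg; apply: le_Rintegral. Qed.

Lemma Ex_ge0 f : (forall w, 0 <= f w) -> 0 <= Ex f.
Proof. by move=> f0; apply: Rintegral_ge0. Qed.

Lemma norm_Ex f : intg f -> `|Ex f| <= Ex (fun w => `|f w|).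
Proof. by move=> fi; apply: le_normr_Rintegral. Qed.

Definition Pr A : R := fine (P A).

Lemma PrE A : measurable A -> P A = (Pr A)%:E.
Proof. by move=> mA; rewrite /Pr fineK// fin_num_measure. Qed.

Lemma Ex_indic A : measurable A -> Ex (\1_A) = Pr A.
Proof. by move=> mA; rewrite /Ex /Rintegral integral_indic// setIT. Qed.

Lemma Pr_ge0 A : 0 <= Pr A.
Proof. by rewrite /Pr fine_ge0. Qed.

Lemma le_Pr A B : measurable A -> measurable B -> A `<=` B -> Pr A <= Pr B.
Proof.
by move=> mA mB AB; rewrite -lee_fin -!PrE// le_measure ?inE.
Qed.

Lemma PrU_le A B : measurable A -> measurable B -> Pr (A `|` B) <= Pr A + Pr B.
Proof.
move=> mA mB; rewrite -lee_fin EFinD -!PrE//; last exact: measurableU.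
exact: measureU2.
Qed.

Lemma PrDI A B : measurable A -> measurable B ->
  Pr A = Pr (A `\` B) + Pr (A `&` B).
Proof.
move=> mA mB; apply: EFin_inj; rewrite EFinD -!PrE//.
- by rewrite (measureDI P mA mB).
- exact: measurableI.
- exact: measurableD.
Qed.

Lemma Ex_cvg (h : nat -> Omega -> R) f g :
  (forall n, measurable_fun setT (h n)) -> intg g ->
  (forall n w, `|h n w| <= g w) -> (forall w, h n w @[n --> \oo] --> f w) ->
  intg f /\ Ex (h n) @[n --> \oo] --> Ex f.
Proof.
move=> mh ig hg hf.
have mf : measurable_fun setT f.
  by apply: (measurable_fun_cvg (h := h)) => // w _; exact: hf.
have fg w : `|f w| <= g w.
  have hn : `|h n w| @[n --> \oo] --> `|f w| by exact: cvg_norm.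
  move/cvg_lim : (hn) => <-//; apply: limr_le; last exact: nearW.
  by apply/cvg_ex; exists `|f w|.
have iF : intg f by exact: (intg_le mf ig).
split => //.
suff: (\int[P]_w (h n w)%:E)%E @[n --> \oo] --> (\int[P]_w (f w)%:E)%E.
  rewrite -[X in _ --> X](fineK (integrable_fin_num measurableT iF)).
  by move=> /fine_cvgP[].
apply: (dominated_cvg measurableT (g := EFin \o g)) => //.
- by move=> n; apply/measurable_EFinP.
- by move=> w _; apply/fine_cvgP => //=; split; [exact: nearW|exact: hf].
- by move=> n w _ /=; rewrite lee_fin.
Qed.

Lemma Ex_fatou (h : nat -> Omega -> R) f C :
  (forall n, intg (h n)) -> (forall n w, 0 <= h n w) ->
  (forall n, Ex (h n) <= C) -> (forall w, h n w @[n --> \oo] --> f w) ->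
  intg f /\ Ex f <= C.
Proof.
move=> ih h0 hC hf.
have f0 w : 0 <= f w.
  move/cvg_lim : (hf w) => <-//; apply: limr_ge; last exact: nearW.
  by apply/cvg_ex; exists (f w).
have mf : measurable_fun setT f.
  apply: (measurable_fun_cvg (h := h)) => //.
  by move=> n; exact: intg_measurable.
have le : (\int[P]_w (f w)%:E <= C%:E)%E.
  have -> : (\int[P]_w (f w)%:E = \int[P]_w limn_einf (fun n => (h n w)%:E))%E.
    apply: eq_integral => w _; have fw : (h n w)%:E @[n --> \oo] --> (f w)%:E.
      by apply/fine_cvgP => //=; split; [exact: nearW|exact: hf].
    rewrite is_cvg_limn_einfE; first by apply/esym/cvg_lim.
    by apply/cvg_ex; exists (f w)%:E.
  apply: le_trans (fatou P measurableT _ _) _.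
  - by move=> n; apply/measurable_EFinP; exact: intg_measurable.
  - by move=> n w _; rewrite lee_fin.
  rewrite limn_einf_lim; apply: lime_le; first exact: is_cvg_einfs.
  apply: nearW => n; apply: le_trans (_ : (\int[P]_w (h n w)%:E <= _)%E).
    by apply: ereal_inf_lbound; exists n => /=.
  by rewrite -(fineK (integrable_fin_num measurableT (ih n))) lee_fin; exact: hC.
have iF : intg f.
  apply/integrableP; split; first exact/measurable_EFinP.
  rewrite (le_lt_trans _ (ltry C))//.
  by under eq_integral do rewrite /= ger0_norm//.
by split => //; rewrite -lee_fin /Ex /Rintegral fineK//; exact: integrable_fin_num.
Qed.

Lemma Pr_markov f A l : intg f -> measurable A -> 0 <= l ->
  (forall w, 0 <= f w) -> (forall w, A w -> l <= f w) -> l * Pr A <= Ex f.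
Proof.
move=> fi mA l0 f0 Af; rewrite -Ex_indic// -ExZ; last exact: intg_indic.
apply: le_Ex => //; first exact/intgZ/intg_indic.
move=> w; rewrite indicE; case: (boolP (w \in A)); rewrite ?mulr1 ?mulr0//.
by rewrite inE => /Af.
Qed.

(** Bounded convergence of the indicators. Compared with continuity from above, no monotonicity of
    the events is involved, which suits events that are only known to fail eventually along each
    path. *)
Lemma Pr_cvg0 (A : nat -> set Omega) : (forall n, measurable (A n)) ->
  (forall w, \forall n \near \oo, ~ A n w) -> Pr (A n) @[n --> \oo] --> 0.
Proof.
move=> mA A0.
have A1 w : (\1_(A n) w : R) @[n --> \oo] --> (0 : R).
  apply: cvg_near_cst; near=> n.
  by rewrite indicE memNset//; near: n; exact: A0.
have [_] := Ex_cvg (fun n => intg_measurable (intg_indic (mA n))) (intg_cst 1)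
  (fun n w => norm_indic (A n) w) A1.
by rewrite Ex_cst; under eq_cvg do rewrite Ex_indic//.
Unshelve. all: by end_near. Qed.

Lemma intg_abs_cont f : intg f -> forall eps : R, 0 < eps ->
  exists2 del : R, 0 < del & forall A, measurable A -> Pr A <= del ->
    Ex (fun w => \1_A w * `|f w|) <= eps.
Proof.
move=> fi eps e0.
have mnf : measurable_fun setT (fun w => `|f w|) by exact/intg_measurable/intg_norm.
pose h (n : nat) w : R := `|f w| - Num.min `|f w| n%:R.
have mh n : measurable_fun setT (h n).
  by apply: measurable_funB => //; exact: measurable_minr.
have h0 n w : 0 <= h n w by rewrite subr_ge0 ge_min lexx.
have hf n w : `|h n w| <= `|f w|.
  by rewrite ger0_norm// /h lerBlDr lerDl le_min normr_ge0 ler0n.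
have hi n : intg (h n) := intg_le (mh n) (intg_norm fi) (hf n).
have hc w : h n w @[n --> \oo] --> (0 : R).
  apply: cvg_near_cst; near=> n.
  rewrite /h; apply/eqP; rewrite subr_eq0; apply/eqP/esym/min_idPl.
  by near: n; exact: nbhs_infty_ger.
have [_] := Ex_cvg mh (intg_norm fi) hf hc.
rewrite Ex_cst => /cvgrPdist_lt /(_ (eps / 2) (divr_gt0 e0 (ltr0Sn _ 1))) [N _].
move=> /(_ N (leqnn N)) /=; rewrite sub0r normrN => hN.
(* The truncated part of [f] is at most [N], hence costs at most [N.+1 * Pr A]; the successor keeps
   the divisor positive. *)
exists (eps / 2 / N.+1%:R) => [|A mA Ad]; first by rewrite !divr_gt0.
have : Ex (fun w => \1_A w * `|f w|) <= Ex (fun w => h N w + N.+1%:R * \1_A w).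
  apply: le_Ex.
  - exact/intg_indicM/intg_norm.
  - by apply: intgD => //; exact/intgZ/intg_indic.
  move=> w; rewrite indicE; case: (w \in A) => /=;
    rewrite ?mulr1 ?mul1r ?mulr0 ?mul0r ?addr0//.
  rewrite /h addrAC -addrA lerDl subr_ge0 ge_min ler_nat leqnSn orbT//.
move/le_trans; apply; rewrite ExD//; last exact/intgZ/intg_indic.
rewrite ExZ; last exact: intg_indic.
rewrite Ex_indic// [leRHS]splitr lerD//.
  by rewrite (le_trans (ler_norm _))// ltW.
by rewrite mulrC -ler_pdivlMr.
Unshelve. all: by end_near. Qed.

Section orthogonality.
Variable G : set (set Omega).
Hypotheses (sG : sigma_algebra [set: Omega] G) (GM : G `<=` measurable).

(** The sum is the integer part of [x], counted level by level. *)
Let sum_levels (m : nat) (x : R) : 0 <= x <= m%:R ->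
  x - 1 <= \sum_(i < m) (i.+1%:R <= x)%R%:R <= x.
Proof.
elim: m => [|m IH] /andP[x0 xm].
  by rewrite big_ord0; apply/andP; split=> //; lra.
rewrite big_ord_recr /=; have [xm'|mx] := leP x m%:R.
  have := IH; rewrite x0 xm' => /(_ isT) /andP[h1 h2].
  have -> : (m.+1%:R <= x) = false.
    by apply/negbTE; rewrite -ltNge (le_lt_trans xm')// ltr_nat.
  by rewrite addr0 h1 h2.
have -> : \sum_(i < m) (i.+1%:R <= x)%R%:R = m%:R :> R.
  rewrite (eq_bigr (fun=> 1)) ?sumr_const ?card_ord// => i _.
  by rewrite (le_trans _ (ltW mx))// ler_nat.
have : m.+1%:R = m%:R + 1 :> R by rewrite -natr1.
by case: (leP m.+1%:R x) => /= h1 h2; apply/andP; rewrite ?mulr1n ?mulr0n; split; lra.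
Qed.

(* The bounded function xi is within 1/m of a combination of the indicators of
   the levels [xi >= - k + 2 k i / m]. *)
Lemma Ex_orth_bounded (D xi : Omega -> R) (k : R) : intg D ->
  (forall A, G A -> Ex (fun w => \1_A w * D w) = 0) ->
  measurable_wrt G xi -> (forall w, `|xi w| <= k) ->
  Ex (fun w => xi w * D w) = 0.
Proof.
move=> Di D0 mxi xik.
have mxi' := measurable_wrt_fun GM mxi.
have k0 : 0 <= k.
  by rewrite (le_trans (normr_ge0 _) (xik point)).
(* [xi] rescaled to [0, 1]; [k + 1] instead of [k] keeps the denominator positive when [k = 0]. *)
pose z w : R := (xi w + k) / (2 * (k + 1)).
have z01 w : 0 <= z w <= 1.
  have := xik w; rewrite ler_norml => /andP[h1 h2]; apply/andP; split.
    by rewrite divr_ge0//; lra.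
  by rewrite ler_pdivrMr; lra.
pose A m i : set Omega := [set w | i.+1%:R <= m.+1%:R * z w].
have GA m i : G (A m i).
  have mz : measurable_wrt G z.
    move/(measurable_wrtP sG) : mxi => mxi; apply/(measurable_wrtP sG).
    by apply: measurable_funM => //; exact: measurable_funD.
  have -> : A m i = z @^-1` `[i.+1%:R / m.+1%:R, +oo[%classic.
    by apply/seteqP; split=> w; rewrite /A /= in_itv /= andbT ler_pdivrMr// mulrC.
  by apply: mz; exact: measurable_itv.
pose s m w : R := m.+1%:R^-1 * \sum_(i < m.+1) \1_(A m i) w.
have si m : intg (s m) by apply/intgZ/intg_sum => i; apply/intg_indic/GM/GA.
have sz m w : z w - m.+1%:R^-1 <= s m w <= z w.
  have /(@sum_levels m.+1) : 0 <= m.+1%:R * z w <= m.+1%:R.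
    by have /andP[h1 h2] := z01 w; rewrite mulr_ge0//= ler_piMr.
  rewrite /s [X in _ <= X <= _ -> _](_ : _ = \sum_(i < m.+1) \1_(A m i) w); last first.
    apply: eq_bigr => i _; rewrite indicE.
    suff -> : (w \in A m i) = (i.+1%:R <= m.+1%:R * z w) by [].
    by apply/idP/idP; rewrite inE.
  move=> /andP[h1 h2]; apply/andP; split.
    rewrite -(ler_pM2l (ltr0Sn R m)) mulrA mulfV// mul1r mulrBr mulfV//.
  by rewrite ler_pdivrMl.
have ED0 : Ex D = 0.
  rewrite -[RHS](D0 setT); last by case: sG => s0 sC _; rewrite -(setD0 setT); exact: sC.
  by congr Ex; apply/funext => w; rewrite indicT mul1r.
have sD m : Ex (fun w => s m w * D w) = 0.
  rewrite (_ : (fun w => _) = fun w => m.+1%:R^-1 * \sum_(i < m.+1) (\1_(A m i) w * D w)); last first.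
    by apply/funext => w; rewrite /s -mulrA mulr_suml.
  rewrite ExZ; last by apply: intg_sum => i; exact/intg_indicM/Di/GM/GA.
  rewrite Ex_sum; last by move=> i; exact/intg_indicM/Di/GM/GA.
  by rewrite big1 ?mulr0// => i _; exact: D0.
have s_cvg w : s m w * D w @[m --> \oo] --> z w * D w.
  apply: cvgMl => //.
  apply: (@squeeze_cvgr _ _ _ _ (fun m => z w - m.+1%:R^-1) (fun=> z w)).
  - exact: nearW (sz^~ w).
  - rewrite -[X in _ --> X]subr0; apply: cvgB; first exact: cvg_cst.
    exact: cvg_harmonic.
  - exact: cvg_cst.
have sDle m w : `|s m w * D w| <= `|D w|.
  rewrite normrM ler_piMl// ger0_norm.
    by have /andP[_ h] := sz m w; have /andP[_ h'] := z01 w; exact: le_trans h h'.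
  by rewrite mulr_ge0// sumr_ge0// => i _; rewrite indicE.
have [zi zE] := Ex_cvg (fun m => measurable_funM (intg_measurable (si m))
  (intg_measurable Di)) (intg_norm Di) sDle s_cvg.
have zE0 : Ex (fun w => z w * D w) = 0.
  move: zE; under eq_cvg do rewrite sD.
  by move/cvg_lim => <-//; rewrite lim_cst.
rewrite (_ : (fun w => _) = fun w => 2 * (k + 1) * (z w * D w) - k * D w); last first.
  by apply/funext => w; rewrite /z; field; lra.
rewrite ExB ?ExZ//; [|exact: intgZ..].
by rewrite zE0 ED0 !mulr0 subr0.
Qed.

(** Cutting [xi] off outside the G-event [|xi| <= n] reduces to the bounded case; [|xi * D|]
    dominates the limit in n. *)
Lemma Ex_orth_sq (D xi : Omega -> R) : intg D ->
  (forall A, G A -> Ex (fun w => \1_A w * D w) = 0) ->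
  measurable_wrt G xi -> intg (fun w => xi w * D w) ->
  Ex (fun w => xi w * D w) = 0.
Proof.
move=> Di D0 mxi xiD.
pose B (n : nat) := [set w | `|xi w| <= n%:R].
have GB n : G (B n).
  have -> : B n = xi @^-1` `[- n%:R, n%:R]%classic.
    by apply/seteqP; split=> w; rewrite /B /= in_itv /= ler_norml.
  by apply: mxi; exact: measurable_itv.
pose xic (n : nat) w : R := \1_(B n) w * xi w.
have mxic n : measurable_wrt G (xic n).
  move/(measurable_wrtP sG) : mxi => mxi; apply/(measurable_wrtP sG).
  apply: measurable_funM => //; apply: measurable_indic.
  by apply: sub_sigma_algebra; exact: GB.
have xicn n w : `|xic n w| <= n%:R.
  rewrite /xic indicE; have [|] := boolP (w \in B n); rewrite ?mul1r ?mul0r ?normr0//.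
  by rewrite inE.
have h1 n : Ex (fun w => xic n w * D w) = 0 by exact: Ex_orth_bounded (xicn n).
have xic_cvg w : xic n w * D w @[n --> \oo] --> xi w * D w.
  apply: cvgMl; apply: cvg_near_cst; near=> n.
  rewrite /xic indicE mem_set ?mul1r// /B /=.
  by near: n; exact: nbhs_infty_ger.
have xicle n w : `|xic n w * D w| <= `|xi w * D w|.
  by rewrite /xic -mulrA normrM ler_piMl// norm_indic.
have [_] := Ex_cvg (fun n => measurable_funM (measurable_wrt_fun GM (mxic n))
  (intg_measurable Di)) (intg_norm xiD) xicle xic_cvg.
under eq_cvg do rewrite h1.
by move/cvg_lim => <-//; rewrite lim_cst.
Unshelve. all: by end_near. Qed.

End orthogonality.
End expectation.

(** * Cadlag paths, filtrations and stopping times *)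

Section cadlag_paths.
Context {R : realType}.

Lemma cvg_maxr {T : Type} (F : set_system T) {FF : Filter F} (f g : T -> R) a b :
  f x @[x --> F] --> a -> g x @[x --> F] --> b ->
  Num.max (f x) (g x) @[x --> F] --> Num.max a b.
Proof.
move=> fa gb; rewrite maxr_absE; under eq_fun do rewrite maxr_absE.
by apply: cvgMl; apply: cvgD; [exact: cvgD|apply: cvg_norm; exact: cvgB].
Qed.

Lemma cvg_minr {T : Type} (F : set_system T) {FF : Filter F} (f g : T -> R) a b :
  f x @[x --> F] --> a -> g x @[x --> F] --> b ->
  Num.min (f x) (g x) @[x --> F] --> Num.min a b.
Proof.
move=> fa gb; rewrite minr_absE; under eq_fun do rewrite minr_absE.
by apply: cvgMl; apply: cvgB; [exact: cvgD|apply: cvg_norm; exact: cvgB].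
Qed.

(** Restricting the neighbourhoods to [0, +oo[ has an effect only on the left of 0, where the filter
    becomes trivial and converges to anything. *)
Lemma cadlagP {T : ptopologicalType} (f : R -> T) :
  cadlag `[0, +oo[ f <->
  (forall t : R, 0 <= t -> f s @[s --> t^'+] --> f t) /\
  (forall t : R, 0 < t -> cvg (f s @[s --> t^'-])).
Proof.
have wr (t : R) : 0 <= t -> within `[0, +oo[%classic t^'+ = t^'+.
  move=> t0; apply/seteqP; split => A; rewrite /within /=.
    apply: filterS2 (nbhs_right_gt t) => s ts; apply.
    by rewrite /= in_itv /= andbT ltW// (le_lt_trans t0).
  by apply: filterS.
have wl (t : R) : 0 < t -> within `[0, +oo[%classic t^'- = t^'-.
  move=> t0; apply/seteqP; split => A; rewrite /within /=; last exact: filterS.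
  by apply: filterS2 (nbhs_left_ge t0) => s ts; apply; rewrite /= in_itv /= andbT.
split=> [h|[h1 h2]].
  split=> t t0.
    have [|+ _] := h t; first by rewrite /= in_itv /= andbT.
    by rewrite wr.
  have [|_] := h t; first by rewrite /= in_itv /= andbT ltW.
  by rewrite wl.
move=> t; rewrite /= in_itv /= andbT => t0; split; first by rewrite wr//; exact: h1.
move: t0; rewrite le_eqVlt => /predU1P[<-|t0]; last by rewrite wl//; exact: h2.
apply/cvg_ex; exists point => A _; rewrite /within /= /nbhs /=.
near=> s; rewrite /= in_itv /= andbT => s0; exfalso.
have : s < 0 by near: s; exact: nbhs_left_lt.
by rewrite ltNge s0.
Unshelve. all: by end_near. Qed.

(** Terms equal to [t] are allowed because the limit is [f t] itself; on the left the approach has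
    to be strict. *)
Lemma right_cvg_seq {T : topologicalType} (f : R -> T) (t : R) (u : nat -> R) :
  f s @[s --> t^'+] --> f t -> (forall n, t <= u n) ->
  u n @[n --> \oo] --> t -> f (u n) @[n --> \oo] --> f t.
Proof.
move=> ft tu ut A /= nA; have := ft A nA; rewrite /= /at_right => wA.
have : \forall s \near t, t < s -> A (f s) by exact: wA.
move=> /ut; rewrite /nbhs /=; apply: filterS => n /=.
move: (tu n); rewrite le_eqVlt => /predU1P[<-|tun /(_ tun)//] _.
exact: nbhs_singleton.
Qed.

Lemma left_cvg_seq {T : topologicalType} (f : R -> T) (t : R) (l : T) (u : nat -> R) :
  f s @[s --> t^'-] --> l -> (forall n, u n < t) ->
  u n @[n --> \oo] --> t -> f (u n) @[n --> \oo] --> l.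
Proof.
move=> ft tu ut A /= nA; have := ft A nA; rewrite /= /at_left => wA.
have : \forall s \near t, s < t -> A (f s) by exact: wA.
by move=> /ut; rewrite /nbhs /=; apply: filterS => n /= /(_ (tu n)).
Qed.

Lemma cadlag_stopped {T : ptopologicalType} (f : R -> T) (r : \bar R) :
  (0 <= r)%E -> cadlag `[0, +oo[ f ->
  cadlag `[0, +oo[ (fun t => f (fine (Order.min t%:E r))).
Proof.
case: r => [r| |]//; last first.
  move=> _ fc; rewrite (_ : (fun t => _) = f)//; apply/funext => t.
  by rewrite min_l ?leey.
rewrite lee_fin => r0 /cadlagP[f1 f2]; apply/cadlagP.
rewrite (_ : (fun t => _) = fun t => f (Order.min t r)); last first.
  by apply/funext => t; rewrite -EFin_min.
split=> [t t0|t t0].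
  have [tr|rt] := ltP t r.
    rewrite min_l ?ltW//; apply: cvg_trans (f1 _ t0).
    apply: near_eq_cvg; near=> s; rewrite min_l//.
    by near: s; exact: nbhs_right_le.
  rewrite min_r//; apply: cvg_near_cst; near=> s.
  rewrite min_r//; apply: le_trans rt _.
  by near: s; exact: nbhs_right_ge.
have [tr|rt] := leP t r.
  have /cvg_ex[l fl] := f2 _ t0; apply/cvg_ex; exists l.
  apply: cvg_trans fl; apply: near_eq_cvg; near=> s; rewrite min_l//.
  by apply: le_trans tr; near: s; exact: nbhs_left_le.
apply/cvg_ex; exists (f r); apply: cvg_near_cst; near=> s.
by rewrite min_r//; near: s; exact: nbhs_left_ge.
Unshelve. all: by end_near. Qed.

End cadlag_paths.

Lemma in_setb {T : Type} (p : T -> bool) w : (w \in [set w | p w]) = p w.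
Proof. by apply/idP/idP; rewrite inE. Qed.

Section filtration.
Context {R : realType} {dO : measure_display} {Omega : measurableType dO}.
Variables (P : probability Omega R) (Ft : R -> set (set Omega)).
Hypothesis hFt : usual_filtration P Ft.

Lemma Ft_sigma (t : R) : 0 <= t -> sigma_algebra [set: Omega] (Ft t).
Proof. by case: hFt => h _ _ _ /h[]. Qed.

Lemma Ft_measurable (t : R) : 0 <= t -> Ft t `<=` measurable.
Proof. by case: hFt => h _ _ _ /h[]. Qed.

Lemma Ft_mono (s t : R) : 0 <= s -> s <= t -> Ft s `<=` Ft t.
Proof. by case: hFt => _ h _ _; exact: h. Qed.

Lemma FtP (t : R) (A : set Omega) : 0 <= t ->
  Ft t A <-> measurable (A : set (g_sigma_algebraType (Ft t))).
Proof.
move=> t0; split=> [FA|]; first by apply: sub_sigma_algebra.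
by rewrite /measurable /= sigma_algebra_id//; exact: Ft_sigma.
Qed.

Lemma adapted_le (dV : measure_display) (V : measurableType dV)
  (X : R -> Omega -> V) (s t : R) : adapted Ft X -> 0 <= s -> s <= t ->
  measurable_wrt (Ft t) (X s).
Proof. by move=> aX s0 st B mB; apply: (Ft_mono s0 st); exact: aX. Qed.

Lemma stopping_lt S (t : R) : stopping_time Ft S -> 0 <= t ->
  Ft t [set w | (S w < t%:E)%E].
Proof.
move=> [S0 hS] t0; apply/FtP => //.
have -> : [set w | (S w < t%:E)%E] =
    \bigcup_(q : rat) [set w | ratr q < t /\ (S w <= (ratr q)%:E)%E].
  apply/seteqP; split=> w /=; last first.
    by move=> [q _ [qt]] /le_lt_trans; apply; rewrite lte_fin.
  case E : (S w) => [r| |]//; rewrite ?lte_fin => rt; last first.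
    by have := S0 w; rewrite E.
  have [q] := rat_in_itvoo rt; rewrite in_itv /= => /andP[rq qt].
  by exists q => //; split=> //; rewrite E lee_fin ltW.
apply: bigcupT_measurable_rat => q.
have [qt|qt] := boolP (ratr q < t); last first.
  by rewrite (_ : [set w | _] = set0)//; apply/seteqP; split=> // w [].
rewrite (_ : [set w | _] = [set w | (S w <= (ratr q)%:E)%E]); last first.
  by apply/seteqP; split=> [w []|w].
have [q0|q0] := leP 0 (ratr q : R).
  by apply/FtP => //; apply: (Ft_mono q0 (ltW qt)); exact: hS.
rewrite (_ : [set w | _] = set0)//.
apply/seteqP; split=> // w /= Sq; have := le_trans (S0 w) Sq.
by rewrite lee_fin leNgt q0.
Qed.

Lemma stopping_ge S (t : R) : stopping_time Ft S -> 0 <= t ->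
  Ft t [set w | (t%:E <= S w)%E].
Proof.
move=> hS t0; apply/FtP => //.
rewrite (_ : [set w | _] = ~` [set w | (S w < t%:E)%E]); last first.
  by apply/seteqP; split=> w /=; rewrite leNgt => /negP.
by apply: measurableC; apply/FtP => //; exact: stopping_lt.
Qed.

Lemma stopping_min S S' : stopping_time Ft S -> stopping_time Ft S' ->
  stopping_time Ft (fun w => Order.min (S w) (S' w)).
Proof.
move=> [S0 hS] [S'0 hS']; split=> [w|t t0]; first by rewrite le_min S0 S'0.
apply/FtP => //; rewrite (_ : [set w | _] =
    [set w | (S w <= t%:E)%E] `|` [set w | (S' w <= t%:E)%E]).
  by apply: measurableU; apply/FtP => //; [exact: hS|exact: hS'].
by apply/seteqP; split=> w /=; rewrite ge_min => /orP.
Qed.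

Lemma stopping_cst (r : \bar R) : (0 <= r)%E -> stopping_time Ft (fun=> r).
Proof.
move=> r0; split=> // t t0; apply/FtP => //.
have [rt|rt] := boolP (r <= t%:E)%E.
  by rewrite (_ : [set w | _] = setT)//; apply/seteqP; split.
by rewrite (_ : [set w | _] = set0)//; apply/seteqP; split.
Qed.

Lemma mul_measurable_wrt G (f g : Omega -> R) : sigma_algebra [set: Omega] G ->
  measurable_wrt G f -> measurable_wrt G g -> measurable_wrt G (fun w => f w * g w).
Proof.
move=> sG /(measurable_wrtP sG) mf /(measurable_wrtP sG) mg.
by apply/(measurable_wrtP sG); exact: measurable_funM.
Qed.

Lemma stopped_stopped (Y : R -> Omega -> R) rho rho' t w :
  (0 <= rho w)%E -> (0 <= rho' w)%E ->
  stopped (stopped Y rho) rho' t w =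
  stopped Y (fun w => Order.min (rho w) (rho' w)) t w.
Proof.
move=> r0 r0'; rewrite /stopped fineK; last first.
  by case: (rho' w) r0' => //= [r _|_]; rewrite -?EFin_min// min_l ?leey.
by rewrite -minA [Order.min (rho' w) _]minC.
Qed.

End filtration.

(** * Uniform grids and random times *)

Section grid.
Context {R : realType}.

Definition grid (s s' : R) (n j : nat) : R := s + j%:R * ((s' - s) / n%:R).

Lemma grid0 s s' n : grid s s' n 0 = s.
Proof. by rewrite /grid mul0r addr0. Qed.

Lemma gridn s s' n : grid s s' n.+1 n.+1 = s'.
Proof. by rewrite /grid mulrC divfK ?pnatr_eq0// addrC subrK. Qed.

Lemma gridS s s' n j : grid s s' n j.+1 = grid s s' n j + (s' - s) / n%:R.
Proof. by rewrite /grid -natr1 mulrDl mul1r addrA. Qed.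

Lemma grid_mono s s' n i j : s <= s' -> (i <= j)%N ->
  grid s s' n i <= grid s s' n j.
Proof.
move=> ss ij; rewrite /grid lerD2l ler_wpM2r ?ler_nat//.
by rewrite divr_ge0// subr_ge0.
Qed.

Lemma grid_ge s s' n j : s <= s' -> s <= grid s s' n j.
Proof. by move=> ss; rewrite -{1}(grid0 s s' n) grid_mono. Qed.

Lemma grid_le s s' n j : s <= s' -> (j <= n.+1)%N -> grid s s' n.+1 j <= s'.
Proof. by move=> ss jn; rewrite -{2}(gridn s s' n) grid_mono. Qed.

(* Reading [r] for a random time, the sum is the value of u at the first grid
   point after [r]. *)
Lemma grid_stop (s s' : R) (r : \bar R) n : s <= s' -> (s%:E <= r)%E ->
  exists J, [/\ (J <= n.+1)%N,
    fine (Order.min s'%:E r) <= grid s s' n.+1 J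
      <= fine (Order.min s'%:E r) + (s' - s) / n.+1%:R &
    forall u : nat -> R, u 0%N + \sum_(j < n.+1)
      ((grid s s' n.+1 j)%:E <= r)%E%:R * (u j.+1 - u j) = u J].
Proof.
move=> ss sr; set g := grid s s' n.+1.
have [m ms] : exists m : R, Order.min s'%:E r = m%:E.
  move: sr; case: (r) => [r'| |]// _; first by exists (Order.min s' r'); rewrite EFin_min.
  by exists s'; rewrite min_l ?leey.
have ms' : m <= s' by rewrite -lee_fin -ms ge_min lexx.
have sm : s <= m by rewrite -lee_fin -ms le_min lee_fin ss sr.
(* Among the first [k] indices, [J] is the first one whose grid point exceeds [r], and [J = k] if
   there is none. For the full grid this is either the point after [r] or the end point [s']. *)
have H k : (k <= n.+1)%N -> exists J, [/\ (J <= k)%N,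
    forall j, (j < J)%N -> ((g j)%:E <= r)%E,
    (J < k)%N -> (r < (g J)%:E)%E &
    forall u : nat -> R, u 0%N + \sum_(j < k)
      ((g j)%:E <= r)%E%:R * (u j.+1 - u j) = u J].
  elim: k => [_|k IH kn]; first by exists 0%N; split=> // u; rewrite big_ord0 addr0.
  have [J [Jk gJ rJ uJ]] := IH (ltnW kn).
  have [Jk'|] := ltnP J k.
    exists J; split; [exact: leqW|exact: gJ|by move=> _; exact: rJ|move=> u].
    rewrite big_ord_recr /= addrA uJ leNgt (lt_le_trans (rJ Jk')) ?mul0r ?addr0//.
    by rewrite lee_fin grid_mono.
  move=> kJ; have {kJ Jk} Jk : J = k by apply/eqP; rewrite eqn_leq Jk.
  subst J; have [gk|gk] := leP (g k)%:E r.
    exists k.+1; split=> //; last first.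
      by move=> u; rewrite big_ord_recr /= addrA uJ gk mul1r addrC subrK.
    - by rewrite ltnn.
    - by move=> j; rewrite ltnS leq_eqVlt => /predU1P[->|/gJ].
  exists k; split=> // u.
  by rewrite big_ord_recr /= addrA uJ leNgt gk mul0r addr0.
have [J [Jn gJ rJ uJ]] := H _ (leqnn _); exists J; split=> //.
have J0 : (0 < J)%N.
  rewrite lt0n; apply/eqP => J0; have := rJ; rewrite J0 => /(_ isT).
  by rewrite /g grid0 ltNge sr.
rewrite ms /=; apply/andP; split.
  move: Jn; rewrite leq_eqVlt => /predU1P[->|/rJ rgJ]; first by rewrite /g gridn.
  by rewrite -lee_fin -ms ge_min (ltW rgJ) orbT.
rewrite -(prednK J0) /g gridS lerD2r -lee_fin -ms le_min gJ ?ltn_predL// andbT.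
by rewrite lee_fin /g grid_le// (leq_trans (leq_pred _)).
Qed.

(** The selected grid point lies in [min t r, min t r + mesh], so right continuity alone gives the
    limit. *)
Lemma grid_stop_cvg (f : R -> R) (s t : R) (r : \bar R) : 0 <= s -> s <= t ->
  (s%:E <= r)%E -> cadlag `[0, +oo[ f ->
  f s + \sum_(j < m.+1) ((grid s t m.+1 j)%:E <= r)%E%:R *
     (f (grid s t m.+1 j.+1) - f (grid s t m.+1 j)) @[m --> \oo] -->
  f (fine (Order.min t%:E r)).
Proof.
move=> s0 st sr /cadlagP[cr _]; have t0 := le_trans s0 st.
have [q q0 qE] : exists2 q, 0 <= q & Order.min t%:E r = q%:E.
  case: r sr => [q| |]// sq.
    exists (Order.min t q); rewrite ?EFin_min// le_min t0.
    by rewrite (le_trans s0)// -lee_fin.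
  by exists t => //; rewrite min_l ?leey.
pose x m := grid s t m.+1 (sval (cid (grid_stop m st sr))).
have xq m : q <= x m <= q + (t - s) / m.+1%:R.
  by rewrite /x; case: cid => /= J [_ + _]; rewrite qE.
have fx m : f s + \sum_(j < m.+1) ((grid s t m.+1 j)%:E <= r)%E%:R *
     (f (grid s t m.+1 j.+1) - f (grid s t m.+1 j)) = f (x m).
  rewrite /x; case: cid => /= J [_ _ /(_ (fun j => f (grid s t m.+1 j)))].
  by rewrite grid0.
rewrite qE /=; under eq_cvg do rewrite fx.
apply: right_cvg_seq; first exact: cr.
  by move=> m; have /andP[] := xq m.
apply: (@squeeze_cvgr _ _ _ _ (fun=> q) (fun m => q + (t - s) / m.+1%:R)).
- exact: nearW xq.
- exact: cvg_cst.
- rewrite -[X in _ --> X]addr0; apply: cvgD; first exact: cvg_cst.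
  rewrite -[X in _ --> X](mulr0 (t - s)); apply: cvgMr.
  exact: cvg_harmonic.
Qed.

End grid.

(** * Optional stopping and quadratic variation *)

Section optional_stopping.
Context {R : realType} {dO : measure_display} {Omega : measurableType dO}.
Variables (P : probability Omega R) (Ft : R -> set (set Omega)).
Hypothesis hFt : usual_filtration P Ft.

Lemma FtI (t : R) A B : 0 <= t -> Ft t A -> Ft t B -> Ft t (A `&` B).
Proof.
by move=> t0 FA FB; apply/(FtP hFt) => //; apply: measurableI; apply/(FtP hFt).
Qed.

Lemma FtD (t : R) A B : 0 <= t -> Ft t A -> Ft t B -> Ft t (A `\` B).
Proof.
by move=> t0 FA FB; apply/(FtP hFt) => //; apply: measurableD; apply/(FtP hFt).
Qed.

Lemma FtT (t : R) : 0 <= t -> Ft t setT.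
Proof. by move=> t0; apply/(FtP hFt). Qed.

(** Conditional expectations disappear here: a martingale becomes an integrable process whose
    increments are orthogonal to the indicators of earlier events. *)
Lemma martingaleP (Y : R -> Omega -> R) : adapted Ft Y ->
  martingale P Ft Y <->
  (forall t, 0 <= t -> intg P (Y t)) /\
  (forall s t A, 0 <= s -> s <= t -> Ft s A ->
     Ex P (fun w => \1_A w * (Y t w - Y s w)) = 0).
Proof.
have ind A (f : Omega -> R) : (fun w => \1_A w * f w) = f \_ A.
  by apply/funext => w; rewrite patchE indicE; case: (w \in A); rewrite ?mul1r ?mul0r.
move=> aY; split=> -[h1 h2]; split=> //.
  move=> s t A s0 st FA; have t0 := le_trans s0 st.
  have mA := Ft_measurable hFt s0 FA.
  have [_ /(_ A FA) e] := h2 s t s0 st.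
  rewrite (_ : (fun w => _) = fun w => \1_A w * Y t w - \1_A w * Y s w); last first.
    by apply/funext => w; rewrite mulrBr.
  rewrite ExB; [|exact/intg_indicM/h1|exact/intg_indicM/h1].
  by rewrite !ind /Ex -!Rintegral_mkcond /Rintegral e subrr.
move=> s t s0 st; have t0 := le_trans s0 st; split.
  move=> B mB; have : measurable_wrt (Ft s) (EFin \o Y s); last exact.
  apply/(measurable_wrtP (Ft_sigma hFt s0))/measurable_EFinP.
  apply/(measurable_wrtP (Ft_sigma hFt s0)); exact: aY.
move=> A FA; have mA := Ft_measurable hFt s0 FA.
have := h2 s t A s0 st FA.
rewrite (_ : (fun w => _) = fun w => \1_A w * Y t w - \1_A w * Y s w); last first.
  by apply/funext => w; rewrite mulrBr.
rewrite ExB; [|exact/intg_indicM/h1|exact/intg_indicM/h1].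
rewrite !ind /Ex -!Rintegral_mkcond /Rintegral => /eqP; rewrite subr_eq0 => /eqP e.
rewrite -[LHS]fineK -1?e ?fineK//; apply: integrable_fin_num => //.
  exact: (integrableS measurableT mA _ (h1 _ t0)).
exact: (integrableS measurableT mA _ (h1 _ s0)).
Qed.

(** Truncation at level c: [clip c x] is bounded by c and differs from x by exactly [excess c x] in
    absolute value. For [0 <= c] the excess is convex, so a martingale composed with it is a
    submartingale; this is how uniform integrability is expressed. *)
Definition excess (c x : R) : R := Num.max (`|x| - c) 0.
Definition clip (c x : R) : R := Num.max (- c) (Num.min c x).

Lemma excess_ge0 c x : 0 <= excess c x.
Proof. by rewrite /excess le_max lexx orbT. Qed.

Lemma excess_le c x : 0 <= c -> excess c x <= `|x|.
Proof. by move=> c0; rewrite /excess ge_max normr_ge0 lerBlDr lerDl c0. Qed.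

Lemma norm_clip c x : 0 <= c -> `|clip c x| <= c.
Proof.
move=> c0; rewrite /clip ler_norml le_max lexx /= ge_max ge_min lexx andbT.
by rewrite (le_trans _ c0)// oppr_le0.
Qed.

Lemma clip_excess c x : 0 <= c -> `|x - clip c x| = excess c x.
Proof.
move=> c0; rewrite /clip /excess.
have [x0|x0] := leP 0 x.
  rewrite (ger0_norm x0).
  have [cx|cx] := leP c x.
    rewrite (max_r (_ : - c <= c)); last by lra.
    by rewrite max_l ?subr_ge0// ger0_norm ?subr_ge0.
  rewrite max_r; last by lra.
  by rewrite subrr normr0 max_r// subr_le0 ltW.
rewrite (ltr0_norm x0) min_r; last by lra.
have [cx|cx] := leP (- c) x.
  by rewrite subrr normr0 max_r//; lra.
by rewrite max_l; [rewrite ltr0_norm; lra|lra].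
Qed.

Lemma measurable_excess c (f : Omega -> R) : measurable_fun setT f ->
  measurable_fun setT (fun w => excess c (f w)).
Proof.
move=> mf; apply: measurable_maxr => //; apply: measurable_funB => //.
exact: measurableT_comp.
Qed.

Lemma intg_excess c f : 0 <= c -> intg P f -> intg P (fun w => excess c (f w)).
Proof.
move=> c0 fi; apply: (intg_le _ (intg_norm fi)).
  exact/measurable_excess/(intg_measurable fi).
by move=> w; rewrite ger0_norm ?excess_ge0// excess_le.
Qed.

Lemma excess_cvg f : intg P f -> Ex P (fun w => excess n%:R (f w)) @[n --> \oo] --> 0.
Proof.
move=> fi; have h w : excess n%:R (f w) @[n --> \oo] --> (0 : R).
  apply: cvg_near_cst; near=> n; rewrite /excess max_r// subr_le0.
  by near: n; exact: nbhs_infty_ger.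
have h' n w : `|excess n%:R (f w)| <= `|f w|.
  by rewrite ger0_norm ?excess_ge0// excess_le.
have [_] := Ex_cvg (P := P) (fun n => measurable_excess n%:R (intg_measurable fi))
  (intg_norm fi) h' h.
by rewrite Ex_cst.
Unshelve. all: by end_near. Qed.

Variable Y : R -> Omega -> R.
Hypotheses (cY : cadlag_process Y) (aY : adapted Ft Y) (mY : martingale P Ft Y).

Let iY t : 0 <= t -> intg P (Y t).
Proof. by case/(martingaleP aY): mY => h _; exact: h. Qed.

Let Y0 s t A : 0 <= s -> s <= t -> Ft s A ->
  Ex P (fun w => \1_A w * (Y t w - Y s w)) = 0.
Proof. by case/(martingaleP aY): mY => _ h; exact: h. Qed.

Let excess_sub c s t A : 0 <= c -> 0 <= s -> s <= t -> Ft s A ->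
  0 <= Ex P (fun w => \1_A w * (excess c (Y t w) - excess c (Y s w))).
Proof.
move=> c0 s0 st FA; have t0 := le_trans s0 st.
(* A subgradient of [excess c] at [Y s] is 1 on [Ap], -1 on [An] and 0 elsewhere. It is measurable
   at time [s], so its product with the increment has mean 0. *)
pose Ap := A `&` [set w | c < Y s w]; pose An := A `&` [set w | Y s w < - c].
have FAp : Ft s Ap.
  apply: FtI => //; rewrite (_ : [set w | _] = Y s @^-1` `]c, +oo[%classic).
    by apply: aY => //; exact: measurable_itv.
  by apply/seteqP; split=> w /=; rewrite in_itv /= andbT.
have FAn : Ft s An.
  apply: FtI => //; rewrite (_ : [set w | _] = Y s @^-1` `]-oo, - c[%classic).
    by apply: aY => //; exact: measurable_itv.
  by apply/seteqP; split=> w /=; rewrite in_itv.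
have mA := Ft_measurable hFt s0 FA; have mAp := Ft_measurable hFt s0 FAp.
have mAn := Ft_measurable hFt s0 FAn.
have iD : intg P (fun w => Y t w - Y s w) by apply: intgB; exact: iY.
have -> : 0 = Ex P (fun w => \1_Ap w * (Y t w - Y s w) - \1_An w * (Y t w - Y s w)).
  by rewrite ExB ?Y0 ?subrr//; exact: intg_indicM.
apply: le_Ex.
- by apply: intgB; exact: intg_indicM.
- by apply: intg_indicM => //; apply: intgB; apply: intg_excess => //; exact: iY.
move=> w; rewrite !indicE /Ap /An !in_setI.
have := excess_ge0 c (Y t w).
case: (w \in A) => /=; last by rewrite !mul0r subrr.
have [h1|h1] := boolP (w \in [set w | c < Y s w]);
have [h2|h2] := boolP (w \in [set w | Y s w < - c]).
all: move: h1 h2; rewrite ?inE ?notin_setE /=.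
- lra.
- move=> h1 _ _; rewrite mul1r mul0r subr0 mul1r.
  have -> : excess c (Y s w) = Y s w - c.
    by rewrite /excess ger0_norm ?max_l ?subr_ge0 ?(ltW h1)// (le_trans c0 (ltW h1)).
  have : `|Y t w| - c <= excess c (Y t w) by rewrite le_max lexx.
  have := ler_norm (Y t w); lra.
- move=> _ h2 _; rewrite mul1r mul0r sub0r mul1r.
  have ys : Y s w < 0 by lra.
  have -> : excess c (Y s w) = - Y s w - c.
    by rewrite /excess ltr0_norm ?max_l//; lra.
  have : `|Y t w| - c <= excess c (Y t w) by rewrite le_max lexx.
  have := ler_norm (- Y t w); rewrite normrN; lra.
- move=> h1 h2 e0; rewrite !mul0r subrr mul1r [X in _ - X](_ : _ = 0) ?subr0//.
  rewrite /excess max_r// subr_le0 ler_norml; apply/andP; split; lra.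
Qed.

Section grid_sums.
Variables (rho : Omega -> \bar R) (s t : R) (G : set Omega).
Hypotheses (hrho : stopping_time Ft rho) (s0 : 0 <= s) (st : s <= t) (FG : Ft s G)
  (Grho : forall w, G w -> (s%:E <= rho w)%E).

(** On [G] this is [phi] of [Y] at the first grid point after [rho], or at [t]; off [G] it is 0. The
    form of a sum exposes increments multiplied by events known at the left end of each cell. *)
Definition stop_sum (phi : R -> R) m w := \1_G w * (phi (Y s w) + \sum_(j < m.+1)
  ((grid s t m.+1 j)%:E <= rho w)%E%:R *
    (phi (Y (grid s t m.+1 j.+1) w) - phi (Y (grid s t m.+1 j) w))).

Lemma stop_sum_comp m w : G w -> exists r, forall phi, stop_sum phi m w = phi (Y r w).
Proof.
move=> Gw; have [J [_ _ uJ]] := grid_stop m st (Grho Gw).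
exists (grid s t m.+1 J) => phi.
rewrite /stop_sum indicE mem_set// mul1r -(uJ (fun j => phi (Y (grid s t m.+1 j) w))).
by rewrite grid0.
Qed.

Lemma stop_sum_cvg w : stop_sum id m w @[m --> \oo] --> \1_G w * stopped Y rho t w.
Proof.
have [Gw|nGw] := pselect (G w); last first.
  rewrite /stop_sum indicE memNset// mul0r; apply: cvg_near_cst.
  by apply: nearW => m; rewrite mul0r.
rewrite /stop_sum indicE mem_set// mul1r; under eq_cvg do rewrite mul1r.
exact: grid_stop_cvg (Grho Gw) (cY w).
Qed.

Let A m j := G `&` [set w | ((grid s t m.+1 j)%:E <= rho w)%E].

Let gs m j : 0 <= grid s t m.+1 j.
Proof. exact: le_trans s0 (grid_ge _ _ st). Qed.

Let FA m j : Ft (grid s t m.+1 j) (A m j).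
Proof.
by apply: FtI => //; [exact: (Ft_mono hFt s0 (grid_ge _ _ st))|
  exact: stopping_ge hFt _ _ _ _].
Qed.

Variable phi : R -> R.
Hypothesis iphi : forall u, 0 <= u -> intg P (fun w => phi (Y u w)).

Lemma stop_sumE m : intg P (stop_sum phi m) /\
  Ex P (stop_sum phi m) = Ex P (fun w => \1_G w * phi (Y s w)) +
    \sum_(j < m.+1) Ex P (fun w => \1_(A m j) w *
      (phi (Y (grid s t m.+1 j.+1) w) - phi (Y (grid s t m.+1 j) w))).
Proof.
have mG := Ft_measurable hFt s0 FG.
rewrite (_ : stop_sum phi m = fun w => \1_G w * phi (Y s w) + \sum_(j < m.+1)
    \1_(A m j) w *
    (phi (Y (grid s t m.+1 j.+1) w) - phi (Y (grid s t m.+1 j) w))); last first.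
  apply/funext => w; rewrite /stop_sum mulrDr mulr_sumr; congr (_ + _).
  apply: eq_bigr => j _; rewrite mulrA; congr (_ * _).
  rewrite !indicE /A in_setI in_setb.
  by case: (w \in G); rewrite ?mul0r// mul1r.
have i1 : intg P (fun w => \1_G w * phi (Y s w)) by apply: intg_indicM => //; exact: iphi.
have i2 j : intg P (fun w => \1_(A m j) w *
    (phi (Y (grid s t m.+1 j.+1) w) - phi (Y (grid s t m.+1 j) w))).
  apply: intg_indicM; first exact: (Ft_measurable hFt _ (FA m j)).
  by apply: intgB; exact: iphi.
by split; [apply: intgD => //; exact: intg_sum|rewrite ExD ?Ex_sum//; exact: intg_sum].
Qed.

Hypothesis phi0 : forall x, 0 <= phi x.
Hypothesis phi_sub : forall u v B, 0 <= u -> u <= v -> Ft u B ->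
  0 <= Ex P (fun w => \1_B w * (phi (Y v w) - phi (Y u w))).

(** Dropping the condition on [rho] makes the sum telescope to [phi] of [Y t]. What is added are the
    increments on the events where [rho] has already passed; they are known at the left end of the
    cell, so the submartingale property makes them non-negative in mean. *)
Lemma stop_sum_le m : Ex P (stop_sum phi m) <= Ex P (fun w => phi (Y t w)).
Proof.
have mG := Ft_measurable hFt s0 FG; have t0 := le_trans s0 st.
have [_ ->] := stop_sumE m.
apply: (@le_trans _ _ (Ex P (fun w => \1_G w * phi (Y t w)))); last first.
  apply: le_Ex; [exact/intg_indicM/iphi|exact: iphi|move=> w].
  by rewrite ler_piMl// (le_trans (ler_norm _))// norm_indic.
have : Ex P (fun w => \1_G w * phi (Y s w)) +
  \sum_(j < m.+1) Ex P (fun w => \1_G w *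
    (phi (Y (grid s t m.+1 j.+1) w) - phi (Y (grid s t m.+1 j) w))) =
  Ex P (fun w => \1_G w * phi (Y t w)).
  have i2 (j : 'I_m.+1) : intg P (fun w => \1_G w *
      (phi (Y (grid s t m.+1 j.+1) w) - phi (Y (grid s t m.+1 j) w))).
    by apply: intg_indicM => //; apply: intgB; exact: iphi.
  rewrite -Ex_sum// -ExD//; last 2 first.
    by apply: intg_indicM => //; exact: iphi.
    exact: intg_sum.
  congr Ex; apply/funext => w; rewrite -mulr_sumr -mulrDr; congr (_ * _).
  rewrite -(big_mkord xpredT (fun j =>
    phi (Y (grid s t m.+1 j.+1) w) - phi (Y (grid s t m.+1 j) w))).
  by rewrite telescope_sumr// grid0 gridn addrC subrK.
move=> <-; rewrite lerD2l; apply: ler_sum => j _.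
have gj : grid s t m.+1 j <= grid s t m.+1 j.+1 by rewrite grid_mono.
have GA : Ft (grid s t m.+1 j) (G `\` A m j).
  by apply: FtD => //; exact: (Ft_mono hFt s0 (grid_ge _ _ st)).
have := phi_sub (gs m j) gj GA.
have mA := Ft_measurable hFt (gs m j) (FA m j).
have iD : intg P (fun w => phi (Y (grid s t m.+1 j.+1) w) -
                           phi (Y (grid s t m.+1 j) w)).
  by apply: intgB; exact: iphi.
rewrite -subr_ge0 -ExB; [|exact: intg_indicM..].
congr (_ <= Ex P _); apply/funext => w; rewrite -mulrBl; congr (_ * _).
rewrite !indicE /A in_setD !in_setI.
by move: (w \in G) (w \in [set w | ((grid s t m.+1 j)%:E <= rho w)%E]) =>
  [] [] /=; lra.
Qed.

End grid_sums.

(* The value at a stopping time rho is approached from the right along grids;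
   the excess of these discrete values is dominated by that of Y t, which makes
   the family uniformly integrable. *)
Lemma stopping_from rho s t G : stopping_time Ft rho -> 0 <= s -> s <= t ->
  Ft s G -> (forall w, G w -> (s%:E <= rho w)%E) ->
  intg P (fun w => \1_G w * stopped Y rho t w) /\
  Ex P (fun w => \1_G w * (stopped Y rho t w - Y s w)) = 0.
Proof.
move=> hrho s0 st FG Grho.
have t0 := le_trans s0 st; have mG := Ft_measurable hFt s0 FG.
pose F (phi : R -> R) m w := stop_sum rho s t G phi m w.
have iF m : intg P (F id m) by have [|] := stop_sumE hrho s0 st FG (phi := id) _ m.
have Fid m : Ex P (F id m) = Ex P (fun w => \1_G w * Y s w).
  have [|_ ->] := stop_sumE hrho s0 st FG (phi := id) _ m => //.
  rewrite big1 ?addr0// => j _; apply: Y0; first exact: le_trans s0 (grid_ge _ _ st).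
    by rewrite grid_mono.
  by apply: FtI; [exact: le_trans s0 (grid_ge _ _ st)|
    exact: (Ft_mono hFt s0 (grid_ge _ _ st))|
    apply: (stopping_ge hFt) => //; exact: le_trans s0 (grid_ge _ _ st)].
have Fex c m : 0 <= c -> Ex P (F (excess c) m) <= Ex P (fun w => excess c (Y t w)).
  move=> c0; apply: stop_sum_le => //.
  - by move=> u u0; exact/intg_excess/iY.
  - by move=> x; exact: excess_ge0.
  - by move=> u v B; exact: excess_sub.
pose L w := \1_G w * stopped Y rho t w.
have Fex' c m w : 0 <= c -> F (excess c) m w = excess c (F id m w).
  move=> c0; have [Gw|nGw] := pselect (G w).
    by have [r Fr] := stop_sum_comp st Grho m Gw; rewrite /F !Fr.
  rewrite /F /stop_sum indicE memNset// !mul0r /excess normr0 max_r//; lra.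
have FL w : F id m w @[m --> \oo] --> L w by exact: stop_sum_cvg.
have mL : measurable_fun setT L.
  apply: (measurable_fun_cvg (h := F id)) => // m; exact: intg_measurable.
have cont_ex c : continuous (excess c).
  move=> x; apply: cvg_maxr; last exact: cvg_cst.
  by apply: cvgB; [exact: norm_continuous|exact: cvg_cst].
have exL c : 0 <= c -> intg P (fun w => excess c (L w)) /\
    Ex P (fun w => excess c (L w)) <= Ex P (fun w => excess c (Y t w)).
  move=> c0; apply: (@Ex_fatou _ _ _ P (fun m w => excess c (F id m w))).
  - by move=> m; exact/intg_excess/iF.
  - by move=> m w; exact: excess_ge0.
  - by move=> m; rewrite -(funext (fun w => Fex' c m w c0)); exact: Fex.
  - by move=> w; apply: (cvg_comp _ _ (FL w)); exact: cont_ex.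
have iL : intg P L.
  have [i0 _] := exL 0 (lexx _); apply: intg_le mL i0 _ => w.
  by rewrite /excess subr0 max_l.
(* The discrete stopped values all have the mean of [Y s] on [G]. Clipping them at n moves the mean
   by at most the excess of [Y t], and the clipped values pass to the limit by bounded convergence.
   The limit [L] obeys the same bound, and both errors vanish as n grows. *)
have a_clip n : `|Ex P (fun w => \1_G w * Y s w) - Ex P (fun w => clip n%:R (L w))| <=
    Ex P (fun w => excess n%:R (Y t w)).
  have mclip (f : Omega -> R) : measurable_fun setT f ->
      measurable_fun setT (fun w => clip n%:R (f w)).
    by move=> mf; apply: measurable_maxr => //; exact: measurable_minr.
  have iclip (f : Omega -> R) : measurable_fun setT f -> intg P (fun w => clip n%:R (f w)).
    by move=> mf; apply: (@intg_bounded _ _ _ P n%:R) => [|w]; [exact: mclip|exact: norm_clip].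
  have cl w : clip n%:R (F id m w) @[m --> \oo] --> clip n%:R (L w).
    apply: cvg_maxr; first exact: cvg_cst.
    by apply: cvg_minr; [exact: cvg_cst|exact: FL].
  have [_ cE] := Ex_cvg (P := P) (fun m => mclip _ (intg_measurable (iF m)))
    (intg_cst P n%:R) (fun m w => norm_clip _ (ler0n _ _)) cl.
  have : `|Ex P (fun w => \1_G w * Y s w) - Ex P (fun w => clip n%:R (F id m w))| @[m --> \oo]
     --> `|Ex P (fun w => \1_G w * Y s w) - Ex P (fun w => clip n%:R (L w))|.
    by apply: cvg_norm; apply: cvgB => //; exact: cvg_cst.
  move=> cv; rewrite -(cvg_lim _ cv)//; apply: limr_le; first by apply/cvg_ex; eexists; exact: cv.
  apply: nearW => m; rewrite -(Fid m) -ExB//; last exact/iclip/intg_measurable.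
  apply: le_trans (norm_Ex _) _.
    by apply: intgB => //; exact/iclip/intg_measurable.
  rewrite (_ : (fun w => `|_|) = F (excess n%:R) m); first exact: Fex.
  by apply/funext => w; rewrite Fex'// clip_excess.
have L_clip n : `|Ex P L - Ex P (fun w => clip n%:R (L w))| <=
    Ex P (fun w => excess n%:R (Y t w)).
  have iclip : intg P (fun w => clip n%:R (L w)).
    apply: (@intg_bounded _ _ _ P n%:R) => [|w]; last exact: norm_clip.
    by apply: measurable_maxr => //; exact: measurable_minr.
  rewrite -ExB//; apply: le_trans (norm_Ex _) _; first exact: intgB.
  rewrite (_ : (fun w => `|_|) = (fun w => excess n%:R (L w))); last first.
    by apply/funext => w; rewrite clip_excess.
  by have [] := exL n%:R (ler0n _ _).
split=> //.
rewrite (_ : (fun w => _) = fun w => L w - \1_G w * Y s w); last first.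
  by apply/funext => w; rewrite mulrBr.
rewrite ExB//; last exact/intg_indicM/iY.
apply/eqP; rewrite subr_eq0 -subr_eq0 -normr_eq0 eq_le normr_ge0 andbT.
have cv := excess_cvg (iY t0).
have {}cv : 2 * Ex P (fun w => excess n%:R (Y t w)) @[n --> \oo] --> (2 * 0 : R).
  by apply: cvgMr.
rewrite mulr0 in cv; rewrite -(cvg_lim _ cv)//.
apply: limr_ge; first by apply/cvg_ex; eexists; exact: cv.
apply: nearW => n; have := a_clip n; have := L_clip n.
set x := Ex P L; set y := Ex P (fun w => clip _ _); set z := Ex P (fun w => \1_G w * _).
move=> h1 h2; rewrite (_ : x - z = (x - y) - (z - y)); last by ring.
by rewrite (le_trans (ler_normB _ _))// mulr2n mulrDl !mul1r lerD.
Qed.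

(** The square of [Y] is a submartingale because the cross term is orthogonal; hence the discrete
    stopped values have second moments bounded by that of [Y t], and Fatou's lemma concludes. *)
Lemma stopped_sq rho t : (forall u, 0 <= u -> intg P (fun w => Y u w ^+ 2)) ->
  stopping_time Ft rho -> 0 <= t -> intg P (fun w => stopped Y rho t w ^+ 2).
Proof.
move=> iY2 hrho t0; pose sq (x : R) := x ^+ 2.
have rho0 w : [set: Omega] w -> (0 <= rho w)%E by case: hrho => h _ _; exact: h.
have i1 m : intg P (stop_sum rho 0 t setT sq m).
  by have [] := stop_sumE hrho (lexx 0) t0 (FtT (lexx 0)) (phi := sq) iY2 m.
have sub u v B : 0 <= u -> u <= v -> Ft u B ->
    0 <= Ex P (fun w => \1_B w * (sq (Y v w) - sq (Y u w))).
  move=> u0 uv FB; have v0 := le_trans u0 uv; have mB := Ft_measurable hFt u0 FB.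
  have mD : measurable_fun setT (fun w => Y v w - Y u w).
    by apply/intg_measurable/intgB; exact: iY.
  have iD2 : intg P (fun w => (Y v w - Y u w) ^+ 2).
    apply: (intg_le _ (intgD (intgZ 2 (iY2 _ v0)) (intgZ 2 (iY2 _ u0)))).
      exact: measurable_funX.
    by move=> w; rewrite ger0_norm ?sqr_ge0//; have := sqr_ge0 (Y v w + Y u w); lra.
  have iX : intg P (fun w => Y u w * (Y v w - Y u w)).
    by apply: intg_sqrM => //; [exact/intg_measurable/iY|exact: iY2].
  have e0 : Ex P (fun w => \1_B w * Y u w * (Y v w - Y u w)) = 0.
    apply: (Ex_orth_sq (Ft_sigma hFt u0) (Ft_measurable hFt u0)).
    - by apply: intgB; exact: iY.
    - by move=> A; exact: Y0.
    - apply: mul_measurable_wrt; first exact: (Ft_sigma hFt u0).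
        apply/(measurable_wrtP (Ft_sigma hFt u0)); apply: measurable_indic.
        exact/(FtP hFt).
      exact: aY.
    - rewrite (_ : (fun w => _) = fun w => \1_B w * (Y u w * (Y v w - Y u w))).
        exact: intg_indicM.
      by apply/funext => w; rewrite mulrA.
  rewrite (_ : (fun w => _) = fun w => 2 * (\1_B w * Y u w * (Y v w - Y u w)) +
      \1_B w * (Y v w - Y u w) ^+ 2); last first.
    by apply/funext => w; rewrite /sq; ring.
  rewrite ExD; [|apply: intgZ|exact: intg_indicM]; last first.
    rewrite (_ : (fun w => _) = fun w => \1_B w * (Y u w * (Y v w - Y u w))).
      exact: intg_indicM.
    by apply/funext => w; rewrite mulrA.
  rewrite ExZ ?e0 ?mulr0 ?add0r; last first.
    rewrite (_ : (fun w => _) = fun w => \1_B w * (Y u w * (Y v w - Y u w))).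
      exact: intg_indicM.
    by apply/funext => w; rewrite mulrA.
  by apply: Ex_ge0 => w; rewrite indicE mulr_ge0 ?ler0n ?sqr_ge0.
apply: (proj1 (@Ex_fatou _ _ _ P (stop_sum rho 0 t setT sq) _
  (Ex P (fun w => sq (Y t w))) i1 _ _ _)).
- move=> m w; have [r ->] := stop_sum_comp t0 rho0 m (I : [set: Omega] w).
  exact: sqr_ge0.
- by move=> m; apply: stop_sum_le => //; [exact: FtT|move=> x; exact: sqr_ge0].
- move=> w; rewrite (_ : (fun m => _) = fun m => sq (stop_sum rho 0 t setT id m w)).
    have := @stop_sum_cvg rho 0 t setT (lexx 0) t0 rho0 w.
    rewrite indicT mul1r => h; apply: cvg_comp h _; exact: exprn_continuous.
  apply/funext => m; have [r hr] := stop_sum_comp t0 rho0 m (I : [set: Omega] w).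
  by rewrite !hr.
Qed.

(** The grid ends at [t], so approaching the stopped value from the right never looks beyond [t]. *)
Lemma adapted_stopped_cadlag (Z : R -> Omega -> R) rho : cadlag_process Z ->
  adapted Ft Z -> stopping_time Ft rho -> adapted Ft (stopped Z rho).
Proof.
move=> cZ aZ hrho t t0; apply/(measurable_wrtP (Ft_sigma hFt t0)).
have g0 m j : 0 <= grid 0 t m.+1 j by exact: grid_ge.
apply: (measurable_fun_cvg (T := g_sigma_algebraType (Ft t)) (h := fun m w => Z 0 w + \sum_(j < m.+1)
  ((grid 0 t m.+1 j)%:E <= rho w)%E%:R *
  (Z (grid 0 t m.+1 j.+1) w - Z (grid 0 t m.+1 j) w))); last first.
  move=> w _; apply: (grid_stop_cvg (lexx 0) t0 _ (cZ w)).
  by case: hrho => h _; exact: h.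
have mZ u : 0 <= u -> u <= t -> measurable_fun [set: g_sigma_algebraType (Ft t)] (Z u).
  by move=> u0 ut; apply/(measurable_wrtP (Ft_sigma hFt t0)); exact: (adapted_le hFt).
move=> m; apply: measurable_funD; first exact: mZ.
apply: measurable_sum => j; apply: measurable_funM; last first.
  by apply: measurable_funB; apply: mZ => //; apply: grid_le => //; exact: ltnW.
rewrite (_ : (fun w => _) = \1_[set w | ((grid 0 t m.+1 j)%:E <= rho w)%E]); last first.
  by apply/funext => w; rewrite indicE mem_setE.
apply: measurable_indic; apply/(FtP hFt) => //.
apply: (Ft_mono hFt (g0 m j)); last exact: (stopping_ge hFt).
by apply: grid_le => //; exact: ltnW.
Qed.

Lemma stopped_martingale rho : stopping_time Ft rho ->
  martingale P Ft (stopped Y rho).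
Proof.
move=> hrho; apply/martingaleP; first exact: adapted_stopped_cadlag.
have i0 t : 0 <= t -> intg P (stopped Y rho t).
  move=> t0; have [|+ _] := stopping_from hrho (lexx 0) t0 (FtT (lexx 0)).
    by case: hrho => h _ w _; exact: h.
  by rewrite (_ : (fun w => _) = stopped Y rho t)//; apply/funext => w; rewrite indicT mul1r.
split=> // s t A s0 st FA; have t0 := le_trans s0 st.
(* Off this event [rho] has passed before [s] and the stopped process no longer moves. *)
pose G := A `&` [set w | (s%:E <= rho w)%E].
have FG : Ft s G by apply: FtI => //; exact: (stopping_ge hFt).
have [|_ <-] := stopping_from hrho s0 st FG; first by move=> w [].
congr Ex; apply/funext => w.
rewrite !indicE /G in_setI in_setb; case: (w \in A); rewrite ?mul0r//=.
have [sr|rs] := leP s%:E (rho w).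
  by rewrite /= [stopped Y rho s w]/stopped min_l.
rewrite mul1r mul0r /stopped !min_r ?subrr ?(ltW rs)// (le_trans (ltW rs))//.
Qed.

End optional_stopping.

Section cadlag_algebra.
Context {R : realType}.
Implicit Types f g : R -> R.

Lemma cadlag_cst (c : R) : cadlag `[0, +oo[ (fun _ : R => c).
Proof.
by apply/cadlagP; split=> t _; [exact: cvg_cst|exact: is_cvg_cst].
Qed.

Lemma cadlagD f g : cadlag `[0, +oo[ f -> cadlag `[0, +oo[ g ->
  cadlag `[0, +oo[ (fun t => f t + g t).
Proof.
move=> /cadlagP[f1 f2] /cadlagP[g1 g2]; apply/cadlagP; split=> t t0.
  by apply: cvgD; [exact: f1|exact: g1].
by apply: is_cvgD; [exact: f2|exact: g2].
Qed.

Lemma cadlagM f g : cadlag `[0, +oo[ f -> cadlag `[0, +oo[ g ->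
  cadlag `[0, +oo[ (fun t => f t * g t).
Proof.
move=> /cadlagP[f1 f2] /cadlagP[g1 g2]; apply/cadlagP; split=> t t0.
  by apply: cvgM; [exact: f1|exact: g1].
by apply: is_cvgM; [exact: f2|exact: g2].
Qed.

Lemma cadlagN f : cadlag `[0, +oo[ f -> cadlag `[0, +oo[ (fun t => - f t).
Proof.
move=> fc; rewrite (_ : (fun t => _) = fun t => -1 * f t).
  exact: (cadlagM (cadlag_cst (-1)) fc).
by apply/funext => t; rewrite mulN1r.
Qed.

Lemma cadlagB f g : cadlag `[0, +oo[ f -> cadlag `[0, +oo[ g ->
  cadlag `[0, +oo[ (fun t => f t - g t).
Proof. by move=> fc gc; exact: (cadlagD fc (cadlagN gc)). Qed.

End cadlag_algebra.

(** * Quadratic variation under a common localization *)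

Section quadratic_variation.
Context {R : realType} {dO : measure_display} {Omega : measurableType dO}.
Variables (P : probability Omega R) (Ft : R -> set (set Omega)).
Hypothesis hFt : usual_filtration P Ft.

Lemma ae_exists (Q : Omega -> Prop) : {ae P, forall w, Q w} ->
  exists N : set Omega, [/\ measurable N, P N = 0%E & forall w, ~ N w -> Q w].
Proof.
move=> [N [mN N0 sub]]; exists N; split=> // w Nw; apply: contrapT => Qw.
by apply: Nw; exact: sub.
Qed.

Lemma Pr_setD_null A N : measurable A -> measurable N -> P N = 0%E ->
  Pr P (A `\` N) = Pr P A.
Proof.
move=> mA mN N0; apply/eqP; rewrite eq_le; apply/andP; split.
  by apply: le_Pr => //; exact: measurableD.
rewrite (PrDI P mA mN) gerDl.
have : Pr P (A `&` N) <= Pr P N by apply: le_Pr => //; exact: measurableI.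
by rewrite {2}/Pr N0.
Qed.

Lemma adapted_measurable (X : R -> Omega -> R) (s t : R) : adapted Ft X -> 0 <= s -> s <= t ->
  measurable_fun [set: g_sigma_algebraType (Ft t)] (X s).
Proof.
move=> aX s0 st; have t0 := le_trans s0 st.
by apply/(measurable_wrtP (Ft_sigma hFt t0)); exact: (adapted_le hFt).
Qed.

Lemma adapted_opp_init (X : R -> Omega -> R) : adapted Ft X ->
  adapted Ft (fun t w => X t w - X 0 w).
Proof.
move=> aX t t0; apply/(measurable_wrtP (Ft_sigma hFt t0)).
by apply: measurable_funB; exact: adapted_measurable.
Qed.

(** Stopping at 0 off [Q] kills all increments there; [Q] will be the event on which the initial
    value is bounded. *)
Lemma stopping_restrict S (Q : set Omega) : stopping_time Ft S -> Ft 0 Q ->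
  stopping_time Ft (fun w => if w \in Q then S w else 0%E).
Proof.
move=> [S0 hS] FQ; split=> [w|t t0]; first by case: ifP.
apply/(FtP hFt) => //.
rewrite (_ : [set w | _] = ([set w | (S w <= t%:E)%E] `&` Q) `|` ~` Q).
  apply: measurableU; last by apply: measurableC; apply/(FtP hFt) => //; exact: (Ft_mono hFt _ t0).
  by apply: measurableI; apply/(FtP hFt) => //; [exact: hS|exact: (Ft_mono hFt _ t0)].
apply/seteqP; split=> w /=; have [wQ|wQ] := boolP (w \in Q).
- by move=> h; left; split=> //; rewrite inE in wQ.
- by move=> _; right; move: wQ; rewrite notin_setE.
- by move=> [[]|]//; move: wQ; rewrite inE.
- by rewrite lee_fin.
Qed.

Variables M A : R -> Omega -> R.
Hypotheses (hM : locally_square_integrable_martingale P Ft M)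
  (hA : is_predictable_qv P Ft M A).

Lemma adapted_qv : adapted Ft A.
Proof.
case: hM => cM aM _; case: hA => _ _ _ [_ aMA _] t t0.
apply/(measurable_wrtP (Ft_sigma hFt t0)).
rewrite (_ : A t = fun w => M t w ^+ 2 - (M t w ^+ 2 - A t w)); last first.
  by apply/funext => w; ring.
apply: measurable_funB; last exact: (adapted_measurable aMA).
by apply: measurable_funX; exact: adapted_measurable.
Qed.

(** One sequence localizes [M], [M ^+ 2 - A] and the size of the initial value: it is the minimum of
    the two given sequences where [|M 0| <= n], and 0 elsewhere. Only increments occur, as the
    initial value may fail to be integrable. The extra time [rho] leaves room for a further
    stopping, chosen later. *)
Lemma qv_localization : exists L : nat -> Omega -> \bar R,
  [/\ forall n, stopping_time Ft (L n),
      forall u : R, Pr P [set w | (L n w < u%:E)%E] @[n --> \oo] --> (0 : R) &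
      forall n rho, stopping_time Ft rho ->
      let sig w := Order.min (L n w) (rho w) in
      forall s t : R, 0 <= s -> s <= t ->
      let D w := stopped M sig t w - stopped M sig s w in
      [/\ measurable_fun setT D, intg P (fun w => D w ^+ 2),
          (forall xi : Omega -> R, measurable_wrt (Ft s) xi -> intg P (fun w => xi w ^+ 2) ->
            Ex P (fun w => xi w * D w) = 0),
          intg P (fun w => stopped A sig t w - stopped A sig s w) &
          forall G, Ft s G -> Ex P (fun w => \1_G w * D w ^+ 2) =
            Ex P (fun w => \1_G w * (stopped A sig t w - stopped A sig s w))]].
Proof.
have aA := adapted_qv.
case: hM => cM aM [T [hT Tmono Tlim sqM]].
case: hA => pA cA A0 [cMA aMA [S [hS Smono Slim mMA]]].
pose Q n := [set w | `|M 0 w| <= n%:R].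
have FQ n : Ft 0 (Q n).
  rewrite (_ : Q n = M 0 @^-1` `[- n%:R, n%:R]%classic).
    by apply: aM => //; exact: measurable_itv.
  by apply/seteqP; split=> w; rewrite /Q /= in_itv /= ler_norml.
pose L n w := if w \in Q n then Order.min (T n w) (S n w) else 0%E.
have hL n : stopping_time Ft (L n).
  by apply: (stopping_restrict _ (FQ n)); exact: (stopping_min hFt).
exists L; split=> //.
  move=> u; have [N1 [mN1 N10 hN1]] := ae_exists Tlim.
  have [N2 [mN2 N20 hN2]] := ae_exists Slim.
  have mL n : measurable [set w | (L n w < u%:E)%E].
    have [u0|u0] := leP 0 u; first exact/(Ft_measurable hFt u0)/(stopping_lt hFt).
    rewrite (_ : [set w | _] = set0)//; apply/seteqP; split=> // w /=.
    have [L0 _] := hL n; move=> /(le_lt_trans (L0 w)).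
    by rewrite lte_fin ltNge (ltW u0).
  have e n : Pr P [set w | (L n w < u%:E)%E] = Pr P ([set w | (L n w < u%:E)%E] `\` N1 `\` N2).
    by rewrite !Pr_setD_null//; exact: measurableD.
  under eq_cvg do rewrite e.
  apply: Pr_cvg0 => [n|w]; first by do 2 apply: measurableD => //.
  have [n1|/hN1 Tw] := pselect (N1 w); first by apply: nearW => n [[]].
  have [n2|/hN2 Sw] := pselect (N2 w); first by apply: nearW => n [_].
  near=> n; move=> [[/=]]; rewrite /L mem_set; last first.
    by rewrite /Q /=; near: n; exact: nbhs_infty_ger.
  rewrite gt_min => /orP[]; rewrite ltNge => /negP + _ _; apply.
  - by near: n; move/cvgeyPge : Tw; exact.
  - by near: n; move/cvgeyPge : Sw; exact.
move=> n rho hrho sig s t s0 st D.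
have t0 := le_trans s0 st.
have hsig : stopping_time Ft sig by exact: (stopping_min hFt).
have sig0 w : (0 <= sig w)%E by case: hsig.
pose N1 t w := stopped M (T n) t w - M 0 w.
have T0 w : (0 <= T n w)%E by case: (hT n).
have S0 w : (0 <= S n w)%E by case: (hS n).
have sig_leT w : (sig w <= T n w)%E.
  by rewrite /sig /L ge_min; case: ifP => _; rewrite ?ge_min ?lexx ?T0.
have sig_leS w : (sig w <= S n w)%E.
  by rewrite /sig /L ge_min; case: ifP => _; rewrite ?ge_min ?lexx ?orbT ?S0.
have cN1 : cadlag_process N1.
  by move=> w; apply: cadlagB; [exact: cadlag_stopped (T0 w) (cM w)|exact: cadlag_cst].
have st0 (Z : R -> Omega -> R) tau w : (0 <= tau w)%E -> stopped Z tau 0 w = Z 0 w.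
  by move=> tau0; rewrite /stopped min_l.
have aN1 : adapted Ft N1.
  move=> u u0; rewrite (_ : N1 u = fun w => stopped M (T n) u w - stopped M (T n) 0 w).
    exact: (adapted_opp_init (adapted_stopped_cadlag hFt cM aM (hT n)) u0).
  by apply/funext => w; rewrite st0.
have [mN1 iN1] := sqM n.
have mart1 := stopped_martingale hFt cN1 aN1 mN1 hsig.
have sigT w u : stopped N1 sig u w = stopped M sig u w - M 0 w.
  rewrite /N1 {1}/stopped; congr (_ - _).
  rewrite -[LHS]/(stopped (stopped M (T n)) sig u w) stopped_stopped//.
  rewrite /stopped; congr (M (fine _) _).
  by rewrite (min_r (sig_leT w)).
pose N2 t w := stopped (fun t w => M t w ^+ 2 - A t w) (S n) t w - (M 0 w ^+ 2 - A 0 w).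
have cN2 : cadlag_process N2.
  by move=> w; apply: cadlagB; [exact: cadlag_stopped (S0 w) (cMA w)|exact: cadlag_cst].
have aN2 : adapted Ft N2.
  move=> u u0; rewrite (_ : N2 u = fun w =>
    stopped (fun t w => M t w ^+ 2 - A t w) (S n) u w - stopped (fun t w => M t w ^+ 2 - A t w) (S n) 0 w).
    exact: (adapted_opp_init (adapted_stopped_cadlag hFt cMA aMA (hS n)) u0).
  by apply/funext => w; rewrite st0.
have mart2 := stopped_martingale hFt cN2 aN2 (mMA n) hsig.
have sigS w u : stopped N2 sig u w = stopped (fun t w => M t w ^+ 2 - A t w) sig u w - (M 0 w ^+ 2 - A 0 w).
  rewrite /N2 {1}/stopped; congr (_ - _).
  rewrite -[LHS]/(stopped (stopped _ (S n)) sig u w) stopped_stopped//.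
  rewrite /stopped; congr ((fun t w => M t w ^+ 2 - A t w) (fine _) _).
  by rewrite (min_r (sig_leS w)).
have [iV oV] := (martingaleP hFt (adapted_stopped_cadlag hFt cN1 aN1 hsig)).1 mart1.
have [iK oK] := (martingaleP hFt (adapted_stopped_cadlag hFt cN2 aN2 hsig)).1 mart2.
pose V := stopped N1 sig; pose K := stopped N2 sig.
have aV : adapted Ft V := adapted_stopped_cadlag hFt cN1 aN1 hsig.
have DE : D = fun w => V t w - V s w.
  by apply/funext => w; rewrite /D /V !sigT; ring.
have iD : intg P D by rewrite DE; apply: intgB; exact: iV.
have mD := intg_measurable iD.
have oD G : Ft s G -> Ex P (fun w => \1_G w * D w) = 0.
  by move=> FG; rewrite DE; exact: oV.
have iV2 u : 0 <= u -> intg P (fun w => V u w ^+ 2).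
  by move=> u0; exact: (stopped_sq hFt cN1 aN1 mN1 iN1 hsig u0).
have iD2 : intg P (fun w => D w ^+ 2).
  apply: (intg_le _ (intgD (intgZ 2 (iV2 _ t0)) (intgZ 2 (iV2 _ s0)))).
    exact: measurable_funX.
  move=> w; rewrite ger0_norm ?sqr_ge0// DE.
  by have := sqr_ge0 (V t w + V s w); lra.
have oxi (xi : Omega -> R) : measurable_wrt (Ft s) xi -> intg P (fun w => xi w ^+ 2) ->
    intg P (fun w => xi w * D w) /\ Ex P (fun w => xi w * D w) = 0.
  move=> mxi ixi; have mxi' := measurable_wrt_fun (Ft_measurable hFt s0) mxi.
  have iX : intg P (fun w => xi w * D w) by exact: intg_sqrM.
  split=> //.
  exact: (Ex_orth_sq (Ft_sigma hFt s0) (Ft_measurable hFt s0) iD oD mxi iX).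
pose B u w := stopped A sig u w.
have DQ w : ~ Q n w -> D w = 0.
  move=> nQ; rewrite /D /stopped /sig /L memNset//.
  by rewrite (min_l (_ : (0 <= rho w)%E)) ?(min_r (_ : (0 <= _)%E)) ?subrr//; case: hrho.
(* On [Q n] this is the stopped [M] at time [s], and [D] vanishes elsewhere; so [2 * (xi * D)] is
   the cross term in the increment of the square, with a square integrable factor. *)
pose xi w := V s w + \1_(Q n) w * M 0 w.
have mQ := Ft_measurable hFt (lexx 0) (FQ n).
have mxi : measurable_wrt (Ft s) xi.
  apply/(measurable_wrtP (Ft_sigma hFt s0)); apply: measurable_funD.
    exact: adapted_measurable.
  apply: measurable_funM; last exact: adapted_measurable.
  apply: measurable_indic; apply/(FtP hFt) => //; exact: (Ft_mono hFt (lexx 0) s0).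
have ixi : intg P (fun w => xi w ^+ 2).
  have mM0 : measurable_fun setT (M 0).
    exact: (measurable_wrt_fun (Ft_measurable hFt (lexx 0)) (aM 0 (lexx 0))).
  have mQM : measurable_fun setT (fun w => \1_(Q n) w * M 0 w).
    by apply: measurable_funM.
  have iQ : intg P (fun w => (\1_(Q n) w * M 0 w) ^+ 2).
    apply: (@intg_bounded _ _ _ P (n%:R ^+ 2)); first exact: measurable_funX.
    move=> w; rewrite normrX lerXn2r ?nnegrE// normrM indicE.
    have [|] := boolP (w \in Q n); rewrite ?normr1 ?mul1r ?normr0 ?mul0r//.
    by rewrite inE.
  apply: (intg_le _ (intgD (intgZ 2 (iV2 _ s0)) (intgZ 2 iQ))).
    apply: measurable_funX; apply: measurable_funD => //.
    exact/intg_measurable/iV.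
  move=> w; rewrite ger0_norm ?sqr_ge0// /xi.
  by have := sqr_ge0 (V s w - \1_(Q n) w * M 0 w); lra.
have [ixD oxD] := oxi _ mxi ixi.
have BE w : B t w - B s w = D w ^+ 2 + 2 * (xi w * D w) - (K t w - K s w).
  have -> : xi w * D w = stopped M sig s w * D w.
    rewrite /xi /V sigT indicE; have [|] := boolP (w \in Q n).
      by rewrite mul1r subrK.
    by rewrite notin_setE => /DQ ->; rewrite !mulr0.
  by rewrite /K !sigS /B /D /stopped; ring.
have iKd : intg P (fun w => K t w - K s w) by apply: intgB; exact: iK.
have iB : intg P (fun w => B t w - B s w).
  rewrite (funext BE); apply: intgB => //; apply: intgD => //; exact: intgZ.
split=> //.
  by move=> xi' h1 h2; have [] := oxi xi' h1 h2.
move=> G FG; have mG := Ft_measurable hFt s0 FG.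
have e1 : Ex P (fun w => \1_G w * xi w * D w) = 0.
  have [||//] := oxi (fun w => \1_G w * xi w).
    apply: (mul_measurable_wrt (Ft_sigma hFt s0) _ mxi).
    apply/(measurable_wrtP (Ft_sigma hFt s0)); apply: measurable_indic.
    exact/(FtP hFt).
  apply: (intg_le _ ixi).
    apply: measurable_funX; apply: measurable_funM => //.
    exact: (measurable_wrt_fun (Ft_measurable hFt s0) mxi).
  move=> w; rewrite ger0_norm ?sqr_ge0// indicE.
  by case: (w \in G); rewrite ?mul1r ?mul0r ?expr0n ?sqr_ge0.
have i1 : intg P (fun w => \1_G w * xi w * D w).
  rewrite (_ : (fun w => _) = fun w => \1_G w * (xi w * D w)); first exact: intg_indicM.
  by apply/funext => w; rewrite mulrA.
rewrite [RHS](_ : _ = Ex P (fun w => \1_G w * D w ^+ 2 + 2 * (\1_G w * xi w * D w)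
   - \1_G w * (K t w - K s w))); last first.
  by congr Ex; apply/funext => w; rewrite -/(B t w) -/(B s w) BE; ring.
rewrite ExB; last 2 first.
- by apply: intgD; [exact: intg_indicM|exact: intgZ].
- exact: intg_indicM.
rewrite oK// subr0 ExD ?ExZ ?e1 ?mulr0 ?addr0//; [exact: intg_indicM|exact: intgZ].
Unshelve. all: by end_near. Qed.

End quadratic_variation.

Lemma div_natS_lt {R : realType} (a e : R) : 0 < e ->
  exists m : nat, a / m.+1%:R < e.
Proof.
move=> e0; exists (Num.bound (a / e)).
rewrite ltr_pdivrMr// mulrC -ltr_pdivrMr//.
apply: (@le_lt_trans _ _ (Num.bound (a / e))%:R); last by rewrite ltr_nat.
have [ae|ae] := leP 0 (a / e); first exact/ltW/archi_boundP.
by rewrite (le_trans (ltW ae)).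
Qed.

(** * Lenglart's inequality *)

Section debut.
Context {R : realType} {dO : measure_display} {Omega : measurableType dO}.
Variables (P : probability Omega R) (Ft : R -> set (set Omega)).
Hypothesis hFt : usual_filtration P Ft.

Definition debut (t : R) (Phi : R -> set Omega) (w : Omega) : \bar R :=
  ereal_inf [set s%:E | s in [set s | t < s /\ Phi s w]].

Variables (t : R) (Phi : R -> set Omega).
Hypothesis t0 : 0 <= t.

Lemma debut_ge w : (t%:E <= debut t Phi w)%E.
Proof. by apply: le_ereal_inf_tmp => _ [s [ts _] <-]; rewrite lee_fin ltW. Qed.

Lemma debut_ltP w (x : R) : (debut t Phi w < x%:E)%E ->
  exists s, [/\ t < s, s < x & Phi s w].
Proof.
move=> /ereal_inf_lt[_ [s [ts Ps] <-]]; rewrite lte_fin => sx.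
by exists s.
Qed.

Lemma debut_gtN w (s : R) : t < s -> (s%:E < debut t Phi w)%E -> ~ Phi s w.
Proof.
move=> ts sd Ps; move: sd; rewrite ltNge => /negP; apply.
by apply: ereal_inf_lbound; exists s.
Qed.

(** The density hypothesis turns the event that the debut is before [x] into a countable union over
    rational times. Right continuity of the filtration then replaces the strict inequality by the
    weak one in the definition of a stopping time. *)
Lemma debut_stopping : (forall s, t < s -> Ft s (Phi s)) ->
  (forall w s x, t < s -> s < x -> Phi s w ->
    exists q : rat, [/\ t < ratr q, ratr q < x & Phi (ratr q) w]) ->
  stopping_time Ft (debut t Phi).
Proof.
move=> FPhi dense; split=> [w|x x0].
  by apply: le_trans (debut_ge w); rewrite lee_fin.
have lt x' : t < x' -> Ft x' [set w | (debut t Phi w < x'%:E)%E].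
  move=> tx'; have x'0 : 0 <= x' by rewrite (le_trans t0)// ltW.
  apply/(FtP hFt) => //.
  rewrite (_ : [set w | _] = \bigcup_(q : rat)
      [set w | [/\ t < ratr q, ratr q < x' & Phi (ratr q) w]]); last first.
    apply/seteqP; split=> w /=.
      move=> /debut_ltP[s [ts sx Ps]]; have [q hq] := dense w s x' ts sx Ps.
      by exists q.
    move=> [q _ /= [tq qx Pq]]; apply: (@le_lt_trans _ _ (ratr q)%:E).
      by apply: ereal_inf_lbound; exists (ratr q).
    by rewrite lte_fin.
  apply: bigcupT_measurable_rat => q.
  have [/andP[tq qx]|nq] := boolP ((t < ratr q) && (ratr q < x')); last first.
    rewrite (_ : [set w | _] = set0)//; apply/seteqP; split=> // w [h1 h2 _].
    by move: nq; rewrite h1 h2.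
  rewrite (_ : [set w | _] = Phi (ratr q)); last by apply/seteqP; split=> [w []|w].
  apply/(FtP hFt) => //; apply: (Ft_mono hFt _ (ltW qx)); last exact: FPhi.
  by rewrite (le_trans t0)// ltW.
have [xt|tx] := ltP x t.
  apply/(FtP hFt) => //; rewrite (_ : [set w | _] = set0)//.
  apply/seteqP; split=> // w /= h; have := le_trans (debut_ge w) h.
  by rewrite lee_fin leNgt xt.
case: hFt => _ _ rc _; apply: rc => // s; rewrite /= in_itv /= andbT => xs.
have s0 : 0 <= s by rewrite (le_trans x0)// ltW.
have sm m : x < x + (s - x) / m.+1%:R <= s.
  have sx0 : 0 < s - x by lra.
  rewrite ltrDl divr_gt0//= -lerBrDl ler_pdivrMr// ler_peMr ?ler1n// ltW//.
rewrite (_ : [set w | _] =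
    \bigcap_m [set w | (debut t Phi w < (x + (s - x) / m.+1%:R)%:E)%E]); last first.
  apply/seteqP; split=> w /=.
    by move=> h m _ /=; apply: le_lt_trans h _; rewrite lte_fin; case/andP: (sm m).
  move=> h; apply/lee_addgt0Pr => e e0.
  have [m hm] : exists m : nat, (s - x) / m.+1%:R < e.
    exact: div_natS_lt.
  by rewrite -EFinD ltW// (lt_le_trans (h m I))// lee_fin lerD2l ltW.
apply/(FtP hFt) => //; apply: bigcapT_measurable => m.
have /andP[xm ms] := sm m; apply/(FtP hFt) => //.
apply: (Ft_mono hFt _ ms); first by rewrite (le_trans x0)// ltW.
by apply: lt; exact: le_lt_trans xm.
Qed.

End debut.

(** * Outer regularity by adapted rectangles *)

Section predictable_cover.
Context {R : realType} {dO : measure_display} {Omega : measurableType dO}.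
Variables (P : probability Omega R) (Ft : R -> set (set Omega)).
Hypothesis hFt : usual_filtration P Ft.

Definition orect (x : R * R * set Omega) : set (R * Omega) :=
  [set p | x.1.1 < p.1 < x.1.2 /\ x.2 p.2].
Definition crect (x : R * R * set Omega) : set (R * Omega) :=
  [set p | x.1.1 < p.1 <= x.1.2 /\ x.2 p.2].
Definition adapted_rect (x : R * R * set Omega) := 0 <= x.1.1 /\ Ft x.1.1 x.2.

(** A countable cover is recorded twice. The open rectangles supply compactness in time; the
    right-closed ones still contain the time at which a finite subfamily is left. *)
Definition rcover (O C : set (R * Omega)) := exists D : nat -> R * R * set Omega,
  [/\ forall j, adapted_rect (D j), O = \bigcup_j orect (D j) &
      C = \bigcup_j crect (D j)].

Lemma rcover_sub O C : rcover O C -> O `<=` C.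
Proof.
move=> [D [_ -> ->]] p [j _ [/andP[h1 h2] h3]]; exists j => //; split=> //.
by rewrite h1 ltW.
Qed.

Lemma rcover_rect x : adapted_rect x -> rcover (orect x) (crect x).
Proof.
move=> ax; exists (fun=> x); split=> //.
  by apply/seteqP; split=> [p px|p [_ _]//]; exists 0%N.
by apply/seteqP; split=> [p px|p [_ _]//]; exists 0%N.
Qed.

Lemma adapted_rect0 : adapted_rect (0, 0, set0).
Proof.
by split=> //=; apply/(FtP hFt).
Qed.

Let rect0 p : ~ crect (0, 0, set0) p. Proof. by move=> []. Qed.
Let orect0 p : ~ orect (0, 0, set0) p. Proof. by move=> []. Qed.

Let rcover_count (I : countType) (D : I -> R * R * set Omega) :
  (forall i, adapted_rect (D i)) ->
  rcover (\bigcup_i orect (D i)) (\bigcup_i crect (D i)).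
Proof.
move=> aD; exists (fun k => if unpickle k is Some i then D i else (0, 0, set0)).
split=> [j||].
- by case: unpickle => [i|]; [exact: aD|exact: adapted_rect0].
- apply/seteqP; split=> p [i _ pi].
    by exists (pickle i); rewrite ?pickleK.
  by move: pi; case: unpickle => [k pk|/orect0//]; exists k.
- apply/seteqP; split=> p [i _ pi].
    by exists (pickle i); rewrite ?pickleK.
  by move: pi; case: unpickle => [k pk|/rect0//]; exists k.
Qed.

Lemma rcover_bigcup (O C : nat -> set (R * Omega)) :
  (forall i, rcover (O i) (C i)) -> rcover (\bigcup_i O i) (\bigcup_i C i).
Proof.
move=> h; have /choice[D hD] := h.
have := @rcover_count (nat * nat)%type (fun p => D p.1 p.2) _.
rewrite (_ : \bigcup_i orect _ = \bigcup_i O i); last first.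
  apply/seteqP; split=> p [].
    by move=> [i j] _ /= pij; exists i => //; have [_ -> _] := hD i; exists j.
  by move=> i _; have [_ -> _] := hD i => -[j _ pj]; exists (i, j).
rewrite (_ : \bigcup_i crect _ = \bigcup_i C i); last first.
  apply/seteqP; split=> p [].
    by move=> [i j] _ /= pij; exists i => //; have [_ _ ->] := hD i; exists j.
  by move=> i _; have [_ _ ->] := hD i => -[j _ pj]; exists (i, j).
by apply=> -[i j] /=; have [h1 _ _] := hD i.
Qed.

Lemma rcoverI O1 C1 O2 C2 : rcover O1 C1 -> rcover O2 C2 ->
  rcover (O1 `&` O2) (C1 `&` C2).
Proof.
move=> [D1 [a1 -> ->]] [D2 [a2 -> ->]].
pose D (p : nat * nat) := (Num.max (D1 p.1).1.1 (D2 p.2).1.1,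
  Num.min (D1 p.1).1.2 (D2 p.2).1.2, (D1 p.1).2 `&` (D2 p.2).2).
have := @rcover_count (nat * nat)%type D _.
rewrite (_ : \bigcup_i orect _ =
    (\bigcup_j orect (D1 j)) `&` (\bigcup_j orect (D2 j))); last first.
  apply/seteqP; split=> p.
    move=> [[i j] _ [/=]]; rewrite gt_max lt_min => /andP[/andP[h1 h2] /andP[h3 h4]] [h5 h6].
    by split; [exists i => //; split=> //; rewrite h1|exists j => //; split=> //; rewrite h2].
  move=> [[i _ [/andP[h1 h3] h5]] [j _ [/andP[h2 h4] h6]]].
  by exists (i, j) => //; split=> //=; rewrite gt_max lt_min h1 h2 h3.
rewrite (_ : \bigcup_i crect _ =
    (\bigcup_j crect (D1 j)) `&` (\bigcup_j crect (D2 j))); last first.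
  apply/seteqP; split=> p.
    move=> [[i j] _ [/=]]; rewrite gt_max le_min => /andP[/andP[h1 h2] /andP[h3 h4]] [h5 h6].
    by split; [exists i => //; split=> //; rewrite h1|exists j => //; split=> //; rewrite h2].
  move=> [[i _ [/andP[h1 h3] h5]] [j _ [/andP[h2 h4] h6]]].
  by exists (i, j) => //; split=> //=; rewrite gt_max le_min h1 h2 h3.
apply=> -[i j] /=; have [s1 F1] := a1 i; have [s2 F2] := a2 j.
split; rewrite /D /=; first by rewrite le_max s1.
have m0 : 0 <= Num.max (D1 i).1.1 (D2 j).1.1 by rewrite le_max s1.
by apply: (FtI hFt) => //; [apply: (Ft_mono hFt s1)|apply: (Ft_mono hFt s2)];
  rewrite // le_max lexx ?orbT.
Qed.

Variables (Ev : set Omega) (sg : Omega -> R).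
Hypothesis msg : forall x, measurable (Ev `&` [set w | sg w <= x]).

Definition at_sg (Q : set (R * Omega)) := [set w | Ev w /\ Q (sg w, w)].

Lemma measurable_at_sg O C : rcover O C -> measurable (at_sg C).
Proof.
move=> [D [aD _ ->]].
rewrite (_ : at_sg _ = \bigcup_j (((Ev `&` [set w | sg w <= (D j).1.2])
     `\` (Ev `&` [set w | sg w <= (D j).1.1])) `&` (D j).2)); last first.
  apply/seteqP; split=> w.
    move=> [Ew [j _ [/andP[/= h1 h2] h3]]]; exists j => //; split=> //.
    by split=> // -[_ /=]; rewrite leNgt h1.
  move=> [j _ [[[Ew /= h2] nh] h3]]; split=> //; exists j => //; split=> //=.
  by rewrite h2 andbT ltNge; apply/negP => h; exact: nh.
apply: bigcupT_measurable => j; apply: measurableI; first exact: measurableD.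
by have [s0 /(Ft_measurable hFt s0)] := aD j.
Qed.

(** Outer regularity, with respect to unions of adapted rectangles, of the image of P on [Ev] under
    the graph of [sg]. It is imposed on [K] and its complement together, through the mass of the
    overlap of the two covers; this symmetry makes the class stable under complements. Only positive
    times matter. *)
Definition approximable (K : set (R * Omega)) := forall eps : R, 0 < eps ->
  exists O C O' C', [/\ rcover O C, rcover O' C',
    forall p, 0 < p.1 -> K p -> O p, forall p, 0 < p.1 -> ~ K p -> O' p &
    Pr P (at_sg (C `&` C')) <= eps].

Lemma rcover_pos : rcover [set p | 0 < p.1] [set p | 0 < p.1].
Proof.
exists (fun j => (0, j%:R, setT)); split=> [j||].
- by split=> //=; exact: (FtT hFt).
- apply/seteqP; split=> p /=; last by move=> [j _ [/andP[]]].
  move=> p0; exists (Num.bound p.1) => //; split=> //=.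
  by rewrite p0 archi_boundP// ltW.
- apply/seteqP; split=> p /=; last by move=> [j _ [/andP[]]].
  move=> p0; exists (Num.bound p.1) => //; split=> //=.
  by rewrite p0 ltW// archi_boundP// ltW.
Qed.

Lemma rcover0 : rcover set0 set0.
Proof.
have := rcover_rect adapted_rect0; congr rcover.
  by apply/seteqP; split=> // p /orect0.
by apply/seteqP; split=> // p /rect0.
Qed.

Lemma approximable_null (K : set (R * Omega)) :
  (forall p, 0 < p.1 -> ~ K p) -> approximable K.
Proof.
move=> K0 eps e0; exists set0, set0, [set p | 0 < p.1], [set p | 0 < p.1].
split; [exact: rcover0|exact: rcover_pos|by move=> p /K0|by []|].
rewrite set0I (_ : at_sg _ = set0); last by apply/seteqP; split=> // w [].
by rewrite /Pr measure0 ltW.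
Qed.

Lemma approximableC D K : (forall p, 0 < p.1 -> D p) -> approximable K ->
  approximable (D `\` K).
Proof.
move=> hD aK eps e0; have [U [C [U' [C' [h1 h2 h3 h4 h5]]]]] := aK eps e0.
exists U', C', U, C; split=> //; last by rewrite setIC.
- by move=> p p0 [_ nK]; exact: h4.
- move=> p p0 nDK; apply: h3 => //; apply: contrapT => nK.
  by apply: nDK; split=> //; exact: hD.
Qed.

Lemma approximable_bigcup (K : nat -> set (R * Omega)) :
  (forall i, approximable (K i)) -> approximable (\bigcup_i K i).
Proof.
move=> aK eps e0.
(* These shares add up to at most [eps / 2]; the other half pays for the tail [Z n] below. *)
have e2 i : 0 < eps / (2 ^ i.+2)%:R by rewrite divr_gt0// ltr0n expn_gt0.
have {e2} aKe i := aK i _ (e2 i).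
have [U {}aKe] := choice aKe; have [C {}aKe] := choice aKe.
have [U' {}aKe] := choice aKe; have [C' hh] := choice aKe.
(* A countable intersection would not be a union of rectangles, so the complement is covered by a
   finite one. Its overlap with the whole union consists of finitely many overlaps and of the points
   reached only by later covers, whose mass tends to 0. Intersecting with the positive times handles
   [n = 0]. *)
pose W n := \bigcap_(i < n) U' i; pose CW n := \bigcap_(i < n) C' i.
have rW n : rcover (W n `&` [set p | 0 < p.1]) (CW n `&` [set p | 0 < p.1]).
  elim: n => [|n IH].
    by rewrite /W /CW !bigcap_mkord !big_ord0 !setTI; exact: rcover_pos.
  rewrite /W /CW !bigcap_mkord !big_ord_recr /= -!bigcap_mkord -/(W n) -/(CW n).
  have [_ r' _ _ _] := hh n.
  have := rcoverI IH r'; congr rcover; by rewrite setIAC.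
have rU : rcover (\bigcup_i U i) (\bigcup_i C i).
  by apply: rcover_bigcup => i; have [] := hh i.
pose Z n := at_sg (\bigcup_i C i) `\` \bigcup_(i in `I_n) at_sg (C i).
have mC i : measurable (at_sg (C i)) by have [r _ _ _ _] := hh i; exact: measurable_at_sg r.
have mZ n : measurable (Z n).
  apply: measurableD; first exact: measurable_at_sg rU.
  by apply: bigcup_measurable => i _.
have Z0 : Pr P (Z n) @[n --> \oo] --> 0.
  apply: Pr_cvg0 => // w; have [[Ew [i _ Ci]]|nC] := pselect (at_sg (\bigcup_i C i) w).
    near=> n; move=> [_]; apply.
    exists i => //=.
    by near: n; exact: nbhs_infty_gt.
  by apply: nearW => n [].
have [n hn] : exists n, Pr P (Z n) <= eps / 2.
  have /cvgrPdist_le /(_ _ (divr_gt0 e0 (ltr0Sn _ 1))) [n _ /(_ n (leqnn n))] := Z0.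
  by rewrite sub0r normrN => h; exists n; rewrite (le_trans (ler_norm _)).
exists (\bigcup_i U i), (\bigcup_i C i), (W n `&` [set p | 0 < p.1]), (CW n `&` [set p | 0 < p.1]).
split=> //.
- by move=> p p0 [i _ Ki]; exists i => //; have [_ _ h _ _] := hh i; exact: h.
- move=> p p0 nK; split=> // i _; have [_ _ _ h _] := hh i; apply: h => //.
  by move=> Ki; apply: nK; exists i.
have mI i : measurable (at_sg (C i `&` C' i)).
  by have [r r' _ _ _] := hh i; exact: (measurable_at_sg (rcoverI r r')).
apply: (@le_trans _ _ (Pr P (Z n `|` \bigcup_(i in `I_n) at_sg (C i `&` C' i)))).
  apply: le_Pr.
  - exact: (measurable_at_sg (rcoverI rU (rW n))).
  - by apply: measurableU => //; apply: bigcup_measurable => i _.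
  move=> w [Ew [[i _ Ci] [CWw _]]].
  have [h|h] := pselect ((\bigcup_(i in `I_n) at_sg (C i)) w); last first.
    by left; split=> //; split=> //; exists i.
  right; move: h => -[k kn [_ Ck]].
  by exists k => //; split=> //; split=> //; exact: CWw.
apply: le_trans (PrU_le _ _ _) _ => //; first by apply: bigcup_measurable => i _.
rewrite [leRHS]splitr lerD//.
suff H m : Pr P (\bigcup_(i in `I_m) at_sg (C i `&` C' i)) <= eps / 2 * (1 - (2 ^ m)%:R^-1).
  by rewrite (le_trans (H n))// ler_piMr ?divr_ge0 ?(ltW e0)// lerBlDr lerDl.
elim: m => [|m IH].
  rewrite (_ : \bigcup_(i in _) _ = set0) /Pr ?measure0 ?expn0 ?invr1 ?subrr ?mulr0//.
  by apply/seteqP; split=> // w [].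
apply: (@le_trans _ _ (Pr P ((\bigcup_(i in `I_m) at_sg (C i `&` C' i)) `|` at_sg (C m `&` C' m)))).
  apply: le_Pr; [by apply: bigcup_measurable => i _| |].
    by apply: measurableU => //; apply: bigcup_measurable => i _.
  move=> w [i /=]; rewrite ltnS leq_eqVlt => /predU1P[->|im] wi; [by right|left].
  by exists i.
apply: le_trans (PrU_le _ _ _) _ => //; first by apply: bigcup_measurable => i _.
have [_ _ _ _ hm] := hh m; apply: le_trans (lerD IH hm) _.
by rewrite !expnS !natrM !invfM; lra.
Unshelve. all: by end_near. Qed.

(** The rectangle is prolonged a little beyond [t], and the part of the complement before [s] a
    little beyond [s]. The covers then overlap only when [sg] falls in a short right-closed interval
    after [s] or after [t]; such intervals shrink to the empty set. *)
Lemma approximable_rect s t C : 0 <= s -> s <= t -> Ft s C ->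
  approximable (`]s, t] `*` C).
Proof.
move=> s0 st FC eps e0; have t0 := le_trans s0 st.
pose d n : R := n.+1%:R^-1.
have d0 n : 0 < d n by rewrite invr_gt0.
pose I x n := at_sg (crect (x, x + d n, setT)).
have rI x n : 0 <= x -> rcover (orect (x, x + d n, setT)) (crect (x, x + d n, setT)).
  by move=> x0; apply: rcover_rect; split=> //; exact: (FtT hFt).
have mI x n : 0 <= x -> measurable (I x n) by move=> x0; exact: measurable_at_sg (rI x n x0).
have I0 x : 0 <= x -> Pr P (I x n) @[n --> \oo] --> 0.
  move=> x0; apply: Pr_cvg0 => [n|w]; first exact: mI.
  have [xs|sx] := ltP x (sg w); last first.
    by apply: nearW => n [_ [/= /andP[]]]; rewrite ltNge sx.
  near=> n; move=> [_ [/= /andP[_ h] _]].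
  suff : x + d n < sg w by rewrite ltNge h.
  rewrite -ltrBrDl; near: n; apply: (near_infty_natSinv_lt (PosNum (_ : 0 < sg w - x))).
  by rewrite subr_gt0.
have [n hn1 hn2] : exists2 n, Pr P (I s n) <= eps / 2 & Pr P (I t n) <= eps / 2.
  have /cvgrPdist_le /(_ _ (divr_gt0 e0 (ltr0Sn _ 1))) h1 := I0 _ s0.
  have /cvgrPdist_le /(_ _ (divr_gt0 e0 (ltr0Sn _ 1))) h2 := I0 _ t0.
  have [n _ /(_ n (leqnn n)) [/=]] := filterI h1 h2.
  by rewrite !sub0r !normrN => k1 k2; exists n; rewrite (le_trans (ler_norm _)).
(* Complement of the rectangle: times up to [s], the times in question off [C], and the times after
   [t], the latter exhausted by bounded intervals. *)
pose D j := match j with 0%N => (0, s + d n, setT) | 1%N => (s, t + d n, ~` C)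
  | k.+2 => (t, t + k%:R, setT) end.
have rD : rcover (\bigcup_j orect (D j)) (\bigcup_j crect (D j)).
  exists D; split=> // -[|[|j]] /=; split=> //=.
  - exact: (FtT hFt).
  - by apply/(FtP hFt) => //; apply: measurableC; apply/(FtP hFt).
  - exact: (FtT hFt).
exists (orect (s, t + d n, C)), (crect (s, t + d n, C)), (\bigcup_j orect (D j)), (\bigcup_j crect (D j)).
split=> //.
- exact: rcover_rect.
- move=> p p0 [/=]; rewrite in_itv /= => /andP[h1 h2] h3; split=> //=.
  by rewrite h1 (le_lt_trans h2)// ltrDl.
- move=> p p0 np; have [ps|sp] := leP p.1 s.
    by exists 0%N => //; split=> //=; rewrite p0 (le_lt_trans ps)// ltrDl.
  have [pt|tp] := leP p.1 t; last first.
    exists (Num.bound (p.1 - t)).+2 => //; split=> //=.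
    by rewrite tp -ltrBlDl archi_boundP// subr_ge0 ltW.
  exists 1%N => //; split=> /=; first by rewrite sp (le_lt_trans pt)// ltrDl.
  by move=> Cp; apply: np; split=> //=; rewrite in_itv /= sp.
apply: (@le_trans _ _ (Pr P (I s n `|` I t n))); last first.
  apply: le_trans (PrU_le P (mI s n s0) (mI t n t0)) _.
  by rewrite [leRHS]splitr lerD.
apply: le_Pr; [|by apply: measurableU; exact: mI|].
  by apply: measurable_at_sg; apply: rcoverI rD; exact: rcover_rect.
move=> w [Ew [[/= /andP[h1 h2] h3] [[|[|j]] _ [/= /andP[k1 k2] k3]]]]; [left|by []|right].
  by split=> //; split=> //=; rewrite h1.
by split=> //; split=> //=; rewrite k1.
Unshelve. all: by end_near. Qed.

Lemma predictable_approximable (K : set (R * Omega)) :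
  <<s `[0, +oo[ `*` [set: Omega], [set [set 0] `*` C | C in Ft 0] `|`
    [set Q | exists s t C, [/\ 0 <= s, s <= t, Ft s C & Q = `]s, t] `*` C]] >> K ->
  approximable K.
Proof.
apply: smallest_sub; first split.
- by apply: approximable_null => p _ [].
- move=> A aA; apply: approximableC => // p p0; split=> //=.
  by rewrite in_itv /= andbT ltW.
- exact: approximable_bigcup.
move=> Q [[C FC <-]|[s [t [C [s0 st FC ->]]]]].
  by apply: approximable_null => p p0 [/= p00 _]; rewrite p00 ltxx in p0.
exact: approximable_rect.
Qed.

Lemma approximable_ext K K' : (forall p, 0 < p.1 -> K p <-> K' p) ->
  approximable K -> approximable K'.
Proof.
move=> KK' aK eps e0; have [U [C [U' [C' [h1 h2 h3 h4 h5]]]]] := aK eps e0.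
exists U, C, U', C'; split=> // p p0 hp.
  by apply: h3 => //; apply/KK'.
by apply: h4 => //; move/KK' : hp; apply.
Qed.

Lemma approximable_setC K : approximable K -> approximable (~` K).
Proof. by move=> aK; rewrite -setTD; exact: approximableC. Qed.

Lemma approximable_setU K K' : approximable K -> approximable K' ->
  approximable (K `|` K').
Proof.
move=> aK aK'; rewrite -bigcup2E; apply: approximable_bigcup => -[|[|i]] //=.
by apply: approximable_null => p _ [].
Qed.

Lemma approximable_setI K K' : approximable K -> approximable K' ->
  approximable (K `&` K').
Proof.
move=> aK aK'; rewrite -[_ `&` _]setCK setCI.
by apply/approximable_setC/approximable_setU; exact: approximable_setC.
Qed.

End predictable_cover.

Section covering_time.
Context {R : realType} {dO : measure_display} {Omega : measurableType dO}.
Variables (P : probability Omega R) (Ft : R -> set (set Omega)).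
Hypothesis hFt : usual_filtration P Ft.
Variable D : nat -> R * R * set Omega.
Hypothesis aD : forall j, adapted_rect Ft (D j).

Definition crects n := \bigcup_(j in `I_n) crect (D j).

Lemma crectsS n p : crects n.+1 p <-> crect (D n) p \/ crects n p.
Proof.
split=> [[j /=]|[h|[j jn h]]]; last 2 first.
- by exists n => //=; rewrite ltnS.
- by exists j => //=; rewrite ltnS ltnW.
by rewrite ltnS leq_eqVlt => /predU1P[->|jn] h; [left|right; exists j].
Qed.

Variables (t : R).
Hypothesis t0 : 0 <= t.

Let covered n r := [set w | forall x, t <= x -> x <= r -> crects n (x, w)].

(** [Q] makes the induction possible: it collects the time intervals of the rectangles already
    removed whose base contains [w]. A rectangle that opens before [r] has its base in [Ft r] and
    splits the event in two; one that opens later does not meet [t, r]. Once no rectangle is left,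
    the condition no longer involves [w]. *)
Let Ft_cover n r (Q : set R) : t <= r ->
  Ft r [set w | forall x, t <= x -> x <= r -> Q x \/ crects n (x, w)].
Proof.
move=> tr; have r0 := le_trans t0 tr.
elim: n Q => [|n IH] Q.
  have [h|h] := pselect (forall x, t <= x -> x <= r -> Q x).
    rewrite (_ : [set w | _] = setT); first exact: (FtT hFt).
    by apply/seteqP; split=> // w _ x tx xr; left; exact: h.
  apply/(FtP hFt) => //; rewrite (_ : [set w | _] = set0)//.
  apply/seteqP; split=> // w hw; apply: h => x tx xr.
  by have [//|[]] := hw x tx xr.
pose s := (D n).1.1; have [s0 FC] := aD n.
have [rs|sr] := leP r s.
  rewrite (_ : [set w | _] = [set w | forall x, t <= x -> x <= r -> Q x \/ crects n (x, w)]); first exact: IH.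
  apply/seteqP; split=> w h x tx xr; have [|] := h x tx xr; try by left.
    by move=> /crectsS[[/= /andP[sx _] _]|]; [move: (le_lt_trans rs sx); rewrite ltNge xr|right].
  by move=> h'; right; apply/crectsS; right.
pose Q' := Q `|` `](D n).1.1, (D n).1.2]%classic.
apply/(FtP hFt) => //.
have mC : measurable ((D n).2 : set (g_sigma_algebraType (Ft r))).
  by apply/(FtP hFt) => //; exact: (Ft_mono hFt s0 (ltW sr)).
rewrite (_ : [set w | _] =
  ((D n).2 `&` [set w | forall x, t <= x -> x <= r -> Q' x \/ crects n (x, w)]) `|`
  (~` (D n).2 `&` [set w | forall x, t <= x -> x <= r -> Q x \/ crects n (x, w)])).
  by apply: measurableU; apply: measurableI => //;
    [apply/(FtP hFt)|exact: measurableC|apply/(FtP hFt)].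
apply/seteqP; split=> w.
  move=> h; have [Cw|Cw] := pselect ((D n).2 w); [left|right]; split=> // x tx xr.
    have [|/crectsS[[/= sx _]|]] := h x tx xr; [by left; left| |by right].
    by left; right; rewrite /= in_itv.
  have [|/crectsS[[_ /Cw]|]] := h x tx xr => //; [by left|by right].
move=> [[Cw h]|[Cw h]] x tx xr.
  have [[|]|] := h x tx xr; [by left| |by right; apply/crectsS; right].
  by rewrite /= in_itv /= => hx; right; apply/crectsS; left.
by have [|] := h x tx xr; [left|right; apply/crectsS; right].
Qed.

Definition cover_time n := debut t (fun r => ~` covered n r).

Lemma cover_time_stopping n : stopping_time Ft (cover_time n).
Proof.
apply: (debut_stopping hFt t0).
  move=> s ts; have s0 := le_trans t0 (ltW ts).
  apply/(FtP hFt) => //; apply: measurableC; apply/(FtP hFt) => //.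
  rewrite (_ : covered n s = [set w | forall x, t <= x -> x <= s -> set0 x \/ crects n (x, w)]).
    exact: Ft_cover (ltW ts).
  apply/seteqP; split=> w h x tx xs; first by right; exact: h.
  by have [|] := h x tx xs.
move=> w s x ts sx nc; have [q] := rat_in_itvoo sx.
rewrite in_itv /= => /andP[sq qx]; exists q; split=> //; first exact: lt_trans sq.
by move=> c; apply: nc => y ty ys; apply: c => //; exact: le_trans ys (ltW sq).
Qed.

Lemma cover_time_in n w : (t%:E < cover_time n w)%E ->
  forall x, t <= x -> (x%:E <= cover_time n w)%E -> crects n (x, w).
Proof.
move=> tT x tx xT.
have lt y : t <= y -> (y%:E < cover_time n w)%E -> crects n (y, w).
  move=> ty yT.
  have [z tz zT] : exists2 z, Num.max t y < z & (z%:E < cover_time n w)%E.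
    move: yT; case: (cover_time n w) tT => [T| |]// => [tT yT|_ _].
      have : Num.max t y < T by rewrite gt_max -!lte_fin tT.
      move=> /midf_lt[h1 h2]; exists ((Num.max t y + T) / 2) => //.
    by exists (Num.max t y + 1); rewrite ?ltry// ltrDl.
  move: tz; rewrite gt_max => /andP[tz yz].
  have := debut_gtN tz zT => /contrapT; apply=> //; exact: ltW.
move: xT; rewrite le_eqVlt => /predU1P[xT|]; last exact: lt.
move: tx; rewrite le_eqVlt => /predU1P[txE|tx].
  by rewrite -xT -txE ltxx in tT.
(* Every end point lying strictly before [x] is at most [y]. A rectangle containing a time strictly
   between [y] and [x] therefore cannot end before [x], and contains [x] as well. *)
have [y [ty yx hy]] : exists y, [/\ t <= y, y < x & forall j, (j < n)%N ->
    ((D j).1.1 < x -> (D j).1.1 <= y) /\ ((D j).1.2 < x -> (D j).1.2 <= y)].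
  elim: (n) => [|m [y [ty yx hy]]]; first by exists t.
  pose f z := if z < x then z else y.
  have fx z : f z < x by rewrite /f; case: ifP.
  exists (Num.max y (Num.max (f (D m).1.1) (f (D m).1.2))); split.
  - by rewrite le_max ty.
  - by rewrite !gt_max yx !fx.
  - move=> j; rewrite ltnS leq_eqVlt => /predU1P[->|jm].
      by split=> h; rewrite !le_max /f h lexx !orbT.
    by have [h1 h2] := hy j jm; split=> h; rewrite le_max ?h1 ?h2.
have [z1 z2] := midf_lt yx; set z := (y + x) / 2 in z1 z2.
have [||j jn [/= /andP[h1 h2] h3]] := lt z; first exact: le_trans ty (ltW z1).
  by rewrite -xT lte_fin.
have [hj1 hj2] := hy j jn.
exists j => //; split=> //=; rewrite (lt_trans h1 z2) /= leNgt; apply/negP => h.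
by have := le_lt_trans (hj2 h) z1; rewrite ltNge h2.
Qed.

(** Heine-Borel on [t, u]: finitely many of the open sections cover the segment. This is the reason
    for having open rectangles. *)
Lemma cover_time_ge w u : t <= u -> 
  (forall x, t <= x -> x <= u -> (\bigcup_j orect (D j)) (x, w)) ->
  \forall n \near \oo, (u%:E <= cover_time n w)%E.
Proof.
move=> tu cov.
have := @segment_compact R t u; rewrite compact_cover.
pose f j : set R := if `[< (D j).2 w >] then `](D j).1.1, (D j).1.2[%classic else set0.
move=> /(_ nat setT f) [].
- by move=> j _; rewrite /f; case: ifP => _; [exact: interval_open|exact: open0].
- move=> x; rewrite /= in_itv /= => /andP[tx xu].
  have [j _ [/= h1 h2]] := cov x tx xu; exists j => //.
  by rewrite /f asboolT//= in_itv.
move=> J _ cJ.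
have [N JN] : exists N, forall j, j \in finmap.enum_fset J -> (j < N)%N.
  exists (\max_(i <- finmap.enum_fset J) i).+1 => j jJ; rewrite ltnS.
  exact: (leq_bigmax_seq (F := id)).
near=> n.
apply: le_ereal_inf_tmp => _ [r [tr nr] <-]; rewrite lee_fin leNgt.
apply/negP => ru; apply: nr => x tx xr.
have [|j jJ fj] := cJ x; first by rewrite /= in_itv /= tx (le_trans xr)// ltW.
exists j => /=.
  by apply: leq_trans (JN _ jJ) _; near: n; exact: nbhs_infty_ge.
move: fj; rewrite /f; case: ifPn => // /asboolP Cj; rewrite /= in_itv /= => /andP[h1 h2].
by split=> //=; rewrite h1 ltW.
Unshelve. all: by end_near. Qed.

End covering_time.

(** * Transforms of a martingale by bounded coefficients *)

Section martingale_transform.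
Context {R : realType} {dO : measure_display} {Omega : measurableType dO}.
Variables (P : probability Omega R) (Ft : R -> set (set Omega)).
Hypothesis hFt : usual_filtration P Ft.
Variables M A : R -> Omega -> R.
Hypotheses (hM : locally_square_integrable_martingale P Ft M)
  (hA : is_predictable_qv P Ft M A).

Let aA : adapted Ft A := adapted_qv hFt hM hA.

Lemma qv_mono w s t : 0 <= s -> s <= t -> A s w <= A t w.
Proof.
case: hA => _ _ A0 _ s0 st; have [_ h] := A0 w.
by apply: h => //=; rewrite in_itv /= andbT// (le_trans s0).
Qed.

Lemma qv_right_cvg w t : 0 <= t -> A s w @[s --> t^'+] --> A t w.
Proof. by case: hA => _ /(_ w)/cadlagP[h _] _ _; exact: h. Qed.

(* sg is the first time at which A gains c: it is reached by right continuity,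
   but A may jump there. *)
Lemma hitting_time t u c : 0 <= t -> t <= u -> 0 < c ->
  let Ev := [set w | c <= A u w - A t w] in
  exists sg : Omega -> R,
    [/\ forall x, measurable (Ev `&` [set w | sg w <= x]),
        forall w, Ev w -> t < sg w /\ c <= A (sg w) w - A t w &
        forall w s, Ev w -> t <= s -> c <= A s w - A t w -> sg w <= s].
Proof.
move=> t0 tu c0 Ev; have u0 := le_trans t0 tu.
pose S w := [set s | t <= s /\ c <= A s w - A t w].
pose sg w := inf (S w).
have Su w : Ev w -> S w u by [].
have lbS w : lbound (S w) t by move=> s [].
have hlb w : has_lbound (S w) by exists t.
have att w : Ev w -> S w (sg w).
  move=> Ew; have ts : t <= sg w by apply: lb_le_inf => //; exists u.
  split=> //; rewrite leNgt; apply/negP => h.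
  have := @qv_right_cvg w _ (le_trans t0 ts).
  move=> /cvgrPdist_lt /(_ (c - (A (sg w) w - A t w))).
  rewrite subr_gt0 => /(_ h) hn.
  have [e /= e0 he] : exists2 e : R, 0 < e & forall s, sg w < s -> s < sg w + e ->
      `|A (sg w) w - A s w| < c - (A (sg w) w - A t w).
    move: hn => [e /= e0 he]; exists e => // s ss se; apply: he => //=.
    by rewrite ltr0_norm ?subr_lt0// opprB ltrBlDl.
  have [s [ts' cs] sse] := inf_adherent e0 (conj (ex_intro _ u (Su w Ew)) (hlb w)).
  have := cs; rewrite leNgt => /negP; apply.
  have : sg w <= s by apply: inf_lbound => //; split.
  rewrite le_eqVlt => /predU1P[<-//|sgs].
  have := he s sgs sse; rewrite ltr_norml => /andP[h1 h2].
  lra.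
have min w s : Ev w -> t <= s -> c <= A s w - A t w -> sg w <= s.
  by move=> Ew ts cs; apply: inf_lbound => //; split.
exists sg; split=> //; last first.
  move=> w Ew; have [ts cs] := att w Ew; split=> //.
  rewrite lt_neqAle ts andbT; apply/eqP => e.
  by move: cs; rewrite -e subrr leNgt c0.
have mA s : 0 <= s -> measurable_fun setT (A s).
  by move=> s0; exact: (measurable_wrt_fun (Ft_measurable hFt s0) (aA s0)).
have mset s : 0 <= s -> measurable [set w | c <= A s w - A t w].
  move=> s0; rewrite (_ : [set w | _] = (fun w => A s w - A t w) @^-1` `[c, +oo[%classic).
    have := measurable_funB (mA _ s0) (mA _ t0) measurableT (measurable_itv `[c, +oo[).
    by rewrite setTI.
  by apply/seteqP; split=> w /=; rewrite in_itv /= andbT.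
move=> x; have [tx|xt] := leP t x; last first.
  rewrite (_ : _ `&` _ = set0)//; apply/seteqP; split=> // w [Ew /= sx].
  by have [ts _] := att w Ew; have := le_lt_trans (le_trans ts sx) xt; rewrite ltxx.
have x0 := le_trans t0 tx.
rewrite (_ : _ `&` _ = Ev `&` [set w | c <= A x w - A t w]).
  by apply: measurableI; exact: mset.
apply/seteqP; split=> w [Ew /= h]; split=> //=; last exact: min.
have [ts cs] := att w Ew; apply: le_trans cs _; rewrite lerD2r.
by apply: qv_mono h; exact: le_trans ts.
Qed.

(** The random level [A t + c] is known at [t]. Beyond [t], the set is thus a countable union over
    rational q of the predictable set where [A < q], cut with ]t, +oo[ times an event of [Ft t]. *)
Lemma qv_level_approximable Ev sg t c :
  (forall x, measurable (Ev `&` [set w | sg w <= x])) -> 0 <= t ->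
  approximable P Ft Ev sg [set p | p.1 <= t \/ A p.1 p.2 - A t p.2 < c].
Proof.
move=> msg t0; have [pA _ _ _] := hA.
pose B (q : rat) := [set w | ratr q < A t w + c].
have FB q : Ft t (B q).
  rewrite (_ : B q = A t @^-1` `](ratr q - c), +oo[%classic).
    by apply: (aA t0); exact: measurable_itv.
  by apply/seteqP; split=> w; rewrite /B /= in_itv /= andbT ltrBlDr.
have a1 : approximable P Ft Ev sg (`]0, t] `*` setT).
  by apply: (approximable_rect hFt msg) => //; exact: (FtT hFt).
have a2 q : approximable P Ft Ev sg ([set p | t < p.1] `&` [set p | B q p.2]).
  apply: (@approximable_ext _ _ _ _ _ _ _ (\bigcup_k (`]t, t + k%:R] `*` B q))).
    move=> p p0; split=> [[k _ [/=]]|[/= tp Bp]].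
      by rewrite in_itv /= => /andP[].
    exists (Num.bound (p.1 - t)) => //; split=> //=; rewrite in_itv /= tp /=.
    by rewrite -lerBlDl ltW// archi_boundP// subr_ge0 ltW.
  apply: (approximable_bigcup hFt msg) => k.
  by apply: (approximable_rect hFt msg) => //; rewrite lerDl.
have a3 (q : rat) : approximable P Ft Ev sg (`[0, +oo[ `*` setT `&` [set p | A p.1 p.2 < ratr q]).
  apply: (predictable_approximable hFt msg).
  rewrite (_ : [set p | _] = [set p | `]-oo, (ratr q : R)[%classic (A p.1 p.2)]).
    by apply: pA; exact: measurable_itv.
  by apply/seteqP; split=> p /=; rewrite in_itv.
have aU q := approximable_setI hFt msg (a2 q) (a3 q).
have [e qe] : exists e : nat -> rat, forall q, exists n, e n = q.
  exists (fun n => odflt 0 (unpickle n)) => q; exists (pickle q).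
  by rewrite pickleK.
have a4 := approximable_setU hFt msg a1
  (approximable_bigcup hFt msg (fun n => aU (e n))).
apply: approximable_ext a4 => p p0; split.
  move=> [[/=]|]; first by rewrite in_itv /= p0 /= => pt _; left.
  move=> [n _ [[/= tp Bp] [_ /= Aq]]]; right.
  by rewrite ltrBlDl (lt_trans Aq).
move=> [pt|h]; first by left; split=> //=; rewrite in_itv /= p0.
have [pt|tp] := leP p.1 t; first by left; split=> //=; rewrite in_itv /= p0.
right; move: h; rewrite ltrBlDl => /rat_in_itvoo[q]; rewrite in_itv /= => /andP[q1 q2].
have [n nq] := qe q; exists n => //; rewrite nq; split; split=> //=.
by rewrite in_itv /= andbT ltW.
Qed.

(* The jump of A at sg cannot be ignored, but sg is predictable: stopping at the
   exit time of a cover of the stochastic interval before sg stops strictly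
   before sg, up to a set Z of small probability. *)
Lemma announce t u c del : 0 < t -> t <= u -> 0 < c -> 0 < del ->
  exists (T : nat -> Omega -> \bar R) (Z : set Omega),
  [/\ forall n, stopping_time Ft (T n) /\ (forall w, (t%:E <= T n w)%E),
      measurable Z /\ Pr P Z <= del,
      forall n w s, t <= s -> s <= u -> (s%:E <= T n w)%E -> ~ Z w -> A s w - A t w < c &
      forall w, A u w - A t w < c -> \forall n \near \oo, (u%:E <= T n w)%E].
Proof.
move=> tp tu c0 d0; have t0 := ltW tp.
have [sg [msg sgE sgmin]] := hitting_time t0 tu c0.
set Ev := [set w | c <= A u w - A t w] in msg sgE sgmin.
have [U [C [U' [C' [rU rU' h3 h4 h5]]]]] := qv_level_approximable c msg t0 d0.
have [D [aD UE CE]] := rU.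
exists (cover_time D t), (at_sg Ev sg (C `&` C')); split.
- move=> n; split; first exact: (cover_time_stopping hFt aD).
  by move=> w; exact: debut_ge.
- by split=> //; exact: (measurable_at_sg hFt msg (rcoverI hFt rU rU')).
- move=> n w s ts su sT nZ; rewrite ltNge; apply/negP => cs.
  have s0 := le_trans t0 ts.
  have Ew : Ev w by rewrite /Ev /= (le_trans cs)// lerD2r qv_mono.
  have [tsg csg] := sgE w Ew; have sgs := sgmin w s Ew ts cs.
  (* Lying before the exit time, [sg w] is in the cover [C]; since [A] has gained [c] at [sg w], it
     is also in the cover [C'] of the complement. *)
  apply: nZ; split=> //; split.
    have tT : (t%:E < cover_time D t n w)%E.
      by apply: lt_le_trans sT; rewrite lte_fin (lt_le_trans tsg).
    have [|j _ hj] := cover_time_in tT (ltW tsg).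
      by apply: le_trans sT; rewrite lee_fin.
    by rewrite CE; exists j.
  apply: (rcover_sub rU'); apply: h4 => /=; first exact: lt_trans tsg.
  by move=> [h|h]; [move: tsg; rewrite ltNge h|move: csg; rewrite leNgt h].
- move=> w cw; apply: cover_time_ge => // x tx xu.
  rewrite -UE; apply: h3 => /=; first exact: lt_le_trans tx.
  right; apply: le_lt_trans cw; rewrite lerD2r qv_mono//.
  exact: le_trans tx.
Qed.

(** Orthogonality of the increments, by induction. [G] is a mere measurable set, as it will be the
    event of getting far at some grid point, known at the end only. Hence the squared increment is
    traded for that of [A] against the adapted weight [v ^+ 2] first, and this weight is bounded by
    the indicator of [G] afterwards. *)
Lemma transform_sq (sig : Omega -> \bar R) (g : nat -> R) (v : nat -> Omega -> R) n G :
  (forall i, 0 <= g i) -> {homo g : i j / (i <= j)%N >-> i <= j} ->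
  adapted Ft (stopped M sig) ->
  (forall s t : R, 0 <= s -> s <= t ->
      let D w := stopped M sig t w - stopped M sig s w in
      [/\ measurable_fun setT D, intg P (fun w => D w ^+ 2),
          (forall xi : Omega -> R, measurable_wrt (Ft s) xi -> intg P (fun w => xi w ^+ 2) ->
            Ex P (fun w => xi w * D w) = 0),
          intg P (fun w => stopped A sig t w - stopped A sig s w) &
          forall G, Ft s G -> Ex P (fun w => \1_G w * D w ^+ 2) =
            Ex P (fun w => \1_G w * (stopped A sig t w - stopped A sig s w))]) ->
  (forall w s t, 0 <= s -> s <= t -> stopped A sig s w <= stopped A sig t w) ->
  measurable G ->
  (forall k, measurable_wrt (Ft (g k)) (v k)) ->
  (forall k w, `|v k w| <= \1_G w) ->
  let S w := \sum_(k < n) v k w * (stopped M sig (g k.+1) w - stopped M sig (g k) w) in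
  [/\ measurable_wrt (Ft (g n)) S, intg P (fun w => S w ^+ 2) &
    Ex P (fun w => S w ^+ 2) <=
    Ex P (fun w => \1_G w * (stopped A sig (g n) w - stopped A sig (g 0%N) w))].
Proof.
move=> g0 gm aN hN Amono mG mv vG.
elim: n => [|n IH] S.
  have S0 : S = fun=> 0 by apply/funext => w; rewrite /S big_ord0.
  split.
  - apply/(measurable_wrtP (Ft_sigma hFt (g0 0%N))); rewrite S0; exact: measurable_cst.
  - by rewrite S0; apply: eq_integrable (intg_cst P 0) => // w _ /=; rewrite expr0n.
  - apply: le_Ex => //; last 1 first.
    by move=> w; rewrite S0 subrr mulr0 expr0n.
    by rewrite S0; apply: eq_integrable (intg_cst P 0) => // w _ /=; rewrite expr0n.
    by apply: eq_integrable (intg_cst P 0) => // w _ /=; rewrite subrr mulr0.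
set S' := (fun w => \sum_(k < n) _) in IH; have [mS' iS' eS'] := IH.
have gn : g n <= g n.+1 by exact: gm.
have [mD iD2 oD iA eA] := hN _ _ (g0 n) gn.
set D := (fun w => stopped M sig (g n.+1) w - _) in mD iD2 oD eA.
have SE w : S w = S' w + v n w * D w by rewrite /S big_ord_recr.
have F0 := Ft_sigma hFt (g0 n); have FM := Ft_measurable hFt (g0 n).
have mvn := measurable_wrt_fun FM (mv n).
have mS'' := measurable_wrt_fun FM mS'.
have v1 w : `|v n w| <= 1.
  by apply: le_trans (vG n w) _; rewrite (le_trans (ler_norm _))// norm_indic.
have vsq w : v n w ^+ 2 <= \1_G w.
  have := vG n w; rewrite indicE; case: (w \in G) => /=.
    by rewrite -real_normK ?num_real// => h; rewrite expr_le1.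
  by rewrite normr_le0 => /eqP ->; rewrite expr0n.
have v2 w : `|v n w ^+ 2| <= 1.
  by rewrite ger0_norm ?sqr_ge0// (le_trans (vsq w))// (le_trans (ler_norm _))// norm_indic.
have mv2 : measurable_fun setT (fun w => v n w ^+ 2) by exact: measurable_funX.
have ivD2 : intg P (fun w => v n w ^+ 2 * D w ^+ 2) by exact: (intg_mulb iD2 mv2 v2).
have ivA : intg P (fun w => v n w ^+ 2 * (stopped A sig (g n.+1) w - stopped A sig (g n) w)).
  exact: (intg_mulb iA mv2 v2).
have iSv : intg P (fun w => (S' w * v n w) ^+ 2).
  apply: (intg_le _ iS'); first by apply: measurable_funX; exact: measurable_funM.
  move=> w; rewrite ger0_norm ?sqr_ge0// exprMn ler_piMr ?sqr_ge0//.
  by rewrite (le_trans (ler_norm _)).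
have mSv : measurable_wrt (Ft (g n)) (fun w => S' w * v n w) by exact: mul_measurable_wrt.
have oSv := oD _ mSv iSv.
have iSvD : intg P (fun w => S' w * v n w * D w).
  by apply: intg_sqrM => //; exact: measurable_funM.
have S2E : (fun w => S w ^+ 2) = fun w => S' w ^+ 2 + 2 * (S' w * v n w * D w) + v n w ^+ 2 * D w ^+ 2.
  by apply/funext => w; rewrite SE; ring.
have i12 : intg P (fun w => S' w ^+ 2 + 2 * (S' w * v n w * D w)).
  by apply: intgD => //; exact: intgZ.
have eDA : Ex P (fun w => v n w ^+ 2 * D w ^+ 2) =
    Ex P (fun w => v n w ^+ 2 * (stopped A sig (g n.+1) w - stopped A sig (g n) w)).
  apply/eqP; rewrite -subr_eq0 -ExB//; apply/eqP.
  rewrite (_ : (fun w => _) = fun w => v n w ^+ 2 *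
    (D w ^+ 2 - (stopped A sig (g n.+1) w - stopped A sig (g n) w))); last first.
    by apply/funext => w; rewrite /D; ring.
  apply: (Ex_orth_bounded F0 FM (intgB iD2 iA) _ _ v2).
    move=> B FB; have mB := FM _ FB.
    rewrite (_ : (fun w => _) = fun w => \1_B w * D w ^+ 2 -
      \1_B w * (stopped A sig (g n.+1) w - stopped A sig (g n) w)); last first.
      by apply/funext => w; rewrite /D; ring.
    by rewrite ExB ?eA ?subrr//; exact: intg_indicM.
  apply/(measurable_wrtP F0); apply: measurable_funX; exact/(measurable_wrtP F0).
split.
- have F1 := Ft_sigma hFt (g0 n.+1).
  apply/(measurable_wrtP F1); rewrite (funext SE); apply: measurable_funD.
    apply/(measurable_wrtP F1) => B mB; apply: (Ft_mono hFt (g0 n) gn); exact: mS'.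
  apply: measurable_funM.
    apply/(measurable_wrtP F1) => B mB; apply: (Ft_mono hFt (g0 n) gn); exact: mv.
  by apply: measurable_funB; apply: (adapted_measurable hFt).
- by rewrite S2E; exact: intgD.
rewrite S2E ExD// ExD ?ExZ ?oSv ?mulr0 ?addr0//; last exact: intgZ.
have iA0 : intg P (fun w => \1_G w * (stopped A sig (g n) w - stopped A sig (g 0%N) w)).
  by apply: intg_indicM => //; have [] := hN _ _ (g0 0%N) (gm _ _ (leq0n n)).
have iA1 : intg P (fun w => \1_G w * (stopped A sig (g n.+1) w - stopped A sig (g n) w)).
  exact: intg_indicM.
rewrite [leRHS](_ : _ = Ex P (fun w => \1_G w * (stopped A sig (g n) w - stopped A sig (g 0%N) w) +
   \1_G w * (stopped A sig (g n.+1) w - stopped A sig (g n) w))); last first.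
  by congr Ex; apply/funext => w; ring.
rewrite (ExD iA0 iA1) eDA; apply: lerD => //; apply: (le_Ex ivA iA1) => w.
by apply: ler_wpM2r; [rewrite subr_ge0; exact: Amono|exact: vsq].
Qed.

(** Chebyshev's inequality for the transform stopped at an announcing time of level [2 * c]. The
    doubled level exceeds [c] strictly, so on the event where [A] gains at most [c] the announcing
    times eventually pass [u]; before them the gain of [A] stays below [2 * c] outside [Z]. *)
Lemma transform_bound t u (g : nat -> R) (v : nat -> Omega -> R) n G c lam :
  0 < t -> t <= u -> {homo g : i j / (i <= j)%N >-> i <= j} -> g 0%N = t -> g n = u ->
  (forall k, measurable_wrt (Ft (g k)) (v k)) ->
  (forall k w, `|v k w| <= \1_G w) -> measurable G -> 0 < c -> 0 < lam ->
  lam ^+ 2 * Pr P ([set w | lam <= `|\sum_(k < n) v k w * (M (g k.+1) w - M (g k) w)|]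
    `&` [set w | A u w - A t w <= c]) <= 2 * c * Pr P G.
Proof.
move=> tp tu gm g0 gn mv vG mG c0 lam0.
have t0 := ltW tp; have u0 := le_trans t0 tu.
have gt i : t <= g i by rewrite -g0 gm.
have gi0 i : 0 <= g i by exact: le_trans t0 (gt i).
have [cM aM _] := hM.
set B := _ `&` _.
have mM s : 0 <= s -> measurable_fun setT (M s).
  by move=> s0; exact: (measurable_wrt_fun (Ft_measurable hFt s0) (aM _ s0)).
have mA s : 0 <= s -> measurable_fun setT (A s).
  by move=> s0; exact: (measurable_wrt_fun (Ft_measurable hFt s0) (aA s0)).
have mv' k := measurable_wrt_fun (Ft_measurable hFt (gi0 k)) (mv k).
have mlev (f : Omega -> R) x : measurable_fun setT f -> measurable [set w | x <= f w].
  move=> mf; have := mf measurableT _ (measurable_itv `[x, +oo[).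
  by rewrite setTI; congr measurable; apply/seteqP; split=> w /=; rewrite in_itv /= andbT.
have mlev' (f : Omega -> R) x : measurable_fun setT f -> measurable [set w | f w <= x].
  move=> mf; have := mf measurableT _ (measurable_itv `]-oo, x]).
  by rewrite setTI; congr measurable; apply/seteqP; split=> w /=; rewrite in_itv.
have mAc : measurable [set w | A u w - A t w <= c].
  by apply: mlev'; apply: measurable_funB; exact: mA.
have mB : measurable B.
  apply: measurableI => //; apply: mlev; apply: measurableT_comp => //.
  apply: measurable_sum => k; apply: measurable_funM; first exact: mv'.
  by apply: measurable_funB; exact: mM.
apply/ler_addgt0Pr => e e0.
have [L [hL L0 hqv]] := qv_localization hFt hM hA.
(* The total error will be [e1 + lam ^+ 2 * (e1 + e1)]: the contribution of [Z] to the second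
   moment, and the probabilities of stopping before [u] because of [L N] or of [T m]. *)
pose e1 := e / (3 * (1 + lam ^+ 2)).
have e10 : 0 < e1 by rewrite divr_gt0// mulr_gt0// ltr_wpDr// sqr_ge0.
have [N hN] : exists N, Pr P [set w | (L N w < u%:E)%E] <= e1.
  have /cvgrPdist_le /(_ _ e10) [N _ /(_ N (leqnn N))] := L0 u.
  by rewrite sub0r normrN => h; exists N; rewrite (le_trans (ler_norm _)).
have hinf : stopping_time Ft (fun=> +oo%E : \bar R) by exact: (stopping_cst hFt).
(* [h] is the gain of [A] up to [L N], before any announcing time is chosen. It is integrable and
   bounds the gain on [Z]; the admissible probability [del] of [Z] comes from the absolute
   continuity of its integral. *)
have [_ _ _ ih _] := hqv N _ hinf _ _ t0 tu.
set h := (fun w => _ - _) in ih.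
have [del del0 hdel] := intg_abs_cont ih e10.
have c20 : 0 < 2 * c by rewrite mulr_gt0.
have [T [Z [hT [mZ PZ] hT1 hT2]]] := announce tp tu c20 del0.
have mTu m : measurable ([set w | A u w - A t w <= c] `&` [set w | (T m w < u%:E)%E]).
  by apply: measurableI => //; apply: (Ft_measurable hFt u0); apply: (stopping_lt hFt) => //; exact: (hT m).1.
have [m hm] : exists m, Pr P ([set w | A u w - A t w <= c] `&` [set w | (T m w < u%:E)%E]) <= e1.
  have : Pr P ([set w | A u w - A t w <= c] `&` [set w | (T m w < u%:E)%E]) @[m --> \oo] --> 0.
    apply: Pr_cvg0 => // w; have [cw|cw] := leP (A u w - A t w) c; last first.
      by apply: nearW => m [/=]; rewrite leNgt cw.
    have : A u w - A t w < 2 * c by rewrite (le_lt_trans cw)//; lra.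
    by move/hT2; apply: filterS => m h1 [_ /=]; rewrite ltNge h1.
  move=> /cvgrPdist_le /(_ _ e10) [m _ /(_ m (leqnn m))].
  by rewrite sub0r normrN => h'; exists m; rewrite (le_trans (ler_norm _)).
have [hTm Tt] := hT m.
pose sig w := Order.min (L N w) (T m w).
have hsig : stopping_time Ft sig by exact: (stopping_min hFt).
have stA w s s' : 0 <= s -> s <= s' -> stopped A sig s w <= stopped A sig s' w.
  move=> s0 ss'; rewrite /stopped.
  have sg0 : (0 <= sig w)%E by case: hsig.
  have s'0 := le_trans s0 ss'.
  case: (sig w) sg0 => [x| |]//; last first.
    by move=> _; rewrite !min_l ?leey//=; exact: qv_mono.
  rewrite lee_fin -!EFin_min /= => x0; apply: qv_mono; first by rewrite le_min s0.
  by rewrite le_min !ge_min lexx ss' orbT.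
have aS := adapted_stopped_cadlag hFt cM aM hsig.
have [mS iS eS] := transform_sq n gi0 gm aS (hqv N _ hTm) stA mG mv vG.
set S := (fun w => \sum_(k < n) _) in mS iS eS.
have mS' := measurable_wrt_fun (Ft_measurable hFt (gi0 n)) mS.
have mS2 : measurable [set w | lam ^+ 2 <= S w ^+ 2].
  by apply: mlev; exact: measurable_funX.
have Bsub : B `<=` [set w | lam ^+ 2 <= S w ^+ 2] `|` ([set w | (L N w < u%:E)%E] `|`
    ([set w | A u w - A t w <= c] `&` [set w | (T m w < u%:E)%E])).
  move=> w [lw cw]; have [LN|LN] := ltP (L N w) u%:E; first by right; left.
  have [Tm|Tm] := ltP (T m w) u%:E; first by right; right.
  left => /=; rewrite (_ : S w = \sum_(k < n) v k w * (M (g k.+1) w - M (g k) w)).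
    by rewrite -[leRHS]real_normK ?num_real// lerXn2r ?nnegrE// ltW.
  apply: eq_bigr => k _; rewrite /stopped !min_l//= le_min.
    by rewrite (le_trans _ LN) ?(le_trans _ Tm)// lee_fin -gn gm// ltnW.
  by rewrite (le_trans _ LN) ?(le_trans _ Tm)// lee_fin -gn gm.
have mLu : measurable [set w | (L N w < u%:E)%E].
  by apply: (Ft_measurable hFt u0); exact: (stopping_lt hFt).
have PB : Pr P B <= Pr P [set w | lam ^+ 2 <= S w ^+ 2] + (e1 + e1).
  apply: le_trans (le_Pr P mB _ Bsub) _.
    by apply: measurableU => //; exact: measurableU.
  apply: le_trans (PrU_le P _ _) _ => //; first exact: measurableU.
  rewrite lerD2l; apply: le_trans (PrU_le P _ _) _ => //.
  exact: lerD.
have mk : lam ^+ 2 * Pr P [set w | lam ^+ 2 <= S w ^+ 2] <= 2 * c * Pr P G + e1.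
  apply: le_trans (Pr_markov iS mS2 (sqr_ge0 _) (fun w => sqr_ge0 _) (fun w => id)) _.
  apply: le_trans eS _; rewrite g0 gn.
  have [_ _ _ iAs _] := hqv N _ hTm _ _ t0 tu.
  apply: (@le_trans _ _ (Ex P (fun w => 2 * c * \1_G w + \1_Z w * `|h w|))).
    apply: le_Ex.
    - exact: intg_indicM.
    - apply: intgD; first exact/intgZ/intg_indic.
      by apply: intg_indicM => //; exact: intg_norm.
    move=> w.
    have [LT|TL] := leP (L N w) t%:E.
      rewrite {1 2}/stopped !min_r ?subrr ?mulr0.
      + by rewrite addr_ge0// mulr_ge0 ?normr_ge0// ?indicE// ltW.
      + by rewrite ge_min LT.
      + by rewrite ge_min (le_trans LT).
    have min_t : Order.min t%:E (sig w) = t%:E.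
      by rewrite min_l// le_min (ltW TL) Tt.
    have [r [rE tr ru rT rL]] : exists r, [/\ Order.min u%:E (sig w) = r%:E, t <= r, r <= u,
        (r%:E <= T m w)%E & (r%:E <= L N w)%E].
      have : (t%:E <= Order.min u%:E (sig w))%E by rewrite le_min lee_fin tu /= /sig le_min (ltW TL) Tt.
      have : (Order.min u%:E (sig w) <= u%:E)%E by rewrite ge_min lexx.
      have : (Order.min u%:E (sig w) <= T m w)%E by rewrite /sig !ge_min lexx !orbT.
      have : (Order.min u%:E (sig w) <= L N w)%E by rewrite /sig !ge_min lexx !orbT.
      case: (Order.min u%:E (sig w)) => [r| |]//; exists r; split=> //.
    rewrite {1 2}/stopped min_t rE /=.
    have [Zw|nZ] := pselect (Z w).
      rewrite [\1_Z w]indicE mem_set// mul1r.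
      have hA1 : A r w - A t w <= `|h w|.
        rewrite /h /stopped !(min_l (leey _)) (min_l (ltW TL)) /=.
        have [s [sE rs]] : exists s, Order.min u%:E (L N w) = s%:E /\ r <= s.
          move: rL TL; case: (L N w) => [x| |]//; rewrite ?lee_fin => rx _.
            by exists (Order.min u x); rewrite EFin_min le_min ru rx.
          by exists u; rewrite min_l ?leey.
        rewrite sE /= (le_trans _ (ler_norm _))// lerD2r.
        by apply: qv_mono => //; exact: le_trans tr.
      have Ar0 : 0 <= A r w - A t w by rewrite subr_ge0 qv_mono.
      apply: (@le_trans _ _ (A r w - A t w)).
        by rewrite ler_piMl// (le_trans (ler_norm _))// norm_indic.
      by rewrite (le_trans hA1)// lerDr mulr_ge0 ?indicE// ltW.
    rewrite [\1_Z w]indicE memNset// mul0r addr0 mulrC ler_wpM2r ?indicE//.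
    exact: ltW (hT1 m w r tr ru rT nZ).
  rewrite ExD; [|exact/intgZ/intg_indic|by apply: intg_indicM => //; exact: intg_norm].
  by rewrite ExZ ?Ex_indic ?lerD2l//; [exact: hdel|exact: intg_indic].
apply: (@le_trans _ _ (2 * c * Pr P G + e1 + lam ^+ 2 * (e1 + e1))).
  by rewrite (le_trans (ler_wpM2l (sqr_ge0 _) PB))// mulrDr lerD2r.
rewrite -addrA lerD2l.
have : e1 * (3 * (1 + lam ^+ 2)) = e.
  by rewrite /e1 divfK// mulf_neq0// gt_eqF// ltr_wpDr// sqr_ge0.
by move=> <-; have := mulr_ge0 (ltW e10) (sqr_ge0 lam); lra.
Qed.

End martingale_transform.

(** * The Lyapunov form of a repulsive matrix *)

Section lyapunov.
Context {R : realType}.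
Local Notation Rc := (real_complex R).

Let ReD (x y : R[i]) : complex.Re (x + y) = complex.Re x + complex.Re y.
Proof. by case: x; case: y. Qed.
Let ImD (x y : R[i]) : complex.Im (x + y) = complex.Im x + complex.Im y.
Proof. by case: x; case: y. Qed.
Let ReM (x y : R[i]) : complex.Re (x * y) =
  complex.Re x * complex.Re y - complex.Im x * complex.Im y.
Proof. by case: x; case: y. Qed.
Let ImM (x y : R[i]) : complex.Im (x * y) =
  complex.Re x * complex.Im y + complex.Im x * complex.Re y.
Proof. by case: x; case: y. Qed.
Let Re_sum (I : finType) (f : I -> R[i]) :
  complex.Re (\sum_i f i) = \sum_i complex.Re (f i).
Proof. exact: (big_morph _ ReD). Qed.
Let Im_sum (I : finType) (f : I -> R[i]) :
  complex.Im (\sum_i f i) = \sum_i complex.Im (f i).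
Proof. exact: (big_morph _ ImD). Qed.

(** Schur's theorem in real terms: [P H = T P] with P = U + iV unitary and T = a + ib lower
    triangular, the diagonal of T consisting of eigenvalues of [H]. The case [d = 0] is apart
    because Schur's theorem asks for a positive dimension. *)
Lemma repulsive_triangular d (H : 'M[R]_d) : repulsive H ->
  exists (a b U V : 'M[R]_d),
  [/\ U *m H = a *m U - b *m V, V *m H = a *m V + b *m U,
      forall i j : 'I_d, (i < j)%N -> a i j = 0 /\ b i j = 0,
      forall i, 0 < a i i &
      forall x : 'cV[R]_d, \sum_i ((U *m x) i 0 ^+ 2 + (V *m x) i 0 ^+ 2) =
        \sum_i x i 0 ^+ 2].
Proof.
case: d H => [|d] H rH.
  exists 0, 0, 0, 0; split=> [|||[]//|x]; rewrite ?big_ord0 //.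
  - by rewrite !mul0mx subrr.
  - by rewrite !mul0mx addr0.
  - by move=> [].
have [P uP tP] := Schur (map_mx Rc H) (ltn0Sn d).
have iP := unitarymx_unit uP.
pose T := P *m map_mx Rc H *m invmx P.
have {}tP : is_trig_mx T.
  by have : is_trig_mx (conjmx P (map_mx Rc H)) := tP; rewrite conjumx.
have PTE : P *m map_mx Rc H = T *m P by rewrite /T mulmxKV.
clearbody T.
pose re : R[i] -> R := @complex.Re R; pose im : R[i] -> R := @complex.Im R.
have key i j : \sum_k P i k * Rc (H k j) = \sum_k T i k * P k j.
  have /matrixP/(_ i j) := PTE; rewrite !mxE => e0; rewrite -e0.
  by apply: eq_bigr => k _; rewrite mxE.
exists (map_mx re T), (map_mx im T), (map_mx re P), (map_mx im P); split.
- apply/matrixP => i j; have := congr1 re (key i j).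
  rewrite /re !Re_sum !mxE -sumrB => h.
  under eq_bigr do rewrite mxE; under [RHS]eq_bigr do rewrite !mxE.
  rewrite [RHS](eq_bigr (fun k => complex.Re (T i k * P k j))); last by move=> k _; rewrite ReM.
  by rewrite -h; apply: eq_bigr => k _; rewrite ReM /= mulr0 subr0.
- apply/matrixP => i j; have := congr1 im (key i j).
  rewrite /im !Im_sum !mxE -big_split /= => h.
  under eq_bigr do rewrite mxE; under [RHS]eq_bigr do rewrite !mxE.
  rewrite [RHS](eq_bigr (fun k => complex.Im (T i k * P k j))); last by move=> k _; rewrite ImM.
  by rewrite -h; apply: eq_bigr => k _; rewrite ImM /= mulr0 add0r.
- move=> i j ij; rewrite !mxE; have /is_trig_mxP/(_ i j ij) -> := tP.
  by [].
- move=> i; rewrite mxE /re; apply: rH.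
  have : eigenvalue T (T i i).
    rewrite eigenvalue_root_char char_poly_trig// /root horner_prod.
    by apply/eqP; rewrite (bigD1 i) //= !hornerE subrr mul0r.
  move=> /eigenvalueP[v vT v0]; apply/eigenvalueP; exists (v *m P).
    by rewrite -mulmxA PTE mulmxA vT -scalemxAl.
  apply: contra v0 => /eqP vP; rewrite -(mulmxK iP v) vP mul0mx//.
- move=> x; pose xc : 'cV_d.+1 := map_mx Rc x.
  have e : ((P *m xc)^t* *m (P *m xc) = xc^t* *m xc)%sesqui.
    rewrite trmx_mul map_mxM /= -mulmxA (mulmxA _ P) -(invmx_unitary uP).
    by rewrite mulVmx// mul1mx.
  have sq m (y : 'cV[R[i]]_m) : re ((y^t* *m y)%sesqui 0 0) = \sum_i (re (y i 0) ^+ 2 + im (y i 0) ^+ 2).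
    rewrite mxE /re Re_sum; apply: eq_bigr => i _.
    by rewrite !mxE ReM /im; case: (y i 0) => p q /=; ring.
  have /matrixP/(_ 0 0)/(congr1 re) := e.
  rewrite !sq [in RHS](eq_bigr (fun i => x i 0 ^+ 2)); last first.
    by move=> i _; rewrite mxE /re /im /= expr0n addr0.
  move=> <-; apply: eq_bigr => i _; congr (_ ^+ 2 + _ ^+ 2).
    rewrite !mxE /re Re_sum; apply: eq_bigr => k _.
    by rewrite !mxE ReM /= mulr0 subr0.
  rewrite !mxE /im Im_sum; apply: eq_bigr => k _.
  by rewrite !mxE ImM /= mulr0 add0r.
Qed.

Definition qform d (Q : 'M[R]_d) (x y : 'cV[R]_d) : R := (x^T *m Q *m y) 0 0.

Lemma qformDr d (Q : 'M[R]_d) x y z : qform Q x (y + z) = qform Q x y + qform Q x z.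
Proof. by rewrite /qform mulmxDr mxE. Qed.

Lemma qformDl d (Q : 'M[R]_d) x y z : qform Q (y + z) x = qform Q y x + qform Q z x.
Proof. by rewrite /qform linearD /= !mulmxDl mxE. Qed.

Lemma qformZr d (Q : 'M[R]_d) x k y : qform Q x (k *: y) = k * qform Q x y.
Proof. by rewrite /qform -scalemxAr mxE. Qed.

Lemma qformZl d (Q : 'M[R]_d) x k y : qform Q (k *: y) x = k * qform Q y x.
Proof. by rewrite /qform linearZ /= -!scalemxAl mxE. Qed.

Lemma qform_sym d (Q : 'M[R]_d) x y : Q^T = Q -> qform Q x y = qform Q y x.
Proof.
move=> sQ; rewrite /qform -[in RHS](trmxK (y^T *m Q *m x)) [RHS]mxE.
by rewrite !trmx_mul trmxK sQ mulmxA.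
Qed.

(* With the weights s^(2i) the off-diagonal part of the triangular matrix
   becomes small. *)
Lemma triangular_form d (a b : 'M[R]_d) :
  (forall i j : 'I_d, (i < j)%N -> a i j = 0 /\ b i j = 0) -> (forall i, 0 < a i i) ->
  exists (w : 'I_d -> R) (c : R), [/\ 0 < c, forall i, c <= w i <= 1 &
    forall u v : 'cV[R]_d,
      c * \sum_i w i * (u i 0 ^+ 2 + v i 0 ^+ 2) <=
      \sum_i w i * ((a *m u - b *m v) i 0 * u i 0 + (a *m v + b *m u) i 0 * v i 0)].
Proof.
move=> tri pos.
have sum_ge (f : 'I_d -> R) i : (forall j, 0 <= f j) -> f i <= \sum_j f j.
  by move=> f0; rewrite (bigD1 i)//= lerDl sumr_ge0.
(* A positive lower bound of the diagonal that also makes sense for an empty diagonal. *)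
pose l := (1 + \sum_i (a i i)^-1)^-1.
have l0 : 0 < l.
  by rewrite invr_gt0 ltr_pwDl// sumr_ge0// => i _; rewrite invr_ge0 ltW.
have hl i : l <= a i i.
  rewrite -[leRHS]invrK lef_pV2 ?posrE ?invr_gt0//.
    by rewrite (le_trans (sum_ge (fun i => (a i i)^-1) i _)) ?lerDr// => j; rewrite invr_ge0 ltW.
  by rewrite -invr_gt0 -/l.
pose L := 1 + \sum_i \sum_j (`|a i j| + `|b i j|).
have L0 : 0 < L by rewrite ltr_pwDl// !sumr_ge0// => i _; rewrite sumr_ge0.
have hL i j : `|a i j| + `|b i j| <= L.
  apply: (@le_trans _ _ (\sum_j (`|a i j| + `|b i j|))).
    by apply: (sum_ge (fun j => `|a i j| + `|b i j|)) => k; exact: addr_ge0.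
  rewrite (le_trans (sum_ge (fun i => \sum_j (`|a i j| + `|b i j|)) i _)) ?lerDr//.
  by move=> k; rewrite sumr_ge0// => k' _; exact: addr_ge0.
(* Small enough for [2 * d * L * s <= l / 2]: the off-diagonal entries use up at most half of the
   diagonal gain [l]. *)
pose s := l / (4 * d.+1%:R * L + l).
have D0 : 0 < 4 * d.+1%:R * L + l by rewrite addr_gt0// !mulr_gt0// ltr0n.
have s0 : 0 < s by rewrite divr_gt0.
have s1 : s <= 1 by rewrite ler_pdivrMr// mul1r lerDr !mulr_ge0// ltW.
have sl : 2 * d%:R * L * s <= l / 2.
  rewrite /s mulrA ler_pdivrMr//.
  have : 4 * d%:R * L * l <= l * (4 * d.+1%:R * L + l).
    rewrite mulrC ler_pM2l//.
    apply: (@le_trans _ _ (4 * d.+1%:R * L)); last by rewrite lerDl ltW.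
    by rewrite ler_pM2r// ler_pM2l// ler_nat.
  lra.
pose w (i : 'I_d) := s ^+ (2 * i).
have w0 i : 0 < w i by rewrite exprn_gt0.
exists w, (Num.min (l / 2) (s ^+ (2 * d))); split.
- by rewrite lt_min divr_gt0// exprn_gt0.
- move=> i; apply/andP; split; last by rewrite exprn_ile1// ltW.
  by rewrite ge_min; apply/orP; right; rewrite ler_wiXn2l// ?ltW// leq_mul2l ltnW.
move=> u v; pose N i := u i 0 ^+ 2 + v i 0 ^+ 2.
have N0 i : 0 <= N i by rewrite addr_ge0// sqr_ge0.
have term i j : (j == i)%:R * (l * (w i * N i)) - L * s * (w i * N i + w j * N j) <=
    w i * (a i j * (u j 0 * u i 0 + v j 0 * v i 0) + b i j * (u j 0 * v i 0 - v j 0 * u i 0)).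
  have Ls : 0 <= L * s * (w i * N i + w j * N j).
    apply: mulr_ge0; first by rewrite mulr_ge0// ltW.
    by rewrite addr_ge0// mulr_ge0// ltW.
  have [ij|ji|/val_inj ij] := ltngtP i j.
  - have [-> ->] := tri _ _ ij; rewrite !mul0r addr0 mulr0.
    by case: eqP => [e|_]; [rewrite e ltnn in ij|rewrite mul0r sub0r oppr_le0].
  - have -> : (j == i) = false by apply/negbTE; rewrite -val_eqE neq_ltn ji.
    rewrite mul0r sub0r.
    (* As [j < i], the exponent 2i is at least i + j + 1: the weight of the row leaves a spare
       factor [s] over the geometric mean of the two weights. *)
    have ws : w i <= s * (s ^+ i * s ^+ j).
      by rewrite -exprD -exprS ler_wiXn2l// ?ltW// mul2n -addnn -addnS leq_add2l.
    have wE k : w k = s ^+ k ^+ 2 by rewrite -exprM mulnC.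
    set p := s ^+ i in ws *; set q := s ^+ j in ws *.
    have bnd (x z t m : R) : 0 <= z -> 0 <= t ->
        m = p ^+ 2 * (z) + q ^+ 2 * t -> `|x| * (2 * (p * q)) <= m -> w i * `|x| <= s * (m / 2).
      move=> z0 t0 mE xm; apply: (@le_trans _ _ (s * (p * q) * `|x|)).
        by rewrite ler_wpM2r.
      by rewrite -[leLHS]mulrA ler_pM2l//; lra.
    have n1 : w i * `|u j 0 * u i 0 + v j 0 * v i 0| <= s * ((w i * N i + w j * N j) / 2).
      apply: (bnd _ (N i) (N j)) => //; first by rewrite !wE -/p -/q.
      rewrite !wE -/p -/q.
      have pq0 : 0 <= 2 * (p * q) by rewrite !mulr_ge0// exprn_ge0// ltW.
      rewrite -[X in _ * X]ger0_norm// -normrM ler_norml /N.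
      apply/andP; split.
        have := sqr_ge0 (p * u i 0 + q * u j 0); have := sqr_ge0 (p * v i 0 + q * v j 0); lra.
      have := sqr_ge0 (p * u i 0 - q * u j 0); have := sqr_ge0 (p * v i 0 - q * v j 0); lra.
    have n2 : w i * `|u j 0 * v i 0 - v j 0 * u i 0| <= s * ((w i * N i + w j * N j) / 2).
      apply: (bnd _ (N i) (N j)) => //; first by rewrite !wE -/p -/q.
      rewrite !wE -/p -/q.
      have pq0 : 0 <= 2 * (p * q) by rewrite !mulr_ge0// exprn_ge0// ltW.
      rewrite -[X in _ * X]ger0_norm// -normrM ler_norml /N.
      apply/andP; split.
        have := sqr_ge0 (p * v i 0 + q * u j 0); have := sqr_ge0 (p * u i 0 - q * v j 0); lra.
      have := sqr_ge0 (p * v i 0 - q * u j 0); have := sqr_ge0 (p * u i 0 + q * v j 0); lra.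
    set z := (w i * N i + w j * N j) / 2 in n1 n2.
    have z0 : 0 <= s * z by rewrite (le_trans _ n1)// mulr_ge0// ltW.
    have nb (x y : R) : w i * `|y| <= s * z -> - (`|x| * (s * z)) <= w i * (x * y).
      move=> h; rewrite lerNl -mulrN.
      apply: (le_trans (ler_norm _)); rewrite normrM normrN normrM (gtr0_norm (w0 i)) mulrCA.
      by rewrite ler_wpM2l.
    have := nb (a i j) _ n1; have := nb (b i j) _ n2.
    have : (`|a i j| + `|b i j|) * (s * z) <= L * (s * z) by rewrite ler_wpM2r.
    have : L * s * (w i * N i + w j * N j) = 2 * (L * (s * z)) by rewrite /z; field.
    have := mulr_ge0 (ltW L0) z0.
    rewrite mulrDr; lra.
  - subst j; rewrite eqxx mul1r.
    have : l * (w i * N i) <= a i i * (w i * N i) by rewrite ler_wpM2r// mulr_ge0// ltW.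
    have -> : w i * (a i i * (u i 0 * u i 0 + v i 0 * v i 0) + b i i * (u i 0 * v i 0 - v i 0 * u i 0)) = a i i * (w i * N i) by rewrite /N; ring.
    lra.
apply: (@le_trans _ _ (\sum_i \sum_j ((j == i)%:R * (l * (w i * N i)) - L * s * (w i * N i + w j * N j)))); last first.
  apply: ler_sum => i _; apply: (@le_trans _ _ (\sum_j w i * (a i j * (u j 0 * u i 0 + v j 0 * v i 0) + b i j * (u j 0 * v i 0 - v j 0 * u i 0)))).
    by apply: ler_sum => j _; exact: term.
  rewrite -mulr_sumr !mxE -sumrN -!big_split /= !mulr_suml -big_split /=.
  by rewrite le_eqVlt; apply/orP; left; apply/eqP; congr (_ * _); apply: eq_bigr => j _; ring.
have -> : \sum_i \sum_j ((j == i)%:R * (l * (w i * N i)) - L * s * (w i * N i + w j * N j)) =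
    (l - 2 * d%:R * L * s) * \sum_i w i * N i.
  transitivity (\sum_i (l * (w i * N i) - L * s * (d%:R * (w i * N i) + \sum_j w j * N j))).
    apply: eq_bigr => i _; rewrite sumrB; congr (_ - _).
      by rewrite (bigD1 i)//= eqxx mul1r big1 ?addr0// => j /negbTE ->; rewrite mul0r.
    by rewrite -mulr_sumr big_split /= sumr_const card_ord mulr_natl.
  rewrite sumrB -!mulr_sumr big_split /= sumr_const card_ord -mulr_sumr -mulr_natl; ring.
apply: ler_wpM2r.
  by rewrite sumr_ge0// => i _; apply: mulr_ge0; [rewrite ltW|exact: N0].
by rewrite ge_min; apply/orP; left; lra.
Qed.

Lemma mulmx_sqr_bound m n (B : 'M[R]_(m, n)) : exists2 K : R, 0 < K &
  forall x : 'cV[R]_n, \sum_i (B *m x) i 0 ^+ 2 <= K * \sum_j x j 0 ^+ 2.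
Proof.
pose L : R := \sum_i \sum_j `|B i j|.
have L0 : 0 <= L by rewrite !sumr_ge0// => i _; rewrite sumr_ge0.
exists (m%:R * L ^+ 2 + 1); first by rewrite ltr_wpDl// !mulr_ge0// sqr_ge0.
move=> x; set S : R := (X in _ <= _ * X).
have S0 : 0 <= S by rewrite sumr_ge0// => j _; rewrite sqr_ge0.
apply: (@le_trans _ _ (\sum_(i < m) (L ^+ 2 * S))); last first.
  rewrite sumr_const card_ord -mulr_natl; lra.
apply: ler_sum => i _.
have xS j : `|x j 0| <= Num.sqrt S.
  by rewrite -sqrtr_sqr ler_wsqrtr// /S (bigD1 j)//= lerDl sumr_ge0// => k _; exact: sqr_ge0.
have BL : `|(B *m x) i 0| <= L * Num.sqrt S.
  rewrite mxE; apply: (le_trans (ler_norm_sum _ _ _)).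
  apply: (@le_trans _ _ (\sum_j `|B i j| * Num.sqrt S)).
    by apply: ler_sum => j _; rewrite normrM ler_wpM2l.
  rewrite -mulr_suml ler_wpM2r ?sqrtr_ge0// /L (bigD1 i)//= lerDl sumr_ge0// => k _.
  by rewrite sumr_ge0.
rewrite -[leLHS]real_normK ?num_real// (le_trans (lerXn2r 2 _ _ BL)) ?nnegrE ?mulr_ge0 ?sqrtr_ge0//.
by rewrite exprMn sqr_sqrtr.
Qed.

Lemma orthonormal_coordE d (dot : {dot 'cV[R]_d for idfun}) (e : d.-tuple 'cV[R]_d) :
  orthonormal dot e -> exists C B : 'M[R]_d,
  [/\ B *m C = 1%:M, C *m B = 1%:M,
      forall i x, coord_in dot e i x = (C *m x) i 0 &
      forall x, dot x x = \sum_i (C *m x) i 0 ^+ 2].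
Proof.
move=> he.
have dotE i j : dot (tnth e i) (tnth e j) = (i == j)%:R.
  have /andP[/allP /= e1 e0] := he.
  have dC x y : dot x y = dot y x by rewrite hermC /= expr0 mul1r.
  have ortho (s : seq 'cV[R]_d) (m n : nat) : pair_ortho_rec dot s -> (m < n)%N -> (n < size s)%N ->
      dot (nth 0 s m) (nth 0 s n) = 0.
    elim: s m n => [|x s IH] [|m] [|n]//= /andP[q1 q2].
      move=> _ ns; move: q1; rewrite /= andbT => /allP/(_ _ (mem_nth 0 ns)) /eqP; exact.
    by move=> mn ns; apply: IH.
  have [ij|ji|/val_inj ->] := ltngtP i j; rewrite !(tnth_nth 0).
  - by rewrite ortho ?size_tuple// -val_eqE ltn_eqF.
  - by rewrite dC ortho ?size_tuple// -val_eqE gtn_eqF.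
  - by rewrite eqxx -tnth_nth; apply/eqP/e1/mem_tnth.
pose C : 'M[R]_d := \matrix_(i, k) coord_in dot e i (delta_mx k 0).
pose B : 'M[R]_d := \matrix_(k, i) (tnth e i) k 0.
have CE i x : coord_in dot e i x = (C *m x) i 0.
  rewrite mxE [x in LHS]matrix_sum_delta exchange_big big_ord1 /coord_in linear_sumlz /=.
  by apply: eq_bigr => k _; rewrite mxE linearZl_LR /= mulrC.
have CB : C *m B = 1%:M.
  apply/matrixP => i j; rewrite [RHS]mxE -dotE.
  have -> : dot (tnth e i) (tnth e j) = coord_in dot e i (tnth e j).
    by rewrite /coord_in dotE dotE eq_sym.
  rewrite CE !mxE; apply: eq_bigr => k _; congr (_ * _); rewrite mxE//.
have BC := mulmx1C CB.
exists C, B; split => // x.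
have {2}-> : x = \sum_i (C *m x) i 0 *: tnth e i.
  apply/matrixP => k j; rewrite ord1 -[LHS](congr1 (fun y : 'cV_d => y k 0) (mul1mx x)) -BC -mulmxA.
  by rewrite mxE summxE; apply: eq_bigr => i _; rewrite !mxE mulrC.
rewrite linear_sumr; apply: eq_bigr => i _.
by rewrite linearZr /= -CE expr2.
Qed.

(** The Lyapunov form is the weighted sum of the squared moduli of the coordinates of x in the Schur
    basis. The single constant returned is the minimum of those needed by the separate
    inequalities. *)
Lemma repulsive_form d (dot : {dot 'cV[R]_d for idfun}) (e : d.-tuple 'cV[R]_d) (H : 'M[R]_d) :
  orthonormal dot e -> repulsive H ->
  exists (Q : 'M[R]_d) (c : R), [/\ Q^T = Q, 0 < c <= 1,
    forall x, c * dot x x <= qform Q x x <= dot x x &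
    forall x, c * qform Q x x <= qform Q (H *m x) x].
Proof.
move=> he rH.
have [C [B [BC CB CE dotE]]] := orthonormal_coordE he.
have [a [b [U [V [UH VH tri pos UV]]]]] := repulsive_triangular rH.
have [w [c [c0 wb wq]]] := triangular_form tri pos.
have [K1 K10 hK1] := mulmx_sqr_bound C; have [K2 K20 hK2] := mulmx_sqr_bound B.
pose W : 'M[R]_d := diag_mx (\row_i w i).
(* The real part of the Hermitian form of weights [W] pulled back by U + iV. The factor [K2^-1]
   brings it below [dot]. *)
pose Q : 'M[R]_d := K2^-1 *: (U^T *m W *m U + V^T *m W *m V).
have QE x y : qform Q x y = K2^-1 * \sum_i w i * ((U *m x) i 0 * (U *m y) i 0 + (V *m x) i 0 * (V *m y) i 0).
  have dE (Z : 'M[R]_d) : (x^T *m (Z^T *m W *m Z) *m y) 0 0 = \sum_i w i * ((Z *m x) i 0 * (Z *m y) i 0).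
    rewrite !mulmxA -trmx_mul -!mulmxA (mulmxA _ W) mxE; apply: eq_bigr => i _.
    rewrite mul_mx_diag !mxE; ring.
  rewrite /qform /Q -scalemxAr -scalemxAl mxE mulmxDr mulmxDl [in LHS]mxE !dE; congr (_ * _).
  by rewrite -big_split /=; apply: eq_bigr => i _; rewrite mulrDr.
have WT : W^T = W by rewrite tr_diag_mx.
have xC (x : 'cV[R]_d) : \sum_i x i 0 ^+ 2 <= K2 * dot x x.
  by have := hK2 (C *m x); rewrite mulmxA BC mul1mx -dotE.
have Cx (x : 'cV[R]_d) : dot x x <= K1 * \sum_i x i 0 ^+ 2 by rewrite dotE.
have S0 (x : 'cV[R]_d) : 0 <= \sum_i x i 0 ^+ 2 by rewrite sumr_ge0// => i _; exact: sqr_ge0.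
have Qx x : qform Q x x = K2^-1 * \sum_i w i * ((U *m x) i 0 ^+ 2 + (V *m x) i 0 ^+ 2).
  by rewrite QE.
have Qpos x : 0 <= qform Q x x.
  rewrite Qx; apply: mulr_ge0; first by rewrite invr_ge0 ltW.
  rewrite sumr_ge0// => i _; rewrite mulr_ge0 ?addr_ge0 ?sqr_ge0//.
  by have /andP[+ _] := wb i; apply: le_trans; rewrite ltW.
exists Q, (Num.min 1 (Num.min c (c / K1 / K2))); split.
- by rewrite linearZ /= linearD /= !trmx_mul !trmxK WT !mulmxA.
- by rewrite !lt_min ltr01 c0 !divr_gt0//= ge_min lexx.
- move=> x; apply/andP; split.
    apply: (@le_trans _ _ (c / K1 / K2 * dot x x)).
      by rewrite ler_wpM2r ?ge_min ?lexx ?orbT// dotE.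
    rewrite Qx mulrAC mulrC ler_pM2l ?invr_gt0//.
    apply: (@le_trans _ _ (c * \sum_i x i 0 ^+ 2)).
      by rewrite -mulrA ler_pM2l// mulrC ler_pdivrMr// mulrC.
    rewrite -UV mulr_sumr; apply: ler_sum => i _.
    by rewrite ler_wpM2r ?addr_ge0 ?sqr_ge0//; have /andP[] := wb i.
  rewrite Qx mulrC ler_pdivrMr// mulrC (le_trans _ (xC x))// -UV; apply: ler_sum => i _.
  by rewrite ler_piMl ?addr_ge0 ?sqr_ge0//; have /andP[] := wb i.
- move=> x; apply: (@le_trans _ _ (c * qform Q x x)).
    by rewrite ler_wpM2r// !ge_min lexx orbT.
  rewrite Qx mulrCA QE ler_pM2l ?invr_gt0// (le_trans (wq (U *m x) (V *m x)))//.
  by rewrite !mulmxA UH VH !mulmxBl !mulmxDl.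
Qed.

(** A strict inequality survives a small perturbation, uniformly in x by homogeneity. Only the sign
    is kept, since [gamma] may be arbitrarily small or large and preserves nothing else. *)
Lemma qform_near d (Q H : 'M[R]_d) (c : R) (Ht : R -> 'M[R]_d) :
  0 < c -> (forall x : 'cV[R]_d, c * \sum_i x i 0 ^+ 2 <= qform Q (H *m x) x) ->
  (forall i j, Ht t i j @[t --> +oo] --> H i j) ->
  \forall t \near +oo, forall x : 'cV[R]_d, 0 <= qform Q (Ht t *m x) x.
Proof.
move=> c0 hc HtH.
pose L : R := 1 + \sum_i \sum_j `|Q i j|.
have L0 : 0 < L by rewrite ltr_pwDl// !sumr_ge0// => i _; rewrite sumr_ge0.
have QL i j : `|Q i j| <= L.
  apply: (@le_trans _ _ (\sum_i \sum_j `|Q i j|)); last by rewrite lerDr.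
  rewrite (bigD1 i)//= (bigD1 j)//= -addrA lerDl addr_ge0// ?sumr_ge0// => k _.
  by rewrite sumr_ge0.
pose D : R := d.+1%:R; have D0 : 0 < D by rewrite ltr0n.
have dD : d%:R <= D by rewrite ler_nat.
(* The perturbation of the form sums over three indices, each costing a factor [D], and [L] bounds
   the entries of [Q]. *)
pose ep := c / (D ^+ 3 * L); have ep0 : 0 < ep by rewrite divr_gt0// mulr_gt0// exprn_gt0.
have close i j : \forall t \near +oo, `|Ht t i j - H i j| <= ep.
  have HtHij := HtH i j.
  near=> t; rewrite distrC; near: t; exact: (proj1 (cvgrPdist_le _ _) HtHij _ ep0).
have : \forall t \near +oo, forall i j, `|Ht t i j - H i j| <= ep.
  by apply: filter_forall => i; apply: filter_forall => j; exact: close.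
apply: filterS => t ht x.
set S : R := \sum_i x i 0 ^+ 2 in hc *.
have S0 : 0 <= S by rewrite sumr_ge0// => i _; exact: sqr_ge0.
have xS j : `|x j 0| <= Num.sqrt S.
  by rewrite -sqrtr_sqr ler_wsqrtr// /S (bigD1 j)//= lerDl sumr_ge0// => k _; exact: sqr_ge0.
have sumB (f : 'I_d -> R) (b : R) : 0 <= b -> (forall j, `|f j| <= b) -> `|\sum_j f j| <= D * b.
  move=> b0 fb; apply: (le_trans (ler_norm_sum _ _ _)); apply: (@le_trans _ _ (\sum_(j < d) b)); first exact: ler_sum.
  by rewrite sumr_const card_ord -[leLHS]mulr_natl ler_wpM2r.
set y := (Ht t - H) *m x.
have q0 := sqrtr_ge0 S.
have ye k : `|y k 0| <= D * (ep * Num.sqrt S).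
  rewrite mxE; apply: (sumB _ _) => [|j]; first by rewrite mulr_ge0// ltW.
  by rewrite normrM !mxE ler_pM.
have qy : `|qform Q y x| <= D * (D * (D * (ep * Num.sqrt S) * L) * Num.sqrt S).
  have e1 : 0 <= D * (ep * Num.sqrt S) by apply: mulr_ge0; [exact: ltW|apply: mulr_ge0 => //; exact: ltW].
  have e2 : 0 <= D * (ep * Num.sqrt S) * L by rewrite mulr_ge0// ltW.
  have e3 : 0 <= D * (D * (ep * Num.sqrt S) * L) by rewrite mulr_ge0// ltW.
  rewrite /qform mxE; apply: (sumB _ _) => [|j]; first by rewrite mulr_ge0.
  rewrite normrM ler_pM// mxE; apply: (sumB _ _) => // k.
  by rewrite normrM mxE ler_pM.
have -> : Ht t *m x = y + H *m x by rewrite /y mulmxBl subrK.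
rewrite qformDl; have := hc x; rewrite -/S.
have := ler_norm (- qform Q y x); rewrite normrN.
have e : D * (D * (D * (ep * Num.sqrt S) * L) * Num.sqrt S) = c * S.
  rewrite -[in RHS](sqr_sqrtr S0) /ep; field.
  by rewrite !gt_eqF.
rewrite e in qy; lra.
Unshelve. all: by end_near. Qed.
End lyapunov.

(** * The Huber function and discrete paths *)

Section quadratic.
Context {R : realType} {d : nat}.
Variables (Q : 'M[R]_d) (c : R).
Hypotheses (sQ : Q^T = Q) (c0 : 0 < c)
  (hQ : forall x : 'cV[R]_d, c * \sum_i x i 0 ^+ 2 <= qform Q x x <= \sum_i x i 0 ^+ 2).
Implicit Types x y z : 'cV[R]_d.
Local Notation q := (qform Q).
Local Notation nq x := (qform Q x x).

Lemma nq_ge0 x : 0 <= nq x.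
Proof.
have /andP[+ _] := hQ x; apply: le_trans; apply: mulr_ge0; first exact: ltW.
by rewrite sumr_ge0// => i _; exact: sqr_ge0.
Qed.

Lemma nqD x y : nq (x + y) = nq x + 2 * q x y + nq y.
Proof. rewrite qformDl !qformDr (qform_sym y x sQ); ring. Qed.

Lemma nqZ k x : nq (k *: x) = k ^+ 2 * nq x.
Proof. by rewrite qformZl qformZr mulrA. Qed.

Lemma qformN x y : q (- x) y = - q x y.
Proof. by rewrite -scaleN1r qformZl mulN1r. Qed.

Lemma qform0r x : q x 0 = 0.
Proof. by rewrite -(scale0r 0) qformZr mul0r. Qed.

Lemma qform_young x y : 2 * q x y <= nq x + nq y.
Proof.
have := nq_ge0 (x + -1 *: y); rewrite nqD qformZr nqZ; lra.
Qed.

Lemma nq_half x y : 2^-1 * nq x - nq y <= nq (x + y).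
Proof. by have := nq_ge0 (x + 2 *: y); rewrite !nqD qformZr nqZ; lra. Qed.

Lemma qform_cs x y : q x y <= Num.sqrt (nq x) * Num.sqrt (nq y).
Proof.
have [x0|x0] := eqVneq (nq x) 0.
  rewrite x0 sqrtr0 mul0r leNgt; apply/negP => xy0.
  have := qform_young ((((nq y) + 1) / q x y) *: x) y.
  by rewrite qformZl nqZ x0 mulr0 add0r divfK ?gt_eqF//; have := nq_ge0 y; lra.
have [y0|y0] := eqVneq (nq y) 0.
  rewrite y0 sqrtr0 mulr0 leNgt; apply/negP => xy0.
  have := qform_young x (((nq x + 1) / q x y) *: y).
  by rewrite qformZr nqZ y0 mulr0 addr0 divfK ?gt_eqF//; have := nq_ge0 x; lra.
set a := Num.sqrt (nq x); set b := Num.sqrt (nq y).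
have ap : 0 < a by rewrite sqrtr_gt0 lt_def x0 nq_ge0.
have bp : 0 < b by rewrite sqrtr_gt0 lt_def y0 nq_ge0.
have xE : nq x = a ^+ 2 by rewrite sqr_sqrtr// nq_ge0.
have yE : nq y = b ^+ 2 by rewrite sqr_sqrtr// nq_ge0.
have := qform_young (b *: x) (a *: y); rewrite qformZl qformZr !nqZ xE yE => h.
have ab : 0 < a * b by rewrite mulr_gt0.
rewrite -(ler_pM2l ab); nra.
Qed.

Lemma norm_qform x y : `|q x y| <= Num.sqrt (nq x) * Num.sqrt (nq y).
Proof.
rewrite ler_norml lerNl -qformN qform_cs andbT.
have -> : nq x = nq (- x) by rewrite -scaleN1r nqZ sqrrN expr1n mul1r.
exact: qform_cs.
Qed.

Lemma sqr_sum_norm x : \sum_i x i 0 ^+ 2 <= (\sum_i `|x i 0|) ^+ 2.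
Proof.
rewrite expr2 mulr_suml; apply: ler_sum => i _.
rewrite -real_normK ?num_real// expr2 ler_wpM2l// (bigD1 i)//= lerDl sumr_ge0//.
Qed.

Lemma sqrt_nq_le x : Num.sqrt (nq x) <= \sum_i `|x i 0|.
Proof.
have s0 : 0 <= \sum_i `|x i 0| by rewrite sumr_ge0.
rewrite -(ger0_norm s0) -sqrtr_sqr ler_wsqrtr//.
by have /andP[_ h] := hQ x; rewrite (le_trans h)// sqr_sum_norm.
Qed.

Lemma qformE x y : q x y = \sum_i (Q *m x) i 0 * y i 0.
Proof.
rewrite /qform mxE; apply: eq_bigr => i _; congr (_ * _).
by rewrite -[in RHS]sQ -[x in RHS]trmxK -trmx_mul [RHS]mxE.
Qed.

(* The gradient of [huber r] is twice this radial projection. *)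
Definition chi (r : R) x : 'cV[R]_d := (r / Num.max r (Num.sqrt (nq x))) *: x.

Definition huber (r : R) x : R :=
  if nq x <= r ^+ 2 then nq x else 2 * r * Num.sqrt (nq x) - r ^+ 2.

Variable r : R.
Hypothesis r0 : 0 < r.

Let max0 x : 0 < Num.max r (Num.sqrt (nq x)). Proof. by rewrite lt_max r0. Qed.

Lemma sqrt_nq_ler x : (Num.sqrt (nq x) <= r) = (nq x <= r ^+ 2).
Proof. rewrite -[in RHS](sqr_sqrtr (nq_ge0 x)) ler_sqr// nnegrE ?sqrtr_ge0//; exact: ltW. Qed.

Lemma sqrt_nq_gt x : r ^+ 2 < nq x -> r <= Num.sqrt (nq x).
Proof.
by move=> xr; rewrite leNgt; apply/negP => /ltW; rewrite sqrt_nq_ler leNgt xr.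
Qed.

Lemma chi_id x : nq x <= r ^+ 2 -> chi r x = x.
Proof.
by rewrite -sqrt_nq_ler => xr; rewrite /chi max_l// divff ?gt_eqF// scale1r.
Qed.

Lemma chi_scale x : exists2 l : R, 0 <= l & chi r x = l *: x.
Proof. by exists (r / Num.max r (Num.sqrt (nq x))); rewrite ?divr_ge0// ltW. Qed.

Lemma nq_chi x : nq (chi r x) <= r ^+ 2.
Proof.
rewrite /chi nqZ exprMn -mulrA ler_piMr ?sqr_ge0// exprVn mulrC ler_pdivrMr ?exprn_gt0// mul1r.
rewrite -[leLHS](sqr_sqrtr (nq_ge0 x)) ler_sqr ?nnegrE ?sqrtr_ge0 ?(ltW (max0 _))//.
by rewrite le_max lexx orbT.
Qed.

Lemma qform_chi_le x y : `|q (chi r x) y| <= r * \sum_i `|y i 0|.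
Proof.
apply: (le_trans (norm_qform _ _)); apply: ler_pM; rewrite ?sqrtr_ge0 ?sqrt_nq_le//.
by rewrite sqrt_nq_ler nq_chi.
Qed.

Lemma mulmx_chi_le x i : `|(Q *m chi r x) i 0| <= r.
Proof.
have := qform_chi_le x (delta_mx i 0).
have sumd (f : 'I_d -> R) : \sum_j f j * (delta_mx i 0 : 'cV[R]_d) j 0 = f i.
  by rewrite (bigD1 i)//= mxE !eqxx mulr1 big1 ?addr0// => j /negbTE ji; rewrite mxE ji mulr0.
rewrite qformE sumd (eq_bigr (fun j => 1 * (delta_mx i 0 : 'cV[R]_d) j 0)) ?sumd ?mulr1//.
by move=> j _; rewrite mul1r mxE ger0_norm.
Qed.

(** [huber r y] is the maximum over the ball of the affine functions [2 * q z y - nq z] of y,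
    attained at [z = chi r y]. Convexity and the gradient are read off from this representation. *)
Lemma huber_ge z y : nq z <= r ^+ 2 -> 2 * q z y - nq z <= huber r y.
Proof.
move=> zr; rewrite /huber; have [_|yr] := leP (nq y); first by have := qform_young z y; lra.
have := qform_cs z y; have := zr; rewrite -sqrt_nq_ler => zr'.
have ry := sqrt_nq_gt yr.
have := sqr_sqrtr (nq_ge0 z); have := sqrtr_ge0 (nq z).
set a := Num.sqrt (nq z) in zr' *; set b := Num.sqrt (nq y) in ry *.
move=> a0 <- qab; nra.
Qed.

Lemma huber_convex x y : huber r x + 2 * q (chi r x) (y - x) <= huber r y.
Proof.
have := huber_ge y (nq_chi x).
have -> : q (chi r x) (y - x) = q (chi r x) y - q (chi r x) x.
  by rewrite qformDr -scaleN1r qformZr mulN1r.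
move=> h1.
suff : huber r x = 2 * q (chi r x) x - nq (chi r x) by lra.
rewrite /huber; have [xr|xr] := leP (nq x); first by rewrite chi_id//; ring.
have ry := sqrt_nq_gt xr.
rewrite /chi max_r// nqZ qformZl.
have b0 := lt_le_trans r0 ry.
rewrite -[in X in _ = _ * (_ * X) - _](sqr_sqrtr (nq_ge0 x)).
rewrite -[in X in _ = _ - _ * X](sqr_sqrtr (nq_ge0 x)).
by field; rewrite gt_eqF.
Qed.

Lemma huber_le x : huber r x <= nq x.
Proof.
rewrite /huber; have [//|_] := leP (nq x); have := sqr_sqrtr (nq_ge0 x).
set b := Num.sqrt _ => e; rewrite -[leRHS]e; have := sqr_ge0 (b - r); lra.
Qed.

Lemma huber_ge_sqr x : r ^+ 2 < nq x -> r ^+ 2 <= huber r x.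
Proof.
move=> xr; rewrite /huber (lt_geF xr).
have := sqrt_nq_gt xr; have := r0; nra.
Qed.

(** An explicit function of the entries of x, from which continuity and measurability follow entry
    by entry. *)
Lemma mulmx_chiE x i : (Q *m chi r x) i 0 =
  r / Num.max r (Num.sqrt (\sum_j (\sum_k Q j k * x k 0) * x j 0)) * \sum_j Q i j * x j 0.
Proof.
rewrite /chi -scalemxAr mxE; congr (_ / Num.max _ (Num.sqrt _) * _).
  by rewrite qformE; apply: eq_bigr => j _; rewrite mxE.
by rewrite mxE.
Qed.

Lemma cvg_mulmx_chi (T : Type) (F : set_system T) (FF : Filter F) (f : T -> 'cV[R]_d) x i :
  (forall j, (f s j 0) @[s --> F] --> x j 0) ->
  (Q *m chi r (f s)) i 0 @[s --> F] --> (Q *m chi r x) i 0.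
Proof.
move=> fx; rewrite mulmx_chiE; under eq_fun do rewrite mulmx_chiE.
have csum (g : 'I_d -> T -> R) (l : 'I_d -> R) : (forall j, g j s @[s --> F] --> l j) ->
    \sum_j g j s @[s --> F] --> \sum_j l j.
  by move=> gl; apply: cvg_big => //; exact: add_continuous.
have lin j : \sum_k Q j k * f s k 0 @[s --> F] --> \sum_k Q j k * x k 0.
  by apply: csum => k; apply: cvgM; [exact: cvg_cst|exact: fx].
apply: cvgM; last exact: lin.
apply: cvgM; [exact: cvg_cst|apply: cvgV].
  by rewrite gt_eqF// lt_max r0.
apply: cvg_maxr; first exact: cvg_cst.
have qc : \sum_j (\sum_k Q j k * f s k 0) * f s j 0 @[s --> F] --> \sum_j (\sum_k Q j k * x k 0) * x j 0.
  by apply: csum => j; apply: cvgM; [exact: lin|exact: fx].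
exact: (cvg_comp _ _ qc (@sqrt_continuous R _)).
Qed.

Lemma measurable_mulmx_chi (dT : measure_display) (T : measurableType dT) (f : T -> 'cV[R]_d) i :
  (forall j, measurable_fun setT (fun w => f w j 0)) ->
  measurable_fun setT (fun w => (Q *m chi r (f w)) i 0).
Proof.
move=> mf; under eq_fun do rewrite mulmx_chiE.
have lin j : measurable_fun setT (fun w => \sum_k Q j k * f w k 0).
  apply: measurable_sum => k; apply: measurable_funM => //; exact: mf.
apply: measurable_funM => //.
have phi_cont : continuous (fun s : R => r / Num.max r s).
  move=> s; apply: cvgM; [exact: cvg_cst|apply: cvgV; last first].
    by apply: cvg_maxr; [exact: cvg_cst|exact: cvg_id].
  by rewrite gt_eqF// lt_max r0.
apply: (@measurable_comp _ _ _ _ _ _ setT (fun s : R => r / Num.max r s)) => //.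
  exact: continuous_measurable_fun.
apply: (@measurable_comp _ _ _ _ _ _ setT (@Num.sqrt R)) => //.
  exact: continuous_measurable_fun (@sqrt_continuous R).
by apply: measurable_sum => j; apply: measurable_funM => //; exact: mf.
Qed.

(** The increment over [a, b] stopped at [s]; a sum over the cells of a fixed grid thereby becomes a
    process in [s]. *)
Definition incr (f : R -> 'cV[R]_d) (a b s : R) := f (Num.min b s) - f (Num.min a s).

Lemma incr_eq0 f a b s : a <= b -> s <= a -> incr f a b s = 0.
Proof. by move=> ab sa; rewrite /incr !min_r ?subrr// (le_trans sa). Qed.

(* The discrete analogue of the process |X|^2 minus its drift: a martingale
   transform plus half the quadratic variation of M. *)
Definition gain (x m : R -> 'cV[R]_d) (g : nat -> R) n s : R :=
  \sum_(k < n) (2 * q (chi r (x (g k))) (incr m (g k) (g k.+1) s) +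
    2^-1 * nq (incr m (g k) (g k.+1) s)).

Section path.
Variables (x m v dd : R -> 'cV[R]_d) (x0 : 'cV[R]_d) (g : nat -> R) (n : nat) (t u b psi : R).
Hypotheses (gm : {homo g : i j / (i <= j)%N >-> i <= j}) (g0 : g 0%N = t) (gn : g n = u).
Hypothesis (xE : forall s, t <= s -> x s = x0 + m s + v s + dd s).
Hypotheses (b0 : 0 <= b) (psi0 : 0 <= psi).

(** The last two clauses are the traces on the grid of two features of the drift: it points outwards
    up to [psi], and, being absolutely continuous, it has negligible quadratic variation. *)
Definition tame s := [/\ forall s', t <= s' -> s' <= s -> nq (x s') <= r ^+ 2,
  \sum_(k < n) \sum_i `|incr v (g k) (g k.+1) s i 0| <= b,
  - psi <= \sum_(k < n) q (chi r (x (g k))) (incr dd (g k) (g k.+1) s) &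
  \sum_(k < n) \sum_i (incr dd (g k) (g k.+1) s i 0) ^+ 2 <= psi].

(** [2 * psi] for the first-order drift terms, [2 * psi] for their squares, and
    [(2 * r + 2 * b) * b] for the finite variation part. *)
Definition slack := 4 * psi + 2 * r * b + 2 * b ^+ 2.

Let gS k : g k <= g k.+1. Proof. exact: gm. Qed.
Let gt k : t <= g k. Proof. by rewrite -g0 gm. Qed.

Let nq_dd s k : tame s -> (k < n)%N -> nq (incr dd (g k) (g k.+1) s) <= psi.
Proof.
move=> [_ _ _ h] kn; have /andP[_ h1] := hQ (incr dd (g k) (g k.+1) s).
rewrite (le_trans h1)// (le_trans _ h)// (bigD1 (Ordinal kn))//= lerDl.
by rewrite sumr_ge0// => j _; rewrite sumr_ge0// => i _; exact: sqr_ge0.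
Qed.

Let nq_v s k : tame s -> (k < n)%N ->
  nq (incr v (g k) (g k.+1) s) <= b * \sum_i `|incr v (g k) (g k.+1) s i 0|.
Proof.
move=> [_ h _ _] kn; have /andP[_ h1] := hQ (incr v (g k) (g k.+1) s).
rewrite (le_trans h1)// (le_trans (sqr_sum_norm _))// expr2 ler_wpM2r ?sumr_ge0//.
rewrite (le_trans _ h)// (bigD1 (Ordinal kn))//= lerDl.
by rewrite sumr_ge0// => j _; rewrite sumr_ge0.
Qed.

(** Inside the ball [chi] is the identity, so the square expands exactly over each cell and
    telescopes. The increment of [m] mixes with those of [v] and [dd] in the quadratic term, and
    separating it by [nq_half] is what costs the factor 1/2 in [gain]. *)
Lemma gain_tame s : t <= s -> s <= u -> tame s -> gain x m g n s <= nq (x s) + slack.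
Proof.
move=> ts su H; have [xr hv hpsi hdd] := H.
pose y k := x (Num.min (g k) s).
have step k : (k < n)%N -> 2 * q (chi r (x (g k))) (incr m (g k) (g k.+1) s) +
    2^-1 * nq (incr m (g k) (g k.+1) s) <=
    nq (y k.+1) - nq (y k) - 2 * q (chi r (x (g k))) (incr dd (g k) (g k.+1) s)
    + (2 * r + 2 * b) * \sum_i `|incr v (g k) (g k.+1) s i 0|
    + 2 * \sum_i (incr dd (g k) (g k.+1) s i 0) ^+ 2.
  move=> kn; have [gs|sg] := leP (g k) s; last first.
    have z f : incr f (g k) (g k.+1) s = 0 by apply: incr_eq0 => //; exact: ltW.
    rewrite !z !qform0r /y !min_r ?(ltW sg)// ?(le_trans (ltW sg))//.
    have e0 : \sum_i `|(0 : 'cV[R]_d) i 0| = 0 by rewrite big1// => i _; rewrite mxE normr0.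
    have e1 : \sum_i (0 : 'cV[R]_d) i 0 ^+ 2 = 0 by rewrite big1// => i _; rewrite mxE expr0n.
    by rewrite e0 e1; lra.
  have -> : chi r (x (g k)) = x (g k) by rewrite chi_id// xr.
  have yk : y k = x (g k) by rewrite /y min_l.
  set dm := incr m _ _ s; set de := incr dd _ _ s; set dv := incr v _ _ s.
  have yS : y k.+1 = x (g k) + (dm + (dv + de)).
    rewrite -yk /y /dm /dv /de /incr !xE ?le_min ?gt ?ts//.
    by apply/matrixP => i j; rewrite !mxE; ring.
  have n1 := nq_dd H kn; have n2 := nq_v H kn.
  have /andP[_ n3] := hQ de.
  have n4 := qform_chi_le (x (g k)) dv; rewrite chi_id ?xr// in n4.
  have n5 := ler_norm (- q (x (g k)) dv); rewrite normrN in n5.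
  rewrite -/dv in n2.
  have n6 : nq (dv + de) <= 2 * nq dv + 2 * nq de.
    by rewrite nqD; have := qform_young dv de; lra.
  have n7 : 2^-1 * nq dm - nq (dv + de) <= nq (dm + (dv + de)).
    exact: nq_half.
  have n8 : q (x (g k)) (dm + (dv + de)) = q (x (g k)) dm + (q (x (g k)) dv + q (x (g k)) de).
    by rewrite !qformDr.
  rewrite yS yk [nq (x (g k) + _)]nqD n8; lra.
apply: (@le_trans _ _ (\sum_(k < n) (nq (y k.+1) - nq (y k)) - 2 * \sum_(k < n) q (chi r (x (g k))) (incr dd (g k) (g k.+1) s)
    + (2 * r + 2 * b) * \sum_(k < n) \sum_i `|incr v (g k) (g k.+1) s i 0|
    + 2 * \sum_(k < n) \sum_i (incr dd (g k) (g k.+1) s i 0) ^+ 2)).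
  rewrite !mulr_sumr -sumrB -!big_split /=; apply: ler_sum => k _; exact: step.
rewrite -(big_mkord xpredT (fun k => nq (y k.+1) - nq (y k))) telescope_sumr//.
rewrite /y gn g0 min_r// min_l//.
have : (2 * r + 2 * b) * \sum_(k < n) \sum_i `|incr v (g k) (g k.+1) s i 0| <= (2 * r + 2 * b) * b.
  by rewrite ler_wpM2l// addr_ge0// mulr_ge0// ltW.
have := nq_ge0 (x t); rewrite /slack; lra.
Qed.

(** Tameness is known strictly before [T], so [T] is compared with earlier times [s] of the same
    cell, where one term of [gain] changes, and then s --> T. With j the increment of m between s
    and T, and I that of the cell up to s, Young's inequality bounds the change by
    [r ^+ 2 + 2^-1 * nq I + 2 * nq j], and [nq I <= 8 * r ^+ 2 + 4 * b ^+ 2 + 4 * psi]. One more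
    [r ^+ 2] comes from [nq (x s)]. *)
Lemma gain_exit T : t < T -> T <= u -> (forall s, t <= s -> s < T -> tame s) ->
  forall l : 'cV[R]_d, (forall i, m s i 0 @[s --> T^'-] --> l i 0) ->
  gain x m g n T <= 6 * r ^+ 2 + 2 * b ^+ 2 + 2 * psi + slack + 2 * \sum_i (m T i 0 - l i 0) ^+ 2.
Proof.
move=> tT Tu H l ml.
have [k kn /andP[gk Tk]] : exists2 k, (k < n)%N & g k < T <= g k.+1.
  have ex : exists j, T <= g j by exists n; rewrite gn.
  case: (ex_minnP ex) => -[|k] Tk mk; first by rewrite g0 leNgt tT in Tk.
  exists k; first by rewrite -ltnS; apply: mk; rewrite gn.
  by rewrite Tk andbT ltNge; apply/negP => /mk; rewrite ltnn.
have bound s : g k <= s -> s < T ->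
    gain x m g n T <= 6 * r ^+ 2 + 2 * b ^+ 2 + 2 * psi + slack + 2 * \sum_i (m T i 0 - m s i 0) ^+ 2.
  move=> gs sT; have ts : t <= s by exact: le_trans (gt k) gs.
  have Hs := H s ts sT; have [xr hv hpsi hdd] := Hs.
  have su : s <= u by rewrite (le_trans (ltW sT)).
  pose j := m T - m s; pose I := incr m (g k) (g k.+1) s.
  have IT : incr m (g k) (g k.+1) T = I + j.
    rewrite /I /j /incr (min_r Tk) (min_l (ltW gk)) (min_l gs) (min_r (le_trans (ltW sT) Tk)).
    by rewrite [RHS]addrC subrKA.
  have diff : gain x m g n T = gain x m g n s + 2 * q (x (g k)) j + q I j + 2^-1 * nq j.
    rewrite /gain (bigD1 (Ordinal kn))//= [in RHS](bigD1 (Ordinal kn))//=.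
    rewrite IT -/I chi_id ?xr// nqD qformDr.
    rewrite (eq_bigr (fun i : 'I_n => 2 * q (chi r (x (g i))) (incr m (g i) (g i.+1) s) +
      2^-1 * nq (incr m (g i) (g i.+1) s))); first by lra.
    move=> i ik; suff -> : incr m (g i) (g i.+1) T = incr m (g i) (g i.+1) s by [].
    have [lik|lki|eik] := ltngtP (i : nat) k.
    - have gi : g i.+1 <= s by rewrite (le_trans _ gs)// gm.
      rewrite /incr !min_l// ?(le_trans (gS i))// (le_trans gi)// ltW//.
    - have gi : T <= g i by rewrite (le_trans Tk)// gm.
      by rewrite !incr_eq0// (le_trans (ltW sT)).
    - by move: ik; rewrite -val_eqE /= eik eqxx.
  have g1 := gain_tame ts su Hs.
  have xs := xr s ts (lexx s); have xk := xr (g k) (gt k) gs.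
  have IE : I = (x s - x (g k)) - (incr v (g k) (g k.+1) s + incr dd (g k) (g k.+1) s).
    rewrite /I /incr (min_l gs) (min_r (le_trans (ltW sT) Tk)) !xE//.
    by apply/matrixP => i' j'; rewrite !mxE; ring.
  have nqB y z : nq (y - z) <= 2 * nq y + 2 * nq z.
    rewrite -scaleN1r nqD qformZr nqZ; have := nq_ge0 (y + z); rewrite nqD; lra.
  have nI : nq I <= 8 * r ^+ 2 + 4 * b ^+ 2 + 4 * psi.
    have h1 := nqB (x s - x (g k)) (incr v (g k) (g k.+1) s + incr dd (g k) (g k.+1) s).
    have h2 := nqB (x s) (x (g k)).
    have h3 := nq_dd Hs kn; have h4 := nq_v Hs kn.
    have h5 : b * \sum_i `|incr v (g k) (g k.+1) s i 0| <= b * b.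
      rewrite ler_wpM2l// (le_trans _ hv)// (bigD1 (Ordinal kn))//= lerDl.
      by rewrite sumr_ge0// => i _; rewrite sumr_ge0.
    have h6 := nqD (incr v (g k) (g k.+1) s) (incr dd (g k) (g k.+1) s).
    have h7 := qform_young (incr v (g k) (g k.+1) s) (incr dd (g k) (g k.+1) s).
    rewrite -IE in h1; lra.
  have h1 := qform_young (x (g k)) j; have h2 := qform_young I j.
  have /andP[_ h3] := hQ j.
  have h4 : \sum_i j i 0 ^+ 2 = \sum_i (m T i 0 - m s i 0) ^+ 2.
    by apply: eq_bigr => i _; rewrite !mxE.
  rewrite diff -h4; lra.
have cv : 6 * r ^+ 2 + 2 * b ^+ 2 + 2 * psi + slack + 2 * \sum_i (m T i 0 - m s i 0) ^+ 2 @[s --> T^'-] -->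
    6 * r ^+ 2 + 2 * b ^+ 2 + 2 * psi + slack + 2 * \sum_i (m T i 0 - l i 0) ^+ 2.
  apply: cvgD; first exact: cvg_cst.
  apply: cvgM; first exact: cvg_cst.
  apply: cvg_big => //; first exact: add_continuous.
  move=> i _; rewrite expr2; under eq_fun do rewrite expr2.
  by apply: cvgM; (apply: cvgB; [exact: cvg_cst|exact: ml]).
rewrite leNgt; apply/negP => lt_gain.
have : \forall s \near T^'-, 6 * r ^+ 2 + 2 * b ^+ 2 + 2 * psi + slack + 2 * \sum_i (m T i 0 - m s i 0) ^+ 2 < gain x m g n T.
  exact: (cvgr_lt _ cv).
move=> near_lt.
have /filter_ex[s [[s1 s2] s3]] : \forall s \near T^'-, (g k <= s /\ s < T) /\
  6 * r ^+ 2 + 2 * b ^+ 2 + 2 * psi + slack + 2 * \sum_i (m T i 0 - m s i 0) ^+ 2 < gain x m g n T.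
  apply: filterI => //; apply: filterI; [exact: nbhs_left_ge|exact: nbhs_left_lt].
by have := bound s s1 s2; rewrite leNgt s3.
Qed.

End path.

End quadratic.

(** * Leaving the ball *)

Section exit.
Context {R : realType} {dO : measure_display} {Omega : measurableType dO}.
Variables (P : probability Omega R) (Ft : R -> set (set Omega)).
Hypothesis hFt : usual_filtration P Ft.

Lemma cadlag_max (f g : R -> R) : cadlag `[0, +oo[ f -> cadlag `[0, +oo[ g ->
  cadlag `[0, +oo[ (fun t => Num.max (f t) (g t)).
Proof.
move=> /cadlagP[f1 f2] /cadlagP[g1 g2]; apply/cadlagP; split=> t t0.
  by apply: cvg_maxr; [exact: f1|exact: g1].
by apply: (cvgP (Num.max _ _)); apply: cvg_maxr; [exact: f2|exact: g2].
Qed.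

Lemma cadlag_sum (I : Type) (s : seq I) (f : I -> R -> R) :
  (forall i, cadlag `[0, +oo[ (f i)) -> cadlag `[0, +oo[ (fun t => \sum_(i <- s) f i t).
Proof.
move=> cf; elim: s => [|i s IH].
  rewrite (_ : (fun t => _) = fun=> 0); first exact: cadlag_cst.
  by apply/funext => t; rewrite big_nil.
rewrite (_ : (fun t => _) = fun t => f i t + \sum_(j <- s) f j t); first exact: (cadlagD (cf i) IH).
by apply/funext => t; rewrite big_cons.
Qed.

Lemma cadlag_norm (f : R -> R) : cadlag `[0, +oo[ f -> cadlag `[0, +oo[ (fun t => `|f t|).
Proof.
move=> cf; rewrite (_ : (fun t => _) = fun t => Num.max (f t) (- f t)).
  by apply: cadlag_max cf (cadlagN cf).
by apply/funext => t; have [h|h] := ger0P (f t); [rewrite max_l|rewrite max_r]; lra.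
Qed.

Lemma cadlag_min_time (f : R -> R) (a : R) : 0 <= a -> cadlag `[0, +oo[ f ->
  cadlag `[0, +oo[ (fun t => f (Num.min a t)).
Proof.
move=> a0 cf; rewrite (_ : (fun t => _) = fun t => f (fine (Order.min t%:E a%:E))).
  by apply: cadlag_stopped => //; rewrite lee_fin.
by apply/funext => t; rewrite -EFin_min minC.
Qed.

(* Strict positivity of a right-continuous path is seen at rational times. *)
Lemma debut_pos (Z : R -> Omega -> R) (t : R) : 0 <= t -> cadlag_process Z -> adapted Ft Z ->
  let T := debut t (fun s => [set w | 0 < Z s w]) in
  [/\ stopping_time Ft T, forall w s, t < s -> (s%:E < T w)%E -> Z s w <= 0,
      forall w, Z t w < 0 -> (t%:E < T w)%E &
      forall w (x : R), (T w < x%:E)%E -> exists q : rat, [/\ t < ratr q, ratr q < x & 0 < Z (ratr q) w]].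
Proof.
move=> t0 cZ aZ T.
have dense w (s x : R) : t < s -> s < x -> 0 < Z s w ->
    exists q : rat, [/\ t < ratr q, ratr q < x & 0 < Z (ratr q) w].
  move=> ts sx Zs; have s0 : 0 <= s by rewrite (le_trans t0)// ltW.
  have [rc _] := proj1 (cadlagP _) (cZ w).
  have : \forall s' \near s^'+, 0 < Z s' w by apply: (cvgr_gt _ (rc s s0)).
  move=> /nbhs_ballP[e /= e0 he].
  have sm : s < Num.min (s + e) x by rewrite lt_min sx ltrDl e0.
  have [q] := rat_in_itvoo sm.
  rewrite in_itv /= lt_min => /and3P[sq qe qx]; exists q; split=> //; first exact: lt_trans sq.
  by apply: he => //; rewrite /ball/= ltr_norml; apply/andP; split; lra.
split.
- apply: (debut_stopping hFt) => // s ts; have s0 : 0 <= s by rewrite (le_trans t0)// ltW.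
  apply/(FtP hFt) => //.
  have /(measurable_wrtP (Ft_sigma hFt s0)) mZ := aZ s s0.
  rewrite -[X in measurable X]setTI (_ : [set w | _] = Z s @^-1` `]0, +oo[).
    exact: mZ.
  by apply/seteqP; split=> w /=; rewrite in_itv /= andbT.
- by move=> w s ts sT; rewrite leNgt; apply/negP; exact: (debut_gtN ts sT).
- move=> w Zt; have [rc _] := proj1 (cadlagP _) (cZ w).
  have : \forall s' \near t^'+, Z s' w < 0 by apply: (cvgr_lt _ (rc t t0)).
  move=> /nbhs_ballP[e /= e0 he].
  apply: (@lt_le_trans _ _ (t + e / 2)%:E); first by rewrite lte_fin ltrDl divr_gt0.
  apply: le_ereal_inf_tmp => _ [s [ts Zs] <-]; rewrite lee_fin leNgt; apply/negP => se.
  have : Z s w < 0 by apply: he => //; rewrite /ball/= ltr_norml; apply/andP; split; lra.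
  by rewrite ltNge ltW.
- by move=> w x /debut_ltP[s [ts sx Zs]]; exact: dense Zs.
Qed.

(** Induction on the coordinates. The minimum of two localizing sequences still localizes both,
    since each side can absorb the other one into its free stopping time [rho]. *)
Lemma qv_localization_vec d (M A : 'I_d -> R -> Omega -> R) :
  (forall i, locally_square_integrable_martingale P Ft (M i)) ->
  (forall i, is_predictable_qv P Ft (M i) (A i)) ->
  exists L : nat -> Omega -> \bar R,
  [/\ forall n, stopping_time Ft (L n),
      forall u : R, Pr P [set w | (L n w < u%:E)%E] @[n --> \oo] --> (0 : R) &
      forall n rho i, stopping_time Ft rho ->
      let sig w := Order.min (L n w) (rho w) in
      forall s t : R, 0 <= s -> s <= t ->
      let D w := stopped (M i) sig t w - stopped (M i) sig s w in
      [/\ measurable_fun setT D, intg P (fun w => D w ^+ 2),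
          (forall xi : Omega -> R, measurable_wrt (Ft s) xi -> intg P (fun w => xi w ^+ 2) ->
            Ex P (fun w => xi w * D w) = 0),
          intg P (fun w => stopped (A i) sig t w - stopped (A i) sig s w) &
          forall G, Ft s G -> Ex P (fun w => \1_G w * D w ^+ 2) =
            Ex P (fun w => \1_G w * (stopped (A i) sig t w - stopped (A i) sig s w))]].
Proof.
move=> hM hA.
suff : forall l : seq 'I_d, exists L : nat -> Omega -> \bar R,
  [/\ forall n, stopping_time Ft (L n),
      forall u : R, Pr P [set w | (L n w < u%:E)%E] @[n --> \oo] --> (0 : R) &
      forall n rho i, i \in l -> stopping_time Ft rho ->
      let sig w := Order.min (L n w) (rho w) in
      forall s t : R, 0 <= s -> s <= t ->
      let D w := stopped (M i) sig t w - stopped (M i) sig s w in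
      [/\ measurable_fun setT D, intg P (fun w => D w ^+ 2),
          (forall xi : Omega -> R, measurable_wrt (Ft s) xi -> intg P (fun w => xi w ^+ 2) ->
            Ex P (fun w => xi w * D w) = 0),
          intg P (fun w => stopped (A i) sig t w - stopped (A i) sig s w) &
          forall G, Ft s G -> Ex P (fun w => \1_G w * D w ^+ 2) =
            Ex P (fun w => \1_G w * (stopped (A i) sig t w - stopped (A i) sig s w))]].
  move=> /(_ (enum 'I_d))[L [L1 L2 L3]]; exists L; split=> // n rho i hr.
  by apply: L3 => //; rewrite mem_enum.
elim=> [|i l [L [L1 L2 L3]]].
  exists (fun _ _ => +oo%E); split=> //.
    by move=> n; apply: (stopping_cst hFt); rewrite leey.
  move=> u; rewrite (_ : [set w | _] = set0); last by apply/seteqP; split.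
  by rewrite /Pr measure0; exact: cvg_cst.
have [K [K1 K2 K3]] := qv_localization hFt (hM i) (hA i).
exists (fun n w => Order.min (L n w) (K n w)); split.
- by move=> n; exact: (stopping_min hFt).
- move=> u; have [u0|u0] := ltP u 0.
    rewrite (_ : (fun n => _) = fun=> 0); first exact: cvg_cst.
    apply/funext => n; rewrite (_ : [set w | _] = set0) ?/Pr ?measure0//.
    apply/seteqP; split=> // w /=; rewrite ltNge => /negP; apply.
    have u0' : (u%:E <= 0)%E by rewrite lee_fin ltW.
    rewrite le_min; apply/andP; split; apply: (le_trans u0').
      by have [h _] := L1 n; exact: h.
    by have [h _] := K1 n; exact: h.
  apply: (@squeeze_cvgr _ _ _ _ (fun=> 0) (fun n => Pr P [set w | (L n w < u%:E)%E] + Pr P [set w | (K n w < u%:E)%E])).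
  + apply: nearW => n; rewrite Pr_ge0 /=.
    have mL := Ft_measurable hFt u0 (stopping_lt hFt (L1 n) u0).
    have mK := Ft_measurable hFt u0 (stopping_lt hFt (K1 n) u0).
    apply: le_trans (PrU_le P mL mK); apply: le_Pr; [|exact: measurableU|].
      exact: (Ft_measurable hFt u0 (stopping_lt hFt (stopping_min hFt (L1 n) (K1 n)) u0)).
    by move=> w /=; rewrite gt_min => /orP[]; [left|right].
  + exact: cvg_cst.
  + by rewrite -[X in _ --> X]addr0; apply: cvgD.
- move=> n rho j; rewrite inE => /orP[/eqP ->|jl] hr sig s t s0 st.
    have := K3 n (fun w => Order.min (L n w) (rho w)) (stopping_min hFt (L1 n) hr) s t s0 st.
    have -> : (fun w => Order.min (K n w) (Order.min (L n w) (rho w))) = sig.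
      by apply/funext => w; rewrite /sig minA (minC (K n w)).
    exact.
  have := L3 n (fun w => Order.min (K n w) (rho w)) j jl (stopping_min hFt (K1 n) hr) s t s0 st.
  have -> : (fun w => Order.min (L n w) (Order.min (K n w) (rho w))) = sig.
    by apply/funext => w; rewrite /sig minA.
  exact.
Qed.

End exit.

Section core.
Context {R : realType} {dO : measure_display} {Omega : measurableType dO}.
Variables (P : probability Omega R) (Ft : R -> set (set Omega)).
Hypothesis hFt : usual_filtration P Ft.
Variables (d : nat) (Q : 'M[R]_d) (c : R).
Hypotheses (sQ : Q^T = Q) (c0 : 0 < c)
  (hQ : forall x : 'cV[R]_d, c * \sum_i x i 0 ^+ 2 <= qform Q x x <= \sum_i x i 0 ^+ 2).
Variable r : R.
Hypothesis r0 : 0 < r.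
Variables X M V D : R -> Omega -> 'cV[R]_d.
Variable A : 'I_d -> R -> Omega -> R.
Hypotheses (cX : forall i, cadlag_process (fun s w => X s w i 0))
  (aX : forall i, adapted Ft (fun s w => X s w i 0))
  (hM : forall i, locally_square_integrable_martingale P Ft (fun s w => M s w i 0))
  (hA : forall i, is_predictable_qv P Ft (fun s w => M s w i 0) (A i)).

(** The first-order terms of [gain] have mean 0. In the second-order ones, [nq] is at least [c]
    times the sum of the squared increments, whose mean is that of the increments of the brackets;
    with the factor 1/2 of [gain] this gives [c / 2]. *)
Lemma gain_expect (L rho : Omega -> \bar R) (t u : R) (g : nat -> R) n B :
  let sig w := Order.min (L w) (rho w) in
  (forall w, (0 <= sig w)%E) ->
  (forall i (s t : R), 0 <= s -> s <= t ->
      let D w := stopped (fun s w => M s w i 0) sig t w - stopped (fun s w => M s w i 0) sig s w in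
      [/\ measurable_fun setT D, intg P (fun w => D w ^+ 2),
          (forall xi : Omega -> R, measurable_wrt (Ft s) xi -> intg P (fun w => xi w ^+ 2) ->
            Ex P (fun w => xi w * D w) = 0),
          intg P (fun w => stopped (A i) sig t w - stopped (A i) sig s w) &
          forall G, Ft s G -> Ex P (fun w => \1_G w * D w ^+ 2) =
            Ex P (fun w => \1_G w * (stopped (A i) sig t w - stopped (A i) sig s w))]) ->
  0 <= t -> {homo g : i j / (i <= j)%N >-> i <= j} -> g 0%N = t -> g n = u -> Ft t B ->
  let G w := gain Q r (X ^~ w) (M ^~ w) g n (fine (Order.min (sig w) u%:E)) in
  intg P (fun w => \1_B w * G w) /\
  c / 2 * Ex P (fun w => \1_B w * \sum_i (stopped (A i) sig u w - stopped (A i) sig t w)) <=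
    Ex P (fun w => \1_B w * G w).
Proof.
move=> sig sig0 loc t0 gm g0 gn FB G.
have gt k : t <= g k by rewrite -g0 gm.
have gp k : 0 <= g k by exact: le_trans t0 (gt k).
have gS k : g k <= g k.+1 by exact: gm.
have mB : measurable B := Ft_measurable hFt t0 FB.
pose Mi i s w := M s w i 0.
pose De k i w := stopped (Mi i) sig (g k.+1) w - stopped (Mi i) sig (g k) w.
pose De_A k i w := stopped (A i) sig (g k.+1) w - stopped (A i) sig (g k) w.
pose inc k w := incr (M ^~ w) (g k) (g k.+1) (fine (Order.min (sig w) u%:E)).
have incE k w i : (k < n)%N -> inc k w i 0 = De k i w.
  move=> kn; have h (a : R) : 0 <= a -> a <= u -> Num.min a (fine (Order.min (sig w) u%:E)) = fine (Order.min a%:E (sig w)).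
    move=> a0 au; have := sig0 w; case: (sig w) => [x| |]// x0.
      rewrite -!EFin_min /=; case: (leP x u) => xu; first by [].
      by rewrite !min_l// (le_trans au)// ltW.
    have -> : Order.min +oo%E u%:E = u%:E by rewrite min_r ?leey.
    by have -> : Order.min a%:E +oo%E = a%:E; [rewrite min_l ?leey|rewrite /= min_l].
  rewrite /inc /incr !mxE /De /stopped /Mi !h//.
  - by rewrite -gn gm// ltnW.
  - by rewrite -gn gm.
pose xi k i w := \1_B w * (Q *m chi Q r (X (g k) w)) i 0.
have xib k i w : `|xi k i w| <= r.
  rewrite normrM -[leRHS]mul1r ler_pM//; first exact: norm_indic.
  exact: (mulmx_chi_le sQ c0 hQ r0).
have xiF k i : measurable_wrt (Ft (g k)) (xi k i).
  apply: mul_measurable_wrt; first exact: (Ft_sigma hFt).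
    apply/(measurable_wrtP (Ft_sigma hFt (gp k))).
    apply: (@measurable_indic _ (g_sigma_algebraType (Ft (g k)))).
    by apply/(FtP hFt) => //; exact: (Ft_mono hFt t0 (gt k)).
  apply/(measurable_wrtP (Ft_sigma hFt (gp k))).
  apply: (measurable_mulmx_chi sQ r0 (T := g_sigma_algebraType (Ft (g k)))) => j.
  exact: (adapted_measurable hFt (aX j) (gp k) (lexx _)).
have xi2 k i : intg P (fun w => xi k i w ^+ 2).
  apply: (@intg_bounded _ _ _ P (r ^+ 2)).
    by apply: measurable_funX; exact: (measurable_wrt_fun (Ft_measurable hFt (gp k)) (xiF k i)).
  by move=> w; rewrite normrX lerXn2r ?nnegrE// ltW.
have mxi k i : measurable_fun setT (xi k i) := measurable_wrt_fun (Ft_measurable hFt (gp k)) (xiF k i).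
have [mDe iDe orth iDA DA] : [/\ forall k i, measurable_fun setT (De k i), forall k i, intg P (fun w => De k i w ^+ 2),
    forall k i, Ex P (fun w => xi k i w * De k i w) = 0, forall k i, intg P (De_A k i) &
    forall k i, Ex P (fun w => \1_B w * De k i w ^+ 2) = Ex P (fun w => \1_B w * De_A k i w)].
  split=> k i; have [l1 l2 l3 l4 l5] := loc i (g k) (g k.+1) (gp k) (gS k) => //.
    exact: l3.
  by apply: l5; exact: (Ft_mono hFt t0 (gt k)).
pose nqD k w := \1_B w * qform Q (inc k w) (inc k w).
have nqDE k w : (k < n)%N -> qform Q (inc k w) (inc k w) = \sum_i (\sum_j Q i j * De k j w) * De k i w.
  move=> kn; rewrite (qformE sQ); apply: eq_bigr => i _; rewrite incE// mxE; congr (_ * _).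
  by apply: eq_bigr => j _; rewrite incE.
have sumDe k w : (k < n)%N -> \sum_i inc k w i 0 ^+ 2 = \sum_i De k i w ^+ 2.
  by move=> kn; apply: eq_bigr => i _; rewrite incE.
have inq k : (k < n)%N -> intg P (nqD k).
  move=> kn; apply: (@intg_le _ _ _ P (fun w => \sum_i De k i w ^+ 2)).
  - apply: measurable_funM; first exact: measurable_indic.
    under eq_fun do rewrite nqDE//.
    apply: measurable_sum => i; apply: measurable_funM => //.
    by apply: measurable_sum => j; apply: measurable_funM.
  - by apply: intg_sum.
  - move=> w; rewrite normrM -[leRHS]mul1r ler_pM//; first exact: norm_indic.
    by rewrite ger0_norm ?(nq_ge0 c0 hQ)// -sumDe//; have /andP[] := hQ (inc k w).
pose h k w := 2 * \sum_i xi k i w * De k i w + 2^-1 * nqD k w.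
have GE w : \1_B w * G w = \sum_(k < n) h k w.
  rewrite /G /gain mulr_sumr; apply: eq_bigr => k _; rewrite /h /nqD -/(inc k w) mulrDr.
  rewrite mulrCA; congr (_ + _); last by rewrite mulrCA.
  congr (_ * _); rewrite (qformE sQ) mulr_sumr; apply: eq_bigr => i _.
  by rewrite /xi -mulrA incE.
have ixi k i : intg P (fun w => xi k i w * De k i w) by apply: intg_sqrM.
have ih k : (k < n)%N -> intg P (h k).
  by move=> kn; apply: intgD; apply: intgZ; [apply: intg_sum|exact: inq].
have iB k i : intg P (fun w => \1_B w * De_A k i w) by apply: intg_indicM.
have iB2 k i : intg P (fun w => \1_B w * De k i w ^+ 2) by apply: intg_indicM.
have Eh (k : 'I_n) : c / 2 * \sum_i Ex P (fun w => \1_B w * De_A k i w) <= Ex P (h k).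
  have -> : Ex P (h k) = 2^-1 * Ex P (nqD k).
    have i1 : intg P (fun w => \sum_i xi k i w * De k i w) by apply: intg_sum.
    have i2 := inq _ (ltn_ord k).
    rewrite /h (ExD (intgZ 2 i1) (intgZ 2^-1 i2)) (ExZ 2 i1) (ExZ 2^-1 i2) Ex_sum//.
    by rewrite big1 ?mulr0 ?add0r// => i _; exact: orth.
  rewrite mulrAC [leLHS]mulrC ler_pM2l ?invr_gt0// -(eq_bigr _ (fun i _ => DA k i)) -Ex_sum//.
  rewrite -ExZ; last by apply: intg_sum.
  apply: le_Ex; [by apply: intgZ; apply: intg_sum|exact: inq|].
  move=> w; rewrite -mulr_sumr mulrCA /nqD ler_wpM2l//.
  by rewrite -sumDe//; have /andP[] := hQ (inc k w).
under eq_fun do rewrite GE.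
split; first by apply: intg_sum => k; exact: ih.
rewrite Ex_sum; last by move=> k; exact: ih.
apply: le_trans (ler_sum _ (fun k _ => Eh k)); rewrite -mulr_sumr ler_pM2l ?divr_gt0//.
rewrite le_eqVlt; apply/orP; left; apply/eqP.
transitivity (Ex P (fun w => \sum_(k < n) \sum_i \1_B w * De_A k i w)).
  congr (Ex P _); apply/funext => w; rewrite exchange_big /= mulr_sumr; apply: eq_bigr => i _.
  rewrite -mulr_sumr; congr (_ * _).
  by rewrite -(big_mkord xpredT (fun k => De_A k i w)) telescope_sumr// gn g0.
rewrite Ex_sum; last by move=> k; apply: intg_sum.
by apply: eq_bigr => k _; rewrite Ex_sum.
Qed.

Hypotheses (cV : forall i, cadlag_process (fun s w => V s w i 0))
  (aV : forall i, adapted Ft (fun s w => V s w i 0))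
  (cD : forall i, cadlag_process (fun s w => D s w i 0))
  (aD : forall i, adapted Ft (fun s w => D s w i 0))
  (XE : forall s w, 0 <= s -> X s w = X 0 w + M s w + V s w + D s w).

Definition sq_jump (f : R -> 'cV[R]_d) (T : R) : R :=
  \sum_i (f T i 0 - lim (f s i 0 @[s --> T^'-])) ^+ 2.

Lemma sq_jump_ge0 f T : 0 <= sq_jump f T.
Proof. by rewrite sumr_ge0// => i _; exact: sqr_ge0. Qed.

Lemma nqE x : qform Q x x = \sum_i (\sum_j Q i j * x j 0) * x i 0.
Proof. by rewrite (qformE sQ); apply: eq_bigr => i _; rewrite mxE. Qed.

Section exit_time.
Variables (t u b psi : R) (g : nat -> R) (n : nat).
Hypotheses (t0 : 0 <= t) (tu : t <= u) (b0 : 0 < b) (psi0 : 0 < psi)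
  (gm : {homo g : i j / (i <= j)%N >-> i <= j}) (g0 : g 0%N = t) (gn : g n = u).

(** Positive exactly when one of the bounds in [tame] is violated at [s]. One real cadlag adapted
    process carries all of them, so that the first violation is a stopping time. *)
Definition exit_level s w : R :=
  Num.max (qform Q (X s w) (X s w) - r ^+ 2)
  (Num.max (\sum_(k < n) \sum_i `|incr (V ^~ w) (g k) (g k.+1) s i 0| - b)
  (Num.max (- psi - \sum_(k < n) qform Q (chi Q r (X (g k) w)) (incr (D ^~ w) (g k) (g k.+1) s))
           (\sum_(k < n) \sum_i (incr (D ^~ w) (g k) (g k.+1) s i 0) ^+ 2 - psi))).

Definition exit_time := debut t (fun s => [set w | 0 < exit_level s w]).

Let gt k : t <= g k. Proof. by rewrite -g0 gm. Qed.
Let gp k : 0 <= g k. Proof. exact: le_trans t0 (gt k). Qed.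
Let gS k : g k <= g k.+1. Proof. exact: gm. Qed.

Let cadlag_incr (Y : R -> Omega -> 'cV[R]_d) i k w : (forall i, cadlag_process (fun s w => Y s w i 0)) ->
  cadlag `[0, +oo[ (fun s => incr (Y ^~ w) (g k) (g k.+1) s i 0).
Proof.
move=> cY; rewrite (_ : (fun s => _) = fun s => Y (Num.min (g k.+1) s) w i 0 - Y (Num.min (g k) s) w i 0).
  by apply: cadlagB; apply: (cadlag_min_time _ (cY i w)).
by apply/funext => s; rewrite /incr !mxE.
Qed.

Let measurable_incr (Y : R -> Omega -> 'cV[R]_d) i k s : (forall i, adapted Ft (fun s w => Y s w i 0)) ->
  0 <= s -> measurable_fun [set: g_sigma_algebraType (Ft s)] (fun w => incr (Y ^~ w) (g k) (g k.+1) s i 0).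
Proof.
move=> aY s0; rewrite (_ : (fun w => _) = fun w => Y (Num.min (g k.+1) s) w i 0 - Y (Num.min (g k) s) w i 0).
  by apply: measurable_funB; apply: (adapted_measurable hFt (aY i)); rewrite ?le_min ?gp ?s0 ?ge_min ?lexx ?orbT.
by apply/funext => w; rewrite /incr !mxE.
Qed.

Lemma cadlag_exit_level : cadlag_process exit_level.
Proof.
move=> w; apply: cadlag_max.
  apply: cadlagB (cadlag_cst _).
  rewrite (_ : (fun s => _) = fun s => \sum_i (\sum_j Q i j * X s w j 0) * X s w i 0).
    apply: cadlag_sum => i; apply: cadlagM (cX i w); apply: cadlag_sum => j.
    exact: cadlagM (cadlag_cst _) (cX j w).
  by apply/funext => s; exact: nqE.
apply: cadlag_max.
  apply: cadlagB (cadlag_cst _); apply: cadlag_sum => k; apply: cadlag_sum => i.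
  exact/cadlag_norm/cadlag_incr.
apply: cadlag_max.
  apply: cadlagB (cadlag_cst _) _; apply: cadlag_sum => k.
  rewrite (_ : (fun s => _) = fun s => \sum_i (Q *m chi Q r (X (g k) w)) i 0 * incr (D ^~ w) (g k) (g k.+1) s i 0).
    by apply: cadlag_sum => i; apply: cadlagM (cadlag_cst _) _; exact: cadlag_incr.
  by apply/funext => s; rewrite (qformE sQ).
apply: cadlagB (cadlag_cst _); apply: cadlag_sum => k; apply: cadlag_sum => i.
rewrite (_ : (fun s => _) = fun s => incr (D^~ w) (g k) (g k.+1) s i 0 * incr (D^~ w) (g k) (g k.+1) s i 0).
  by apply: cadlagM; exact: cadlag_incr.
by apply/funext => s; rewrite expr2.
Qed.

Lemma adapted_exit_level : adapted Ft exit_level.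
Proof.
move=> s s0; apply/(measurable_wrtP (Ft_sigma hFt s0)); apply: measurable_maxr.
  apply: measurable_funB => //; rewrite (_ : (fun w => _) = fun w => \sum_i (\sum_j Q i j * X s w j 0) * X s w i 0).
    apply: measurable_sum => i; apply: measurable_funM; last exact: (adapted_measurable hFt (aX i)).
    by apply: measurable_sum => j; apply: measurable_funM => //; exact: (adapted_measurable hFt (aX j)).
  by apply/funext => w; exact: nqE.
apply: measurable_maxr.
  apply: measurable_funB => //; apply: measurable_sum => k; apply: measurable_sum => i.
  by apply: (measurableT_comp (@normr_measurable R setT)) => //; exact: measurable_incr.
apply: measurable_maxr.
  apply: measurable_funB => //; apply: measurable_sum => k.
  (* The coefficient at [g k] is unknown at an earlier time [s], but then it multiplies an increment
     that is still 0. *)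
  have [gs|sg] := leP (g k) s; last first.
    rewrite (_ : (fun w => _) = fun=> 0) //.
    by apply/funext => w; rewrite incr_eq0 ?qform0r// ltW.
  rewrite (_ : (fun w => _) = fun w => \sum_i (Q *m chi Q r (X (g k) w)) i 0 * incr (D ^~ w) (g k) (g k.+1) s i 0).
    apply: measurable_sum => i; apply: measurable_funM; last exact: measurable_incr.
    apply: (measurable_mulmx_chi sQ r0 (T := g_sigma_algebraType (Ft s))) => j.
    exact: (adapted_measurable hFt (aX j) (gp k) gs).
  by apply/funext => w; rewrite (qformE sQ).
apply: measurable_funB => //; apply: measurable_sum => k; apply: measurable_sum => i.
by apply: measurable_funX; exact: measurable_incr.
Qed.

Lemma exit_level_lt0 w : qform Q (X t w) (X t w) < r ^+ 2 -> exit_level t w < 0.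
Proof.
move=> Xt; have z (Y : R -> Omega -> 'cV[R]_d) k : incr (Y ^~ w) (g k) (g k.+1) t = 0 by apply: incr_eq0.
rewrite /exit_level !gt_max subr_lt0 Xt /= big1 ?sub0r ?oppr_lt0 ?b0 /=; last first.
  by move=> k _; rewrite big1// => i _; rewrite z mxE normr0.
rewrite big1 ?subr0 ?oppr_lt0 ?psi0 /=; last by move=> k _; rewrite z qform0r.
rewrite big1 ?sub0r ?oppr_lt0// => k _; rewrite big1// => i _; rewrite z mxE expr0n//.
Qed.

Lemma exit_time_tame w s : qform Q (X t w) (X t w) < r ^+ 2 -> t <= s -> (s%:E < exit_time w)%E ->
  tame Q r (X ^~ w) (V ^~ w) (D ^~ w) g n t b psi s.
Proof.
move=> Xt ts sT; have [_ lvl _ _] := debut_pos hFt t0 cadlag_exit_level adapted_exit_level.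
have lv s' : t <= s' -> s' <= s -> exit_level s' w <= 0.
  move=> ts' ss'; have [->|ne] := eqVneq s' t; first exact/ltW/exit_level_lt0.
  apply: lvl; first by rewrite lt_def ne.
  by rewrite (le_lt_trans _ sT)// lee_fin.
have := lv s ts (lexx s); rewrite /exit_level !ge_max => /and4P[_ l2 l3 l4]; split.
- by move=> s' ts' ss'; have := lv s' ts' ss'; rewrite /exit_level ge_max subr_le0 => /andP[].
- by rewrite -subr_le0.
- by move: l3; lra.
- by rewrite -subr_le0.
Qed.

(** Two evaluations of the mean of [gain] at the exit time or [u]. From below, the brackets gain [m]
    on the paths that stay, apart from exceptional ones. From above, a path that stays ends within
    [e2], or else within the ball, and a path that leaves is bounded by [gain_exit], its jump being
    [J]. *)
Lemma exit_estimate (m e2 : R) B : 0 <= m -> 0 <= e2 -> Ft t B ->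
  (forall w, B w -> qform Q (X t w) (X t w) < r ^+ 2) ->
  let J w := if exit_time w is x%:E then (if x <= u then sq_jump (M ^~ w) x else 0) else 0 in
  intg P (fun w => \1_B w * J w) ->
  c / 2 * m * (Pr P B - Pr P (B `&` [set w | \sum_i A i u w - \sum_i A i t w < m])
      - Pr P (B `&` [set w | (exit_time w <= u%:E)%E])) <=
    (slack r b psi + e2) * Pr P B
    + (6 * r ^+ 2 + 2 * b ^+ 2 + 2 * psi) * Pr P (B `&` [set w | (exit_time w <= u%:E)%E])
    + 2 * Ex P (fun w => \1_B w * J w)
    + r ^+ 2 * Pr P (B `&` [set w | e2 < qform Q (X u w) (X u w)]).
Proof.
move=> m0 e20 FB BX J iJ; have u0 := le_trans t0 tu.
have [stT _ Tgt _] := debut_pos hFt t0 cadlag_exit_level adapted_exit_level.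
have mB : measurable B := Ft_measurable hFt t0 FB.
set BT := B `&` [set w | (exit_time w <= u%:E)%E].
set BA := B `&` [set w | _ < m]; set BX' := B `&` [set w | e2 < _].
have aAi i := adapted_qv hFt (hM i) (hA i).
have mBT : measurable BT by apply: measurableI => //; apply: (Ft_measurable hFt u0); exact: (proj2 stT).
have mAi i s : 0 <= s -> measurable_fun setT (A i s).
  by move=> s0; exact: (measurable_wrt_fun (Ft_measurable hFt s0) (aAi i _ s0)).
have mXi i s : 0 <= s -> measurable_fun setT (fun w => X s w i 0).
  by move=> s0; exact: (measurable_wrt_fun (Ft_measurable hFt s0) (aX i s0)).
have mBA : measurable BA.
  apply: measurableI => //; rewrite -[X in measurable X]setTI.
  rewrite (_ : [set w | _] = (fun w => \sum_i A i u w - \sum_i A i t w) @^-1` `]-oo, m[); last first.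
    by apply/seteqP; split=> w /=; rewrite in_itv.
  suff h : measurable_fun setT (fun w => \sum_i A i u w - \sum_i A i t w) by exact: h.
  by apply: measurable_funB; apply: measurable_sum => i; exact: mAi.
have mBX : measurable BX'.
  apply: measurableI => //; rewrite -[X in measurable X]setTI.
  rewrite (_ : [set w | _] = (fun w => \sum_i (\sum_j Q i j * X u w j 0) * X u w i 0) @^-1` `]e2, +oo[); last first.
    by apply/seteqP; split=> w /=; rewrite in_itv /= andbT nqE.
  suff h : measurable_fun setT (fun w => \sum_i (\sum_j Q i j * X u w j 0) * X u w i 0) by exact: h.
  apply: measurable_sum => i; apply: measurable_funM; last exact: mXi.
  by apply: measurable_sum => j; apply: measurable_funM => //; exact: mXi.
have [L [L1 L2 L3]] := qv_localization_vec hFt hM hA.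
have mL N : measurable [set w | (L N w < u%:E)%E].
  exact: (Ft_measurable hFt u0 (stopping_lt hFt (L1 N) u0)).
pose K := 6 * r ^+ 2 + 2 * b ^+ 2 + 2 * psi.
have K0 : 0 <= K by rewrite !addr_ge0 ?mulr_ge0 ?sqr_ge0 ?ltW.
have slack0 : 0 <= slack r b psi by rewrite /slack !addr_ge0 ?mulr_ge0 ?sqr_ge0 ?ltW.
have J0 w : 0 <= J w.
  by rewrite /J; case: exit_time => // x; case: ifP => // _; exact: sq_jump_ge0.
(* Moments exist only up to [L N]. Where [L N] comes first the path is still in the ball, so this
   costs at most [r ^+ 2] per path and disappears as N grows. *)
suff main N : c / 2 * m * (Pr P B - Pr P BA - Pr P BT - Pr P [set w | (L N w < u%:E)%E]) <=
    (slack r b psi + e2) * Pr P B + K * Pr P BT + 2 * Ex P (fun w => \1_B w * J w) + r ^+ 2 * Pr P BX'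
    + r ^+ 2 * Pr P [set w | (L N w < u%:E)%E].
  set lhs := Pr P B - Pr P BA - Pr P BT in main *.
  rewrite -/K; set R0 : R := (X in _ <= X).
  have cv : R0 + (c / 2 * m + r ^+ 2) * Pr P [set w | (L N w < u%:E)%E] @[N --> \oo] --> R0.
    rewrite -[X in _ --> X]addr0 -[X in _ --> _ + X](mulr0 (c / 2 * m + r ^+ 2)).
    by apply: cvgD; [exact: cvg_cst|apply: cvgM; [exact: cvg_cst|exact: L2]].
  rewrite -[leRHS](cvg_lim _ cv)//; apply: limr_ge; first exact: (cvgP _ cv).
  by apply: nearW => N; have := main N; rewrite -/R0; lra.
pose sig w := Order.min (L N w) (exit_time w).
have stsig : stopping_time Ft sig by exact: (stopping_min hFt (L1 N) stT).
have [sig0 _] := stsig.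
pose G w := gain Q r (X ^~ w) (M ^~ w) g n (fine (Order.min (sig w) u%:E)).
have [iG low] : intg P (fun w => \1_B w * G w) /\
    c / 2 * Ex P (fun w => \1_B w * \sum_i (stopped (A i) sig u w - stopped (A i) sig t w)) <=
    Ex P (fun w => \1_B w * G w).
  exact: (gain_expect sig0 (fun i s t s0 st => L3 N exit_time i stT s t s0 st) t0 gm g0 gn FB).
pose bnd w := (slack r b psi + e2) * \1_B w + K * \1_BT w + 2 * (\1_B w * J w) + r ^+ 2 * \1_BX' w
   + r ^+ 2 * \1_[set w | (L N w < u%:E)%E] w.
have ibnd : intg P bnd.
  by do !apply: intgD; apply: intgZ => //; exact: intg_indic.
have Ebnd : Ex P bnd = (slack r b psi + e2) * Pr P B + K * Pr P BT + 2 * Ex P (fun w => \1_B w * J w) + r ^+ 2 * Pr P BX'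
    + r ^+ 2 * Pr P [set w | (L N w < u%:E)%E].
  have ii S k : measurable S -> intg P (fun w => k * \1_S w) by move=> mS; apply: intgZ; exact: intg_indic.
  rewrite /bnd !ExD ?ExZ ?Ex_indic//; do ?[exact: ii|apply: intgD|exact: intgZ|exact: intg_indic].
rewrite -Ebnd.
have Gbnd w : \1_B w * G w <= bnd w.
  have [wB|wB] := boolP (w \in B); last first.
    have i0 S : 0 <= \1_S w :> R by rewrite indicE.
    have -> : \1_B w * G w = 0 by rewrite indicE (negbTE wB) mul0r.
    have q1 : 0 <= slack r b psi + e2 by exact: addr_ge0.
    have q2 : 0 <= \1_B w * J w by exact: mulr_ge0.
    have q3 : 0 <= r ^+ 2 by exact: sqr_ge0.
    rewrite /bnd; apply: addr_ge0; last exact: mulr_ge0.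
    apply: addr_ge0; last exact: mulr_ge0.
    apply: addr_ge0; last exact: mulr_ge0.
    by apply: addr_ge0; exact: mulr_ge0.
  have Bw : B w by rewrite inE in wB.
  have Xt := BX w Bw; have tT : (t%:E < exit_time w)%E := Tgt w (exit_level_lt0 Xt).
  have xE s : t <= s -> X s w = X 0 w + M s w + V s w + D s w.
    by move=> ts; apply: XE; exact: le_trans ts.
  pose far : bool := (e2 < qform Q (X u w) (X u w))%R.
  have bndE : bnd w = slack r b psi + e2 + K * (exit_time w <= u%:E)%E%:R + 2 * J w
      + r ^+ 2 * far%:R + r ^+ 2 * (L N w < u%:E)%E%:R.
    rewrite /bnd !indicE wB mulr1 mul1r /BT /BX' !in_setI wB /=.
    by rewrite !in_setb.
  rewrite indicE wB mul1r bndE.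
  have r2 : 0 <= r ^+ 2 := sqr_ge0 r.
  have bool0 (x : bool) (k : R) : 0 <= k -> 0 <= k * x%:R by move=> k0; rewrite mulr_ge0.
  have p1 := bool0 (exit_time w <= u%:E)%E K K0; have p2 := bool0 far _ r2.
  have p3 := bool0 (L N w < u%:E)%E _ r2; have p4 := J0 w.
  have below s : s%:E = Order.min (sig w) u%:E -> (s%:E < exit_time w)%E -> G w <= (if s < t then 0 else qform Q (X s w) (X s w) + slack r b psi).
    move=> sE sT; rewrite /G -sE /=; have [st|ts] := ltP s t.
      rewrite /gain big1// => k _; rewrite incr_eq0// ?qform0r ?mulr0 ?addr0//.
      by rewrite (le_trans (ltW st)).
    have su : s <= u by rewrite -lee_fin sE ge_min lexx orbT.
    exact: (gain_tame sQ c0 hQ r0 gm g0 gn xE (ltW b0) ts su (exit_time_tame Xt ts sT)).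
  have [/andP[LT Lu]|nL] := boolP ((L N w < exit_time w)%E && (L N w < u%:E)%E).
    have [l lE] : exists l : R, L N w = l%:E.
      have [L0 _] := L1 N; have := L0 w; move: Lu; case: (L N w) => [l| |]// _ _; by exists l.
    have tr : true%:R = 1 :> R by [].
    rewrite lE in LT Lu; rewrite lE Lu tr mulr1.
    have {}h : G w <= (if l < t then 0 else qform Q (X l w) (X l w) + slack r b psi).
      by apply: below => //; rewrite /sig lE (min_l (ltW LT)) (min_l (ltW Lu)).
    apply: (le_trans h); have [lt|tl] := ltP l t; first by lra.
    have [xr _ _ _] := exit_time_tame Xt tl LT; have := xr l tl (lexx l); lra.
  have [Tu|uT] := leP (exit_time w) u%:E.
    have TL : (exit_time w <= L N w)%E.
      rewrite leNgt; apply/negP => LT; move: nL; rewrite LT /= -leNgt => uL.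
      by move: (le_lt_trans uL LT); rewrite ltNge Tu.
    have [x Tx] : exists x : R, exit_time w = x%:E.
      by case: (exit_time w) tT Tu => [x| |]// _ _; exists x.
    have xL := TL; rewrite Tx in xL; have tx := tT; rewrite Tx lte_fin in tx.
    have xu := Tu; rewrite Tx lee_fin in xu.
    have Gx : G w = gain Q r (X ^~ w) (M ^~ w) g n x.
      by rewrite /G /sig Tx (min_r xL) -EFin_min min_l.
    pose l : 'cV[R]_d := \col_i lim (M s w i 0 @[s --> x^'-]).
    have Ml i : M s w i 0 @[s --> x^'-] --> l i 0.
      rewrite mxE; have [cM _ _] := hM i; have [_ h] := proj1 (cadlagP _) (cM w).
      by apply: h; exact: le_lt_trans tx.
    have := gain_exit sQ c0 hQ r0 gm g0 gn xE (ltW b0) tx xu _ Ml.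
    have -> : \sum_i (M x w i 0 - l i 0) ^+ 2 = sq_jump (M ^~ w) x.
      by apply: eq_bigr => i _; rewrite mxE.
    have tm s : t <= s -> s < x -> tame Q r (X ^~ w) (V ^~ w) (D ^~ w) g n t b psi s.
      by move=> ts sx; apply: (exit_time_tame Xt ts); rewrite Tx lte_fin.
    have tr : true%:R = 1 :> R by [].
    have Jx : J w = sq_jump (M ^~ w) x by rewrite /J Tx xu.
    move=> /(_ psi tm); rewrite Gx Jx tr mulr1 /K; lra.
  have uL : (u%:E <= L N w)%E.
    by rewrite leNgt; apply/negP => Lu; move: nL; rewrite Lu andbT (lt_trans Lu uT).
  have h : G w <= (if u < t then 0 else qform Q (X u w) (X u w) + slack r b psi).
    by apply: below => //; rewrite min_r// le_min uL ltW.
  apply: (le_trans h); rewrite ltNge tu /=.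
  have [xr _ _ _] := exit_time_tame Xt tu uT; have := xr u tu (lexx u).
  have farE : qform Q (X u w) (X u w) <= r ^+ 2 -> qform Q (X u w) (X u w) <= e2 + r ^+ 2 * far%:R.
    have tr : true%:R = 1 :> R by []. 
    have fr : false%:R = 0 :> R by [].
    rewrite /far; have [e2X|e2X] := ltP e2 (qform Q (X u w) (X u w)) => hr.
      by rewrite tr mulr1 (le_trans hr)// lerDr.
    by rewrite fr mulr0 addr0.
  by move=> /farE; lra.
apply: le_trans (le_Ex iG ibnd Gbnd).
apply: le_trans low.
rewrite -mulrA ler_pM2l ?divr_gt0//.
pose S := (B `\` (BA `|` BT)) `\` [set w | (L N w < u%:E)%E].
have mS : measurable S by apply: measurableD => //; apply: measurableD => //; exact: measurableU.
have h1 : Pr P B <= Pr P S + (Pr P BA + Pr P BT + Pr P [set w | (L N w < u%:E)%E]).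
  have mU : measurable (BA `|` BT `|` [set w | (L N w < u%:E)%E]) by apply: measurableU => //; exact: measurableU.
  rewrite (PrDI P mB mU); apply: lerD.
    apply: le_Pr => //; first exact: measurableD.
    by move=> w [Bw nU]; split; [split=> // hU; apply: nU; left|move=> Lu; apply: nU; right].
  apply: (@le_trans _ _ (Pr P (BA `|` BT `|` [set w | (L N w < u%:E)%E]))).
    by apply: le_Pr => //; exact: measurableI.
  apply: le_trans (PrU_le P _ _) _ => //; first exact: measurableU.
  by rewrite lerD2r; exact: PrU_le.
have Amono w i (x y : R) : 0 <= x -> x <= y -> stopped (A i) sig x w <= stopped (A i) sig y w.
  move=> x0 xy; have [_ _ hAm _] := hA i; have [_ h] := hAm w.
  have y0 := le_trans x0 xy; move: (sig0 w); rewrite /stopped; case: (sig w) => [z| |]// z0.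
    rewrite -!EFin_min /=; rewrite lee_fin in z0.
    apply: h; rewrite ?le_min ?ge_min ?lexx ?orbT ?andbT ?xy//= ?in_itv /= ?andbT ?le_min ?x0 ?y0 ?z0//.
  by rewrite !(min_l (leey _)) /=; apply: h; rewrite //= in_itv /= andbT.
have iA i : intg P (fun w => stopped (A i) sig u w - stopped (A i) sig t w).
  by have [_ _ _ h _] := L3 N exit_time i stT t u t0 tu.
have iS : intg P (fun w => \1_B w * \sum_i (stopped (A i) sig u w - stopped (A i) sig t w)).
  by apply: intg_indicM => //; apply: intg_sum.
apply: (@le_trans _ _ (m * Pr P S)); first by rewrite ler_wpM2l//; lra.
apply: Pr_markov => //.
  move=> w; apply: mulr_ge0 => //; apply: sumr_ge0 => i _; rewrite subr_ge0; exact: Amono.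
move=> w [[Bw nU] /negP]; rewrite -leNgt => uL.
have uT : (u%:E < exit_time w)%E.
  by rewrite ltNge; apply/negP => Tu; apply: nU; right; split.
have us : (u%:E <= sig w)%E by rewrite le_min uL ltW.
have ts : (t%:E <= sig w)%E by rewrite (le_trans _ us)// lee_fin.
rewrite indicE mem_set// mul1r /stopped (min_l us) (min_l ts) sumrB leNgt; apply/negP => lt.
by apply: nU; left; split.
Qed.

End exit_time.

End core.

(** * Conditional expectation and the jump condition *)

Section conditional_expectation.
Context {R : realType} {dO : measure_display} {Omega : measurableType dO}.
Variables (P : probability Omega R) (G : set (set Omega)).
Hypotheses (sG : sigma_algebra [set: Omega] G) (GM : G `<=` measurable).
Local Notation T' := (g_sigma_algebraType G).

Lemma g_sigma_measurable (A : set T') : measurable A -> measurable (A : set Omega).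
Proof. by rewrite /measurable /= sigma_algebra_id// => GA; exact: GM. Qed.

Lemma measurable_to_sub : measurable_fun [set: Omega] (fun w => w : T').
Proof.
move=> _ B mB; rewrite setTI; exact: g_sigma_measurable.
Qed.

Lemma measurable_sub_fun (dV : measure_display) (V : measurableType dV) (f : Omega -> V) (D : set Omega) :
  measurable D -> measurable_fun [set: T'] (f : T' -> V) -> measurable_fun D f.
Proof.
move=> mD mf; apply: (measurable_funS measurableT) => //.
by apply: (measurable_wrt_fun GM); apply/(measurable_wrtP sG).
Qed.

Variables (k : R) (f : Omega -> R).
Hypothesis hf : measurable_fun setT f /\ forall w, 0 <= f w <= k.

(** The measure with density f on G. The hypotheses are arguments of the term so that its measure
    structure, which rests on them, can be inferred from it. *)
Definition weighted (H1 : sigma_algebra [set: Omega] G) (H2 : G `<=` measurable)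
  (H3 : measurable_fun setT f /\ forall w, 0 <= f w <= k) (A : set T') : \bar R :=
  (\int[P]_(w in A) (f w)%:E)%E.

Local Notation m := (weighted sG GM hf).

Let m0 : m set0 = 0%E. Proof. by rewrite /weighted integral_set0. Qed.
Let mge0 A : (0 <= m A)%E.
Proof. by apply: integral_ge0 => w _; rewrite lee_fin; have /andP[] := proj2 hf w. Qed.
Let msig : semi_sigma_additive m.
Proof.
move=> F mF tF mUF; apply: (@semi_sigma_additive_nng_induced _ _ _ P (EFin \o f)).
- by apply/measurable_EFinP; exact: (proj1 hf).
- by move=> w; rewrite lee_fin; have /andP[] := proj2 hf w.
- by move=> i; exact: g_sigma_measurable.
- by [].
- exact: g_sigma_measurable.
Qed.
HB.instance Definition _ := isMeasure.Build _ _ _ m m0 mge0 msig.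

Let mfin : fin_num_fun m.
Proof.
move=> A mA; have ints : P.-integrable [set: Omega] (EFin \o f).
  apply: (@intg_bounded _ _ _ P k); first exact: (proj1 hf).
  by move=> w; have /andP[h1 h2] := proj2 hf w; rewrite ger0_norm.
by apply: integrable_fin_num; [exact: g_sigma_measurable|apply: integrableS ints => //; exact: g_sigma_measurable].
Qed.
HB.instance Definition _ := Measure_isFinite.Build _ _ _ m mfin.

End conditional_expectation.

Section conditional_expectation_existence.
Context {R : realType} {dO : measure_display} {Omega : measurableType dO}.
Variables (P : probability Omega R) (G : set (set Omega)).
Hypotheses (sG : sigma_algebra [set: Omega] G) (GM : G `<=` measurable).
Local Notation T' := (g_sigma_algebraType G).

Let one_bounded : measurable_fun setT (fun _ : Omega => 1 : R) /\ forall w : Omega, 0 <= (1 : R) <= 1.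
Proof. by split=> // _; rewrite ler01 lexx. Qed.

Let weighted1 (A : set T') : measurable A -> weighted P sG GM one_bounded A = P (A : set Omega).
Proof.
by move=> mA; rewrite /weighted integral_cst ?mul1e//; exact: (g_sigma_measurable sG GM).
Qed.

Lemma integral_sub_sigma (g : T' -> \bar R) (A : set T') : measurable A ->
  measurable_fun [set: T'] g -> (forall w, 0 <= g w)%E ->
  (\int[weighted P sG GM one_bounded]_(w in A) g w = \int[P]_(w in (A : set Omega)) g w)%E.
Proof.
move=> mA mg g0.
have := @ge0_integral_pushforward _ _ _ _ R _ (measurable_to_sub sG GM) P A g mA (measurable_funTS mg) (fun w _ => g0 w).
move=> <-; apply: eq_measure_integral => [m1 B mB|mf B mB _]; first exact: (measurable_to_sub sG GM).
exact: weighted1.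
Qed.

Lemma cond_exp_bounded (f : Omega -> R) (k : R) : measurable_fun setT f -> (forall w, 0 <= f w <= k) ->
  exists2 g : Omega -> \bar R, forall w, (0 <= g w)%E & is_cond_exp P G (EFin \o f) g.
Proof.
move=> mf fk; pose hf := conj mf fk.
have dom : weighted P sG GM hf `<< weighted P sG GM one_bounded.
  apply/null_content_dominatesP => A mA.
  have mA' : measurable (A : set Omega) by exact: (g_sigma_measurable sG GM).
  move=> /=; rewrite weighted1// => A0; rewrite /weighted.
  by apply: null_set_integral => //; apply/measurable_EFinP; exact: measurable_funTS.
have [g [g0 ig gE]] := radon_nikodym_finite dom.
have mg : measurable_fun [set: T'] g by exact: measurable_int ig.
exists g => //; split; first exact/(measurable_wrtP sG).
move=> A GA; have mA : measurable (A : set T') by exact: sub_sigma_algebra.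
by rewrite -integral_sub_sigma// -gE.
Qed.

Lemma cond_exp_exists (f : Omega -> R) : measurable_fun setT f -> (forall w, 0 <= f w) ->
  exists2 g : Omega -> \bar R, forall w, (0 <= g w)%E & is_cond_exp P G (EFin \o f) g.
Proof.
move=> mf f0; pose h (j : nat) w := Num.min (f w) j.+1%:R - Num.min (f w) j%:R.
have mh j : measurable_fun setT (h j) by apply: measurable_funB; apply: measurable_minr.
have h0 j w : 0 <= h j w.
  by rewrite subr_ge0 le_min ge_min lexx /= ge_min ler_nat leqnSn orbT.
have hb j w : 0 <= h j w <= j.+1%:R.
  rewrite h0 /= /h lerBlDr (@le_trans _ _ j.+1%:R)//; first by rewrite ge_min lexx orbT.
  by rewrite lerDl le_min f0 ler0n.
have /choice[g hg] : forall j, exists g : Omega -> \bar R, (forall w, (0 <= g w)%E) /\ is_cond_exp P G (EFin \o h j) g.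
  by move=> j; have [g g0 hg] := cond_exp_bounded (mh j) (hb j); exists g.
have g0 j w : (0 <= g j w)%E by have [h1 _] := hg j.
have mg j : measurable_fun [set: T'] (g j) by have [_ [h1 _]] := hg j; exact/(measurable_wrtP sG).
exists (fun w => \sum_(j <oo) g j w)%E; first by move=> w; apply: nneseries_ge0.
split.
  apply/(measurable_wrtP sG); exact: (@ge0_emeasurable_sum _ T').
move=> A GA; have mA := GM GA.
rewrite integral_nneseries//; last by move=> j; exact: (measurable_sub_fun sG GM).
transitivity (\sum_(j <oo) \int[P]_(w in A) (h j w)%:E)%E.
  by apply: eq_eseriesr => j _; have [_ [_ ->]] := hg j.
rewrite -integral_nneseries//; last 2 first.
- by move=> j; apply/measurable_EFinP; exact: measurable_funTS.
- by move=> j w _; rewrite lee_fin.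
apply: eq_integral => w _ /=.
have sumE n : (\sum_(0 <= j < n) (h j w)%:E)%E = (Num.min (f w) n%:R)%:E.
  rewrite sumEFin /h telescope_sumr// (_ : Num.min (f w) 0%:R = 0) ?subr0//.
  by rewrite min_r.
under eq_fun do rewrite sumE.
apply: cvg_lim => //; apply: cvg_near_cst; near=> n; rewrite min_l//.
near: n; exact: nbhs_infty_ger.
Unshelve. all: by end_near. Qed.

End conditional_expectation_existence.

Section random_times.
Context {R : realType} {dO : measure_display} {Omega : measurableType dO}.

(* Y at the random time sigma is the limit of Y at the first multiple of 1/m
   after sigma. *)
Lemma measurable_at_time (Y : R -> Omega -> R) (sigma : Omega -> R) :
  cadlag_process Y -> (forall s, 0 <= s -> measurable_fun setT (Y s)) ->
  measurable_fun setT sigma -> (forall w, 0 <= sigma w) ->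
  measurable_fun setT (fun w => Y (sigma w) w).
Proof.
move=> cY mY ms s0.
pose q (m : nat) w : R := (Num.truncn (m.+1%:R * sigma w)).+1%:R / m.+1%:R.
have q0 m w : 0 <= q m w by rewrite divr_ge0.
have mq (m : nat) w : 0 < m.+1%:R :> R by [].
have qs m w : sigma w <= q m w <= sigma w + m.+1%:R^-1.
  have /andP[h1 h2] := truncn_itv (mulr_ge0 (ler0n R m.+1) (s0 w)).
  apply/andP; split.
    by rewrite /q ler_pdivlMr// mulrC ltW.
  rewrite /q ler_pdivrMr// mulrDl mulVf// [_ * m.+1%:R]mulrC.
  by rewrite -natr1 lerD2r.
apply: (measurable_fun_cvg (h := fun m w => Y (q m w) w)); last first.
  move=> w _; have [rc _] := proj1 (cadlagP _) (cY w).
  apply: (right_cvg_seq (rc _ (s0 w))); first by move=> m; have /andP[] := qs m w.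
  apply: (@squeeze_cvgr _ _ _ _ (fun=> sigma w) (fun m => sigma w + m.+1%:R^-1)).
  - by apply: nearW => m; exact: qs.
  - exact: cvg_cst.
  - rewrite -[X in _ --> X]addr0; apply: cvgD; first exact: cvg_cst.
    exact: cvg_harmonic.
move=> m _ B mB; rewrite setTI.
rewrite (_ : _ @^-1` B = \bigcup_k ([set w | k%:R <= m.+1%:R * sigma w < k.+1%:R] `&` (Y (k.+1%:R / m.+1%:R) @^-1` B))).
  apply: bigcupT_measurable => k; apply: measurableI.
    rewrite (_ : [set w | _] = setT `&` (fun w => m.+1%:R * sigma w) @^-1` `[k%:R, k.+1%:R[).
      have h : measurable_fun setT (fun w => m.+1%:R * sigma w) by apply: measurable_funM.
      exact: h.
    by apply/seteqP; split=> w /=; rewrite in_itv /=; [split|case].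
  by rewrite -[X in measurable X]setTI; apply: (mY (k.+1%:R / m.+1%:R)) => //; rewrite divr_ge0.
apply/seteqP; split=> w /=.
  move=> Bw; exists (Num.truncn (m.+1%:R * sigma w)) => //; split=> //=.
  exact: (truncn_itv (mulr_ge0 (ler0n R m.+1) (s0 w))).
by move=> [k _ [/= /truncn_def kE]]; rewrite /q kE.
Qed.

Lemma measurable_left_lim (Y : R -> Omega -> R) (sigma : Omega -> R) :
  cadlag_process Y -> (forall s, 0 <= s -> measurable_fun setT (Y s)) ->
  measurable_fun setT sigma -> (forall w, 0 < sigma w) ->
  measurable_fun setT (fun w => lim (Y s w @[s --> (sigma w)^'-])).
Proof.
move=> cY mY ms s0.
(* Strictly below [sigma w], as a left limit requires, and positive already for [m = 0]. *)
pose q (m : nat) w : R := sigma w * (1 - m.+2%:R^-1).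
have q1 (m : nat) : 0 < 1 - m.+2%:R^-1 :> R /\ 1 - m.+2%:R^-1 < 1 :> R.
  by rewrite subr_gt0 invf_lt1 ?ltr1n// gtrBl invr_gt0.
apply: (measurable_fun_cvg (h := fun m w => Y (q m w) w)).
  move=> m; apply: measurable_at_time => //; first by apply: measurable_funM.
  by move=> w; rewrite mulr_ge0 ?ltW//; have [h _] := q1 m.
move=> w _; have [_ lc] := proj1 (cadlagP _) (cY w).
apply: (left_cvg_seq (lc _ (s0 w))).
  by move=> m; have [_ h] := q1 m; rewrite /q gtr_pMr.
rewrite -[X in _ --> X]mulr1; apply: cvgM; first exact: cvg_cst.
rewrite -[X in _ --> X]subr0; apply: cvgB; first exact: cvg_cst.
have := @cvg_harmonic R; rewrite -(cvg_shiftn 1) /=.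
by under eq_fun do rewrite addn1.
Qed.

End random_times.

Section jump_control.
Context {R : realType} {dO : measure_display} {Omega : measurableType dO}.
Variables (P : probability Omega R) (Ft : R -> set (set Omega)).
Hypothesis hFt : usual_filtration P Ft.

Lemma cond_exp_le1 (G : set (set Omega)) (f : Omega -> R) (g : Omega -> \bar R) :
  sigma_algebra setT G -> G `<=` measurable ->
  measurable_fun setT f -> (forall w, 0 <= f w <= 1) -> (forall w, 0 <= g w)%E ->
  is_cond_exp P G (EFin \o f) g -> P [set w | (1 < g w)%E] = 0%E.
Proof.
move=> sG GM mf f1 g0 [mg gE].
have mgO : measurable_fun setT g := measurable_wrt_fun GM mg.
pose A (n : nat) := [set w | ((1 + n.+1%:R^-1)%:E <= g w)%E].
have GA n : G (A n).
  have h := mg `[(1 + n.+1%:R^-1)%:E, +oo[%classic (emeasurable_itv _).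
  move: h; rewrite (_ : _ @^-1` _ = A n)//.
  by apply/seteqP; split=> w; rewrite /= in_itv /= andbT.
have A0 n : P (A n) = 0%E.
  have mA := GM _ (GA n).
  apply/eqP; rewrite eq_le measure_ge0 andbT.
  have h : ((1 + n.+1%:R^-1)%:E * P (A n) <= P (A n))%E.
    apply: (@le_trans _ _ (\int[P]_(w in A n) g w)%E).
      rewrite -integral_cst//; apply: ge0_le_integral => //.
      - by move=> w _; rewrite lee_fin addr_ge0.
      - exact: measurable_funTS.
    rewrite gE// -[leRHS]mul1e -integral_cst//; apply: ge0_le_integral => //.
    - by move=> w _ /=; rewrite lee_fin; have /andP[] := f1 w.
    - by apply/measurable_EFinP; exact: measurable_funTS.
    - by move=> w _ /=; rewrite lee_fin; have /andP[] := f1 w.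
  move: h; rewrite (PrE P mA) -EFinM !lee_fin => h.
  have i0 : 0 < n.+1%:R^-1 :> R by rewrite invr_gt0.
  by rewrite mulrDl mul1r gerDl in h; rewrite -(ler_pM2l i0) mulr0.
apply/eqP; rewrite eq_le measure_ge0 andbT.
have mU : measurable (\bigcup_n A n) by apply: bigcupT_measurable => n; exact: GM.
apply: (@le_trans _ _ (P (\bigcup_n A n))).
  apply: le_measure; rewrite ?inE//.
    rewrite -[X in measurable X]setTI; exact: emeasurable_fun_o_infty.
  move=> w /=; have := g0 w; case E : (g w) => [x| |]//=.
    rewrite lte_fin => x0 x1; have x1' : 0 < x - 1 by rewrite subr_gt0.
    have [m hm] := div_natS_lt 1 x1'; exists m => //=; rewrite /A /= E lee_fin.
    by rewrite -lerBrDl ltW// -div1r.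
  by move=> _ _; exists 0%N => //=; rewrite /A /= E leey.
have [N [mN N0 sub]] : P.-negligible (\bigcup_n A n).
  apply: negligible_bigcup => n; exists (A n).
  by split; [exact: (GM _ (GA n))|exact: A0|].
by rewrite -N0; apply: le_measure; rewrite ?inE.
Qed.

(** As [kappa <= 1] is monotone, [kappa p <= kappa del + p / del]; the right-hand side is affine in
    the conditional probability [p] and can be integrated. The jump condition holds on [Gamma] only,
    which is not an event of [Ft t]; so [B'] keeps the part of [B] where the resulting inequality is
    true, and what is removed meets [Gamma] in a null set. *)
Lemma jump_estimate d (dot : {dot 'cV[R]_d for idfun}) (Gamma : set Omega) (kappa : R -> R)
  (Z : R -> Omega -> 'cV[R]_d) (E : R -> Omega -> \bar R) :
  (forall p, 0 <= p <= 1 -> 0 <= kappa p <= 1) -> nondecreasing_on `[0, 1] kappa ->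
  (forall p, 0 <= p <= 1 -> p <= kappa p) ->
  jump_bound P Ft dot Gamma kappa Z E ->
  forall (t : R) (S : Omega -> \bar R) (f : Omega -> R) (B : set Omega) (e del : R),
  0 <= t -> stopping_time Ft S -> (forall w, (t%:E < S w)%E) ->
  measurable_fun setT f -> (forall w, 0 <= f w) ->
  (forall w, sq_jump_at dot Z S w = (f w)%:E) ->
  Ft t B -> 0 <= e -> (forall w, B w -> (E t w <= e%:E)%E) -> 0 < del <= 1 ->
  exists B' N : set Omega, [/\ Ft t B', B' `<=` B, measurable N /\ P N = 0%E,
    (B `\` B') `&` Gamma `<=` N &
    intg P (fun w => \1_B' w * f w) /\
    Ex P (fun w => \1_B' w * f w) <= e * (kappa del * Pr P B + Pr P (B `&` [set w | (S w < +oo)%E]) / del)].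
Proof.
move=> k01 km kge hE t S f B e del t0 stS tS mf f0 fE FB e0 EB /andP[d0 d1].
have sG := Ft_sigma hFt t0; have GM := Ft_measurable hFt t0.
have mB := GM _ FB.
have mS : measurable [set w | (S w < +oo)%E].
  rewrite (_ : [set w | _] = \bigcup_(n : nat) [set w | (S w <= n%:R%:E)%E]).
    by apply: bigcupT_measurable => n; apply: (Ft_measurable hFt (ler0n R n)); exact: (proj2 stS).
  apply/seteqP; split=> w /=.
    have := tS w; case Sx : (S w) => [x| |]//= _ _.
    exists (Num.bound x) => //=; rewrite Sx lee_fin ltW//.
    have [x0|x0] := leP 0 x; first exact: archi_boundP.
    by rewrite (lt_le_trans x0).
  by move=> [n _ /= h]; rewrite (le_lt_trans h)// ltry.
pose i w : R := \1_[set w | (S w < +oo)%E] w.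
have mi : measurable_fun setT i by exact: measurable_indic.
have i01 w : 0 <= i w <= 1 by rewrite /i indicE; case: (_ \in _); rewrite ?ler01 ?lexx.
have [g g0 gc] := cond_exp_exists P sG GM mf f0.
have [p p0 pc] := cond_exp_exists P sG GM mi (fun w => proj1 (andP (i01 w))).
have p1 := cond_exp_le1 sG GM mi i01 p0 pc.
have [mg gE] := gc; have [mp pE] := pc.
have gc' : is_cond_exp P (Ft t) (sq_jump_at dot Z S) g.
  by rewrite (_ : sq_jump_at dot Z S = EFin \o f)//; apply/funext => w; exact: fE.
have /ae_exists[N [mN N0 hN]] := hE t S t0 stS tS g p gc' pc.
have mg' : measurable_fun [set: g_sigma_algebraType (Ft t)] g by exact/(measurable_wrtP sG).
have mp' : measurable_fun [set: g_sigma_algebraType (Ft t)] p by exact/(measurable_wrtP sG).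
pose h w : \bar R := (e%:E * ((kappa del)%:E + p w * (del^-1)%:E))%E.
have mh : measurable_fun [set: g_sigma_algebraType (Ft t)] h.
  by apply: emeasurable_funM => //; apply: emeasurable_funD => //; apply: emeasurable_funM.
pose B' := B `&` [set w | (p w <= 1)%E] `&` [set w | (g w <= h w)%E].
have FB' : Ft t B'.
  apply/(FtP hFt) => //; apply: measurableI; first apply: measurableI.
  - exact/(FtP hFt).
  - by rewrite -[X in measurable X]setTI; exact: emeasurable_fun_infty_c.
  - by rewrite -[X in measurable X]setTI; exact: measurable_lee.
have mB' := GM _ FB'.
exists B', (N `|` [set w | (1 < p w)%E]).
have mp1 : measurable [set w | (1 < p w)%E].
  have mpO : measurable_fun setT p := measurable_wrt_fun GM mp.
  by rewrite -[X in measurable X]setTI; exact: emeasurable_fun_o_infty.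
split=> //.
- by move=> w [[]].
- split; first exact: measurableU.
  by rewrite (measureU0 mN mp1 p1).
- move=> w [[Bw nB'] Gw]; have [pw|pw] := leP (p w) 1%E; last by right.
  left; apply: contrapT => Nw; apply: nB'; split=> //; rewrite /= /h.
  have := hN w Nw Gw; have := EB w Bw; have := p0 w; move: pw.
  case: (p w) => [x| |]//=; rewrite !lee_fin => x1 x0 Ee.
  have x01 : 0 <= x <= 1 by rewrite x0 x1.
  have kx : kappa x <= kappa del + x / del.
    have [xd|dx] := leP x del.
      rewrite (@le_trans _ _ (kappa del))//; first by apply: km; rewrite //= in_itv /= ?x0 ?(ltW d0).
      by rewrite lerDl divr_ge0// ltW.
    have /andP[_ kx1] := k01 x x01; rewrite (le_trans kx1)//.
    have /andP[kd0 _] : 0 <= kappa del <= 1 by apply: k01; rewrite (ltW d0).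
    rewrite (@le_trans _ _ (x / del))// ?lerDr//.
    by rewrite ler_pdivlMr// mul1r ltW.
  have -> : (e%:E * ((kappa del)%:E + x%:E * (del^-1)%:E) = (e * (kappa del + x / del))%:E)%E.
    by rewrite EFinM EFinD EFinM.
  rewrite /quot0; case: eqP => [k0|/eqP k0].
    case: eqP => [-> _|_ hoo]; last by have := le_trans hoo Ee.
    rewrite lee_fin mulr_ge0// addr_ge0 ?divr_ge0 ?(ltW d0)//.
    by have /andP[] : 0 <= kappa del <= 1 by apply: k01; rewrite (ltW d0).
  have kp : 0 < kappa x by rewrite lt_def k0; have /andP[] := k01 x x01.
  move=> hq; have {hq} := le_trans hq Ee; have := g0 w; case: (g w) => [y| |]//=.
    rewrite -EFinM !lee_fin => y0; rewrite ler_pdivrMr// => ye.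
    by rewrite (le_trans ye)// ler_wpM2l.
  by move=> _; rewrite gt0_mulye ?lte_fin ?invr_gt0.
have Ef : (\int[P]_(w in B') (f w)%:E <= (e * (kappa del * Pr P B + Pr P (B `&` [set w | (S w < +oo)%E]) / del))%:E)%E.
  have kd0 : 0 <= kappa del by have /andP[] : 0 <= kappa del <= 1 by apply: k01; rewrite (ltW d0).
  have id0 : 0 <= del^-1 by rewrite invr_ge0 ltW.
  have mpB : measurable_fun B' p by exact: (measurable_sub_fun sG GM).
  have hE0 : (\int[P]_(w in B') h w = e%:E * ((kappa del)%:E * P B' + (\int[P]_(w in B') p w) * (del^-1)%:E))%E.
    rewrite /h ge0_integralZl_EFin//; last 2 first.
    - by move=> w _; rewrite adde_ge0 ?lee_fin// mule_ge0.
    - by apply: emeasurable_funD => //; apply: emeasurable_funM.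
    congr (_ * _)%E; rewrite ge0_integralD//; last 2 first.
    - by move=> w _; rewrite mule_ge0.
    - by apply: emeasurable_funM.
    by rewrite integral_cst// ge0_integralZr.
  have iB : (\int[P]_(w in B') p w = P (B' `&` [set w | (S w < +oo)%E]))%E.
    by rewrite pE//= /i integral_indic// setIC.
  rewrite -(gE _ FB') (@le_trans _ _ (\int[P]_(w in B') h w)%E)//.
    apply: ge0_le_integral => //.
    - exact: (measurable_sub_fun sG GM).
    - exact: (measurable_sub_fun sG GM).
    - by move=> w [].
  have mI : measurable (B' `&` [set w | (S w < +oo)%E]) by exact: measurableI.
  rewrite hE0 iB (PrE P mB') (PrE P mI).
  apply: (@le_trans _ _ (e * (kappa del * Pr P B' + Pr P (B' `&` [set w | (S w < +oo)%E]) / del))%:E).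
    by rewrite EFinM EFinD !EFinM.
  rewrite lee_fin ler_wpM2l// lerD//.
    by rewrite ler_wpM2l//; apply: le_Pr => // w [[]].
  rewrite ler_wpM2r//; apply: le_Pr => //; first exact: measurableI.
  by move=> w [[[Bw _] _] Sw]; split.
have cE : (\int[P]_w (\1_B' w * f w)%:E = \int[P]_(w in B') (f w)%:E)%E.
  rewrite [RHS]integral_mkcond; apply: eq_integral => w _; rewrite patchE indicE.
  by case: (w \in B'); rewrite ?mul1r ?mul0r.
have ii : intg P (fun w => \1_B' w * f w).
  apply/integrableP; split.
    by apply/measurable_EFinP; apply: measurable_funM => //; exact: measurable_indic.
  under eq_integral do rewrite /= ger0_norm ?mulr_ge0//.
  by rewrite cE (le_lt_trans Ef)// ltry.
split=> //; rewrite -lee_fin; apply: le_trans Ef.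
rewrite -cE /Ex /Rintegral fineK//; exact: (integrable_fin_num measurableT ii).
Qed.

End jump_control.

(** * The drift *)

Section cells.
Context {R : realType}.
Local Notation mu := (@lebesgue_measure R).

Lemma grid_cell (g : nat -> R) n (r : R) : g 0%N < r -> r <= g n ->
  exists2 k, (k < n)%N & g k < r <= g k.+1.
Proof.
move=> r0 rn; have ex : exists j, r <= g j by exists n.
case: (ex_minnP ex) => -[|k] rk mk; first by rewrite leNgt r0 in rk.
exists k; first by rewrite -ltnS; apply: mk.
by rewrite rk andbT ltNge; apply/negP => /mk; rewrite ltnn.
Qed.

Lemma Rintegral_cells (f : R -> R) (g : nat -> R) n m :
  {homo g : i j / (i <= j)%N >-> i <= j} -> (m <= n)%N ->
  mu.-integrable `]g 0%N, g n] (EFin \o f) ->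
  \sum_(k < m) \int[mu]_(r in `]g k, g k.+1]) f r = \int[mu]_(r in `]g 0%N, g m]) f r.
Proof.
move=> gm mn intf; elim: m mn => [|m IH] mn.
  by rewrite big_ord0 set_itvoc0 Rintegral_set0.
rewrite big_ord_recr /= IH ?(ltnW mn)//.
rewrite -[X in _ + X](@Rintegral_itvB _ f (BRight (g 0%N)) (BRight (g m.+1)) (g m)).
- by rewrite addrCA subrr addr0.
- by apply: integrableS intf => //; apply: subset_itvl; rewrite bnd_simp gm.
- by rewrite bnd_simp gm.
- by rewrite bnd_simp gm.
Qed.

Lemma grid_mesh_cvg (t u : R) : (u - t) / n.+1%:R @[n --> \oo] --> (0 : R).
Proof.
rewrite -[X in _ --> X](mulr0 (u - t)); apply: cvgM; [exact: cvg_cst|exact: cvg_harmonic].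
Qed.

(** The [z n k] form step functions that converge pointwise to [zl], which makes [zl] measurable;
    the errors are dominated by [2 * b * |f|]. *)
Lemma drift_cells (f : R -> R) (t u b : R) (z : nat -> nat -> R) (zl : R -> R) :
  t < u -> mu.-integrable `]t, u] (EFin \o f) ->
  (forall n k, `|z n k| <= b) ->
  (forall r (k : nat -> nat), t < r <= u ->
     (forall n, (k n < n.+1)%N /\ grid t u n.+1 (k n) < r <= grid t u n.+1 (k n).+1) ->
     z n (k n) @[n --> \oo] --> zl r) ->
  [/\ measurable_fun `]t, u] zl, forall r, t < r <= u -> `|zl r| <= b &
  forall eps : R, 0 < eps -> \forall n \near \oo,
    \sum_(k < n.+1) \int[mu]_(r in `]grid t u n.+1 k, grid t u n.+1 k.+1]) (`|z n k - zl r| * `|f r|) <= eps].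
Proof.
move=> tu intf zb zcvg.
have gm n : {homo grid t u n.+1 : i j / (i <= j)%N >-> i <= j}.
  by move=> i j ij; exact: (grid_mono _ (ltW tu) ij).
pose cell n k : set R := `]grid t u n.+1 k, grid t u n.+1 k.+1]%classic.
pose step n r := \sum_(k < n.+1) z n k * \1_(cell n k) r.
have stepE n k r : (k < n.+1)%N -> grid t u n.+1 k < r <= grid t u n.+1 k.+1 -> step n r = z n k.
  move=> kn /andP[kr rk]; rewrite /step (bigD1 (Ordinal kn))//= big1 ?addr0.
    by rewrite indicE mem_set ?mulr1// /cell /= in_itv /= kr.
  move=> j jk; rewrite indicE memNset ?mulr0// /cell /= in_itv /= => /andP[jr rj].
  have [lt|lt|e] := ltngtP (j : nat) k.
  - by move: (le_lt_trans (le_trans rj (gm n _ _ lt)) kr); rewrite ltxx.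
  - by move: (le_lt_trans (le_trans rk (gm n _ _ lt)) jr); rewrite ltxx.
  - by move: jk; rewrite -val_eqE /= e eqxx.
have kex r : t < r <= u -> exists k : nat -> nat, forall n, (k n < n.+1)%N /\ grid t u n.+1 (k n) < r <= grid t u n.+1 (k n).+1.
  move=> /andP[tr ru].
  have /choice[k hk] : forall n, exists k, (k < n.+1)%N /\ grid t u n.+1 k < r <= grid t u n.+1 k.+1.
    move=> n; have [|| k kn kr] := @grid_cell (grid t u n.+1) n.+1 r; rewrite ?grid0 ?gridn//.
    by exists k.
  by exists k.
have step_cvg r : t < r <= u -> step n r @[n --> \oo] --> zl r.
  move=> tr; have [k hk] := kex r tr.
  rewrite (_ : (fun n => step n r) = fun n => z n (k n)); first exact: zcvg.
  by apply/funext => n; have [h1 h2] := hk n; exact: stepE.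
have mstep n : measurable_fun setT (step n).
  apply: measurable_sum => k; apply: measurable_funM => //; apply: measurable_indic; exact: measurable_itv.
have mzl : measurable_fun `]t, u] zl.
  apply: (measurable_fun_cvg (h := step)); first by move=> n; exact: measurable_funTS.
  by move=> r /=; rewrite in_itv /=; exact: step_cvg.
have b0 : 0 <= b by exact: le_trans (zb 0%N 0%N).
have stepb n r : `|step n r| <= b.
  have [[k [kn kr]]|nex] := pselect (exists k, (k < n.+1)%N /\ grid t u n.+1 k < r <= grid t u n.+1 k.+1).
    by rewrite (stepE n k).
  rewrite /step big1 ?normr0// => k _; rewrite indicE memNset ?mulr0// /cell /= in_itv /= => kr.
  by apply: nex; exists k.
have zlb r : t < r <= u -> `|zl r| <= b.
  move=> tr; have cv : `|step n r| @[n --> \oo] --> `|zl r| by apply: cvg_norm; exact: step_cvg.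
  rewrite -(cvg_lim _ cv)//; apply: limr_le; first exact: (cvgP _ cv).
  by apply: nearW => n; exact: stepb.
split=> // eps eps0.
pose phi n r := `|step n r - zl r| * `|f r|.
have mf : measurable_fun `]t, u] f by apply/measurable_EFinP; exact: measurable_int intf.
have mphi n : measurable_fun `]t, u] (phi n).
  apply: measurable_funM.
    apply: (measurableT_comp (@normr_measurable R setT)) => //; apply: measurable_funB => //; exact: measurable_funTS.
  by apply: (measurableT_comp (@normr_measurable R setT)).
have intg_ : mu.-integrable `]t, u] (EFin \o (fun r => 2 * b * `|f r|)).
  by apply: (integrableZl _ _ (integrable_abse intf)).
have phib n r : t < r <= u -> `|phi n r| <= 2 * b * `|f r|.
  move=> tr; rewrite ger0_norm ?mulr_ge0// ler_wpM2r// (le_trans (ler_normB _ _))//.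
  by have := stepb n r; have := zlb r tr; lra.
have iphi n : mu.-integrable `]t, u] (EFin \o phi n).
  have mp : measurable_fun `]t, u] (EFin \o phi n) by apply/measurable_EFinP.
  apply: le_integrable intg_ => //.
  by move=> r /=; rewrite in_itv /= => tr; rewrite lee_fin [leRHS]ger0_norm ?phib// !mulr_ge0.
have cphi : (\int[mu]_(r in `]t, u]) (phi n r)%:E @[n --> \oo] --> \int[mu]_(r in `]t, u]) (0 : R)%:E)%E.
  apply: (dominated_cvg _ _ _ _ intg_) => //.
  - by move=> n; exact: (measurable_int mu (iphi n)).
  - move=> r /=; rewrite in_itv /= => tr; apply: cvg_EFin; first exact: nearW.
    have : `|step n r - zl r| * `|f r| @[n --> \oo] --> `|zl r - zl r| * `|f r|.
      by apply: cvgM; [apply: cvg_norm; apply: cvgB; [exact: step_cvg|exact: cvg_cst]|exact: cvg_cst].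
    by rewrite subrr normr0 mul0r.
have sumE n : \sum_(k < n.+1) \int[mu]_(r in `]grid t u n.+1 k, grid t u n.+1 k.+1]) (`|z n k - zl r| * `|f r|) =
    \int[mu]_(r in `]t, u]) phi n r.
  have := @Rintegral_cells (phi n) (grid t u n.+1) n.+1 n.+1 (gm n) (leqnn _).
  rewrite grid0 gridn => /(_ (iphi n)) <-.
  apply: eq_bigr => k _; apply: eq_Rintegral => r; rewrite inE /= in_itv /= => kr.
  by rewrite /phi (stepE n k).
have {}cphi : \int[mu]_(r in `]t, u]) phi n r @[n --> \oo] --> (0 : R).
  rewrite integral0 in cphi; exact: (fine_cvg cphi).
near=> n; rewrite sumE; near: n.
by apply: (cvgr_le _ cphi).
Unshelve. all: by end_near. Qed.

Lemma increment_Rintegral (f F : R -> R) (c u a b : R) :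
  mu.-integrable `[0, u] (EFin \o f) ->
  (forall s, 0 <= s -> s <= u -> F s = c + \int[mu]_(r in `[0, s]) f r) ->
  0 <= a -> a <= b -> b <= u -> F b - F a = \int[mu]_(r in `]a, b]) f r.
Proof.
move=> intf FE a0 ab bu; rewrite !FE// ?(le_trans a0)// ?(le_trans ab)// opprD addrACA subrr add0r.
apply: (@Rintegral_itvB _ f (BLeft 0) (BRight b) a); rewrite ?bnd_simp//.
by apply: integrableS intf => //; apply: subset_itvl; rewrite bnd_simp.
Qed.

Lemma Rintegral_sum (I : Type) (s : seq I) (D : set R) (h : I -> R -> R) : measurable D ->
  (forall i, mu.-integrable D (EFin \o h i)) ->
  mu.-integrable D (EFin \o (fun r => \sum_(i <- s) h i r)) /\
  \int[mu]_(r in D) (\sum_(i <- s) h i r) = \sum_(i <- s) \int[mu]_(r in D) h i r.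
Proof.
move=> mD ih; elim: s => [|i s [IH1 IH2]].
  split; last by under eq_Rintegral do rewrite big_nil; rewrite big_nil /Rintegral integral0.
  by apply: eq_integrable (integrable0 _ _) => // r _ /=; rewrite big_nil.
have e r : \sum_(j <- i :: s) h j r = h i r + \sum_(j <- s) h j r by rewrite big_cons.
split.
  rewrite (_ : EFin \o _ = (EFin \o h i) \+ (EFin \o (fun r => (\sum_(j <- s) h j r)%R)))%E; last first.
    by apply/funext => r /=; rewrite e EFinD.
  exact: integrableD.
by under eq_Rintegral do rewrite e; rewrite RintegralD// IH2 big_cons.
Qed.

Lemma small_cells (f : R -> R) (t u : R) : t < u -> mu.-integrable `[t, u] (EFin \o f) ->
  forall eps : R, 0 < eps -> \forall n \near \oo, forall k, (k < n.+1)%N ->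
    \int[mu]_(r in `]grid t u n.+1 k, grid t u n.+1 k.+1]) `|f r| <= eps.
Proof.
move=> tu intf eps eps0; pose fab := f \_ `[t, u].
have [d [d0 hd]] : exists d : R, 0 < d /\
    forall A, measurable A -> (mu A < d%:E)%E -> \int[mu]_(x in A) `|fab x| < eps.
  apply: integral_normr_continuous => //=.
  by rewrite -restrict_EFin; apply/integrable_restrict => //=; rewrite setTI.
have mesh : \forall n \near \oo, (u - t) / n.+1%:R < d.
  by apply: (cvgr_lt _ (grid_mesh_cvg t u)).
near=> n => k kn; have lt_d : (u - t) / n.+1%:R < d by near: n.
have sub : `]grid t u n.+1 k, grid t u n.+1 k.+1] `<=` `[t, u].
  move=> r /=; rewrite !in_itv /= => /andP[h1 h2]; apply/andP; split.
    by rewrite (le_trans _ (ltW h1))// grid_ge// ltW.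
  by rewrite (le_trans h2)// grid_le// ltW.
rewrite [leLHS](_ : _ = \int[mu]_(r in `]grid t u n.+1 k, grid t u n.+1 k.+1]) `|fab r|); last first.
  apply: eq_Rintegral => r; rewrite inE => /sub rtu.
  by rewrite /fab patchE mem_set.
apply/ltW/hd => //; rewrite lebesgue_measure_itv /= lte_fin gridS ltrDl.
by rewrite divr_gt0 ?subr_gt0// -EFinD lte_fin addrC addKr.
Unshelve. all: by end_near. Qed.

End cells.

Section drift.
Context {R : realType} {d : nat}.
Variables (Q : 'M[R]_d) (c : R).
Hypotheses (sQ : Q^T = Q) (c0 : 0 < c)
  (hQ : forall x : 'cV[R]_d, c * \sum_i x i 0 ^+ 2 <= qform Q x x <= \sum_i x i 0 ^+ 2).
Variable r : R.
Hypothesis r0 : 0 < r.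
Local Notation mu := (@lebesgue_measure R).

(* The drift points outwards up to the error made by freezing the path at the
   grid points, which vanishes with the mesh. *)
Lemma drift_tame (x dd F xl : R -> 'cV[R]_d) (a : 'cV[R]_d) (t u : R) : 0 <= t -> t < u ->
  (forall i, mu.-integrable `[0, u] (EFin \o (fun s => F s i 0))) ->
  (forall i s, 0 <= s -> s <= u -> dd s i 0 = a i 0 + \int[mu]_(y in `[0, s]) F y i 0) ->
  (forall i s, t < s <= u -> x y i 0 @[y --> s^'-] --> xl s i 0) ->
  (forall s, t < s <= u -> 0 <= qform Q (xl s) (F s)) ->
  forall psi : R, 0 < psi -> \forall n \near \oo, forall s, t <= s -> s <= u ->
    - psi <= \sum_(k < n.+1) Num.min 0 (qform Q (chi Q r (x (grid t u n.+1 k))) (incr dd (grid t u n.+1 k) (grid t u n.+1 k.+1) s)) /\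
    \sum_(k < n.+1) \sum_i (incr dd (grid t u n.+1 k) (grid t u n.+1 k.+1) s i 0) ^+ 2 <= psi.
Proof.
move=> t0 tu iF ddE xxl out psi psi0.
pose D1 : R := d.+1%:R; have D10 : 0 < D1 by rewrite ltr0n.
have iFtu i : mu.-integrable `[t, u] (EFin \o (fun s => F s i 0)).
  by apply: integrableS (iF i) => //; apply: subset_itvr; rewrite bnd_simp.
have iFtu' i : mu.-integrable `]t, u] (EFin \o (fun s => F s i 0)).
  by apply: integrableS (iF i) => //; apply: subset_itvr; rewrite bnd_simp.
pose z i n k := (Q *m chi Q r (x (grid t u n.+1 k))) i 0.
pose zl i s := (Q *m chi Q r (xl s)) i 0.
have zcvg i s (k : nat -> nat) : t < s <= u ->
    (forall n, (k n < n.+1)%N /\ grid t u n.+1 (k n) < s <= grid t u n.+1 (k n).+1) ->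
    z i n (k n) @[n --> \oo] --> zl i s.
  move=> ts hk.
  have lz : (Q *m chi Q r (x y)) i 0 @[y --> s^'-] --> (Q *m chi Q r (xl s)) i 0.
    by apply: (cvg_mulmx_chi sQ r0) => j; exact: xxl.
  apply: (left_cvg_seq lz); first by move=> n; have [_ /andP[]] := hk n.
  apply: (@squeeze_cvgr _ _ _ _ (fun n => s - (u - t) / n.+1%:R) (fun=> s)).
  - apply: nearW => n; have [_ /andP[h1 h2]] := hk n; rewrite (ltW h1) andbT.
    by move: h2; rewrite gridS lerBlDr.
  - rewrite -[X in _ --> X]subr0; apply: cvgB; [exact: cvg_cst|exact: grid_mesh_cvg].
  - exact: cvg_cst.
have zb i n k : `|z i n k| <= r by exact: (mulmx_chi_le sQ c0 hQ r0).
have H i := drift_cells tu (iFtu' i) (zb i) (zcvg i).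
have e0 : 0 < psi / D1 by rewrite divr_gt0.
have n1 : \forall n \near \oo, forall i, \sum_(k < n.+1)
    \int[mu]_(y in `]grid t u n.+1 k, grid t u n.+1 k.+1]) (`|z i n k - zl i y| * `|F y i 0|) <= psi / D1.
  by apply: filter_forall => i; have [_ _ h] := H i; exact: h.
pose K i := \int[mu]_(y in `]t, u]) `|F y i 0|.
have K0 i : 0 <= K i by apply: Rintegral_ge0.
(* For the sum of squares: the largest increment times the total variation [K i] of the drift. The
   added 1 avoids a division by 0. *)
have n2 : \forall n \near \oo, forall i k, (k < n.+1)%N ->
    \int[mu]_(y in `]grid t u n.+1 k, grid t u n.+1 k.+1]) `|F y i 0| <= psi / D1 / (K i + 1).
  by apply: filter_forall => i; apply: (small_cells tu (iFtu i)); rewrite divr_gt0// ltr_wpDl.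
near=> n => s ts su.
have h1 : forall i, \sum_(k < n.+1)
    \int[mu]_(y in `]grid t u n.+1 k, grid t u n.+1 k.+1]) (`|z i n k - zl i y| * `|F y i 0|) <= psi / D1 by near: n.
have h2 : forall i k, (k < n.+1)%N ->
    \int[mu]_(y in `]grid t u n.+1 k, grid t u n.+1 k.+1]) `|F y i 0| <= psi / D1 / (K i + 1) by near: n.
pose g := grid t u n.+1; pose lo k := Num.min (g k) s; pose hi k := Num.min (g k.+1) s.
have gm : {homo g : i j / (i <= j)%N >-> i <= j} by move=> i j ij; exact: (grid_mono _ (ltW tu) ij).
have gt k : t <= g k by rewrite /g grid_ge// ltW.
have lohi k : lo k <= hi k by rewrite le_min !ge_min gm ?lexx ?orbT.
have lo0 k : t <= lo k by rewrite le_min gt ts.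
have hiu k : hi k <= u by rewrite ge_min su orbT.
have incE k i : incr dd (g k) (g k.+1) s i 0 = \int[mu]_(y in `]lo k, hi k]) F y i 0.
  rewrite /incr !mxE -/(lo k) -/(hi k).
  by apply: (increment_Rintegral (iF i) (ddE i)) => //; exact: le_trans (lo0 k).
have sub k : `]lo k, hi k] `<=` `]t, u].
  by move=> y /=; rewrite !in_itv /= => /andP[y1 y2]; rewrite (le_lt_trans (lo0 k))//= (le_trans y2).
have subc k : `]lo k, hi k] `<=` `]g k, g k.+1].
  move=> y /=; rewrite !in_itv /= le_min => /andP[y1 /andP[y2 y3]]; rewrite y2 andbT.
  by move: y1; rewrite gt_min => /orP[//|sy]; rewrite leNgt sy in y3.
have subm k : (k < n.+1)%N -> `]g k, g k.+1] `<=` `]t, u].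
  move=> kn y /=; rewrite !in_itv /= => /andP[y1 y2]; rewrite (le_lt_trans (gt k))//= (le_trans y2)//.
  by rewrite /g grid_le// ltW.
pose h i k y := `|z i n k - zl i y| * `|F y i 0|.
have mF i : measurable_fun `]t, u] (fun y => F y i 0).
  by apply/measurable_EFinP; exact: measurable_int (iFtu' i).
have mzl i : measurable_fun `]t, u] (zl i) by have [] := H i.
have zlb i y : t < y <= u -> `|zl i y| <= r by have [_ h' _] := H i; exact: h'.
have ih i k : mu.-integrable `]t, u] (EFin \o h i k).
  have mh : measurable_fun `]t, u] (EFin \o h i k).
    apply/measurable_EFinP; apply: measurable_funM; apply: (measurableT_comp (@normr_measurable R setT)) => //.
    exact: measurable_funB.
  have ig : mu.-integrable `]t, u] (EFin \o (fun y => 2 * r * `|F y i 0|)).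
    exact: (integrableZl _ _ (integrable_abse (iFtu' i))).
  apply: le_integrable ig => // y /=; rewrite in_itv /= => ty.
  rewrite lee_fin ger0_norm ?mulr_ge0// [leRHS]ger0_norm ?mulr_ge0 ?(ltW r0)//.
  rewrite /h ler_wpM2r// (le_trans (ler_normB _ _))//.
  by have := zb i n k; have := zlb i y ty; lra.
have izF i k : mu.-integrable `]t, u] (EFin \o (fun y => z i n k * F y i 0)).
  exact: (integrableZl _ _ (iFtu' i)).
have cellS k (f : R -> R) : mu.-integrable `]t, u] (EFin \o f) -> mu.-integrable `]lo k, hi k] (EFin \o f).
  by apply: integrableS => //; exact: sub.
have cellG k (f : R -> R) : (k < n.+1)%N -> mu.-integrable `]t, u] (EFin \o f) -> mu.-integrable `]g k, g k.+1] (EFin \o f).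
  by move=> kn; apply: integrableS => //; exact: subm.
have mono k (f : R -> R) : (k < n.+1)%N -> mu.-integrable `]t, u] (EFin \o f) -> (forall y, 0 <= f y) ->
    \int[mu]_(y in `]lo k, hi k]) f y <= \int[mu]_(y in `]g k, g k.+1]) f y.
  move=> kn intf f0; rewrite /Rintegral fine_le//.
  - by apply: integrable_fin_num => //; exact: cellS.
  - by apply: integrable_fin_num => //; exact: cellG.
  - by apply: ge0_subset_integral => //; do ?[exact: (subc k) | exact: (measurable_int mu (cellG k f kn intf)) | move=> y _; rewrite lee_fin].
split.
  have step (k : 'I_n.+1) : - \sum_i \int[mu]_(y in `]g k, g k.+1]) h i k y <=
      Num.min 0 (qform Q (chi Q r (x (g k))) (incr dd (g k) (g k.+1) s)).
    rewrite le_min oppr_le0 sumr_ge0/=; last by move=> i _; apply: Rintegral_ge0 => y _; rewrite mulr_ge0.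
    rewrite (qformE sQ).
    have [iS eS] := Rintegral_sum (index_enum 'I_d) (measurable_itv `]lo k, hi k]) (fun i => cellS k _ (izF i k)).
    rewrite [leRHS](eq_bigr (fun i => \int[mu]_(y in `]lo k, hi k]) (z i n k * F y i 0))); last first.
      by move=> i _; rewrite RintegralZl//; [rewrite incE|exact: cellS].
    rewrite -eS.
    have [iS' eS'] := Rintegral_sum (index_enum 'I_d) (measurable_itv `]lo k, hi k]) (fun i => cellS k _ (ih i k)).
    apply: (@le_trans _ _ (- (\int[mu]_(y in `]lo k, hi k]) (\sum_i h i k y)))).
      rewrite lerN2 eS'; apply: ler_sum => i _; apply: mono => //.
      by move=> y; rewrite mulr_ge0.
    have -> : - (\int[mu]_(y in `]lo k, hi k]) (\sum_i h i k y)) = \int[mu]_(y in `]lo k, hi k]) (-1 * \sum_i h i k y).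
      by rewrite RintegralZl// mulN1r.
    apply: le_Rintegral => //; first exact: (integrableZl _ _ iS').
    move=> y /sub /=; rewrite in_itv /= => ty.
    have o1 := out y ty.
    have [l l0 lE] := chi_scale Q r0 (xl y).
    have o2 : 0 <= \sum_i zl i y * F y i 0.
      have : 0 <= qform Q (chi Q r (xl y)) (F y) by rewrite lE qformZl mulr_ge0.
      by rewrite (qformE sQ).
    rewrite mulN1r lerNl -subr_ge0 opprK; apply: (le_trans o2).
    rewrite -big_split /=; apply: ler_sum => i _.
    have : - ((z i n k - zl i y) * F y i 0) <= h i k y.
      by rewrite /h -normrM -normrN ler_norm.
    lra.
  apply: (@le_trans _ _ (\sum_(k < n.+1) - \sum_i \int[mu]_(y in `]g k, g k.+1]) h i k y)); last exact: ler_sum.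
  rewrite sumrN lerN2 exchange_big /=.
  apply: (@le_trans _ _ (\sum_(i < d) psi / D1)); first by apply: ler_sum => i _; exact: h1.
  rewrite sumr_const card_ord -mulr_natr -mulrA ler_piMr ?(ltW psi0)//.
  by rewrite ler_pdivrMl// mulr1 ler_nat.
rewrite exchange_big /=.
apply: (@le_trans _ _ (\sum_(i < d) psi / D1)); last first.
  rewrite sumr_const card_ord -mulr_natr -mulrA ler_piMr ?(ltW psi0)//.
  by rewrite ler_pdivrMl// mulr1 ler_nat.
apply: ler_sum => i _; pose G k := \int[mu]_(y in `]g k, g k.+1]) `|F y i 0|.
have iaF : mu.-integrable `]t, u] (EFin \o (fun y => `|F y i 0|)) by exact: (integrable_abse (iFtu' i)).
apply: (@le_trans _ _ (\sum_(k < n.+1) psi / D1 / (K i + 1) * G k)).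
  apply: ler_sum => k _; rewrite -real_normK ?num_real// expr2.
  have G1 : `|incr dd (g k) (g k.+1) s i 0| <= G k.
    rewrite incE (le_trans (le_normr_Rintegral _ _))//; first exact: cellS.
    exact: (mono _ (fun y => `|F y i 0|)).
  by apply: ler_pM => //; rewrite (le_trans G1)//; exact: h2.
rewrite -mulr_sumr /G (@Rintegral_cells _ _ _ n.+1)//; last by rewrite /g grid0 gridn.
have -> : \int[mu]_(y in `]g 0%N, g n.+1]) `|F y i 0| = K i by rewrite /g grid0 gridn.
by rewrite -mulrA ler_piMr ?(ltW e0)// mulrC ler_pdivrMr ?mul1r ?lerDl// ltr_wpDl.
Unshelve. all: by end_near. Qed.

End drift.

(** * Approximation by an initial event *)

Section density.
Context {R : realType} {dO : measure_display} {Omega : measurableType dO}.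
Variables (P : probability Omega R) (Ft : R -> set (set Omega)).
Hypothesis hFt : usual_filtration P Ft.

Definition Ft_infty : set (set Omega) := <<s \bigcup_k Ft k%:R >>.

Lemma Ft_inftyP A : Ft_infty A <-> measurable (A : set (g_sigma_algebraType (\bigcup_k Ft k%:R))).
Proof. by []. Qed.

Lemma Ft_infty_measurable A : Ft_infty A -> measurable A.
Proof.
apply: smallest_sub; last by move=> B [k _]; exact: (Ft_measurable hFt (ler0n R k)).
by split=> [|B mB|F mF]; [exact: measurable0|rewrite setTD; exact: measurableC|exact: bigcupT_measurable].
Qed.

Lemma Ft_sub_infty (t : R) A : 0 <= t -> Ft t A -> Ft_infty A.
Proof.
move=> t0 FA; apply: sub_gen_smallest; exists (Num.bound t) => //.
by apply: (Ft_mono hFt t0 _ FA); apply/ltW/archi_boundP.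
Qed.

Definition nearly (A : set Omega) := measurable A /\ forall e : R, 0 < e ->
  exists k (B : set Omega), Ft k%:R B /\ Pr P (A `\` B) + Pr P (B `\` A) < e.

(** The approximable events form a sigma-algebra. A countable union is first cut to [m] sets at cost
    [e / 2]; these are then treated with equal shares [e / 2 / m.+1], the spare share providing the
    strict inequality for the empty union. *)
Lemma nearly_infty A : Ft_infty A -> nearly A.
Proof.
apply: smallest_sub; last first.
  move=> B [k _ FB]; split; first exact: (Ft_measurable hFt (ler0n R k)).
  by move=> e e0; exists k, B; split=> //; rewrite !setDv /Pr measure0 addr0.
split.
- split; first exact: measurable0.
  move=> e e0; exists 0%N, set0; split; last by rewrite !setDv /Pr measure0 addr0.
  by apply/(FtP hFt).
- move=> B [mB hB]; rewrite setTD; split; first exact: measurableC.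
  move=> e e0; have [k [B' [FB' h]]] := hB e e0; exists k, (~` B'); split.
    by apply/(FtP hFt) => //; apply: measurableC; exact/(FtP hFt).
  have -> : ~` B `\` ~` B' = B' `\` B by rewrite setDE setCK setIC -setDE.
  have -> : ~` B' `\` ~` B = B `\` B' by rewrite setDE setCK setIC -setDE.
  by rewrite addrC.
move=> F hF; have mF i : measurable (F i) by have [] := hF i.
have mU : measurable (\bigcup_i F i) by exact: bigcupT_measurable.
split=> // e e0.
pose Fm m := \bigcup_(i in [set i | (i < m)%N]) F i.
have mFm m : measurable (Fm m) by apply: bigcup_measurable.
have : Pr P ((\bigcup_i F i) `\` Fm m) @[m --> \oo] --> 0.
  apply: Pr_cvg0; first by move=> m; exact: measurableD.
  move=> w; have [[i _ Fw]|nF] := pselect ((\bigcup_i F i) w); last by apply: nearW => m [].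
  near=> m; move=> [_]; apply; exists i => //=; near: m; exact: nbhs_infty_gt.
move=> cv; have e2 : 0 < e / 2 by rewrite divr_gt0.
have /filter_ex[m hm] : \forall m \near \oo, Pr P ((\bigcup_i F i) `\` Fm m) < e / 2.
  exact: (cvgr_lt _ cv).
have ap : forall l : nat, exists k (B : set Omega), Ft k%:R B /\ Pr P (Fm l `\` B) + Pr P (B `\` Fm l) < l%:R * (e / 2 / m.+1%:R) + e / 2 / m.+1%:R.
  elim=> [|l [k [B [FB hB]]]].
    exists 0%N, set0; split; first by apply/(FtP hFt).
    have -> : Fm 0%N = set0 by apply/seteqP; split=> w; case.
    by rewrite setDv /Pr measure0 addr0 mul0r add0r !divr_gt0.
  have [k' [B' [FB' hB']]] := proj2 (hF l) (e / 2 / m.+1%:R) (divr_gt0 e2 (ltr0Sn R m)).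
  exists (maxn k k'), (B `|` B'); split.
    apply/(FtP hFt) => //; apply: measurableU; apply/(FtP hFt) => //.
      by apply: (Ft_mono hFt _ _ FB); rewrite ?ler0n// ler_nat leq_maxl.
    by apply: (Ft_mono hFt _ _ FB'); rewrite ?ler0n// ler_nat leq_maxr.
  have FmS : Fm l.+1 = Fm l `|` F l.
    apply/seteqP; split=> w.
      move=> [i /=]; rewrite ltnS leq_eqVlt => /orP[/eqP -> Fw|il Fw]; first by right.
      by left; exists i.
    by move=> [[i /= il Fw]|Fw]; [exists i => //=; exact: ltnW|exists l => //=].
  have mB := Ft_measurable hFt (ler0n R k) FB; have mB' := Ft_measurable hFt (ler0n R k') FB'.
  have h1 : Pr P (Fm l.+1 `\` (B `|` B')) <= Pr P (Fm l `\` B) + Pr P (F l `\` B').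
    apply: le_trans (PrU_le P (measurableD (mFm l) mB) (measurableD (mF l) mB')).
    apply: le_Pr; [by apply: measurableD => //; exact: measurableU|by apply: measurableU; exact: measurableD|].
    by rewrite FmS => w [[h|h] nB]; [left|right]; split=> // Bw; apply: nB; [left|right].
  have h2 : Pr P ((B `|` B') `\` Fm l.+1) <= Pr P (B `\` Fm l) + Pr P (B' `\` F l).
    apply: le_trans (PrU_le P (measurableD mB (mFm l)) (measurableD mB' (mF l))).
    apply: le_Pr; [by apply: measurableD => //; exact: measurableU|by apply: measurableU; exact: measurableD|].
    by rewrite FmS => w [[h|h] nF]; [left|right]; split=> // Bw; apply: nF; [left|right].
  by rewrite -natr1 mulrDl mul1r; set z := e / 2 / m.+1%:R in hB hB' *; lra.
have [k [B [FB hB]]] := ap m; exists k, B; split=> //.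
have mB := Ft_measurable hFt (ler0n R k) FB.
have h1 : Pr P ((\bigcup_i F i) `\` B) <= Pr P ((\bigcup_i F i) `\` Fm m) + Pr P (Fm m `\` B).
  apply: le_trans (PrU_le P (measurableD mU (mFm m)) (measurableD (mFm m) mB)).
  apply: le_Pr; [exact: measurableD|by apply: measurableU; exact: measurableD|].
  by move=> w [Uw nB]; have [h|h] := pselect (Fm m w); [right|left].
have h2 : Pr P (B `\` \bigcup_i F i) <= Pr P (B `\` Fm m).
  apply: le_Pr; [exact: measurableD|exact: measurableD|].
  by move=> w [Bw nU]; split=> // -[i _ Fw]; apply: nU; exists i.
have h3 : m%:R * (e / 2 / m.+1%:R) + e / 2 / m.+1%:R = e / 2.
  rewrite -{2}[e / 2 / m.+1%:R]mul1r -mulrDl natr1 mulrC divfK//.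
by rewrite h3 in hB; lra.
Unshelve. all: by end_near. Qed.

(* The F_infty-measurable hull of a non-negligible set is almost filled by an
   event of some F_t, so that t can be treated as an initial time at which J is
   almost certain. *)
Lemma density (J : set Omega) (eta : R) (n0 : nat) : ~ P.-negligible J -> 0 < eta ->
  exists (t : nat) (B : set Omega), [/\ (n0 <= t)%N, Ft t%:R B, 0 < Pr P B &
    forall phi : nat -> set Omega, (forall n, Ft_infty (phi n)) ->
      (forall w, J w -> \forall n \near \oo, phi n w) ->
      \forall n \near \oo, Pr P (B `\` phi n) <= eta * Pr P B].
Proof.
move=> nJ eta0.
pose S := [set x : R | exists2 Q, Ft_infty Q /\ J `<=` Q & x = Pr P Q].
have S0 : S !=set0 by exists (Pr P setT), setT => //; split=> //; apply/Ft_inftyP; exact: measurableT.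
have lbS : lbound S 0 by move=> _ [Q _ ->]; exact: Pr_ge0.
have hS : has_inf S by split=> //; exists 0.
have /choice[Qk hQk] : forall k : nat, exists Q, [/\ Ft_infty Q, J `<=` Q & Pr P Q < inf S + k.+1%:R^-1].
  move=> k; have k0 : 0 < k.+1%:R^-1 :> R by rewrite invr_gt0.
  by have [_ [Q [FQ JQ] ->] h] := inf_adherent k0 hS; exists Q.
(* An envelope of least probability: any [Ft_infty] event containing [J] contains [Jh] up to a null
   set. [J] itself may fail to be measurable. *)
pose Jh := \bigcap_k Qk k.
have FJh : Ft_infty Jh.
  by apply/Ft_inftyP; apply: bigcapT_measurable => k; apply/Ft_inftyP; have [] := hQk k.
have mJh := Ft_infty_measurable FJh.
have JJh : J `<=` Jh by move=> w Jw k _; have [_ h _] := hQk k; exact: h.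
have PJh : Pr P Jh <= inf S.
  apply/ler_addgt0Pr => e e0; have [k hk] := div_natS_lt 1 e0; rewrite div1r in hk.
  have [FQ _ h] := hQk k; apply: (@le_trans _ _ (Pr P (Qk k))).
    by apply: le_Pr => //; [exact: Ft_infty_measurable|move=> w; exact].
  by rewrite (le_trans (ltW h))// lerD2l ltW.
have minJ Q : Ft_infty Q -> J `<=` Q -> Pr P (Jh `\` Q) = 0.
  move=> FQ JQ; have mQ := Ft_infty_measurable FQ.
  have : inf S <= Pr P (Jh `&` Q).
    apply: ge_inf; first by exists 0.
    exists (Jh `&` Q) => //; split; last by move=> w Jw; split; [exact: JJh|exact: JQ].
    by apply/Ft_inftyP; apply: measurableI; exact/Ft_inftyP.
  have := PrDI P mJh mQ; have := Pr_ge0 P (Jh `\` Q).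
  by move=> h1 h2 h3; apply/eqP; rewrite eq_le h1 andbT; lra.
have J0 : 0 < Pr P Jh.
  rewrite lt_def Pr_ge0 andbT; apply/eqP => Jh0; apply: nJ; exists Jh; split=> //.
  by rewrite (PrE P mJh) Jh0.
(* The bound 1/4 gives [Pr P Jh <= 2 * Pr P B]; then the two errors, each at most
   [eta / 8 * Pr P Jh], stay below [eta * Pr P B]. *)
pose e := Num.min (eta / 8) (1 / 4) * Pr P Jh.
have m0 : 0 < Num.min (eta / 8) (1 / 4 : R) by rewrite lt_min !divr_gt0.
have e0 : 0 < e by rewrite mulr_gt0.
have [_ /(_ e e0)[k [B [FB hB]]]] := nearly_infty FJh.
have mB := Ft_measurable hFt (ler0n R k) FB.
have e1 : e <= eta / 8 * Pr P Jh by rewrite ler_wpM2r ?Pr_ge0// ge_min lexx.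
have e2 : e <= 1 / 4 * Pr P Jh by rewrite ler_wpM2r ?Pr_ge0// ge_min lexx orbT.
have p1 := Pr_ge0 P (Jh `\` B); have p2 := Pr_ge0 P (B `\` Jh).
have B1 : Pr P Jh <= Pr P B + Pr P (Jh `\` B).
  have := PrDI P mJh mB; have : Pr P (Jh `&` B) <= Pr P B.
    by apply: le_Pr => //; exact: measurableI.
  by lra.
exists (maxn n0 k), B; split.
- exact: leq_maxl.
- by apply: (Ft_mono hFt _ _ FB); rewrite ?ler0n// ler_nat leq_maxr.
- lra.
move=> phi Fphi Jphi.
have mphi n := Ft_infty_measurable (Fphi n).
(* The lower limit of the events [phi n] contains [J], hence almost all of [Jh]. *)
pose psi := \bigcup_m \bigcap_(n in [set n | (m <= n)%N]) phi n.
have Fpsi : Ft_infty psi.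
  by apply/Ft_inftyP; apply: bigcupT_measurable => m; apply: bigcap_measurableType => n _; exact: Fphi.
have Jpsi : J `<=` psi.
  by move=> w /Jphi[m _ hm]; exists m => // n /= mn; exact: hm.
have mpsi := Ft_infty_measurable Fpsi.
have cv : Pr P (psi `\` phi n) @[n --> \oo] --> 0.
  apply: Pr_cvg0; first by move=> n; exact: measurableD.
  move=> w; have [[m _ hm]|npsi] := pselect (psi w); last by apply: nearW => n [].
  near=> n; move=> [_]; apply; apply: hm => /=; near: n; exact: nbhs_infty_ge.
have : \forall n \near \oo, Pr P (psi `\` phi n) < e by exact: (cvgr_lt _ cv).
apply: filterS => n hn.
have h : Pr P (B `\` phi n) <= Pr P (B `\` Jh) + (Pr P (Jh `\` psi) + Pr P (psi `\` phi n)).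
  have mD := measurableD mJh mpsi; have mD' := measurableD mpsi (mphi n).
  apply: (@le_trans _ _ (Pr P (B `\` Jh) + Pr P ((Jh `\` psi) `|` (psi `\` phi n)))); last first.
    by rewrite lerD2l; exact: PrU_le.
  apply: le_trans (PrU_le P (measurableD mB mJh) (measurableU _ _ mD mD')).
  apply: le_Pr; [exact: measurableD|by apply: measurableU; [exact: measurableD|exact: measurableU]|].
  move=> w [Bw nphi]; have [Jw|nJw] := pselect (Jh w); last by left.
  by right; have [pw|npw] := pselect (psi w); [right|left].
rewrite minJ// add0r in h.
have : eta / 8 * Pr P Jh <= eta / 8 * (2 * Pr P B) by rewrite ler_wpM2l ?divr_ge0 ?ltW//; lra.
have : 0 <= eta * Pr P B by rewrite mulr_ge0 ?Pr_ge0// ltW.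
lra.
Unshelve. all: by end_near. Qed.

End density.

(** * Returning to the origin *)

Section return_path.
Context {R : realType} {d : nat}.
Variables (Q : 'M[R]_d) (c : R).
Hypotheses (sQ : Q^T = Q) (c0 : 0 < c)
  (hQ : forall x : 'cV[R]_d, c * \sum_i x i 0 ^+ 2 <= qform Q x x <= \sum_i x i 0 ^+ 2).
Variable r : R.
Hypothesis r0 : 0 < r.
Local Notation q := (qform Q).
Local Notation nq x := (qform Q x x).

(* By convexity of [huber], a path leaving the ball of radius r and coming back
   to the origin is pushed back by the martingale part. *)
Lemma return_push (x m v dd : R -> 'cV[R]_d) (x0 : 'cV[R]_d) (g : nat -> R) (n : nat) (t u b psi e2 : R) (j : nat) :
  {homo g : i j / (i <= j)%N >-> i <= j} -> g 0%N = t -> g n = u ->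
  (forall s, t <= s -> x s = x0 + m s + v s + dd s) ->
  (j < n)%N -> r ^+ 2 < nq (x (g j)) -> nq (x u) <= e2 ->
  \sum_(k < n) \sum_i `|incr v (g k) (g k.+1) u i 0| <= b ->
  - psi <= \sum_(k < n) Num.min 0 (q (chi Q r (x (g k))) (incr dd (g k) (g k.+1) u)) ->
  2^-1 * e2 + psi + r * b <= 4^-1 * r ^+ 2 ->
  \sum_(k < n | (j <= k)%N) q (chi Q r (x (g k))) (m (g k.+1) - m (g k)) <= - (4^-1 * r ^+ 2).
Proof.
move=> gm g0 gn xE jn rj xu hv hpsi small.
have gt k : t <= g k by rewrite -g0 gm.
have gu k : (k <= n)%N -> g k <= u by rewrite -gn; exact: gm.
have incrE f (k : 'I_n) : incr f (g k) (g k.+1) u = f (g k.+1) - f (g k).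
  by rewrite /incr !min_l// gu// ltnW.
have tele : \sum_(k < n | (j <= k)%N) (huber Q r (x (g k.+1)) - huber Q r (x (g k))) = huber Q r (x u) - huber Q r (x (g j)).
  rewrite -(big_mkord (fun k => (j <= k)%N) (fun k => huber Q r (x (g k.+1)) - huber Q r (x (g k)))).
  rewrite (big_cat_nat (n := j)) ?(ltnW jn)//= big_nat_cond big1 ?add0r; last first.
    by move=> i /andP[/andP[_ ij] ji]; move: (leq_ltn_trans ji ij); rewrite ltnn.
  rewrite big_nat_cond (eq_bigl (fun k => (j <= k < n)%N)); last first.
    by move=> k; rewrite andbAC andbb.
  by rewrite -big_nat telescope_sumr ?(ltnW jn)// gn.
have step (k : 'I_n) : (j <= k)%N -> 2 * q (chi Q r (x (g k))) (m (g k.+1) - m (g k)) <=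
   (huber Q r (x (g k.+1)) - huber Q r (x (g k))) + 2 * (r * \sum_i `|incr v (g k) (g k.+1) u i 0|)
   - 2 * Num.min 0 (q (chi Q r (x (g k))) (incr dd (g k) (g k.+1) u)).
  move=> _; have h1 := huber_convex sQ c0 hQ r0 (x (g k)) (x (g k.+1)).
  have e : x (g k.+1) - x (g k) = (m (g k.+1) - m (g k)) + (incr v (g k) (g k.+1) u + incr dd (g k) (g k.+1) u).
    by rewrite !incrE !xE//; apply/matrixP => a1 a2; rewrite !mxE; ring.
  have split3 (x' y z : 'cV[R]_d) l : q l (x' + (y + z)) = q l x' + (q l y + q l z) by rewrite !qformDr.
  rewrite e split3 in h1.
  have h2 := qform_chi_le sQ c0 hQ r0 (x (g k)) (incr v (g k) (g k.+1) u).
  have h3 := ler_norm (- q (chi Q r (x (g k))) (incr v (g k) (g k.+1) u)); rewrite normrN in h3.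
  have h4 : Num.min 0 (q (chi Q r (x (g k))) (incr dd (g k) (g k.+1) u)) <= q (chi Q r (x (g k))) (incr dd (g k) (g k.+1) u).
    by rewrite ge_min lexx orbT.
  lra.
have h : \sum_(k < n | (j <= k)%N) 2 * q (chi Q r (x (g k))) (m (g k.+1) - m (g k)) <=
   \sum_(k < n | (j <= k)%N) ((huber Q r (x (g k.+1)) - huber Q r (x (g k))) + 2 * (r * \sum_i `|incr v (g k) (g k.+1) u i 0|)
   - 2 * Num.min 0 (q (chi Q r (x (g k))) (incr dd (g k) (g k.+1) u))) by apply: ler_sum.
rewrite sumrB big_split /= tele -!mulr_sumr in h.
have hv' : \sum_(k < n | (j <= k)%N) \sum_i `|incr v (g k) (g k.+1) u i 0| <= b.
  by apply: le_trans hv; rewrite [leRHS](bigID (fun k : 'I_n => (j <= k)%N)) /= lerDl sumr_ge0// => k _; rewrite sumr_ge0.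
have hd' : - psi <= \sum_(k < n | (j <= k)%N) Num.min 0 (q (chi Q r (x (g k))) (incr dd (g k) (g k.+1) u)).
  apply: (le_trans hpsi); rewrite [leLHS](bigID (fun k : 'I_n => (j <= k)%N)) /= gerDl sumr_le0// => k _.
  by rewrite ge_min lexx.
have h5 := huber_ge_sqr c0 hQ r0 rj; have h6 := huber_le c0 hQ r (x u).
have h7 : r * \sum_(k < n | (j <= k)%N) \sum_i `|incr v (g k) (g k.+1) u i 0| <= r * b by rewrite ler_wpM2l// ltW.
lra.
Qed.

End return_path.

Section return_estimate.
Context {R : realType} {dO : measure_display} {Omega : measurableType dO}.
Variables (P : probability Omega R) (Ft : R -> set (set Omega)).
Hypothesis hFt : usual_filtration P Ft.
Variables (d : nat) (Q : 'M[R]_d) (c : R).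
Hypotheses (sQ : Q^T = Q) (c0 : 0 < c)
  (hQ : forall x : 'cV[R]_d, c * \sum_i x i 0 ^+ 2 <= qform Q x x <= \sum_i x i 0 ^+ 2).
Variable r : R.
Hypothesis r0 : 0 < r.
Variables X M V D : R -> Omega -> 'cV[R]_d.
Variable A : 'I_d -> R -> Omega -> R.
Hypotheses (aX : forall i, adapted Ft (fun s w => X s w i 0))
  (hM : forall i, locally_square_integrable_martingale P Ft (fun s w => M s w i 0))
  (hA : forall i, is_predictable_qv P Ft (fun s w => M s w i 0) (A i))
  (XE : forall s w, 0 <= s -> X s w = X 0 w + M s w + V s w + D s w).
Variables (t u b psi e2 a : R) (g : nat -> R) (n : nat) (B : set Omega).
Hypotheses (t0 : 0 < t) (tu : t <= u)
  (gm : {homo g : i j / (i <= j)%N >-> i <= j}) (g0 : g 0%N = t) (gn : g n = u) (a0 : 0 < a)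
  (FB : Ft t B) (small : 2^-1 * e2 + psi + r * b <= 4^-1 * r ^+ 2).

Definition far k w := [exists j : 'I_n, (j <= k)%N && (r ^+ 2 < qform Q (X (g j) w) (X (g j) w))].

Let gt k : t <= g k. Proof. by rewrite -g0 gm. Qed.
Let gp k : 0 <= g k. Proof. exact: le_trans (ltW t0) (gt k). Qed.

Let far_Ft k : Ft (g k) (B `&` [set w | far k w]).
Proof.
apply: (FtI hFt (gp k)); first exact: (Ft_mono hFt (ltW t0) (gt k) FB).
rewrite (_ : [set w | _] = \bigcup_(j in [set j : 'I_n | (j <= k)%N]) [set w | r ^+ 2 < qform Q (X (g j) w) (X (g j) w)]).
  apply/(FtP hFt _ (gp k)); apply: fin_bigcup_measurable; first exact: finite_finset.
  move=> j jk; rewrite -[X in measurable X]setTI.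
  rewrite (_ : [set w | _] = (fun w => \sum_i (\sum_l Q i l * X (g j) w l 0) * X (g j) w i 0) @^-1` `]r ^+ 2, +oo[); last first.
    by apply/seteqP; split=> w /=; rewrite in_itv /= andbT (nqE sQ).
  have mX i := adapted_measurable hFt (aX i) (gp j) (gm jk).
  suff h : measurable_fun [set: g_sigma_algebraType (Ft (g k))] (fun w => \sum_i (\sum_l Q i l * X (g j) w l 0) * X (g j) w i 0) by exact: h.
  apply: measurable_sum => i; apply: measurable_funM => //.
  by apply: measurable_sum => l; apply: measurable_funM.
apply/seteqP; split=> w.
  by move=> /existsP[j /andP[jk h]]; exists j.
by move=> [j jk h]; apply/existsP; exists j; rewrite h andbT.
Qed.

(** Half the gradient of the Huber function, switched on from the first grid point outside the ball,
    and divided by [r] so as to be at most 1 in absolute value. *)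
Let coef i k w : R := (Q *m chi Q r (X (g k) w)) i 0 / r * \1_(B `&` [set w | far k w]) w.

Let coef_wrt i k : measurable_wrt (Ft (g k)) (coef i k).
Proof.
apply: (mul_measurable_wrt (Ft_sigma hFt (gp k))).
  apply/(measurable_wrtP (Ft_sigma hFt (gp k))); apply: measurable_funM => //.
  apply: (measurable_mulmx_chi sQ r0 (T := g_sigma_algebraType (Ft (g k)))) => j.
  exact: (adapted_measurable hFt (aX j) (gp k) (lexx _)).
apply/(measurable_wrtP (Ft_sigma hFt (gp k))); apply: measurable_indic.
exact: (proj1 (FtP hFt _ (gp k)) (far_Ft k)).
Qed.

Let far_sub k : B `&` [set w | far k w] `<=` B `&` [set w | far n w].
Proof.
move=> w [Bw /existsP[j /andP[_ h]]]; split=> //; apply/existsP; exists j.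
by rewrite h andbT ltnW.
Qed.

Let coef_le i k w : `|coef i k w| <= \1_(B `&` [set w | far n w]) w.
Proof.
rewrite /coef normrM normf_div (ger0_norm (ltW r0)).
have h1 : `|(Q *m chi Q r (X (g k) w)) i 0| / r <= 1.
  by rewrite ler_pdivrMr// mul1r; exact: (mulmx_chi_le sQ c0 hQ r0).
have [kw|kw] := pselect ((B `&` [set w | far k w]) w).
  rewrite !indicE !mem_set//; last exact: (far_sub kw).
  by rewrite normr1 mulr1.
by rewrite [X in _ * `|X|]indicE memNset// normr0 mulr0 indicE ler0n.
Qed.

Lemma Pr_bigsetU_le (I : Type) (s : seq I) (F : I -> set Omega) : (forall i, measurable (F i)) ->
  measurable (\big[setU/set0]_(i <- s) F i) /\ Pr P (\big[setU/set0]_(i <- s) F i) <= \sum_(i <- s) Pr P (F i).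
Proof.
move=> mF; elim: s => [|i s [m IH]]; first by rewrite !big_nil /Pr measure0; split=> //; exact: measurable0.
rewrite !big_cons; split; first exact: measurableU.
by rewrite (le_trans (PrU_le P (mF i) m))// lerD2l.
Qed.

(** A return forces the transforms of the coordinates of M to sum to at most [- r / 4], so one of
    them reaches [lam = r / (4 * d.+1)] in absolute value. The constant collects [16 * d.+1 ^+ 2]
    from [lam ^+ 2], 2 from Lenglart's inequality and at most [d.+1] from the union over the
    coordinates. *)
Lemma return_estimate : exists W : set Omega, [/\ Ft u W,
  r ^+ 2 * Pr P W <= 32 * d.+1%:R ^+ 3 * a * Pr P (B `&` [set w | far n w]) &
  forall w, B w -> far n w -> qform Q (X u w) (X u w) <= e2 ->
    \sum_(k < n) \sum_i `|incr (V ^~ w) (g k) (g k.+1) u i 0| <= b ->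
    - psi <= \sum_(k < n) Num.min 0 (qform Q (chi Q r (X (g k) w)) (incr (D ^~ w) (g k) (g k.+1) u)) ->
    (forall i, A i u w - A i t w <= a) -> W w].
Proof.
have u0 : 0 <= u by rewrite (le_trans (ltW t0)).
have gu k : (k <= n)%N -> g k <= u by rewrite -gn; exact: gm.
pose D1 : R := d.+1%:R; have D10 : 0 < D1 by rewrite ltr0n.
pose lam := r / (4 * D1); have lam0 : 0 < lam by rewrite divr_gt0// mulr_gt0.
pose S i w := \sum_(k < n) coef i k w * (M (g k.+1) w i 0 - M (g k) w i 0).
pose Wi i := [set w | lam <= `|S i w|] `&` [set w | A i u w - A i t w <= a].
pose G := B `&` [set w | far n w].
have mG : measurable G by exact: (Ft_measurable hFt (gp n) (far_Ft n)).
have FWi i : Ft u (Wi i).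
  have [_ aM _] := hM i; have aAi := adapted_qv hFt (hM i) (hA i).
  apply: (FtI hFt u0).
    apply/(FtP hFt _ u0); rewrite -[X in measurable X]setTI.
    rewrite (_ : [set w | _] = (fun w => `|S i w|) @^-1` `[lam, +oo[); last first.
      by apply/seteqP; split=> w /=; rewrite in_itv /= andbT.
    suff h : measurable_fun [set: g_sigma_algebraType (Ft u)] (fun w => `|S i w|) by exact: h.
    apply: (measurableT_comp (@normr_measurable R setT)) => //.
    apply: measurable_sum => k; apply: measurable_funM.
      apply/(measurable_wrtP (Ft_sigma hFt u0)) => C mC.
      by apply: (Ft_mono hFt (gp k) (gu k (ltnW (ltn_ord k)))); exact: coef_wrt.
    by apply: measurable_funB; apply: (adapted_measurable hFt aM (gp _)); apply: gu => //; exact: ltnW.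
  apply/(FtP hFt _ u0); rewrite -[X in measurable X]setTI.
  rewrite (_ : [set w | _] = (fun w => A i u w - A i t w) @^-1` `]-oo, a]); last first.
    by apply/seteqP; split=> w /=; rewrite in_itv.
  suff h : measurable_fun [set: g_sigma_algebraType (Ft u)] (fun w => A i u w - A i t w) by exact: h.
  by apply: measurable_funB; apply: (adapted_measurable hFt aAi) => //; exact: ltW.
have PWi i : lam ^+ 2 * Pr P (Wi i) <= 2 * a * Pr P G.
  exact: (transform_bound hFt (hM i) (hA i) t0 tu gm g0 gn (coef_wrt i) (coef_le i) mG a0 lam0).
have FW : Ft u (\big[setU/set0]_i Wi i).
  by apply/(FtP hFt _ u0); apply: bigsetU_measurable => i _; exact: (proj1 (FtP hFt _ u0) (FWi i)).
exists (\big[setU/set0]_i Wi i); split=> //.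
- have mWi i : measurable (Wi i) by exact: (Ft_measurable hFt u0 (FWi i)).
  have [_ le1] := Pr_bigsetU_le (index_enum 'I_d) mWi.
  have le2 : lam ^+ 2 * Pr P (\big[setU/set0]_i Wi i) <= D1 * (2 * a * Pr P G).
    apply: (@le_trans _ _ (\sum_(i < d) (2 * a * Pr P G))).
      apply: (@le_trans _ _ (lam ^+ 2 * \sum_i Pr P (Wi i))); first by rewrite ler_wpM2l// sqr_ge0.
      by rewrite mulr_sumr; apply: ler_sum.
    rewrite sumr_const card_ord -[leLHS]mulr_natl ler_wpM2r ?ler_nat//.
    by rewrite mulr_ge0 ?Pr_ge0// mulr_ge0// ltW.
  have -> : r ^+ 2 = 16 * D1 ^+ 2 * lam ^+ 2 by rewrite /lam; field; rewrite gt_eqF.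
  rewrite -mulrA (_ : 32 * _ * a * _ = 16 * D1 ^+ 2 * (D1 * (2 * a * Pr P G))); last first.
    by rewrite -/D1 -/G; ring.
  by rewrite ler_wpM2l// mulr_ge0// sqr_ge0.
move=> w Bw fw Xu hv hpsi hAw.
have : exists j, (j < n)%N && (r ^+ 2 < qform Q (X (g j) w) (X (g j) w)).
  by move: fw => /existsP[j /andP[_ h]]; exists j; rewrite ltn_ord.
move=> ex; case: (ex_minnP ex) => j /andP[jn hj] jmin.
have xE s : t <= s -> X s w = X 0 w + M s w + V s w + D s w.
  by move=> ts; apply: XE; exact: le_trans (ltW t0) ts.
have := return_push sQ c0 hQ r0 gm g0 gn xE jn hj Xu hv hpsi small.
have farE (k : 'I_n) : far k w = (j <= k)%N.
  apply/existsP/idP => [[l /andP[lk h]]|jk].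
    by apply: leq_trans lk; apply: jmin; rewrite ltn_ord h.
  by exists (Ordinal jn); rewrite jk hj.
have -> : \sum_(k < n | (j <= k)%N) qform Q (chi Q r (X (g k) w)) (M (g k.+1) w - M (g k) w) = r * \sum_i S i w.
  rewrite /S exchange_big /= mulr_sumr big_mkcond /=; apply: eq_bigr => k _.
  have iE : \1_(B `&` [set w | far k w]) w = (j <= k)%N%:R :> R.
    by rewrite indicE in_setI mem_set// -farE in_setb.
  rewrite (qformE sQ) mulr_sumr; case: ifP => jk.
    apply: eq_bigr => i _; rewrite /coef iE jk mulr1 !mxE mulrA mulrCA divff ?gt_eqF// mulr1//.
  by rewrite big1// => i _; rewrite /coef iE jk mulr0 mul0r mulr0.
move=> hS.
(* Pigeonhole; [lam] has [d.+1] in its denominator, so [d] smaller terms fall strictly short. *)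
have [i hi] : exists i, lam <= `|S i w|.
  apply: contrapT => nex.
  have h1 : \sum_i - S i w <= \sum_(i < d) lam.
    apply: ler_sum => i _; rewrite leNgt; apply/negP => h; apply: nex; exists i.
    by rewrite (le_trans (ltW h))// -normrN ler_norm.
  rewrite sumrN sumr_const card_ord -mulr_natl in h1.
  have h2 : r * (d%:R * lam) < r * (r / 4).
    have -> : r / 4 = D1 * lam by rewrite /lam; field; rewrite gt_eqF.
    by rewrite ltr_pM2l// ltr_pM2r// ltr_nat.
  have h3 : r * - (\sum_i S i w) <= r * (d%:R * lam) by rewrite ler_wpM2l// ltW.
  have r2 : 0 < r ^+ 2 by rewrite exprn_gt0.
  nra.
by rewrite (bigD1 i)//=; left; split=> //; exact: hAw.
Qed.

End return_estimate.

(** * The two estimates combined *)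

Section crossing.
Context {R : realType} {dO : measure_display} {Omega : measurableType dO}.
Variables (P : probability Omega R) (Ft : R -> set (set Omega)).
Hypothesis hFt : usual_filtration P Ft.

Lemma measurable_stop (T : Omega -> \bar R) (G : set Omega) (t : R) :
  stopping_time Ft T -> measurable G -> (forall w, G w -> (T w < +oo)%E) ->
  measurable_fun setT (fun w => if w \in G then fine (T w) else t).
Proof.
move=> stT mG GT; have [T0 _] := stT.
apply: (measurability _ (RGenInftyO.measurableE R)) => _ [_ [x ->] <-].
rewrite setTI (_ : _ @^-1` _ = (G `&` [set w | (T w < x%:E)%E]) `|` (~` G `&` [set w | t < x])); last first.
  apply/seteqP; split=> w /=; rewrite in_itv /=; have [Gw|nG] := pselect (G w).
  - rewrite mem_set// => h; left; split=> //; move: h (T0 w) (GT w Gw).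
    by case: (T w) => [y| |]//=; rewrite lte_fin.
  - by rewrite memNset// => h; right.
  - rewrite mem_set// => -[[_ h]|[//]]; move: h (T0 w) (GT w Gw).
    by case: (T w) => [y| |]//=; rewrite lte_fin.
  - by rewrite memNset// => -[[//]|[]].
apply: measurableU; apply: measurableI => //.
- have [x0|x0] := leP 0 x; first exact: (Ft_measurable hFt x0 (stopping_lt hFt stT x0)).
  rewrite (_ : [set w | _] = set0); first exact: measurable0.
  apply/seteqP; split=> // w /= h; have := le_lt_trans (T0 w) h.
  by rewrite lte_fin ltNge ltW.
- exact: measurableC.
- by have [tx|tx] := ltP t x; [rewrite (_ : [set w | _] = setT)//|rewrite (_ : [set w | _] = set0)//]; apply/seteqP; split=> // w /=; rewrite ?tx// ltNge tx.
Qed.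

Variables (d : nat) (Q : 'M[R]_d) (c : R).
Hypotheses (sQ : Q^T = Q) (c0 : 0 < c)
  (hQ : forall x : 'cV[R]_d, c * \sum_i x i 0 ^+ 2 <= qform Q x x <= \sum_i x i 0 ^+ 2).
Variables X M V D : R -> Omega -> 'cV[R]_d.
Variable A : 'I_d -> R -> Omega -> R.
Hypotheses (cX : forall i, cadlag_process (fun s w => X s w i 0))
  (aX : forall i, adapted Ft (fun s w => X s w i 0))
  (hM : forall i, locally_square_integrable_martingale P Ft (fun s w => M s w i 0))
  (hA : forall i, is_predictable_qv P Ft (fun s w => M s w i 0) (A i))
  (cV : forall i, cadlag_process (fun s w => V s w i 0))
  (aV : forall i, adapted Ft (fun s w => V s w i 0))
  (cD : forall i, cadlag_process (fun s w => D s w i 0))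
  (aD : forall i, adapted Ft (fun s w => D s w i 0))
  (XE : forall s w, 0 <= s -> X s w = X 0 w + M s w + V s w + D s w).
Local Notation nq x := (qform Q x x).

Lemma nq_measurable s v : 0 <= s -> s <= v ->
  measurable_fun [set: g_sigma_algebraType (Ft v)] (fun w => nq (X s w)).
Proof.
move=> s0 sv; rewrite (_ : (fun w => _) = fun w => \sum_i (\sum_j Q i j * X s w j 0) * X s w i 0).
  apply: measurable_sum => i; apply: measurable_funM; last exact: (adapted_measurable hFt (aX i)).
  by apply: measurable_sum => j; apply: measurable_funM => //; exact: (adapted_measurable hFt (aX j)).
by apply/funext => w; exact: (nqE sQ).
Qed.

Lemma nq_gt_Ft s v x : 0 <= s -> s <= v -> Ft v [set w | x < nq (X s w)].
Proof.
move=> s0 sv; apply/(FtP hFt _ (le_trans s0 sv)); rewrite -[X in measurable X]setTI.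
rewrite (_ : [set w | _] = (fun w => nq (X s w)) @^-1` `]x, +oo[).
  by have := nq_measurable s0 sv; exact.
by apply/seteqP; split=> w /=; rewrite in_itv /= andbT.
Qed.

Lemma nq_lt_Ft s v x : 0 <= s -> s <= v -> Ft v [set w | nq (X s w) < x].
Proof.
move=> s0 sv; apply/(FtP hFt _ (le_trans s0 sv)); rewrite -[X in measurable X]setTI.
rewrite (_ : [set w | _] = (fun w => nq (X s w)) @^-1` `]-oo, x[).
  by have := nq_measurable s0 sv; exact.
by apply/seteqP; split=> w /=; rewrite in_itv.
Qed.

Lemma sq_jump_measurable (sig : Omega -> R) : measurable_fun setT sig -> (forall w, 0 < sig w) ->
  measurable_fun setT (fun w => sq_jump (M ^~ w) (sig w)).
Proof.
move=> ms s0; apply: measurable_sum => i; apply: measurable_funX; apply: measurable_funB.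
  apply: (measurable_at_time (Y := fun s w => M s w i 0)) => //; last by move=> w; exact: ltW.
    by have [cM _ _] := hM i.
  move=> s s0'; have [_ aM _] := hM i; exact: (measurable_wrt_fun (Ft_measurable hFt s0') (aM s s0')).
apply: (measurable_left_lim (Y := fun s w => M s w i 0)) => //.
  by have [cM _ _] := hM i.
move=> s s0'; have [_ aM _] := hM i; exact: (measurable_wrt_fun (Ft_measurable hFt s0') (aM s s0')).
Qed.

(** Rational times keep this an event; by right continuity, exceeding the level at some time of ]t,
    x[ entails exceeding it at a rational one. *)
Definition crossed (t x r : R) w := exists q : rat, [/\ t < ratr q, ratr q < x & r ^+ 2 < nq (X (ratr q) w)].

Lemma crossed_Ft t x r : 0 <= t -> t <= x -> Ft x [set w | crossed t x r w].
Proof.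
move=> t0 tx; apply/(FtP hFt _ (le_trans t0 tx)).
rewrite (_ : [set w | _] = \bigcup_(q : rat) (if t < ratr q < x then [set w | r ^+ 2 < nq (X (ratr q) w)] else set0)).
  apply: bigcupT_measurable_rat => q; case: ifP => [/andP[tq qx]|_]; last exact: measurable0.
  apply: (proj1 (FtP hFt _ (le_trans t0 tx))).
  by apply: nq_gt_Ft; [rewrite (le_trans t0)// ltW|exact: ltW].
apply/seteqP; split=> w.
  by move=> [q [tq qx h]]; exists q => //=; rewrite tq qx.
by move=> [q _]; case: ifP => // /andP[tq qx] h; exists q.
Qed.

Variables (t a C eps eta del K kd : R) (E : R -> Omega -> \bar R) (aE : adapted Ft E) (J B Gamma : set Omega).
Hypotheses (t0 : 0 < t) (a0 : 0 < a) (C1 : 1 <= C) (eps0 : 0 < eps) (eta0 : 0 < eta) (del0 : 0 < del <= 1) (K0 : 0 < K) (kd0 : 0 <= kd).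
Local Notation beta := (Pr P B).
Local Notation brk s w := (\sum_i A i s w).
Hypotheses
  (hJ0 : J `<=` Gamma)
  (hJX : forall w, J w -> forall e, 0 < e -> \forall n \near \oo, nq (X n%:R w) <= e)
  (hJA : forall w, J w -> \forall n \near \oo, a ^+ 2 <= C * (brk n%:R w - brk t w))
  (hJV : forall w, J w -> forall (g : nat -> R) n, {homo g : i j / (i <= j)%N >-> i <= j} -> g 0%N = t ->
     \sum_(k < n) \sum_i `|V (g k.+1) w i 0 - V (g k) w i 0| <= eps * a)
  (hJE : forall w, J w -> (E t w <= (C * a ^+ 2)%:E)%E)
  (hJD : forall w, J w -> forall u r psi, t < u -> 0 < r -> 0 < psi ->
     \forall n \near \oo, forall s, t <= s -> s <= u ->
    - psi <= \sum_(k < n.+1) Num.min 0 (qform Q (chi Q r (X (grid t u n.+1 k) w)) (incr (D ^~ w) (grid t u n.+1 k) (grid t u n.+1 k.+1) s)) /\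
    \sum_(k < n.+1) \sum_i (incr (D ^~ w) (grid t u n.+1 k) (grid t u n.+1 k.+1) s i 0) ^+ 2 <= psi)
  (hjump : forall (S : Omega -> \bar R) (f : Omega -> R) (B0 : set Omega),
    stopping_time Ft S -> (forall w, (t%:E < S w)%E) -> measurable_fun setT f -> (forall w, 0 <= f w) ->
    (forall w, f w = if S w is x%:E then sq_jump (M ^~ w) x else 0) ->
    Ft t B0 -> (forall w, B0 w -> (E t w <= (C * a ^+ 2)%:E)%E) ->
    exists B' N : set Omega, [/\ Ft t B', B' `<=` B0, measurable N /\ P N = 0%E,
      (B0 `\` B') `&` Gamma `<=` N &
      intg P (fun w => \1_B' w * f w) /\
      Ex P (fun w => \1_B' w * f w) <= C * a ^+ 2 * (kd * Pr P B0 + Pr P (B0 `&` [set w | (S w < +oo)%E]) / del)])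
  (FB : Ft t B)
  (dens : forall phi : nat -> set Omega, (forall n, Ft_infty Ft (phi n)) ->
      (forall w, J w -> \forall n \near \oo, phi n w) ->
      \forall n \near \oo, Pr P (B `\` phi n) <= eta * beta).

Let r := K * a.
Let r0 : 0 < r. Proof. exact: mulr_gt0. Qed.
Let B0 := B `&` [set w | (E t w <= (C * a ^+ 2)%:E)%E].
Let B2 := B0 `&` [set w | nq (X t w) < r ^+ 2].
(** In units of [a ^+ 2], the guaranteed mean growth: [c / 2] times the bracket gain 1 / C. Next,
    [L] adds up all the coefficients that multiply the exit probability in the final inequality. *)
Let th := c / (2 * C).
Let L := th + 6 * K ^+ 2 + 2 * eps ^+ 2 + 2 * eps + 2 * C / del.
Let t0' := ltW t0.

Let FB0 : Ft t B0.
Proof.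
apply: (FtI hFt t0' FB); rewrite (_ : [set w | _] = E t @^-1` `]-oo, (C * a ^+ 2)%:E]%classic).
  by apply: aE => //; exact: emeasurable_itv.
by apply/seteqP; split=> w /=; rewrite in_itv.
Qed.

Lemma dens_Ft v phi : 0 <= v -> Ft v phi -> J `<=` phi -> Pr P (B `\` phi) <= eta * beta.
Proof.
move=> v0 Fphi Jphi.
have [] // := filter_ex (dens (phi := fun=> phi) (fun=> Ft_sub_infty hFt v0 Fphi) _).
by move=> w Jw; apply: nearW => n; exact: Jphi.
Qed.

Lemma dens_ex (v : nat -> R) phi N : (forall n, 0 <= v n) -> (forall n, Ft (v n) (phi n)) ->
  (forall w, J w -> \forall n \near \oo, phi n w) ->
  exists2 n, (N <= n)%N & Pr P (B `\` phi n) <= eta * beta.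
Proof.
move=> v0 Fphi Jphi; have h := dens (fun n => Ft_sub_infty hFt (v0 n) (Fphi n)) Jphi.
have [n [h1 h2]] := filter_ex (filterI h (nbhs_infty_ge N)).
by exists n.
Qed.

Lemma PrB0 : Pr P (B `\` B0) <= eta * beta.
Proof.
rewrite (_ : B `\` B0 = B `\` [set w | (E t w <= (C * a ^+ 2)%:E)%E]); last first.
  by apply/seteqP; split=> w [Bw nh]; split=> //; [move=> h; apply: nh|case].
apply: (dens_Ft t0') => //; rewrite (_ : [set w | _] = E t @^-1` `]-oo, (C * a ^+ 2)%:E]%classic).
  by apply: aE => //; exact: emeasurable_itv.
by apply/seteqP; split=> w /=; rewrite in_itv.
Qed.

Hypotheses (hkd : 2 * C * kd <= th / 16) (heps : eps * (5 + 2 * K + 2 * eps) <= th / 16)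
  (heta : (K ^+ 2 + 2 * th) * eta <= th / 16).

(** In [exit_estimate] every error is either at most [th / 16 * beta] or a multiple of the exit
    probability. The sum of the former leaves at least [th / 4 * beta] of the growth, whence a lower
    bound on the latter. On [J] the other clauses of [exit_level] are never violated, so apart from
    probability [eta * beta] an exit is a crossing. *)
Lemma crossing_inside : 2^-1 * beta <= Pr P B2 ->
  exists2 u, t < u & (th / (4 * L) - eta) * beta <= Pr P (B `&` [set w | crossed t u r w]).
Proof.
move=> hB2.
have mB := Ft_measurable hFt t0' FB.
have FB2 : Ft t B2 by apply: (FtI hFt t0' FB0); exact: nq_lt_Ft.
have B2B : B2 `<=` B by move=> w [[]].
pose m := a ^+ 2 / C; pose e2 := eps * a ^+ 2; pose psi := eps * a ^+ 2; pose b := eps * a.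
have C0 : 0 < C by exact: lt_le_trans C1.
have psi0 : 0 < psi by rewrite mulr_gt0// exprn_gt0.
have b0 : 0 < b by exact: mulr_gt0.
have aAi i := adapted_qv hFt (hM i) (hA i).
have brk_Ft n : t <= n%:R -> measurable_fun [set: g_sigma_algebraType (Ft n%:R)] (fun w => brk n%:R w - brk t w).
  by move=> tn; apply: measurable_funB; apply: measurable_sum => i; exact: (adapted_measurable hFt (aAi i)).
have [N tN] : exists N : nat, t < N%:R by exists (Num.bound t); exact: archi_boundP.
pose v n : R := Num.max t n%:R.
have v0 n : 0 <= v n by rewrite le_max t0'.
(* On [J] both conditions hold for all large n, so density yields one deterministic time at which
   they hold on nearly all of [B]. *)
pose phi n := [set w | m <= brk n%:R w - brk t w] `&` ~` [set w | e2 < nq (X n%:R w)].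
have Fphi n : Ft (v n) (phi n).
  apply: (FtI hFt (v0 n)).
    apply/(FtP hFt _ (v0 n)); rewrite -[X in measurable X]setTI.
    rewrite (_ : [set w | _] = (fun w => brk n%:R w - brk t w) @^-1` `[m, +oo[); last first.
      by apply/seteqP; split=> w /=; rewrite in_itv /= andbT.
    suff h : measurable_fun [set: g_sigma_algebraType (Ft (v n))] (fun w => brk n%:R w - brk t w) by exact: h.
    by apply: measurable_funB; apply: measurable_sum => i; apply: (adapted_measurable hFt (aAi i)) => //; rewrite le_max lexx ?orbT.
  apply/(FtP hFt _ (v0 n)); apply: measurableC; apply: (proj1 (FtP hFt _ (v0 n))).
  by apply: nq_gt_Ft => //; rewrite le_max lexx orbT.
have [n Nn hphi] : exists2 n, (N <= n)%N & Pr P (B `\` phi n) <= eta * beta.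
  apply: (dens_ex N v0 Fphi) => w Jw.
  apply: filterS2 (hJA Jw) (hJX Jw psi0) => n h1 h2; split.
    by rewrite /= ler_pdivrMr// mulrC.
  by move=> /=; apply/negP; rewrite -leNgt.
have tn : t < n%:R by rewrite (lt_le_trans tN)// ler_nat.
have Fpn := Fphi n; rewrite /v max_r ?(ltW tn)// in Fpn.
set u : R := n%:R in tn hphi Fpn *.
have u0 : 0 <= u by rewrite (le_trans t0')// ltW.
have hg k : {homo grid t u k : i j / (i <= j)%N >-> i <= j} by move=> i j; apply: grid_mono; exact: ltW.
pose T k := exit_time Q r X V D t b psi (grid t u k.+1) k.+1.
have tp k := debut_pos hFt t0' (cadlag_exit_level sQ r cX cV cD b psi k.+1 t0' (hg k.+1) (grid0 t u k.+1))
  (adapted_exit_level hFt sQ r0 aX aV aD b psi k.+1 t0' (hg k.+1) (grid0 t u k.+1)).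
have stT k : stopping_time Ft (T k) /\ forall w, B2 w -> (t%:E < T k w)%E.
  have [h1 _ h2 _] := tp k; split=> // w [_ Xt]; apply: h2.
  exact: (exit_level_lt0 V D k.+1 b0 psi0 (hg k.+1) (grid0 t u k.+1) Xt).
(* An exit time at most [u] only shows a violation at rational times shortly afterwards, hence the
   crossing is looked for before [u + 1]. *)
pose psik k := [set w | (u%:E < T k w)%E] `|` [set w | crossed t (u + 1) r w].
have u1 : 0 <= u + 1 by rewrite addr_ge0.
have Fpsik k : Ft (u + 1) (psik k).
  have [[st _] _] := stT k; apply/(FtP hFt _ u1); apply: measurableU; apply: (proj1 (FtP hFt _ u1)).
    have -> : [set w | (u%:E < T k w)%E] = ~` [set w | (T k w <= u%:E)%E].
      by apply/seteqP; split=> w /=; rewrite ltNge => /negP.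
    apply/(FtP hFt _ u1); apply: measurableC; apply: (proj1 (FtP hFt _ u1)).
    apply: (Ft_mono hFt u0); first by rewrite lerDl.
    by have [[_ h] _] := stT k; exact: h.
  by apply: crossed_Ft => //; rewrite (le_trans (ltW tn))// lerDl.
have [k _ hk] : exists2 k, (0 <= k)%N & Pr P (B `\` psik k) <= eta * beta.
  apply: (dens_ex 0 (fun=> u1) Fpsik) => w Jw.
  apply: filterS (hJD Jw tn r0 psi0) => k hD.
  have [uT|Tu] := ltP u%:E (T k w); [by left|right].
  have [_ _ _ h] := tp k; have [//|q [tq qu hq]] := h w (u + 1).
    by rewrite (le_lt_trans Tu)// lte_fin ltrDl.
  exists q; split=> //; set s := ratr q in tq qu hq *.
  have gu j : (j <= k.+1)%N -> grid t u k.+1 j <= u by apply: grid_le; exact: ltW.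
  (* The time [s] may exceed [u], but the grid ends at [u], where the increments stop changing. *)
  have incrE (Y : R -> 'cV[R]_d) (j : 'I_k.+1) : incr Y (grid t u k.+1 j) (grid t u k.+1 j.+1) s =
      incr Y (grid t u k.+1 j) (grid t u k.+1 j.+1) (Num.min u s).
    by rewrite /incr !minA !(min_l (gu _ _))// ltnW.
  have ts : t <= Num.min u s by rewrite le_min !ltW.
  have su : Num.min u s <= u by rewrite ge_min lexx.
  have [h1 h2] := hD _ ts su.
  move: hq; rewrite /exit_level !lt_max => /or4P[|hq|hq|hq]; first by rewrite subr_gt0.
  - exfalso; move: hq; rewrite subr_gt0 ltNge => /negP; apply.
    have hv : \sum_(j < k.+1) \sum_i `|V (Num.min (grid t u k.+1 j.+1) s) w i 0 - V (Num.min (grid t u k.+1 j) s) w i 0| <= b.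
      apply: (hJV Jw (g := fun j => Num.min (grid t u k.+1 j) s)); last by rewrite grid0 min_l// ltW.
      by move=> i j ij; rewrite le_min !ge_min lexx orbT (hg k.+1 i j ij).
    apply: le_trans hv; apply: ler_sum => j _; apply: ler_sum => i _.
    by rewrite /incr !mxE.
  - exfalso; move: hq; rewrite subr_gt0 ltNge => /negP; apply; apply: (le_trans h1).
    by apply: ler_sum => j _; rewrite incrE ge_min lexx orbT.
  - exfalso; move: hq; rewrite subr_gt0 ltNge => /negP; apply; apply: le_trans h2.
    by apply: ler_sum => j _; apply: ler_sum => i _; rewrite incrE.
have [stTk tT] := stT k.
pose G := B2 `&` [set w | (T k w <= u%:E)%E].
have FG : Ft u G.
  apply: (FtI hFt u0); first exact: (Ft_mono hFt t0' (ltW tn) FB2).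
  by have [_] := stTk; apply.
have mG := Ft_measurable hFt u0 FG.
have GT w : G w -> (T k w < +oo)%E by move=> [_ /= h]; rewrite (le_lt_trans h)// ltry.
(* The jump condition asks for a time later than [t] everywhere. Infinite off [G], [S] is such a
   time, and the event that it is finite is exactly the exit from [B2] by [u]. *)
pose S w := if w \in G then T k w else +oo%E.
have St w : (t%:E < S w)%E by rewrite /S; case: ifPn => [|_]; [rewrite inE => -[Bw _]; exact: tT|exact: ltry].
have stS : stopping_time Ft S.
  split=> [w|s s0]; first by rewrite (le_trans _ (ltW (St w)))// lee_fin.
  have -> : [set w | (S w <= s%:E)%E] = G `&` [set w | (T k w <= s%:E)%E].
    apply/seteqP; split=> w; rewrite /S /=.
      by case: ifPn => [|_]; [rewrite inE|rewrite leye_eq].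
    by move=> [Gw h]; rewrite mem_set.
  have [us|su] := leP u s.
    by apply: (FtI hFt s0); [exact: (Ft_mono hFt u0 us FG)|have [_] := stTk; apply].
  have [ts|st] := leP t s.
    have -> : G `&` [set w | (T k w <= s%:E)%E] = B2 `&` [set w | (T k w <= s%:E)%E].
      apply/seteqP; split=> w; first by move=> [[]].
      by move=> [Bw h]; do 2 split=> //; rewrite /= (le_trans h)// lee_fin ltW.
    by apply: (FtI hFt s0); [exact: (Ft_mono hFt t0' ts FB2)|have [_] := stTk; apply].
  have -> : G `&` [set w | (T k w <= s%:E)%E] = set0.
    apply/seteqP; split=> w //= -[[Bw _] h]; have := lt_le_trans (tT w Bw) h.
    by rewrite lte_fin ltNge ltW.
  by apply/(FtP hFt _ s0); exact: measurable0.
(* The default [t] is positive, so left limits at [sig] make sense; off [G] the jump is multiplied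
   by 0. *)
pose sig w := if w \in G then fine (T k w) else t.
have sigE w : G w -> T k w = (sig w)%:E.
  move=> Gw; rewrite /sig mem_set// fineK// fin_numE gt_eqF ?lt_eqF ?GT//.
  by rewrite (lt_trans _ (tT w _)) ?ltNyr//; case: Gw.
have msig : measurable_fun setT sig by exact: measurable_stop.
have sig0 w : 0 < sig w.
  have [Gw|nG] := pselect (G w); last by rewrite /sig memNset.
  by rewrite -lte_fin -sigE// (lt_trans _ (tT w _)) ?lte_fin//; case: Gw.
pose f w := \1_G w * sq_jump (M ^~ w) (sig w).
have mf : measurable_fun setT f.
  by apply: measurable_funM; [exact: measurable_indic|exact: sq_jump_measurable].
have f0 w : 0 <= f w by apply: mulr_ge0 => //; exact: sq_jump_ge0.
have fE w : f w = if S w is x%:E then sq_jump (M ^~ w) x else 0.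
  rewrite /f /S indicE; have [Gw|nG] := pselect (G w).
    by rewrite mem_set// mul1r sigE.
  by rewrite memNset// mul0r.
have [B' [N' [FB' B'B [mN N0] hN [iJ EJ]]]] := hjump stS St mf f0 fE FB2 (fun w h => proj2 (proj1 h)).
have mB2 := Ft_measurable hFt t0' FB2; have mB' := Ft_measurable hFt t0' FB'.
have FN : Ft t N'.
  apply: (Ft_mono hFt (lexx 0) t0'); have [_ _ _ h] := hFt; apply: h.
  by exists N'; split.
(* The part lost meets [Gamma], hence [J], in a null set. The complement of this part, completed by
   that null set, is an event of [Ft t] containing [J], and density applies. *)
have PB' : Pr P (B2 `\` B') <= eta * beta.
  pose ph := ~` (B2 `\` B') `|` N'.
  have Fph : Ft t ph.
    apply/(FtP hFt _ t0'); apply: measurableU; last exact: (proj1 (FtP hFt _ t0')).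
    by apply: measurableC; apply: (proj1 (FtP hFt _ t0')); exact: (FtD hFt).
  have mph := Ft_measurable hFt t0' Fph.
  apply: (@le_trans _ _ (Pr P (B `\` ph) + Pr P N')).
    apply: le_trans (PrU_le P (measurableD mB mph) mN).
    apply: le_Pr; [exact: measurableD|by apply: measurableU => //; exact: measurableD|].
    move=> w Bw; have [Nw|nN] := pselect (N' w); [by right|left].
    by split; [apply: B2B; case: Bw|case].
  rewrite [X in _ + X]/Pr N0 addr0; apply: (dens_Ft t0' Fph) => w Jw.
  have [h|h] := pselect ((B2 `\` B') w); last by left.
  by right; apply: hN; split=> //; exact: hJ0.
pose pi := Pr P (B2 `&` [set w | (T k w <= u%:E)%E]).
have Sfin : B2 `&` [set w | (S w < +oo)%E] = B2 `&` [set w | (T k w <= u%:E)%E].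
  apply/seteqP; split=> w [Bw /=]; rewrite /S; have [Gw|nG] := pselect (G w).
  - by case: Gw.
  - by rewrite memNset// ltxx.
  - by rewrite mem_set// => _; split=> //; exact: GT.
  - by move=> h; case: nG.
rewrite Sfin -/pi in EJ.
have mcr : measurable (B `&` [set w | crossed t (u + 1) r w]).
  apply: measurableI => //; apply: (Ft_measurable hFt u1); apply: crossed_Ft => //.
  by rewrite (le_trans (ltW tn))// lerDl.
have mpk := Ft_measurable hFt u1 (Fpsik k).
have pi_le : pi <= Pr P (B `\` psik k) + Pr P (B `&` [set w | crossed t (u + 1) r w]).
  apply: le_trans (PrU_le P (measurableD mB mpk) mcr).
  apply: le_Pr => //; first by apply: measurableU => //; exact: measurableD.
  move=> w [Bw Tw]; have Bw' := B2B w Bw.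
  have [[uT|cr]|np] := pselect (psik k w); [|by right|by left].
  by move: uT; rewrite /= ltNge Tw.
have B'X w : B' w -> nq (X t w) < r ^+ 2 by move=> /B'B[].
pose Jx w := if T k w is x%:E then (if x <= u then sq_jump (M ^~ w) x else 0) else 0.
have Jf w : \1_B' w * f w = \1_B' w * Jx w.
  have [Bw|nB] := pselect (B' w); last by rewrite indicE memNset// !mul0r.
  congr (_ * _); rewrite fE /S /Jx; have [Gw|nG] := pselect (G w).
    rewrite mem_set//; have [_ /=] := Gw; case: (T k w) => // x; by rewrite lee_fin => ->.
  rewrite memNset//; case TE : (T k w) => [x| |]//; case: ifP => // xu.
  by exfalso; apply: nG; split; [exact: B'B|rewrite /= TE lee_fin].
have iJ' : intg P (fun w => \1_B' w * Jx w).
  by move: iJ; rewrite (_ : (fun w => _) = fun w => \1_B' w * Jx w)//; apply/funext.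
have m0 : 0 <= m by rewrite divr_ge0 ?sqr_ge0 ?ltW.
have main := exit_estimate hFt sQ c0 hQ r0 cX aX hM hA cV aV cD aD XE t0' (ltW tn) b0 psi0 (hg k.+1) (grid0 t u k.+1) (gridn t u k) m0 (ltW psi0) FB' B'X iJ'.
have EJ' : Ex P (fun w => \1_B' w * Jx w) <= C * a ^+ 2 * (kd * Pr P B2 + pi / del).
  by rewrite (_ : (fun w => _) = fun w => \1_B' w * f w)//; apply/funext => w; rewrite Jf.
have mphi := Ft_measurable hFt u0 Fpn.
have p1 : Pr P (B' `&` [set w | brk u w - brk t w < m]) <= eta * beta.
  apply: le_trans hphi; apply: le_Pr; [|exact: measurableD|].
    apply: measurableI => //; rewrite -[X in measurable X]setTI.
    rewrite (_ : [set w | _] = (fun w => brk u w - brk t w) @^-1` `]-oo, m[); last first.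
      by apply/seteqP; split=> w /=; rewrite in_itv.
    suff h : measurable_fun setT (fun w => brk u w - brk t w) by exact: h.
    by apply: measurable_funB; apply: measurable_sum => i; [exact: (measurable_wrt_fun (Ft_measurable hFt u0) (aAi i u u0))|exact: (measurable_wrt_fun (Ft_measurable hFt t0') (aAi i t t0'))].
  by move=> w [/B'B/B2B Bw h]; split=> // -[h' _]; move: h; rewrite /= ltNge h'.
have p2 : Pr P (B' `&` [set w | psi < nq (X u w)]) <= eta * beta.
  apply: le_trans hphi; apply: le_Pr; [|exact: measurableD|].
    by apply: measurableI => //; apply: (Ft_measurable hFt u0); exact: nq_gt_Ft.
  by move=> w [/B'B/B2B Bw h]; split=> // -[_ h'].
have p3 : Pr P (B' `&` [set w | (T k w <= u%:E)%E]) <= pi.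
  apply: le_Pr => //; last by move=> w [/B'B Bw h].
  by apply: measurableI => //; apply: (Ft_measurable hFt u0); have [_] := stTk; apply.
have p4 : Pr P B2 <= Pr P B' + eta * beta.
  rewrite (PrDI P mB2 mB'); have : Pr P (B2 `&` B') <= Pr P B' by apply: le_Pr => //; exact: measurableI.
  by lra.
have p5 : Pr P B2 <= beta by exact: le_Pr.
exists (u + 1); first by rewrite ltr_wpDr.
have p6 : Pr P B' <= Pr P B2 by exact: le_Pr.
have th0 : 0 < th by rewrite divr_gt0// mulr_gt0.
have del1 : 0 < del by case/andP: del0.
have L0 : 0 < L.
  rewrite /L; apply: addr_gt0; last by rewrite divr_gt0// mulr_gt0.
  apply: addr_gt0; last exact: mulr_gt0.
  by do 2 (apply: ltr_wpDr; first by rewrite mulr_ge0 ?sqr_ge0).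
have a2 : 0 < a ^+ 2 by rewrite exprn_gt0.
set xA := Pr P (B' `&` [set w | brk u w - brk t w < m]) in main p1.
set xT := Pr P (B' `&` [set w | (T k w <= u%:E)%E]) in main p3.
set xX := Pr P (B' `&` [set w | psi < nq (X u w)]) in main p2.
set xJ := Ex P _ in main EJ'.
set b' := Pr P B' in main p4 p6; set b2 := Pr P B2 in p4 p5 p6 EJ' hB2 *.
have pi0 : 0 <= pi by exact: Pr_ge0.
have xT0 : 0 <= xT by exact: Pr_ge0.
have b'0 : 0 <= b' by exact: Pr_ge0.
have key : th * (b' - xA - xT) <= eps * (5 + 2 * K + 2 * eps) * b' + (6 * K ^+ 2 + 2 * eps ^+ 2 + 2 * eps) * xT
   + 2 * C * kd * b2 + 2 * C / del * pi + K ^+ 2 * xX.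
  rewrite -(ler_pM2l a2).
  have -> : a ^+ 2 * (th * (b' - xA - xT)) = c / 2 * m * (b' - xA - xT) by rewrite /th /m; field; rewrite gt_eqF.
  apply: (le_trans main).
  have -> : a ^+ 2 * (eps * (5 + 2 * K + 2 * eps) * b' + (6 * K ^+ 2 + 2 * eps ^+ 2 + 2 * eps) * xT
   + 2 * C * kd * b2 + 2 * C / del * pi + K ^+ 2 * xX) = (slack r b psi + psi) * b' + (6 * r ^+ 2 + 2 * b ^+ 2 + 2 * psi) * xT
   + 2 * (C * a ^+ 2 * (kd * b2 + pi / del)) + r ^+ 2 * xX by rewrite /slack /r /b /psi; field; rewrite gt_eqF.
  by rewrite lerD2r lerD2l ler_pM2l.
have e1 : eps * (5 + 2 * K + 2 * eps) * b' <= th / 16 * beta by apply: ler_pM => //; [rewrite !(mulr_ge0, addr_ge0)// ltW|exact: le_trans p5].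
have e3 : 2 * C * kd * b2 <= th / 16 * beta by apply: ler_pM => //; [rewrite !mulr_ge0// ltW|exact: Pr_ge0].
have e4 : (6 * K ^+ 2 + 2 * eps ^+ 2 + 2 * eps) * xT <= (6 * K ^+ 2 + 2 * eps ^+ 2 + 2 * eps) * pi.
  by rewrite ler_wpM2l// !addr_ge0 ?mulr_ge0 ?sqr_ge0// ltW.
have e5 : K ^+ 2 * xX <= K ^+ 2 * (eta * beta) by rewrite ler_wpM2l// sqr_ge0.
have e6 : th * (2^-1 * beta - eta * beta - eta * beta - pi) <= th * (b' - xA - xT) by rewrite ler_pM2l//; lra.
have e7 : (K ^+ 2 + 2 * th) * eta * beta <= th / 16 * beta by rewrite ler_wpM2r// Pr_ge0.
have e8 : th / 4 * beta <= L * pi.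
  have b0' : 0 <= th * beta by rewrite mulr_ge0 ?Pr_ge0// ltW.
  rewrite /L; lra.
have e9 : th / (4 * L) * beta <= pi.
  have -> : th / (4 * L) * beta = (th / 4 * beta) / L by field; rewrite gt_eqF.
  by rewrite ler_pdivrMr// [leRHS]mulrC.
lra.
Qed.

Hypotheses (K16 : 16 <= K) (K2 : K ^+ 2 = 256 * d.+1%:R ^+ 3 * C) (eps1 : eps <= 1) (beta0 : 0 < beta)
  (hJA' : forall w, J w -> forall s, t <= s -> brk s w - brk t w <= C * a ^+ 2).

Lemma affine_le_sqr (k : R) : 16 <= k -> 3 / 2 + k / 2 <= k ^+ 2 / 16.
Proof. move=> k16; have : 0 <= (k - 16) * (k - 16) by rewrite -expr2 sqr_ge0. lra. Qed.

Lemma cadlag_nq w : cadlag `[0, +oo[ (fun s => nq (X s w)).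
Proof.
rewrite (_ : (fun s => _) = fun s => \sum_i (\sum_j Q i j * X s w j 0) * X s w i 0).
  apply: cadlag_sum => i; apply: cadlagM (cX i w); apply: cadlag_sum => j.
  exact: cadlagM (cadlag_cst _) (cX j w).
by apply/funext => s; exact: (nqE sQ).
Qed.

(** Paths found beyond [r / 2] on a fine grid form [Gk]. Nearly all of them return, so up to
    [2 * eta * beta] they lie in [W], which has at most half the probability of [Gk]; hence
    [Pr Gk <= 4 * eta * beta]. The grid misses less than another [eta * beta] of the crossings. *)
Lemma no_crossing u : t < u ->
  Pr P (B `&` ([set w | r ^+ 2 <= nq (X t w)] `|` [set w | crossed t u r w])) <= 5 * eta * beta.
Proof.
move=> tu; set Gs := B `&` _; have u0 : 0 <= u by rewrite (le_trans t0')// ltW.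
have mB := Ft_measurable hFt t0' FB.
have C0 : 0 < C by exact: lt_le_trans C1.
(* A strictly smaller radius, so that a path at distance at least [r] at some time is still strictly
   outside at the next grid point of a fine grid. *)
pose rho := r / 2; have rho0 : 0 < rho by rewrite divr_gt0.
pose psi := eps * a ^+ 2; pose b := eps * a; pose cA := C * a ^+ 2.
have psi0 : 0 < psi by rewrite mulr_gt0// exprn_gt0.
have cA0 : 0 < cA by rewrite mulr_gt0// exprn_gt0.
pose D1 : R := d.+1%:R; have D10 : 0 < D1 by rewrite ltr0n.
(* twice the constant of [return_estimate], so that returning has probability
   at most 1/2 *)
have rho2 : rho ^+ 2 = 64 * D1 ^+ 3 * cA.
  have -> : rho ^+ 2 = K ^+ 2 * a ^+ 2 / 4 by rewrite /rho /r; field.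
  by rewrite K2 /cA /D1; field.
have small : 2^-1 * psi + psi + rho * b <= 4^-1 * rho ^+ 2.
  have -> : 2^-1 * psi + psi + rho * b = a ^+ 2 * (eps * (3 / 2 + K / 2)) by rewrite /psi /b /rho /r; field.
  have -> : 4^-1 * rho ^+ 2 = a ^+ 2 * (K ^+ 2 / 16) by rewrite /rho /r; field.
  rewrite ler_pM2l ?exprn_gt0//; apply: (@le_trans _ _ (3 / 2 + K / 2)).
    by rewrite ler_piMl// addr_ge0// divr_ge0// ltW.
  exact: affine_le_sqr.
have mGs : measurable Gs.
  apply: measurableI => //; apply: measurableU.
    rewrite (_ : [set w | _] = ~` [set w | nq (X t w) < r ^+ 2]).
      by apply: measurableC; apply: (Ft_measurable hFt t0'); exact: nq_lt_Ft.
    by apply/seteqP; split=> w /=; rewrite leNgt => /negP.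
  by apply: (Ft_measurable hFt u0); apply: crossed_Ft => //; exact: ltW.
have [N uN] : exists N : nat, u < N%:R by exists (Num.bound u); exact: archi_boundP.
have [n Nn hphi] : exists2 n, (N <= n)%N & Pr P (B `\` ~` [set w | psi < nq (X n%:R w)]) <= eta * beta.
  apply: (dens_ex (v := fun n => n%:R) (phi := fun n => ~` [set w | psi < nq (X n%:R w)])) => // [m|w Jw].
    apply/(FtP hFt _ (ler0n R m)); apply: measurableC; apply: (proj1 (FtP hFt _ (ler0n R m))).
    exact: nq_gt_Ft.
  apply: filterS (hJX Jw psi0) => m h /=; apply/negP; by rewrite -leNgt.
have uu' : u < n%:R by rewrite (lt_le_trans uN)// ler_nat.
set u' : R := n%:R in hphi uu'.
have tu' : t < u' by exact: lt_trans uu'.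
have u'0 : 0 <= u' by rewrite (le_trans t0')// ltW.
have hg k : {homo grid t u' k : i j / (i <= j)%N >-> i <= j} by move=> i j; apply: grid_mono; exact: ltW.
pose fr k w := far Q rho X (grid t u' k.+1) k.+1 k.+1 w.
have ret k := return_estimate hFt sQ c0 hQ rho0 aX hM hA XE t0 (ltW tu') (hg k.+1) (grid0 t u' k.+1) (gridn t u' k) cA0 FB small.
have /choice[W hW] := ret.
pose Gk k := B `&` [set w | fr k w].
have frE k w : fr k w <-> exists2 j, (j < k.+1)%N & rho ^+ 2 < nq (X (grid t u' k.+1 j) w).
  split=> [/existsP[j /andP[_ h]]|[j jk h]]; first by exists j.
  by apply/existsP; exists (Ordinal jk); rewrite h andbT /= ltnW.
have gt k j : t <= grid t u' k.+1 j by rewrite grid_ge// ltW.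
have gu k j : (j <= k.+1)%N -> grid t u' k.+1 j <= u' by apply: grid_le; exact: ltW.
have FGk k : Ft u' (Gk k).
  apply: (FtI hFt u'0); first exact: (Ft_mono hFt t0' (ltW tu') FB).
  rewrite (_ : [set w | _] = \big[setU/set0]_(j < k.+1) [set w | rho ^+ 2 < nq (X (grid t u' k.+1 j) w)]).
    apply/(FtP hFt _ u'0); apply: bigsetU_measurable => j _; apply: (proj1 (FtP hFt _ u'0)).
    by apply: nq_gt_Ft; [rewrite (le_trans t0')|rewrite gu// ltnW].
  rewrite -(bigcup_mkord k.+1 (fun j => [set w | rho ^+ 2 < nq (X (grid t u' k.+1 j) w)])).
  apply/seteqP; split=> w.
    by move=> /frE[j jk h]; exists j.
  by move=> [j jk h]; apply/frE; exists j.
have mGk k := Ft_measurable hFt u'0 (FGk k).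
pose ph k := ~` Gk k `|` W k `|` [set w | psi < nq (X u' w)].
have Fph k : Ft u' (ph k).
  have [FW _ _] := hW k.
  apply/(FtP hFt _ u'0); apply: measurableU; last by apply: (proj1 (FtP hFt _ u'0)); exact: nq_gt_Ft.
  apply: measurableU; last exact: (proj1 (FtP hFt _ u'0)).
  by apply: measurableC; exact: (proj1 (FtP hFt _ u'0)).
have h1 : \forall k \near \oo, Pr P (B `\` ph k) <= eta * beta.
  apply: dens => [k|w Jw]; first exact: (Ft_sub_infty hFt u'0).
  apply: filterS (hJD Jw tu' rho0 psi0) => k hD.
  have [Xu|uX] := ltP psi (nq (X u' w)); [by right|left].
  have [[Bw fw]|nG] := pselect (Gk k w); [right|by left].
  have [_ _ hWk] := hW k; apply: hWk => //.
  - apply: le_trans (hJV Jw k.+1 (hg k.+1) (grid0 _ _ _)); apply: ler_sum => j _; apply: ler_sum => i _.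
    by rewrite /incr !mxE !min_l// gu// ltnW.
  - by have [] := hD u' (ltW tu') (lexx _).
  - move=> i; apply: le_trans (hJA' Jw (ltW tu')); rewrite -sumrB (bigD1 i)//= lerDl sumr_ge0// => j _.
    have [_ _ hm _] := hA j; have [_ hmw] := hm w.
    by rewrite subr_ge0; apply: hmw => /=; rewrite ?in_itv /= ?andbT//; exact: ltW.
have h2 : \forall k \near \oo, Pr P (Gs `\` Gk k) < eta * beta.
  have cv : Pr P (Gs `\` Gk k) @[k --> \oo] --> 0.
    apply: Pr_cvg0 => [k|w]; first exact: measurableD.
    have [[Bw hs]|nG] := pselect (Gs w); last by apply: nearW => k [].
    have [s [ts su hs']] : exists s, [/\ t <= s, s < u & rho ^+ 2 < nq (X s w)].
      have rr : rho ^+ 2 < r ^+ 2 by rewrite /rho; have := exprn_gt0 2 r0; nra.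
      case: hs => [h|[q [tq qu h]]]; first by exists t; split=> //; exact: lt_le_trans h.
      by exists (ratr q); split=> //; [exact: ltW|exact: lt_trans h].
    have s0 : 0 <= s by exact: le_trans ts.
    have [/(_ s s0) rc _] := proj1 (cadlagP _) (cadlag_nq w).
    have /nbhs_ballP[e /= e0 he] : \forall y \near s^'+, rho ^+ 2 < nq (X y w) by exact: (cvgr_gt _ rc).
    (* The mesh is kept below [u' - s] too, because [far] ignores the last point of the grid. *)
    have me0 : 0 < Num.min e (u' - s) by rewrite lt_min e0 subr_gt0 (lt_trans su).
    have : \forall k \near \oo, (u' - t) / k.+1%:R < Num.min e (u' - s) by exact: (cvgr_lt _ (grid_mesh_cvg t u')).
    apply: filterS => k; rewrite lt_min => /andP[ke ku] [_]; apply; split=> //; apply/frE.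
    have [es|ns] := eqVneq s t; first by exists 0%N; rewrite ?grid0 -?es.
    have lts : t < s by rewrite lt_def ns.
    have [j jk /andP[gs sg]] : exists2 j, (j < k.+1)%N & grid t u' k.+1 j < s <= grid t u' k.+1 j.+1.
      by apply: grid_cell; rewrite ?grid0 ?gridn// ltW// (lt_trans su).
    have gS : grid t u' k.+1 j.+1 < s + (u' - t) / k.+1%:R by rewrite gridS ltrD2r.
    have gu' : grid t u' k.+1 j.+1 < u' by rewrite (lt_trans gS)// addrC -ltrBrDr.
    have ge : grid t u' k.+1 j.+1 < s + e by rewrite (lt_trans gS)// ltrD2l.
    exists j.+1.
      rewrite ltn_neqAle jk andbT; apply/negP => /eqP jE.
      by move: gu'; rewrite jE gridn ltxx.
    have [sE|ne] := eqVneq s (grid t u' k.+1 j.+1); first by rewrite -sE.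
    apply: he; last by rewrite lt_def eq_sym ne.
    rewrite /ball /= ltr_norml; apply/andP; split.
      by rewrite -opprB ltrN2 ltrBlDl.
    by rewrite (@le_lt_trans _ _ 0)// subr_le0.
  by apply: (cvgr_lt _ cv); rewrite mulr_gt0.
have [k [hk1 hk2]] := filter_ex (filterI h1 h2).
have [FW PW _] := hW k; have mW := Ft_measurable hFt u'0 FW; have mph := Ft_measurable hFt u'0 (Fph k).
have Gk_le : Pr P (Gk k) <= Pr P (W k) + (Pr P (B `\` ph k) + Pr P (B `\` ~` [set w | psi < nq (X u' w)])).
  have m3 : measurable (B `\` ~` [set w | psi < nq (X u' w)]).
    apply: measurableD => //; apply: measurableC; apply: (Ft_measurable hFt u'0); exact: nq_gt_Ft.
  apply: (@le_trans _ _ (Pr P (W k) + Pr P (B `\` ph k `|` (B `\` ~` [set w | psi < nq (X u' w)])))); last first.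
    by rewrite lerD2l; apply: PrU_le => //; exact: measurableD.
  apply: le_trans (PrU_le P mW _); last by apply: measurableU => //; exact: measurableD.
  apply: le_Pr => //; first by do ?apply: measurableU => //; exact: measurableD.
  move=> w Gw; have [Bw _] := Gw; have [Ww|nW] := pselect (W k w); [by left|right].
  have [Xw|nX] := pselect (psi < nq (X u' w)); [by right; split=> //; apply|left].
  by split=> // -[[nG|//]|//]; exact: nG.
have W_le : Pr P (W k) <= 2^-1 * Pr P (Gk k).
  have rr : 0 < rho ^+ 2 by rewrite exprn_gt0.
  rewrite -(ler_pM2l rr) (le_trans PW)// rho2 -/D1 -/(Gk k).
  by rewrite (_ : 64 * D1 ^+ 3 * cA * _ = 32 * D1 ^+ 3 * cA * Pr P (Gk k))//; field.
have Gs_le : Pr P Gs <= Pr P (Gs `\` Gk k) + Pr P (Gk k).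
  rewrite (PrDI P mGs (mGk k)) lerD2l; apply: le_Pr => //; exact: measurableI.
lra.
Qed.

End crossing.

Lemma sqrt_256 (R : realType) (y : R) : 1 <= y -> exists2 k, 16 <= k & k ^+ 2 = 256 * y.
Proof.
move=> y1; have y0 : 0 <= y by exact: le_trans y1.
have h1 : 1 <= Num.sqrt y by rewrite -[leLHS]sqrtr1 ler_sqrt// (lt_le_trans _ y1).
exists (16 * Num.sqrt y); first lra.
by rewrite exprMn sqr_sqrtr//; ring.
Qed.

(** * Choice of the constants and contradiction *)

Section avoid.
Context {R : realType} {dO : measure_display} {Omega : measurableType dO}.
Variables (P : probability Omega R) (Ft : R -> set (set Omega)).
Hypothesis hFt : usual_filtration P Ft.
Variables (d : nat) (Q : 'M[R]_d) (c : R).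
Hypotheses (sQ : Q^T = Q) (c0 : 0 < c)
  (hQ : forall x : 'cV[R]_d, c * \sum_i x i 0 ^+ 2 <= qform Q x x <= \sum_i x i 0 ^+ 2).
Variables X M V D : R -> Omega -> 'cV[R]_d.
Variable A : 'I_d -> R -> Omega -> R.
Hypotheses (cX : forall i, cadlag_process (fun s w => X s w i 0))
  (aX : forall i, adapted Ft (fun s w => X s w i 0))
  (hM : forall i, locally_square_integrable_martingale P Ft (fun s w => M s w i 0))
  (hA : forall i, is_predictable_qv P Ft (fun s w => M s w i 0) (A i))
  (cV : forall i, cadlag_process (fun s w => V s w i 0))
  (aV : forall i, adapted Ft (fun s w => V s w i 0))
  (cD : forall i, cadlag_process (fun s w => D s w i 0))
  (aD : forall i, adapted Ft (fun s w => D s w i 0))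
  (XE : forall s w, 0 <= s -> X s w = X 0 w + M s w + V s w + D s w).
Variables (E : R -> Omega -> \bar R) (Gamma : set Omega) (alpha kappa : R -> R).
Hypotheses (aE : adapted Ft E) (al0 : forall t, 0 <= t -> 0 < alpha t)
  (kp : forall e, 0 < e -> exists2 del, 0 < del <= 1 & 0 <= kappa del <= e)
  (hjump : forall (t : R) (S : Omega -> \bar R) (f : Omega -> R) (B0 : set Omega) (e del : R),
    0 <= t -> stopping_time Ft S -> (forall w, (t%:E < S w)%E) -> measurable_fun setT f -> (forall w, 0 <= f w) ->
    (forall w, f w = if S w is x%:E then sq_jump (M ^~ w) x else 0) ->
    Ft t B0 -> 0 <= e -> (forall w, B0 w -> (E t w <= e%:E)%E) -> 0 < del <= 1 ->
    exists B' N : set Omega, [/\ Ft t B', B' `<=` B0, measurable N /\ P N = 0%E,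
      (B0 `\` B') `&` Gamma `<=` N &
      intg P (fun w => \1_B' w * f w) /\
      Ex P (fun w => \1_B' w * f w) <= e * (kappa del * Pr P B0 + Pr P (B0 `&` [set w | (S w < +oo)%E]) / del)]).
Local Notation brk s w := (\sum_i A i s w).

(* What is known, from a late time t on, about the paths converging to 0; the
   last clause says that the drift points outwards. *)
Definition calm (C eps t : R) (w : Omega) := [/\
  \forall n \near \oo, alpha t ^+ 2 <= C * (brk n%:R w - brk t w),
  forall s, t <= s -> brk s w - brk t w <= C * alpha t ^+ 2,
  forall (g : nat -> R) n, {homo g : i j / (i <= j)%N >-> i <= j} -> g 0%N = t ->
     \sum_(k < n) \sum_i `|V (g k.+1) w i 0 - V (g k) w i 0| <= eps * alpha t,
  (E t w <= (C * alpha t ^+ 2)%:E)%E &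
  forall u r psi, t < u -> 0 < r -> 0 < psi -> \forall n \near \oo, forall s, t <= s -> s <= u ->
    - psi <= \sum_(k < n.+1) Num.min 0 (qform Q (chi Q r (X (grid t u n.+1 k) w)) (incr (D ^~ w) (grid t u n.+1 k) (grid t u n.+1 k.+1) s)) /\
    \sum_(k < n.+1) \sum_i (incr (D ^~ w) (grid t u n.+1 k) (grid t u n.+1 k.+1) s i 0) ^+ 2 <= psi].

(** [eps] is fixed by [C] before [J] and [n0] are known, so that the little-o condition on the
    finite variation part can supply it. [K] comes from the return estimate, [del] from [kappa],
    [eps] from both, and [eta] last, against the crossing probability [q0] that results from
    them. *)
Lemma calm_negligible (C : R) : 1 <= C -> exists2 eps, 0 < eps & forall (J : set Omega) (n0 : nat),
  J `<=` Gamma ->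
  (forall w, J w -> forall e, 0 < e -> \forall n \near \oo, qform Q (X n%:R w) (X n%:R w) <= e) ->
  (forall w (n : nat), J w -> (n0 <= n)%N -> calm C eps n%:R w) ->
  P.-negligible J.
Proof.
move=> C1; have C0 : 0 < C by exact: lt_le_trans C1.
pose th := c / (2 * C); have th0 : 0 < th by rewrite divr_gt0// mulr_gt0.
pose D1 : R := d.+1%:R; have D11 : 1 <= D1 by rewrite ler1n.
pose y := D1 ^+ 3 * C; have y1 : 1 <= y by rewrite -[leLHS]mulr1 ler_pM// exprn_ege1.
have [K K16 K2'] := sqrt_256 y1.
have K2 : K ^+ 2 = 256 * D1 ^+ 3 * C by rewrite K2' mulrA.
have K0 : 0 < K by exact: lt_le_trans K16.
have [del hdel /andP[kd0 kd1]] := kp (e := th / 16 / (2 * C)) (divr_gt0 (divr_gt0 th0 (ltr0Sn _ _)) (mulr_gt0 (ltr0Sn _ _) C0)).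
have del0 : 0 < del by case/andP: hdel.
have hkd : 2 * C * kappa del <= th / 16 by rewrite mulrC -ler_pdivlMr// mulr_gt0.
(* As [eps <= 1], the factor [5 + 2 * K + 2 * eps] is at most [7 + 2 * K]. *)
pose eps := Num.min 1 (th / 16 / (7 + 2 * K)).
have K7 : 0 < 7 + 2 * K by rewrite addr_gt0// mulr_gt0.
have th16 : 0 < th / 16 by exact: divr_gt0.
have eps0 : 0 < eps by rewrite lt_min ltr01; exact: divr_gt0.
have eps1 : eps <= 1 by rewrite ge_min lexx.
have heps : eps * (5 + 2 * K + 2 * eps) <= th / 16.
  apply: (@le_trans _ _ (eps * (7 + 2 * K))); first by rewrite ler_pM2l//; lra.
  by rewrite -ler_pdivlMr// ge_min lexx orbT.
exists eps => // J n0 JG hJX hJ.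
pose L := th + 6 * K ^+ 2 + 2 * eps ^+ 2 + 2 * eps + 2 * C / del.
have Lth : th <= L.
  rewrite /L -!addrA lerDl; do 2 (apply: addr_ge0; first by rewrite mulr_ge0 ?sqr_ge0).
  by apply: addr_ge0; [rewrite mulr_ge0// ltW|rewrite divr_ge0 ?(ltW del0)// mulr_ge0// ltW].
have L0 : 0 < L by exact: lt_le_trans Lth.
pose q0 := th / (4 * L).
have q00 : 0 < q0 by apply: divr_gt0 => //; exact: mulr_gt0.
have q01 : q0 <= 1 / 4.
  rewrite /q0 ler_pdivrMr ?(mulr_gt0 _ L0)// mulrA (_ : 1 / 4 * 4 = 1) ?mul1r//; by field.
have KK : 0 < K ^+ 2 + 2 * th by rewrite addr_gt0 ?exprn_gt0// mulr_gt0.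
(* With [eta <= q0 / 8], the two crossing bounds would force [q0 <= 6 * eta], which is false. Since
   [q0 <= 1 / 4], also [eta <= 1 / 32], which settles the case of a start outside. *)
pose eta := Num.min (th / 16 / (K ^+ 2 + 2 * th)) (q0 / 8).
have eta0 : 0 < eta by rewrite lt_min; apply/andP; split; exact: divr_gt0.
have eta1 : eta <= q0 / 8 by rewrite ge_min lexx orbT.
have heta : (K ^+ 2 + 2 * th) * eta <= th / 16.
  by rewrite mulrC -ler_pdivlMr// ge_min lexx.
apply: contrapT => nJ.
have [n [B [nn0 FB beta0 dens]]] := density hFt (maxn n0 1) nJ eta0.
have n0n : (n0 <= n)%N by rewrite (leq_trans _ nn0)// leq_maxl.
have n1 : (0 < n)%N by rewrite (leq_trans _ nn0)// leq_maxr.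
set t : R := n%:R in FB; have t0 : 0 < t by rewrite ltr0n.
have a0 := al0 (ltW t0); set a := alpha t in a0.
have hJA w (Jw : J w) : \forall n \near \oo, a ^+ 2 <= C * (brk n%:R w - brk t w) by case: (hJ w n Jw n0n).
have hJA' w (Jw : J w) : forall s, t <= s -> brk s w - brk t w <= C * a ^+ 2 by case: (hJ w n Jw n0n).
have hJV w (Jw : J w) : forall (g : nat -> R) n, {homo g : i j / (i <= j)%N >-> i <= j} -> g 0%N = t ->
   \sum_(k < n) \sum_i `|V (g k.+1) w i 0 - V (g k) w i 0| <= eps * a by case: (hJ w n Jw n0n).
have hJE w (Jw : J w) : (E t w <= (C * a ^+ 2)%:E)%E by case: (hJ w n Jw n0n).
have hJD w (Jw : J w) : forall u r psi, t < u -> 0 < r -> 0 < psi -> \forall n \near \oo, forall s, t <= s -> s <= u ->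
    - psi <= \sum_(k < n.+1) Num.min 0 (qform Q (chi Q r (X (grid t u n.+1 k) w)) (incr (D ^~ w) (grid t u n.+1 k) (grid t u n.+1 k.+1) s)) /\
    \sum_(k < n.+1) \sum_i (incr (D ^~ w) (grid t u n.+1 k) (grid t u n.+1 k.+1) s i 0) ^+ 2 <= psi by case: (hJ w n Jw n0n).
have e0 : 0 <= C * a ^+ 2 by rewrite mulr_ge0 ?sqr_ge0// ltW.
have hj S f B0 stS tS mf f0 fE FB0 hE := @hjump t S f B0 (C * a ^+ 2) del (ltW t0) stS tS mf f0 fE FB0 e0 hE hdel.
have upper u : t < u -> Pr P (B `&` ([set w | (K * a) ^+ 2 <= qform Q (X t w) (X t w)] `|` [set w | crossed Q X t u (K * a) w])) <= 5 * eta * Pr P B.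
  exact: (no_crossing hFt sQ c0 hQ cX aX hM hA XE t0 a0 C1 eps0 eta0 K0 hJX hJV hJD FB dens K16 K2 eps1 beta0 hJA').
have mB := Ft_measurable hFt (ltW t0) FB.
have mU u : t < u -> measurable (B `&` [set w | crossed Q X t u (K * a) w]) /\
    measurable (B `&` ([set w | (K * a) ^+ 2 <= qform Q (X t w) (X t w)] `|` [set w | crossed Q X t u (K * a) w])).
  move=> tu; have u0 : 0 <= u by rewrite (le_trans (ltW t0))// ltW.
  have mc : measurable [set w | crossed Q X t u (K * a) w].
    by apply: (Ft_measurable hFt u0); apply: (crossed_Ft hFt sQ aX) => //; exact: ltW.
  split; apply: measurableI => //; apply: measurableU => //.
  rewrite (_ : [set w | _] = ~` [set w | qform Q (X t w) (X t w) < (K * a) ^+ 2]).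
    by apply: measurableC; apply: (Ft_measurable hFt (ltW t0)); apply: (nq_lt_Ft hFt sQ aX) => //; exact: ltW.
  by apply/seteqP; split=> w /=; rewrite leNgt => /negP.
pose B0 := B `&` [set w | (E t w <= (C * a ^+ 2)%:E)%E].
pose B2 := B0 `&` [set w | qform Q (X t w) (X t w) < (K * a) ^+ 2].
(* If less than half of [B] starts inside the ball, the upper bound applied to the starting point
   alone is contradictory: it leaves at most [6 * eta] of [B] outside [B2]. *)
have [big|small] := leP (2^-1 * Pr P B) (Pr P B2).
  have [u tu low] := crossing_inside hFt sQ c0 hQ cX aX hM hA cV aV cD aD XE aE t0 a0 C1 eps0 hdel K0 kd0
    JG hJX hJA hJV hJD hj FB dens hkd heps heta big.
  have [m1 m2] := mU u tu.
  have up := upper u tu.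
  have mid : Pr P (B `&` [set w | crossed Q X t u (K * a) w]) <=
     Pr P (B `&` ([set w | (K * a) ^+ 2 <= qform Q (X t w) (X t w)] `|` [set w | crossed Q X t u (K * a) w])).
    by apply: le_Pr => // w [Bw h]; split=> //; right.
  have h : (q0 - eta) * Pr P B <= 5 * eta * Pr P B by rewrite (le_trans low)// (le_trans mid).
  rewrite ler_pM2r// in h; lra.
have hB0 := PrB0 hFt aE t0 hJE dens.
have tt : t < t + 1 by rewrite ltrDl.
have [m1 m2] := mU _ tt; have up := upper _ tt.
have FB0 : Ft t B0.
  apply: (FtI hFt (ltW t0) FB); rewrite (_ : [set w | _] = E t @^-1` `]-oo, (C * a ^+ 2)%:E]%classic).
    by apply: aE; [exact: ltW|exact: emeasurable_itv].
  by apply/seteqP; split=> w /=; rewrite in_itv.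
have mB0 := Ft_measurable hFt (ltW t0) FB0.
have mB2 : measurable B2.
  apply: measurableI => //; apply: (Ft_measurable hFt (ltW t0)); apply: (nq_lt_Ft hFt sQ aX) => //; exact: ltW.
have h1 : Pr P B <= Pr P (B `\` B0) + Pr P B0.
  by rewrite (PrDI P mB mB0) lerD2l; apply: le_Pr => //; exact: measurableI.
have h2 : Pr P B0 <= Pr P (B0 `\` B2) + Pr P B2.
  by rewrite (PrDI P mB0 mB2) lerD2l; apply: le_Pr => //; exact: measurableI.
have h3 : Pr P (B0 `\` B2) <= 5 * eta * Pr P B.
  apply: le_trans up; apply: le_Pr => //; first exact: measurableD.
  move=> w [Bw nB]; split; [by case: Bw|left] => /=; rewrite leNgt; apply/negP => h; exact: nB.
have h4 : 6 * eta * Pr P B <= 6 * (1 / 32) * Pr P B by rewrite ler_pM2r//; lra.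
lra.
Qed.

End avoid.

(** * Asymptotic hypotheses *)

Section asymptotics.
Context {R : realType}.
Implicit Types (alpha tau f : R -> R).

Lemma nearinfty_nat (p : R -> Prop) : (\forall t \near +oo, p t) -> \forall n \near \oo, p n%:R.
Proof.
move=> [M [_ hM]]; near=> n; apply: hM.
by near: n; exact: nbhs_infty_gtr.
Unshelve. all: by end_near. Qed.

(* Iterating tau turns the local lower bound on the increments of f into a lower
   bound on its total increment. *)
Lemma iter_lower alpha tau f : (forall t, 0 <= t -> 0 < alpha t) ->
  alpha t @[t --> +oo] --> 0 ->
  (forall t, 0 < t -> t < tau t /\ iter n tau t @[n --> \oo] --> +oo) ->
  nondecreasing_on `[0, +oo[ f ->
  ebigO (fun t => (alpha t ^+ 2 - alpha (tau t) ^+ 2)%:E) (fun t => f (tau t) - f t) ->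
  exists2 C : R, 0 < C & \forall t \near +oo, \forall n \near \oo, alpha t ^+ 2 <= C * (f n%:R - f t).
Proof.
move=> al0 alcv ht fm [C0 hC0].
pose C := Num.max 1 C0; have C1 : 0 < C by rewrite lt_max ltr01.
exists (2 * C); first by rewrite mulr_gt0.
have [s0 [_ hs0]] := hC0.
near=> t.
have t0 : 0 < t by near: t; exact: nbhs_pinfty_gt.
have st : s0 < t by near: t; apply: nbhs_pinfty_gt; exact: num_real.
have step s : t <= s -> alpha s ^+ 2 - alpha (tau s) ^+ 2 <= C * (f (tau s) - f s).
  move=> ts; have s0' : 0 < s by exact: lt_le_trans ts.
  have [tau1 _] := ht s s0'.
  have := hs0 s (lt_le_trans st ts); rewrite lee_fin => h.
  have fs : 0 <= f (tau s) - f s.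
    by rewrite subr_ge0; apply: fm => /=; rewrite ?in_itv /= ?andbT ltW// (lt_trans s0').
  apply: (le_trans (ler_norm _)); apply: (le_trans h); rewrite (ger0_norm fs).
  by rewrite ler_wpM2r// le_max lexx orbT.
have iterP k : t <= iter k tau t /\ alpha t ^+ 2 - alpha (iter k tau t) ^+ 2 <= C * (f (iter k tau t) - f t).
  elim: k => [|k [IH1 IH2]] /=; first by rewrite !subrr mulr0.
  have := step _ IH1; have [h _] := ht _ (lt_le_trans t0 IH1).
  split; [by rewrite (le_trans IH1)// ltW|lra].
have [_ itcv] := ht t t0.
have a0 := al0 t (ltW t0).
(* Once [alpha] is halved, the telescoped difference of squares is at least three quarters of
   [alpha t ^+ 2]; this is where the factor 2 in the constant comes from. *)
have [k hk] : exists k, alpha (iter k tau t) <= alpha t / 2.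
  have : \forall s \near +oo, alpha s < alpha t / 2 by apply: (cvgr_lt _ alcv); rewrite divr_gt0.
  move=> hs; have hs' : \forall k \near \oo, alpha (iter k tau t) < alpha t / 2 := itcv _ hs.
  by have [k hk] := filter_ex hs'; exists k; exact: ltW.
have [tk hk2] := iterP k.
have ak := al0 _ (le_trans (ltW t0) tk).
have hal : alpha t ^+ 2 <= 2 * C * (f (iter k tau t) - f t).
  have : alpha (iter k tau t) ^+ 2 <= (alpha t / 2) ^+ 2 by rewrite ler_sqr// nnegrE ?divr_ge0// ltW.
  have : 0 <= alpha t ^+ 2 by exact: sqr_ge0.
  by rewrite exprMn; lra.
have : \forall n \near \oo, iter k tau t <= n%:R by apply: (nearinfty_nat (p := fun s => iter k tau t <= s)); apply: nbhs_pinfty_ge; exact: num_real.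
apply: filterS => n hn; apply: (le_trans hal); rewrite ler_wpM2l ?mulr_ge0 ?(ltW C1)// lerD2r.
by apply: fm => //=; rewrite in_itv /= andbT ?(le_trans _ tk)// ltW.
Unshelve. all: by end_near. Qed.

Lemma lim_upper f alpha : nondecreasing_on `[0, +oo[ f ->
  ebigO (fun t => lim ((f s - f t)%:E @[s --> +oo])) (fun t => alpha t ^+ 2) ->
  exists2 C : R, 0 < C & \forall t \near +oo, forall s, t <= s -> f s - f t <= C * alpha t ^+ 2.
Proof.
move=> fm [C0 hC0]; exists (Num.max 1 C0); first by rewrite lt_max ltr01.
near=> t.
have t0 : 0 <= t by near: t; exact: nbhs_pinfty_ge.
have h3 : (`|lim ((f s - f t)%:E @[s --> +oo%R])| <= (C0 * `|alpha t ^+ 2|)%:E)%E by near: t.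
move=> s ts; have s0 := le_trans t0 ts.
(* Constant on the negative times, so as to be monotone on the whole line, where the monotone limit
   is a supremum. *)
pose g (y : R) : \bar R := (f (Num.max 0 y) - f t)%:E.
have gm : nondecreasing_fun g.
  move=> y z yz; rewrite lee_fin lerD2r; apply: fm; rewrite /= ?in_itv /= ?andbT ?(le_max 0) ?lexx//.
  by rewrite ge_max !le_max lexx yz orbT.
have gcv := nondecreasing_cvge gm.
have lE : lim ((f s - f t)%:E @[s --> +oo%R]) = ereal_sup (range g).
  apply: cvg_lim => //; apply: cvg_trans gcv; apply: near_eq_cvg.
  near=> y; rewrite /g max_r//; near: y; exact: nbhs_pinfty_ge.
have : (g s <= ereal_sup (range g))%E by apply: ereal_sup_ubound; exists s.
rewrite -lE /g max_r// => h1.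
rewrite -lee_fin.
apply: (le_trans h1); apply: (le_trans (lee_abs _)).
apply: (le_trans h3); rewrite lee_fin ger0_norm ?sqr_ge0// ler_wpM2r ?sqr_ge0//.
by rewrite le_max lexx orbT.
Unshelve. all: by end_near. Qed.

Lemma sum_le_variation f (g : nat -> R) n : {homo g : i j / (i <= j)%N >-> i <= j} ->
  ((\sum_(k < n) `|f (g k.+1) - f (g k)|)%:E <= total_variation (g 0%N) (g n) f)%E.
Proof.
move=> gm; elim: n => [|n IH]; first by rewrite big_ord0 total_variation_ge0.
rewrite big_ord_recr /= EFinD (@total_variationD _ _ _ (g n)) ?gm//.
by apply: leeD => //; apply: total_variation_ge; exact: gm.
Qed.

(* The open interval ]t, +oo[ misses the increments out of t; right continuity
   recovers them. *)
Lemma sum_le_variation_on (d : nat) (v : 'I_d -> R -> R) t (g : nat -> R) n (x : R) : 0 <= t ->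
  {homo g : i j / (i <= j)%N >-> i <= j} -> g 0%N = t ->
  (forall i, v i s @[s --> t^'+] --> v i t) ->
  (\sum_i variation_on `]t, +oo[ (v i) <= x%:E)%E ->
  \sum_(k < n) \sum_i `|v i (g k.+1) - v i (g k)| <= x.
Proof.
move=> t0 gm g0 rc hx.
(* Pushes the partition strictly inside ]t, +oo[, where the variation is controlled, before [e]
   tends to 0. *)
pose h (e : R) k := Num.max (t + e) (g k).
have hm e : {homo h e : i j / (i <= j)%N >-> i <= j}.
  by move=> i j ij; rewrite ge_max !le_max lexx /= gm// orbT.
have bound (e : R) : 0 < e -> \sum_(k < n) \sum_i `|v i (h e k.+1) - v i (h e k)| <= x.
  move=> e0; rewrite exchange_big /= -lee_fin -sumEFin; apply: le_trans hx; apply: lee_sum => i _.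
  apply: (le_trans (sum_le_variation (v i) n (hm e))).
  apply: ereal_sup_ubound; exists (h e 0%N, h e n) => //=; split; first exact: hm.
  move=> y /=; rewrite !in_itv /= andbT => /andP[+ _]; apply: lt_le_trans.
  by rewrite lt_max ltrDl e0.
have gt k : t <= g k by rewrite -g0 gm.
have cv i k : v i (h (m.+1%:R^-1) k) @[m --> \oo] --> v i (g k).
  have [gk|gk] := eqVneq (g k) t.
    apply: (right_cvg_seq (u := fun m => h m.+1%:R^-1 k)).
    - by rewrite gk; exact: rc.
    - by move=> m; rewrite /h gk le_max lexx orbT.
    - rewrite gk (_ : (fun m => _) = fun m => t + m.+1%:R^-1 :> R); last first.
        by apply/funext => m; rewrite /h gk max_l// lerDl.
      by rewrite -[X in _ --> X]addr0; apply: cvgD; [exact: cvg_cst|exact: cvg_harmonic].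
  have tg : t < g k by rewrite lt_def gk gt.
  apply: cvg_near_cst.
  have hh : (m.+1%:R^-1 : R) @[m --> \oo] --> (0 : R) by exact: cvg_harmonic.
  have : \forall m \near \oo, m.+1%:R^-1 < g k - t by apply: (cvgr_lt _ hh); rewrite subr_gt0.
  by apply: filterS => m hm1; rewrite /h max_r// -lerBrDl ltW.
have : \sum_(k < n) \sum_i `|v i (h m.+1%:R^-1 k.+1) - v i (h m.+1%:R^-1 k)| @[m --> \oo] -->
    \sum_(k < n) \sum_i `|v i (g k.+1) - v i (g k)|.
  apply: cvg_big => [|k _]; [exact: add_continuous|].
  apply: cvg_big => [|i _]; [exact: add_continuous|].
  by apply: cvg_norm; apply: cvgB; exact: cv.
move=> c; rewrite -(cvg_lim _ c)//; apply: limr_le; first exact: (cvgP _ c).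
by apply: nearW => m; apply: bound.
Qed.

End asymptotics.

(** * Entrywise limits of matrices *)

Section matrix_limits.
Context {R : realType}.

Lemma cvg_mx_entry (T : Type) (F : set_system T) {FF : Filter F} m n (f : T -> 'M[R]_(m, n)) (l : 'M[R]_(m, n)) :
  (forall i j, f x i j @[x --> F] --> l i j) -> f x @[x --> F] --> l.
Proof.
move=> h A [B nB BA].
have : \forall x \near F, forall i j, B i j (f x i j).
  by apply: filter_forall => i; apply: filter_forall => j; exact: (h i j _ (nB i j)).
by apply: filterS => x hx; exact: BA.
Qed.

Lemma cvg_entry (T : Type) (F : set_system T) {FF : Filter F} m n (f : T -> 'M[R]_(m, n)) (l : 'M[R]_(m, n)) i j :
  f x @[x --> F] --> l -> f x i j @[x --> F] --> l i j.
Proof. by move=> h; exact: (cvg_comp _ (fun A : 'M[R]_(m, n) => A i j) h (@coord_continuous _ _ _ i j l)). Qed.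

Lemma lim_mx_entry (T : Type) (F : set_system T) {FF : ProperFilter F} m n (f : T -> 'M[R]_(m, n)) (l : 'M[R]_(m, n)) :
  (forall i j, f x i j @[x --> F] --> l i j) -> lim (f x @[x --> F]) = l.
Proof.
move=> h; have c : cvg (f x @[x --> F]) by apply: (cvgP l); exact: cvg_mx_entry.
apply/matrixP => i j; have FF' : Filter F by apply: filter_filter.
have h1 := cvg_entry (FF := FF') (i := i) (j := j) c.
by rewrite -(cvg_lim (@Rhausdorff R) h1) (cvg_lim (@Rhausdorff R) (h i j)).
Qed.

Lemma cvg_mulmx (T : Type) (F : set_system T) {FF : Filter F} m n p (Z : 'M[R]_(m, n)) (f : T -> 'M[R]_(n, p)) (l : 'M[R]_(n, p)) i j :
  (forall i j, f x i j @[x --> F] --> l i j) -> (Z *m f x) i j @[x --> F] --> (Z *m l) i j.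
Proof.
move=> h; rewrite mxE; under eq_fun do rewrite mxE.
apply: cvg_big => [|k _]; [exact: add_continuous|].
by apply: cvgM; [exact: cvg_cst|exact: h].
Qed.

End matrix_limits.

Lemma kappa_small (R : realType) (kappa : R -> R) : kappa 0 = 0 -> cadlag `[0, 1] kappa ->
  (forall p, 0 <= p <= 1 -> 0 <= kappa p <= 1) ->
  forall e, 0 < e -> exists2 del, 0 < del <= 1 & 0 <= kappa del <= e.
Proof.
move=> k0 ck kr e e0.
have [|h _] := ck 0; first by rewrite /= in_itv /= lexx ler01.
have he : \forall s \near within `[0, 1] 0^'+, kappa s < e by apply: (cvgr_lt _ h); rewrite k0.
have [s [s0 s1 hs]] : exists s, [/\ 0 < s, s <= 1 & kappa s < e].
  move: he; rewrite /within /at_right /= => /nbhs_ballP[del /= del0 hdel].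
  have d1 : 0 < Num.min 1 (del / 2) by rewrite lt_min ltr01 divr_gt0.
  have d2 : Num.min 1 (del / 2) <= 1 by rewrite ge_min lexx.
  exists (Num.min 1 (del / 2)); split=> //; apply: hdel => //.
    rewrite /ball /= sub0r normrN ger0_norm ?(ltW d1)//.
    by rewrite (@le_lt_trans _ _ (del / 2)) ?ge_min ?lexx ?orbT// ltr_pdivrMr// ltr_pMr// ltr1n.
  by rewrite /= in_itv /= ltW.
exists s; first by rewrite s0.
by have /andP[-> _] := kr s (introT andP (conj (ltW s0) s1)); exact: ltW.
Qed.

(** Setting [F] to 0 on the exceptional null set leaves its integrals unchanged and makes the sign
    condition hold at every time. *)
Lemma drift_tame_ae (R : realType) (d : nat) (Q : 'M[R]_d) (c r : R) :
  Q^T = Q -> 0 < c ->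
  (forall x : 'cV[R]_d, c * \sum_i x i 0 ^+ 2 <= qform Q x x <= \sum_i x i 0 ^+ 2) -> 0 < r ->
  forall (x dd F xl : R -> 'cV[R]_d) (t u : R), 0 <= t -> t < u ->
  (forall i, lebesgue_measure.-integrable `[0, u] (EFin \o (fun s => F s i 0))) ->
  (forall i s, 0 <= s -> s <= u -> dd s i 0 = \int[lebesgue_measure]_(y in `[0, s]) F y i 0) ->
  (forall i s, t < s <= u -> x y i 0 @[y --> s^'-] --> xl s i 0) ->
  {ae lebesgue_measure, forall s : R, t < s -> 0 <= qform Q (xl s) (F s)} ->
  forall psi : R, 0 < psi -> \forall n \near \oo, forall s, t <= s -> s <= u ->
    - psi <= \sum_(k < n.+1) Num.min 0 (qform Q (chi Q r (x (grid t u n.+1 k))) (incr dd (grid t u n.+1 k) (grid t u n.+1 k.+1) s)) /\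
    \sum_(k < n.+1) \sum_i (incr dd (grid t u n.+1 k) (grid t u n.+1 k.+1) s i 0) ^+ 2 <= psi.
Proof.
move=> sQ c0 hQ r0 x dd F xl t u t0 tu iF ddE xxl [N [mN N0 hN]].
pose F' (s : R) : 'cV[R]_d := (\1_(~` N) s : R) *: F s.
have F'E i (s : R) : F' s i 0 = \1_(~` N) s * F s i 0 by rewrite mxE.
have mF' i v : 0 <= v -> v <= u -> measurable_fun `[0, v] (fun s => F' s i 0).
  move=> v0 vu; rewrite (_ : (fun s => _) = fun s : R => \1_(~` N) s * F s i 0); last first.
    by apply/funext => s; exact: F'E.
  apply: measurable_funM; first by apply: measurable_funTS; apply: measurable_indic; exact: measurableC.
  have /measurable_int/measurable_EFinP := iF i; apply: measurable_funS => //.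
  by apply: subset_itvl; rewrite bnd_simp.
have u0 : 0 <= u by rewrite (le_trans t0)// ltW.
apply: (@drift_tame _ _ Q c sQ c0 hQ r r0 x dd F' xl 0 t u t0 tu) => //.
- move=> i; apply: le_integrable (iF i) => //; first by apply/measurable_EFinP; exact: (mF' i u u0 (lexx u)).
  move=> s _ /=; rewrite lee_fin F'E normrM ler_piMl// indicE ger0_norm ?ler0n//.
  by case: (_ \in _).
- move=> i s s0 su; rewrite mxE add0r ddE//; congr fine; apply: ae_eq_integral => //.
  + have /measurable_int h := iF i; apply: measurable_funS h => //.
    by apply: subset_itvl; rewrite bnd_simp.
  + by apply/measurable_EFinP; exact: (mF' i s s0 su).
  exists N; split=> // y /= h; apply: contrapT => nN; apply: h => _.
  by rewrite F'E indicE mem_set// mul1r.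
- move=> s /andP[ts su]; rewrite /F' qformZr indicE; have [Ns|nN] := pselect (N s).
    by rewrite memNset ?mul0r//; apply.
  rewrite mem_set// mul1r; have [//|nq] := boolP (0 <= qform Q (xl s) (F s)).
  by exfalso; apply: nN; apply: hN => /(_ ts) h; rewrite h in nq.
Qed.

Theorem corollary2p1p3
  (R : realType) (d : nat)
  (dO : measure_display) (Omega : measurableType dO)
  (P : probability Omega R) (Ft : R -> set (set Omega))
  (hFt : usual_filtration P Ft)
  (dot : {dot 'cV[R]_d for idfun}) (e : d.-tuple 'cV[R]_d)
  (he : orthonormal dot e)
  (X F M V : R -> Omega -> 'cV[R]_d)
  (hXcadlag : cadlag_process X)
  (hXadapted : forall i, adapted Ft (fun t w => coord_in dot e i (X t w)))
  (hF : forall i,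
    progressively_measurable Ft (fun t w => coord_in dot e i (F t w)))
  (hM : forall i,
    locally_square_integrable_martingale P Ft
      (fun t w => coord_in dot e i (M t w)))
  (hV : forall i,
    finite_variation_process Ft (fun t w => coord_in dot e i (V t w)))
  (hX : {ae P, forall w, forall t i, 0 <= t ->
    lebesgue_measure.-integrable `[0, t]
      (EFin \o (fun s => coord_in dot e i (F s w))) /\
    coord_in dot e i (X t w - X 0 w) =
      Rintegral lebesgue_measure `[0, t] (fun s => coord_in dot e i (F s w))
      + coord_in dot e i (M t w) + coord_in dot e i (V t w)})
  (A : 'I_d -> R -> Omega -> R)
  (hA : forall i,
    is_predictable_qv P Ft (fun t w => coord_in dot e i (M t w)) (A i))
  (Gamma : set Omega) (hGamma : measurable Gamma)
  (alpha : R -> R)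
  (halpha_pos : forall t, 0 <= t -> 0 < alpha t)
  (halpha_noninc : nonincreasing_on `[0, +oo[ alpha)
  (halpha_cadlag : cadlag `[0, +oo[ alpha)
  (halpha_lim : alpha t @[t --> +oo] --> 0)
  (tau : R -> R)
  (htau_ge0 : forall t, 0 <= t -> 0 <= tau t)
  (htau_nondec : nondecreasing_on `[0, +oo[ tau)
  (htau_cadlag : cadlag `[0, +oo[ tau)
  (htau_iter : forall t, 0 < t ->
    t < tau t /\ iter n tau t @[n --> \oo] --> +oo)
  (kappa : R -> R)
  (hkappa_range : forall p, 0 <= p <= 1 -> 0 <= kappa p <= 1)
  (hkappa_nondec : nondecreasing_on `[0, 1] kappa)
  (hkappa_cadlag : cadlag `[0, 1] kappa)
  (hkappa_ge : forall p, 0 <= p <= 1 -> p <= kappa p)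
  (hkappa0 : kappa 0 = 0)
  (E : R -> Omega -> \bar R)
  (hE_ge0 : forall t w, 0 <= t -> (0 <= E t w)%E)
  (hE_cadlag : cadlag_process E)
  (hE_adapted : adapted Ft E)
  (hE : jump_bound P Ft dot Gamma kappa M E)
  (gamma : R -> Omega -> R)
  (hgamma_ge0 : forall t w, 0 <= t -> 0 <= gamma t w)
  (Ht : R -> Omega -> 'M[R]_d)
  (hHt_meas : forall t i j, 0 <= t ->
    measurable_fun [set: Omega] (fun w => Ht t w i j))
  (H : 'M[R]_d) (hH : repulsive H)
  (T0 : Omega -> R) (hT0 : measurable_fun [set: Omega] T0)
  (hdrift : {ae P, forall w, Gamma w ->
    {ae lebesgue_measure, forall t : R, 0 <= t -> T0 w <= t ->
      F t w = gamma t w *: (Ht t w *m left_lim (X ^~ w) t)}})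
  (hHlim : {ae P, forall w, Gamma w -> Ht t w @[t --> +oo] --> H})
  (hasym : {ae P, forall w, Gamma w ->
    let bracket t := \sum_(i < d) A i t w in
    [/\ ebigO (fun t => (alpha t ^+ 2 - alpha (tau t) ^+ 2)%:E)
              (fun t => bracket (tau t) - bracket t),
        ebigO (fun t => lim ((bracket s - bracket t)%:E @[s --> +oo]))
              (fun t => alpha t ^+ 2),
        elittleo (fun t => (\sum_(i < d)
                    variation_on `]t, +oo[
                      (fun s => coord_in dot e i (V s w)))%E)
                 alpha
      & ebigO (fun t => E t w) (fun t => alpha t ^+ 2)]}) :
  P (Gamma `&` [set w | X t w @[t --> +oo] --> (0 : 'cV[R]_d)]) = 0%E.
Proof.
have [C [B [BC CB CE dotE]]] := orthonormal_coordE he.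
have [Q0 [c [sQ0 /andP[c0 _] hQ0 rep]]] := repulsive_form he hH.
(* The Lyapunov form read in the coordinates of [e], where [dot] becomes the standard inner product;
   there the limit matrix is [C *m H *m B]. *)
pose Q := B^T *m Q0 *m B.
have qQ x y : qform Q x y = qform Q0 (B *m x) (B *m y) by rewrite /qform /Q trmx_mul !mulmxA.
have sQ : Q^T = Q by rewrite /Q !trmx_mul trmxK sQ0 mulmxA.
have dotB x : dot (B *m x) (B *m x) = \sum_i x i 0 ^+ 2 by rewrite dotE mulmxA CB mul1mx.
have hQ (x : 'cV[R]_d) : c * \sum_i x i 0 ^+ 2 <= qform Q x x <= \sum_i x i 0 ^+ 2 by rewrite qQ -dotB.
have repQ (x : 'cV[R]_d) : c * c * \sum_i x i 0 ^+ 2 <= qform Q (C *m H *m B *m x) x.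
  rewrite qQ !mulmxA BC mul1mx -mulmxA; apply: le_trans (rep (B *m x)).
  rewrite -mulrA ler_pM2l// -qQ; by have /andP[] := hQ x.
pose Xh s w := C *m X s w; pose Mh s w := C *m M s w; pose Vh s w := C *m V s w.
(* The drift is defined as what remains of X, hence is cadlag and adapted on all of [Omega]; it
   equals the integral of F almost surely. *)
pose Fh s w := C *m F s w; pose Dh s w := Xh s w - Xh 0 w - Mh s w - Vh s w.
have coE (Z : R -> Omega -> 'cV[R]_d) i : (fun s w => coord_in dot e i (Z s w)) = (fun s w => (C *m Z s w) i 0).
  by apply/funext => s; apply/funext => w; exact: CE.
have hMh i : locally_square_integrable_martingale P Ft (fun s w => Mh s w i 0) by have := hM i; rewrite coE.
have hVh i : finite_variation_process Ft (fun s w => Vh s w i 0) by have := hV i; rewrite coE.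
have aXh i : adapted Ft (fun s w => Xh s w i 0) by have := hXadapted i; rewrite coE.
have hAh i : is_predictable_qv P Ft (fun s w => Mh s w i 0) (A i) by have := hA i; rewrite coE.
have left_X w s : 0 < s -> forall i, X y w i 0 @[y --> s^'-] --> left_lim (X ^~ w) s i 0.
  move=> s0 i; have [_ /(_ s s0) h] := proj1 (cadlagP _) (hXcadlag w).
  exact: cvg_entry h.
have cXh i : cadlag_process (fun s w => Xh s w i 0).
  move=> w; have [h1 h2] := proj1 (cadlagP _) (hXcadlag w); apply/cadlagP; split=> s s0.
    by apply: cvg_mulmx => k l; exact: cvg_entry (h1 s s0).
  apply: (cvgP ((C *m left_lim (X ^~ w) s) i 0)); apply: cvg_mulmx => k l.
  by rewrite ord1; exact: left_X.
have cVh i : cadlag_process (fun s w => Vh s w i 0) by have [] := hVh i.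
have aVh i : adapted Ft (fun s w => Vh s w i 0) by have [] := hVh i.
have cMh i : cadlag_process (fun s w => Mh s w i 0) by have [] := hMh i.
have aMh i : adapted Ft (fun s w => Mh s w i 0) by have [] := hMh i.
have DhE i s w : Dh s w i 0 = Xh s w i 0 - Xh 0 w i 0 - Mh s w i 0 - Vh s w i 0 by rewrite /Dh !mxE.
have cDh i : cadlag_process (fun s w => Dh s w i 0).
  move=> w; rewrite (_ : (fun s => _) = fun s => Xh s w i 0 - Xh 0 w i 0 - Mh s w i 0 - Vh s w i 0); last first.
    by apply/funext => s; exact: DhE.
  by apply: cadlagB (cVh i w); apply: cadlagB (cMh i w); apply: cadlagB (cXh i w) (cadlag_cst _).
have aDh i : adapted Ft (fun s w => Dh s w i 0).
  move=> s s0; apply/(measurable_wrtP (Ft_sigma hFt s0)).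
  rewrite (_ : (fun w => _) = fun w => Xh s w i 0 - Xh 0 w i 0 - Mh s w i 0 - Vh s w i 0); last first.
    by apply/funext => w; exact: DhE.
  have ms (Z : R -> Omega -> 'cV[R]_d) (r : R) : adapted Ft (fun s w => Z s w i 0) -> 0 <= r -> r <= s ->
      measurable_fun [set: g_sigma_algebraType (Ft s)] (fun w => Z r w i 0).
    by move=> aZ r0 rs; exact: (adapted_measurable hFt aZ r0 rs).
  by do !apply: measurable_funB; apply: ms.
have XhE s w : 0 <= s -> Xh s w = Xh 0 w + Mh s w + Vh s w + Dh s w.
  by move=> _; apply/matrixP => i j; rewrite /Dh !mxE; ring.
have jumpE (S : Omega -> \bar R) t w : 0 <= t -> (t%:E < S w)%E ->
    sq_jump_at dot M S w = (if S w is x%:E then sq_jump (Mh ^~ w) x else 0)%:E.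
  rewrite /sq_jump_at; case: (S w) => [x| |]// t0; rewrite lte_fin => tx.
  have x0 : 0 < x by exact: le_lt_trans tx.
  pose l : 'cV[R]_d := \col_i lim (Mh s w i 0 @[s --> x^'-]).
  have Ml i j : Mh s w i j @[s --> x^'-] --> l i j.
    by rewrite ord1 mxE; have [_ h] := proj1 (cadlagP _) (cMh i w); exact: h.
  have -> : left_lim (M ^~ w) x = B *m l.
    apply: lim_mx_entry => i j; rewrite (_ : (fun s => M s w i j) = fun s => (B *m Mh s w) i j).
      by apply: cvg_mulmx => i' j'; exact: Ml.
    by apply/funext => s; rewrite /Mh mulmxA BC mul1mx.
  congr EFin; rewrite dotE /sq_jump; apply: eq_bigr => i _.
  by rewrite mulmxBr mulmxA CB mul1mx !mxE.
have hjump (t : R) (S : Omega -> \bar R) (f : Omega -> R) (B0 : set Omega) (e' del : R) :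
    0 <= t -> stopping_time Ft S -> (forall w, (t%:E < S w)%E) -> measurable_fun setT f -> (forall w, 0 <= f w) ->
    (forall w, f w = if S w is x%:E then sq_jump (Mh ^~ w) x else 0) ->
    Ft t B0 -> 0 <= e' -> (forall w, B0 w -> (E t w <= e'%:E)%E) -> 0 < del <= 1 ->
    exists B' N : set Omega, [/\ Ft t B', B' `<=` B0, measurable N /\ P N = 0%E,
      (B0 `\` B') `&` Gamma `<=` N &
      intg P (fun w => \1_B' w * f w) /\
      Ex P (fun w => \1_B' w * f w) <= e' * (kappa del * Pr P B0 + Pr P (B0 `&` [set w | (S w < +oo)%E]) / del)].
  move=> t0 stS tS mf f0 fE FB e0 hE' hdel.
  apply: (jump_estimate hFt hkappa_range hkappa_nondec hkappa_ge hE t0 stS tS mf f0 _ FB e0 hE' hdel).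
  by move=> w; rewrite (jumpE S t w t0 (tS w)) fE.
have kp := kappa_small hkappa0 hkappa_cadlag hkappa_range.
have neg := calm_negligible hFt sQ c0 hQ cXh aXh hMh hAh cVh aVh cDh aDh XhE hE_adapted halpha_pos kp hjump.
pose cl := calm Q Xh Vh Dh A E alpha.
have /choice[ep hep] : forall n : nat, exists eps, 0 < eps /\ forall (J : set Omega) (n0 : nat),
    J `<=` Gamma ->
    (forall w, J w -> forall e, 0 < e -> \forall n \near \oo, qform Q (Xh n%:R w) (Xh n%:R w) <= e) ->
    (forall w (m : nat), J w -> (n0 <= m)%N -> cl n.+1%:R eps m%:R w) -> P.-negligible J.
  by move=> n; have [|eps eps0 h] := neg n.+1%:R; [rewrite ler1n|exists eps].
pose brk w s := \sum_i A i s w.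
pose good w := [/\ forall t i, 0 <= t -> lebesgue_measure.-integrable `[0, t] (EFin \o (fun s => Fh s w i 0)) /\
      Dh t w i 0 = \int[lebesgue_measure]_(s in `[0, t]) Fh s w i 0,
    Gamma w -> {ae lebesgue_measure, forall t : R, 0 <= t -> T0 w <= t -> F t w = gamma t w *: (Ht t w *m left_lim (X ^~ w) t)},
    Gamma w -> Ht t w @[t --> +oo] --> H &
    Gamma w -> [/\ ebigO (fun t => (alpha t ^+ 2 - alpha (tau t) ^+ 2)%:E) (fun t => brk w (tau t) - brk w t),
        ebigO (fun t => lim ((brk w s - brk w t)%:E @[s --> +oo%R])) (fun t => alpha t ^+ 2),
        elittleo (fun t => (\sum_(i < d) variation_on `]t, +oo[ (fun s => (Vh s w i 0)%R))%E) alpha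
      & ebigO (fun t => E t w) (fun t => alpha t ^+ 2)]].
have aegood : {ae P, forall w, good w}.
  apply: filterS3 (filterI hX hdrift) hHlim hasym => w [h1 h2] h3 h4; split=> //.
    move=> t i t0; have [h5 h6] := h1 t i t0; split.
      by move: h5; congr (_.-integrable _ _); apply/funext => s /=; rewrite CE.
    have e1 : (fun s => coord_in dot e i (F s w)) = fun s => Fh s w i 0 by apply/funext => s; exact: CE.
    have e2 : (C *m (X t w - X 0 w)) i 0 = Xh t w i 0 - Xh 0 w i 0 by rewrite mulmxBr !mxE.
    rewrite e1 !CE e2 -/(Mh t w) -/(Vh t w) in h6.
    by rewrite DhE h6; ring.
  move=> Gw; have [q1 q2 q3 q4] := h4 Gw; split=> //.
  move: q3; rewrite (_ : (fun t => _) = (fun t => (\sum_(i < d) variation_on `]t, +oo[ (fun s => (Vh s w i 0)%R))%E))//.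
  apply/funext => t; apply: eq_bigr => i _; congr variation_on; apply/funext => s; exact: CE.
(* The constants and the starting time in the asymptotic hypotheses depend on the path. Integers
   [n.+1] and [n0] dominating them give countably many pieces, on each of which they are
   deterministic. *)
pose J n n0 := [set w | [/\ Gamma w, good w, X t w @[t --> +oo] --> (0 : 'cV[R]_d) &
  forall m, (n0 <= m)%N -> cl n.+1%:R (ep n) m%:R w]].
have negJ n n0 : P.-negligible (J n n0).
  have [_ h] := hep n; apply: (h _ n0).
  - by move=> w [].
  - move=> w [_ _ Xw _] e' e0.
    have Xi i : Xh t w i 0 @[t --> +oo] --> 0.
      have -> : 0 = (C *m (0 : 'cV[R]_d)) i 0 by rewrite mulmx0 mxE.
      by apply: cvg_mulmx => k l; exact: cvg_entry Xw.
    have cv : \sum_i Xh t w i 0 ^+ 2 @[t --> +oo] --> \sum_(i < d) (0 : R) ^+ 2.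
      apply: cvg_big => [|i _]; first exact: add_continuous.
      by apply: cvgM; exact: Xi.
    rewrite big1 in cv; last by move=> i _; rewrite expr0n.
    have : \forall t \near +oo, \sum_i Xh t w i 0 ^+ 2 <= e' by apply: (cvgr_le _ cv).
    move=> /nearinfty_nat; apply: filterS => m h1; apply: le_trans h1.
    by have /andP[] := hQ (Xh m%:R w).
  - by move=> w m [_ _ _ h1]; exact: h1.
suff cover : Gamma `&` [set w | X t w @[t --> +oo] --> (0 : 'cV[R]_d)] `<=`
    ~` [set w | good w] `|` \bigcup_n \bigcup_n0 J n n0.
  have ng : P.-negligible (Gamma `&` [set w | X t w @[t --> +oo] --> (0 : 'cV[R]_d)]).
    apply: negligibleS cover _; apply: negligibleU => //.
    by apply: negligible_bigcup => n; apply: negligible_bigcup => n0; exact: negJ.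
  (* The event is measurable because it is negligible and the filtration is complete. *)
  apply: measure_negligible => //; have [_ _ _ h] := hFt.
  by apply: (Ft_measurable hFt (lexx 0)); exact: h.
move=> w [Gw Xw]; have [gw|ngw] := pselect (good w); [right|by left].
have [gF gdrift gH gas] := gw.
have [as1 as2 as3 [C3 as4]] := gas Gw.
have brkm : nondecreasing_on `[0, +oo[ (brk w).
  move=> s t s0 t0 st; apply: ler_sum => i _; have [_ _ hm _] := hA i; have [_ h] := hm w.
  exact: h.
have [C1 C10 lowA] := iter_lower halpha_pos halpha_lim htau_iter brkm as1.
have [C2 C20 upA] := lim_upper brkm as2.
have [n [nC1 nC2 nC3]] : exists n : nat, [/\ C1 <= n.+1%:R, C2 <= n.+1%:R & C3 <= n.+1%:R].
  exists (Num.bound (C1 + C2 + `|C3|)).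
  have h : C1 + C2 + `|C3| < (Num.bound (C1 + C2 + `|C3|))%:R.
    by apply: archi_boundP; rewrite !addr_ge0// ltW.
  have := ler_norm C3; have := normr_ge0 C3; rewrite -natr1; split; lra.
have [ep0 _] := hep n.
have near_calm : \forall m \near \oo, cl n.+1%:R (ep n) m%:R w.
  have hHt i j : (C *m Ht t w *m B) i j @[t --> +oo] --> (C *m H *m B) i j.
    rewrite -mulmxA; under eq_fun do rewrite -mulmxA.
    apply: cvg_mulmx => k l; rewrite mxE; under eq_fun do rewrite mxE.
    apply: cvg_big => [|k' _]; first exact: add_continuous.
    by apply: cvgM; [exact: cvg_entry (gH Gw)|exact: cvg_cst].
  have qn := qform_near (Q := Q) (Ht := fun t => C *m Ht t w *m B) (mulr_gt0 c0 c0) repQ hHt.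
  have [s1 [_ hs1]] := qn.
  have hV' := as3 (ep n) ep0.
  suff h : \forall t \near +oo, cl n.+1%:R (ep n) t w by exact: nearinfty_nat h.
  near=> t.
  have t0 : 0 < t by near: t; exact: nbhs_pinfty_gt.
  have s1t : s1 <= t by near: t; apply: nbhs_pinfty_ge; exact: num_real.
  have T0t : T0 w <= t by near: t; apply: nbhs_pinfty_ge; exact: num_real.
  have low : \forall m \near \oo, alpha t ^+ 2 <= C1 * (brk w m%:R - brk w t) by near: t; exact: lowA.
  have up : forall s, t <= s -> brk w s - brk w t <= C2 * alpha t ^+ 2 by near: t; exact: upA.
  have Vt : (`|\sum_(i < d) variation_on `]t, +oo[ (fun s => (Vh s w i 0)%R)| <= (ep n * `|alpha t|)%:E)%E.
    by near: t; exact: hV'.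
  have Et : (`|E t w| <= (C3 * `|alpha t ^+ 2|)%:E)%E by near: t; exact: as4.
  have a2 : 0 < alpha t ^+ 2 by rewrite exprn_gt0// halpha_pos// ltW.
  split.
  - apply: filterS low => m h; apply: (le_trans h); rewrite ler_wpM2r//.
    by rewrite -(ler_pM2l C10) mulr0; exact: le_trans (ltW a2) h.
  - move=> s ts; apply: (le_trans (up s ts)); by rewrite ler_pM2r.
  - move=> g k gm g0.
    apply: (@sum_le_variation_on R d (fun i s => Vh s w i 0) t g k (ep n * alpha t) (ltW t0) gm g0).
      by move=> i; have [h _] := proj1 (cadlagP _) (cVh i w); apply: h; exact: ltW.
    apply: (le_trans (lee_abs _)); apply: (le_trans Vt).
    by rewrite ger0_norm// ltW// halpha_pos// ltW.
  - apply: (le_trans (lee_abs _)); apply: (le_trans Et).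
    by rewrite lee_fin ger0_norm ?(ltW a2)// ler_pM2r.
  - move=> u r psi tu r0 psi0.
    have u0 : 0 <= u by rewrite (le_trans (ltW t0))// ltW.
    have h := @drift_tame_ae R d Q c r sQ c0 hQ r0 (Xh ^~ w) (Dh ^~ w) (Fh ^~ w)
      (fun s => C *m left_lim (X ^~ w) s) t u (ltW t0) tu.
    apply: h _ _ _ _ psi psi0.
    + by move=> i; have [] := gF u i u0.
    + by move=> i s s0 _; have [] := gF s i s0.
    + move=> i s /andP[ts _]; apply: cvg_mulmx => k l; rewrite ord1; apply: left_X.
      exact: lt_trans ts.
    have [N [mN N0 hN]] := gdrift Gw; exists N; split=> // s; apply: contra_notP => nN ts.
    have hs : 0 <= s -> T0 w <= s -> F s w = gamma s w *: (Ht s w *m left_lim (X ^~ w) s).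
      by apply: contrapT => ns; apply: nN; exact: hN.
    have st0 : 0 <= s by rewrite ltW// (lt_trans t0).
    rewrite /Fh hs//; last by rewrite (le_trans T0t)// ltW.
    rewrite -scalemxAr qformZr mulr_ge0 ?hgamma_ge0// (qform_sym _ _ sQ).
    have := hs1 s (le_lt_trans s1t ts) (C *m left_lim (X ^~ w) s).
    by rewrite !mulmxA -[C *m _ *m B *m C]mulmxA BC mulmx1.
have [n0 _ hn0] := near_calm.
exists n => //; exists n0 => //; split=> // m n0m; exact: hn0.
Unshelve. all: by end_near. Qed.
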